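(* Let $F$ be a finite extension of $\mathbb{Q}_p$ and $k$ a finite field of characteristic $\ell\neq p$. Let $\overline\theta: G_F\to GL_n(k)$ be an absolutely irreducible continuous representation with $\ell\nmid n$ and $\overline\theta$ not equivalent to $\overline\theta(1)$, and let $s$ be the smallest positive integer with $\overline\theta(s)\sim\overline\theta$. Suppose $1\leq m\leq s-2$ and let $\overline\rho: G_F\to GL_{mn}(k)$ be a continuous representation with $\overline\rho^{\mathrm{ss}}\cong\overline\theta(a_1)\oplus\cdots\oplus\overline\theta(a_m)$ for some integers $a_i$. Then there is a deformation condition $\mathcal{E}$ for $\overline\rho$ such that: for every $(A,\rho_A)\in\mathcal{E}$, $\det\rho_A$ restricted to the inertia subgroup of $G_F$ equals the Teichmüller lift of $\det\overline\rho$; $\mathcal{E}$ is smooth; and $\dim_k T\mathcal{E}=\dim_k H^0(G_F,\mathrm{ad}\overline\rho)$.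
   Context: $\overline\theta(r)$ is the twist by the $r$-th power of the mod $\ell$ cyclotomic character. $W=W(k)$; a CNL $W$-algebra is a complete Noetherian local $W$-algebra with residue field $k$. $\mathrm{Rep}_d(G_F;k)$: objects $(A,\rho_A)$, $A$ a CNL $W$-algebra, $\rho_A:G_F\to GL_d(A)$ continuous; morphisms $(f,M)$ with $f$ local and $f\rho_A=M\rho_BM^{-1}$. A deformation condition for $\overline\rho$ is a full subcategory $\mathcal{D}$ with: (DC0) $(k,\overline\rho)\in\mathcal{D}$ and each object reduces mod $\mathfrak m_A$ to a representation equivalent to $\overline\rho$; (DC1) closed under targets of morphisms; (DC2) for Artinian CNL algebras, $\alpha:A\to C$, $\beta:B\to C$, $\beta$ small (surjective, principal kernel killed by $\mathfrak m_B$), $(A\times_CB,\rho)\in\mathcal D$ iff both projections are. Smooth: objects lift along surjections of CNL algebras. $T\mathcal D\subseteq H^1(G_F,\mathrm{ad}\overline\rho)$: classes $\xi$ with $(I+\varepsilon\xi)\overline\rho$ of type $\mathcal D$ over $k[\varepsilon]/(\varepsilon^2)$; $\mathrm{ad}\overline\rho$ is matrices with conjugation action. *)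

(* Defs.v *)
From HB Require Import structures.
From mathcomp Require Import all_boot all_order all_algebra all_field.
From mathcomp Require Import boolp classical_sets functions.
From mathcomp Require Import zify ring.

Set Implicit Arguments.
Unset Strict Implicit.
Unset Printing Implicit Defensive.

Import GRing.Theory.
Local Open Scope classical_set_scope.
Local Open Scope ring_scope.

(* Z_p is the inverse limit of the rings Z/p^n; the class modulo p^n is
   represented by its residue in [0, p^n). *)
Record padic_int (p : nat) (p_pr : prime p) : Type := PadicInt {
  padic_seq :> nat -> nat;
  _ : forall n, (padic_seq n < p ^ n)%N;
  _ : forall n, padic_seq n.+1 = padic_seq n %[mod p ^ n]
}.

Section PadicIntegers.
Variables (p : nat) (p_pr : prime p).
Local Open Scope nat_scope.
Local Notation padic_int := (padic_int p_pr).

HB.instance Definition _ := gen_eqMixin padic_int.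
HB.instance Definition _ := gen_choiceMixin padic_int.

Let pX_gt0 n : (0 < p ^ n)%N. Proof. by rewrite expn_gt0 prime_gt0. Qed.

Lemma padic_lt (x : padic_int) n : (x n < p ^ n)%N. Proof. by case: x. Qed.

Lemma padicS (x : padic_int) n : x (n.+1) = x n %[mod p ^ n]. Proof. by case: x. Qed.

Lemma padic_coh (x : padic_int) n m : x (m + n) = x n %[mod p ^ n].
Proof.
elim: m => // m IH; rewrite addSn -IH.
have d : (p ^ n %| p ^ (m + n))%N by rewrite dvdn_exp2l // leq_addl.
by rewrite -(modn_dvdm _ d) padicS (modn_dvdm _ d).
Qed.

Lemma padicP (x y : padic_int) : (forall n, x n = y n %[mod p ^ n]) -> x = y.
Proof.
move=> xy; have {}xy : padic_seq x = padic_seq y.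
  by apply/funext => n; have := xy n; rewrite !modn_small // padic_lt.
case: x y xy => [u u1 u2] [v v1 v2] /= E; case: _ / E v1 v2 => v1 v2.
by rewrite (Prop_irrelevance u1 v1) (Prop_irrelevance u2 v2).
Qed.

Lemma padic_of_lt (u : nat -> nat) n : (u n %% p ^ n < p ^ n)%N.
Proof. by rewrite ltn_mod. Qed.

Lemma padic_of_coh (u : nat -> nat) :
  (forall n, u n.+1 = u n %[mod p ^ n]) ->
  forall n, u n.+1 %% p ^ n.+1 = u n %% p ^ n %[mod p ^ n].
Proof. by move=> hu n; rewrite modn_dvdm ?dvdn_exp2l // hu modn_mod. Qed.

Definition padic_of (u : nat -> nat)
    (hu : forall n, u n.+1 = u n %[mod p ^ n]) : padic_int :=
  PadicInt p_pr (padic_of_lt u) (padic_of_coh hu).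

Lemma padic_ofE u hu n : @padic_of u hu n = u n %[mod p ^ n].
Proof. by rewrite /= modn_mod. Qed.

Lemma padic_cst_coh (a n : nat) : a = a %[mod p ^ n]. Proof. by []. Qed.

Lemma padic_add_coh (x y : padic_int) n :
  x (n.+1) + y (n.+1) = x n + y n %[mod p ^ n].
Proof. by rewrite -modnDm !padicS modnDm. Qed.

Lemma padic_mul_coh (x y : padic_int) n :
  x (n.+1) * y (n.+1) = x n * y n %[mod p ^ n].
Proof. by rewrite -modnMm !padicS modnMm. Qed.

Lemma padic_opp_coh (x : padic_int) n :
  p ^ n.+1 - x (n.+1) = p ^ n - x n %[mod p ^ n].
Proof.
apply/eqP; rewrite -(eqn_modDr (x (n.+1))).
rewrite subnK ?(ltnW (padic_lt _ _)) // -modnDmr padicS modnDmr.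
by rewrite subnK ?(ltnW (padic_lt _ _)) // modnn expnS modnMl.
Qed.

Definition padic_cst a := padic_of (padic_cst_coh a).
Definition padic_add x y := padic_of (padic_add_coh x y).
Definition padic_mul x y := padic_of (padic_mul_coh x y).
Definition padic_opp x := padic_of (padic_opp_coh x).

Lemma padic_addA : associative padic_add.
Proof.
move=> x y z; apply: padicP => n; rewrite !padic_ofE.
by rewrite -modnDmr padic_ofE modnDmr -[RHS]modnDml padic_ofE modnDml addnA.
Qed.

Lemma padic_addC : commutative padic_add.
Proof. by move=> x y; apply: padicP => n; rewrite !padic_ofE addnC. Qed.

Lemma padic_add0 : left_id (padic_cst 0) padic_add.
Proof. by move=> x; apply: padicP => n; rewrite padic_ofE /= mod0n. Qed.

Lemma padic_addN : left_inverse (padic_cst 0) padic_opp padic_add.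
Proof.
move=> x; apply: padicP => n; rewrite padic_ofE -modnDml padic_ofE modnDml.
by rewrite subnK ?(ltnW (padic_lt _ _)) // padic_ofE modnn mod0n.
Qed.

HB.instance Definition _ :=
  GRing.isZmodule.Build padic_int padic_addA padic_addC padic_add0 padic_addN.

Lemma padic_mulA : associative padic_mul.
Proof.
move=> x y z; apply: padicP => n; rewrite !padic_ofE.
by rewrite -modnMmr padic_ofE modnMmr -[RHS]modnMml padic_ofE modnMml mulnA.
Qed.

Lemma padic_mulC : commutative padic_mul.
Proof. by move=> x y; apply: padicP => n; rewrite !padic_ofE mulnC. Qed.

Lemma padic_mul1 : left_id (padic_cst 1) padic_mul.
Proof.
by move=> x; apply: padicP => n; rewrite padic_ofE -modnMml padic_ofE modnMml mul1n.
Qed.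

Lemma padic_mulD : left_distributive padic_mul padic_add.
Proof.
move=> x y z; apply: padicP => n; rewrite !padic_ofE.
by rewrite -modnMml padic_ofE modnMml -[RHS]modnDm !padic_ofE modnDm mulnDl.
Qed.

Lemma padic_1neq0 : padic_cst 1 != 0%R.
Proof.
apply/eqP => /(congr1 (fun x : padic_int => x 1)).
by rewrite /= expn1 mod0n modn_small ?prime_gt1.
Qed.

HB.instance Definition _ := GRing.Zmodule_isComNzRing.Build padic_int
  padic_mulA padic_mulC padic_mul1 padic_mulD padic_1neq0.

Definition padic_unit : {pred padic_int} :=
  fun x => `[< exists y : padic_int, (y * x = 1)%R >].
Definition padic_inv (x : padic_int) : padic_int :=
  xget x [set y | (y * x = 1)%R].

Lemma padic_mulVx : {in padic_unit, left_inverse 1%R padic_inv *%R}.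
Proof. by move=> x /asboolP hx; apply: (xgetPex x hx). Qed.

Lemma padic_unitPl (x y : padic_int) : (y * x = 1)%R -> padic_unit x.
Proof. by move=> yx; apply/asboolP; exists y. Qed.

Lemma padic_inv_out : {in [predC padic_unit], padic_inv =1 id}.
Proof.
move=> x /negP hx; rewrite /padic_inv; case: xgetP => // y _ yx.
by case: hx; apply: padic_unitPl yx.
Qed.

HB.instance Definition _ := GRing.ComNzRing_hasMulInverse.Build padic_int
  padic_mulVx padic_unitPl padic_inv_out.

Lemma padic_neq0 (x : padic_int) :
  (x != 0)%R -> exists n, forall m, ~~ (p ^ n %| x (m + n))%N.
Proof.
move=> /eqP x0; apply: contrapT => /forallNP h; apply: x0; apply: padicP => n.
rewrite padic_ofE mod0n; have /existsNP[m /negP] := h n.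
by rewrite negbK => /eqP; rewrite padic_coh.
Qed.

Lemma padic_idomain : GRing.integral_domain_axiom padic_int.
Proof.
move=> x y xy0; apply: contraT => /norP[/padic_neq0[a ha] /padic_neq0[b hb]].
move: (ha b) (hb a); rewrite [(a + b)%N]addnC.
move: (congr1 (fun z : padic_int => z (b + a)) xy0); rewrite /= mod0n => /eqP.
move: (x _) (y _) => u v uv hu hv.
have u0 : (0 < u)%N by case: u hu {uv}; rewrite ?dvdn0.
have v0 : (0 < v)%N by case: v hv {uv}; rewrite ?dvdn0.
move: uv hu hv; rewrite -/(dvdn _ _) !pfactor_dvdn ?muln_gt0 ?u0 // lognM //.
by rewrite -!ltnNge => le ltu ltv; lia.
Qed.

HB.instance Definition _ :=
  GRing.ComUnitRing_isIntegral.Build padic_int padic_idomain.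

End PadicIntegers.

Definition padic_num (p : nat) (p_pr : prime p) := {fraction padic_int p_pr}.

(* E is meant to be an algebraic closure of F, embedded by iota. *)
Section GaloisGroup.
Variables (F E : fieldType) (iota : F -> E).

Record abs_gal : Type := AbsGal {
  abs_gal_fun :> E -> E;
  abs_galD : {morph abs_gal_fun : x y / x + y};
  abs_galM : {morph abs_gal_fun : x y / x * y};
  abs_gal_bij : bijective abs_gal_fun;
  abs_gal_fix : forall x, abs_gal_fun (iota x) = iota x
}.

HB.instance Definition _ := gen_eqMixin abs_gal.
HB.instance Definition _ := gen_choiceMixin abs_gal.

Lemma abs_galP (g h : abs_gal) : g =1 h -> g = h.
Proof.
move=> /funext gh; case: g h gh => [u u1 u2 u3 u4] [v v1 v2 v3 v4] /= E'.
case: _ / E' v1 v2 v3 v4 => v1 v2 v3 v4.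
by congr AbsGal; apply: Prop_irrelevance.
Qed.

Definition abs_gal_one : abs_gal :=
  @AbsGal id (fun _ _ => erefl) (fun _ _ => erefl) (Bijective (fun=> erefl) (fun=> erefl))
    (fun=> erefl).

Program Definition abs_gal_mul (g h : abs_gal) : abs_gal := @AbsGal (g \o h) _ _ _ _.
Next Obligation. by move=> x y /=; rewrite !abs_galD. Qed.
Next Obligation. by move=> x y /=; rewrite !abs_galM. Qed.
Next Obligation. exact: bij_comp (abs_gal_bij g) (abs_gal_bij h). Qed.
Next Obligation. by rewrite !abs_gal_fix. Qed.

Definition abs_gal_inv_fun (g : abs_gal) (y : E) : E := xget 0 [set x | g x = y].

Lemma abs_gal_inv_funK (g : abs_gal) : cancel (abs_gal_inv_fun g) g.
Proof.
move=> y; have [f fK gK] := abs_gal_bij g.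
by rewrite /abs_gal_inv_fun; apply: (xgetPex 0 (P := [set x | g x = y])); exists (f y).
Qed.

Lemma abs_gal_funK (g : abs_gal) : cancel g (abs_gal_inv_fun g).
Proof. by move=> x; apply: (bij_inj (abs_gal_bij g)); rewrite abs_gal_inv_funK. Qed.

Program Definition abs_gal_inv (g : abs_gal) : abs_gal := @AbsGal (abs_gal_inv_fun g) _ _ _ _.
Next Obligation.
by move=> x y; apply: (bij_inj (abs_gal_bij g)); rewrite abs_galD !abs_gal_inv_funK.
Qed.
Next Obligation.
by move=> x y; apply: (bij_inj (abs_gal_bij g)); rewrite abs_galM !abs_gal_inv_funK.
Qed.
Next Obligation. exact: Bijective (abs_gal_inv_funK g) (abs_gal_funK g). Qed.
Next Obligation.
by apply: (bij_inj (abs_gal_bij g)); rewrite abs_gal_inv_funK abs_gal_fix.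
Qed.

Lemma abs_gal_mulA : associative abs_gal_mul. Proof. by move=> *; apply: abs_galP. Qed.
Lemma abs_gal_mul1 : left_id abs_gal_one abs_gal_mul. Proof. by move=> *; apply: abs_galP. Qed.
Lemma abs_gal_1mul : right_id abs_gal_one abs_gal_mul. Proof. by move=> *; apply: abs_galP. Qed.
Lemma abs_gal_mulV : left_inverse abs_gal_one abs_gal_inv abs_gal_mul.
Proof. by move=> g; apply: abs_galP => x /=; rewrite abs_gal_funK. Qed.
Lemma abs_gal_Vmul : right_inverse abs_gal_one abs_gal_inv abs_gal_mul.
Proof. by move=> g; apply: abs_galP => x /=; rewrite abs_gal_inv_funK. Qed.

HB.instance Definition _ :=
  isGroup.Build abs_gal abs_gal_mulA abs_gal_mul1 abs_gal_1mul abs_gal_mulV abs_gal_Vmul.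

End GaloisGroup.

Section Inertia.
Variables (p : nat) (p_pr : prime p) (F : fieldExtType (padic_num p_pr)).
Variables (E : fieldType) (iota : F -> E).

Definition padic_embed (z : padic_int p_pr) : E :=
  iota ((FracField.tofrac z)%:A).

(* The valuation ring of E is the integral closure of Z_p; its maximal ideal
   consists of its nonunits. *)
Definition int_closure : set E := [set x | integralOver padic_embed x].

Definition int_maximal : set E :=
  [set x | int_closure x /\ (x = 0 \/ ~ int_closure x^-1)].

(* Inertia acts trivially on the residue field of the valuation ring of E. *)
Definition inertia : set (abs_gal iota) :=
  [set g : abs_gal iota | forall x, int_closure x -> int_maximal (g x - x)].

End Inertia.

Section Ideals.
Variable A : comNzRingType.

Definition is_ideal (I : set A) : Prop :=
  [/\ I 0, forall x y, I x -> I y -> I (x + y) & forall a x, I x -> I (a * x)].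

Definition ideal_span (X : set A) : set A :=
  [set x | exists2 s : seq (A * A),
      forall t, t \in s -> X t.2 & x = \sum_(t <- s) t.1 * t.2].

Definition ideal_pow (I : set A) (n : nat) : set A :=
  ideal_span [set x | exists t : seq A,
    [/\ size t = n, forall y, y \in t -> I y & x = \prod_(y <- t) y]].

Definition noetherian : Prop :=
  forall I, is_ideal I -> exists s : seq A, I = ideal_span [set` s].

Definition artinian : Prop :=
  forall I : nat -> set A, (forall n, is_ideal (I n)) ->
    (forall n, I n.+1 `<=` I n) ->
    exists N, forall n, (N <= n)%N -> I n = I N.

Definition adic_complete (I : set A) : Prop :=
  (forall x, (forall n, ideal_pow I n x) -> x = 0) /\
  (forall u : nat -> A, (forall n, ideal_pow I n (u n.+1 - u n)) ->
    exists x, forall n, ideal_pow I n (x - u n)).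

Lemma ideal_span_ideal X : is_ideal (ideal_span X).
Proof.
split.
- by exists [::] => //; rewrite big_nil.
- move=> _ _ [s hs ->] [t ht ->]; exists (s ++ t); last by rewrite big_cat.
  by move=> u; rewrite mem_cat => /orP[/hs|/ht].
move=> a _ [s hs ->]; exists [seq (a * t.1, t.2) | t <- s].
  by move=> _ /mapP[t /hs Xt ->].
by rewrite big_map mulr_sumr; apply: eq_bigr => t _; rewrite mulrA.
Qed.

Lemma ideal_pow_ideal I n : is_ideal (ideal_pow I n).
Proof. exact: ideal_span_ideal. Qed.

Lemma ideal_powS I n : ideal_pow I n.+1 `<=` ideal_pow I n.
Proof.
have [J0 JD JM] := ideal_pow_ideal I n => _ [s hs ->].
rewrite big_seq; elim/big_ind: _ => // t /hs[[|y r] [//= [sz] hr ->]].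
rewrite big_cons mulrA; apply: (JM (t.1 * y) (\prod_(z <- r) z)).
exists [:: (1, \prod_(z <- r) z)].
  move=> _ /[!inE] /eqP -> /=; exists r; split=> // z zr.
  by apply: hr; rewrite inE zr orbT.
by rewrite big_seq1 mul1r.
Qed.

Lemma adic_complete_nilpotent I N :
  (forall x, ideal_pow I N x -> x = 0) -> adic_complete I.
Proof.
move=> nil; split=> [x hx|u hu]; first exact: nil.
have low m n : ideal_pow I (m + n) `<=` ideal_pow I n.
  by elim: m => [//|m IH x hx]; apply: IH; apply: ideal_powS hx.
have tel m n : ideal_pow I n (u (m + n)%N - u n).
  have [J0 JD _] := ideal_pow_ideal I n.
  elim: m => [|m IH]; first by rewrite subrr.
  by rewrite -(subrKA (u (m + n)%N)); apply: JD => //; apply/(low m)/hu.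
exists (u N) => n; have [/subnK <- //|/ltnW/subnK <-] := leqP n N.
rewrite -opprB (nil _ (tel _ _)) oppr0.
by have [] := ideal_pow_ideal I (n - N + N).
Qed.

End Ideals.

Lemma fin_noetherian (A : comNzRingType) (e : seq A) :
  (forall x, x \in e) -> noetherian A.
Proof.
move=> he I [I0 ID IM]; exists [seq x <- e | `[< I x >]].
apply/seteqP; split=> [x Ix|_ [s hs ->]].
  exists [:: (1, x)]; last by rewrite big_seq1 mul1r.
  by move=> _ /[!inE] /eqP -> /=; rewrite mem_filter he andbT; apply/asboolP.
rewrite big_seq; elim/big_ind: _ => // t /hs /=.
by rewrite mem_filter => /andP[/asboolP It _]; apply: IM.
Qed.

Section DualNumbers.
Variable k : finFieldType.

(* (a, b) stands for a + b * eps with eps ^+ 2 = 0. *)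
Definition dual_number : Type := (k * k)%type.

HB.instance Definition _ := GRing.Zmodule.on dual_number.
HB.instance Definition _ := Finite.on dual_number.

Definition dual_mul (x y : dual_number) : dual_number := (x.1 * y.1, x.1 * y.2 + x.2 * y.1).

Lemma dual_mulA : associative dual_mul.
Proof. by move=> x y z; congr pair => /=; ring. Qed.
Lemma dual_mulC : commutative dual_mul.
Proof. by move=> x y; congr pair => /=; ring. Qed.
Lemma dual_mul1 : left_id ((1, 0) : dual_number) dual_mul.
Proof. by case=> a b; congr pair => /=; ring. Qed.
Lemma dual_mulD : left_distributive dual_mul +%R.
Proof. by move=> x y z; congr pair => /=; ring. Qed.
Lemma dual_1neq0 : ((1, 0) : dual_number) != 0.
Proof. by apply/eqP => -[] /eqP; rewrite oner_eq0. Qed.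

HB.instance Definition _ := GRing.Zmodule_isComNzRing.Build dual_number
  dual_mulA dual_mulC dual_mul1 dual_mulD dual_1neq0.

Definition dual_unit : {pred dual_number} := fun x => x.1 != 0.
Definition dual_inv (x : dual_number) : dual_number :=
  if x.1 == 0 then x else (x.1^-1, - x.2 / x.1 ^+ 2).

Lemma dual_mulVx : {in dual_unit, left_inverse 1 dual_inv *%R}.
Proof.
move=> x; rewrite unfold_in => x0; rewrite /dual_inv (negPf x0).
by congr pair => /=; field.
Qed.
Lemma dual_unitPl (x y : dual_number) : y * x = 1 -> dual_unit x.
Proof.
move=> [yx _]; rewrite /dual_unit; apply/eqP => x0.
by move/eqP: yx; rewrite x0 mulr0 eq_sym oner_eq0.
Qed.
Lemma dual_inv_out : {in [predC dual_unit], dual_inv =1 id}.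
Proof. by move=> x; rewrite inE negbK /dual_inv => ->. Qed.

HB.instance Definition _ := GRing.ComNzRing_hasMulInverse.Build dual_number
  dual_mulVx dual_unitPl dual_inv_out.

Definition dual_const (a : k) : dual_number := (a, 0).
Definition dual_eps : dual_number := (0, 1).
Definition dual_res (x : dual_number) : k := x.1.

Lemma dual_const_zmod : zmod_morphism dual_const.
Proof. by move=> a b; congr pair => /=; ring. Qed.
Lemma dual_const_monoid : monoid_morphism dual_const.
Proof. by split=> // a b; congr pair => /=; ring. Qed.
HB.instance Definition _ :=
  GRing.isZmodMorphism.Build k dual_number dual_const dual_const_zmod.
HB.instance Definition _ :=
  GRing.isMonoidMorphism.Build k dual_number dual_const dual_const_monoid.

Lemma dual_res_zmod : zmod_morphism dual_res. Proof. by []. Qed.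
Lemma dual_res_monoid : monoid_morphism dual_res. Proof. by []. Qed.
HB.instance Definition _ :=
  GRing.isZmodMorphism.Build dual_number k dual_res dual_res_zmod.
HB.instance Definition _ :=
  GRing.isMonoidMorphism.Build dual_number k dual_res dual_res_monoid.

End DualNumbers.

(* W(k) as the strict l-ring with residue ring k, that is, the complete
   discrete valuation ring with uniformizer l and residue field k. *)
Definition is_witt_ring (l : nat) (k W : comNzRingType)
    (red : {rmorphism W -> k}) : Prop :=
  [/\ forall x, exists w, red w = x,
      forall w, red w = 0 <-> exists v, w = l%:R * v,
      forall w : W, l%:R * w = 0 -> w = 0
    & adic_complete [set w | red w = 0]].

Section CNL.
Variables (k : finFieldType) (W : comNzRingType) (red : {rmorphism W -> k}).

(* The unique representative w of x with w ^+ #|k| = w. *)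
Definition teichmuller (x : k) : W :=
  xget 0 [set w | red w = x /\ w ^+ #|k| = w].

(* The maximal ideal is the kernel of cnl_res. When red is onto, cnl_algE makes
   cnl_res onto and identifies the residue field with k as a W-algebra. *)
Record cnl : Type := CNL {
  cnl_ring :> comUnitRingType;
  cnl_alg : {rmorphism W -> cnl_ring};
  cnl_res : {rmorphism cnl_ring -> k};
  cnl_algE : forall w, cnl_res (cnl_alg w) = red w;
  cnl_local : forall x, (x \is a GRing.unit) = (cnl_res x != 0);
  cnl_noetherian : noetherian cnl_ring;
  cnl_complete : adic_complete [set x | cnl_res x = 0]
}.

Definition cnl_max (A : cnl) : set A := [set x | cnl_res A x = 0].

Definition cnl_morphism (A B : cnl) (f : {rmorphism A -> B}) : Prop :=
  (forall w, f (cnl_alg A w) = cnl_alg B w) /\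
  (forall x, cnl_max x -> cnl_max (f x)).

Definition surjective_map (A B : Type) (f : A -> B) : Prop :=
  forall y, exists x, f x = y.

Definition small_map (A B : cnl) (f : {rmorphism A -> B}) : Prop :=
  surjective_map f /\
  exists t, (forall x, f x = 0 <-> exists a, x = a * t) /\
            (forall y : A, cnl_max y -> y * t = 0).

(* The underlying set of A x_C B determines P up to a unique isomorphism of CNL
   algebras, so no particular model of it is needed. *)
Definition fiber_product (A B C P : cnl) (alpha : A -> C) (beta : B -> C)
    (p1 : P -> A) (p2 : P -> B) : Prop :=
  (forall x, alpha (p1 x) = beta (p2 x)) /\
  (forall a b, alpha a = beta b -> exists! x, p1 x = a /\ p2 x = b).

Fact residue_algE w : (idfun : k -> k) (red w) = red w. Proof. by []. Qed.
Fact residue_local (x : k) : (x \is a GRing.unit) = (idfun x != 0).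
Proof. exact: unitfE. Qed.
Fact residue_noetherian : noetherian k.
Proof. exact: (@fin_noetherian _ (enum k) (mem_enum k)). Qed.
Fact residue_complete : adic_complete [set x : k | idfun x = 0].
Proof.
apply: (@adic_complete_nilpotent _ _ 1) => _ [s hs ->].
rewrite big_seq big1 // => t /hs[r [sr hr ->]].
case: r sr hr => [|y [|]] //= _ /(_ y (mem_head _ _)) y0.
by rewrite big_seq1 y0 mulr0.
Qed.

Definition residue_cnl : cnl :=
  @CNL k red idfun residue_algE residue_local residue_noetherian
    residue_complete.

Fact dual_algE w : dual_res ((@dual_const k \o red) w) = red w.
Proof. by []. Qed.
Fact dual_local (x : dual_number k) : (x \is a GRing.unit) = (dual_res x != 0).
Proof. by []. Qed.
Fact dual_noetherian : noetherian (dual_number k).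
Proof. by apply: (@fin_noetherian _ (enum {: dual_number k})) => x; rewrite mem_enum. Qed.
Fact dual_complete : adic_complete [set x : dual_number k | dual_res x = 0].
Proof.
apply: (@adic_complete_nilpotent _ _ 2) => _ [s hs ->].
rewrite big_seq big1 // => t /hs[r [sr yz ->]].
case: r sr yz => [|y [|z [|]]] //= _ yz.
rewrite big_cons big_seq1.
have y0 := yz y (mem_head _ _); have z0 : dual_res z = 0.
  by apply: yz; rewrite !inE eqxx orbT.
suff -> : y * z = 0 by rewrite mulr0.
case: y z {yz} y0 z0 => [a b] [c d]; rewrite /dual_res /= => -> ->.
by congr pair => /=; ring.
Qed.

Definition dual_cnl : cnl :=
  @CNL (dual_number k) (@dual_const k \o red) (@dual_res k) dual_algE dual_local
    dual_noetherian dual_complete.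

End CNL.

Section Representations.
Local Open Scope group_scope.
Variable G : groupType.

Definition is_rep (A : comNzRingType) d (rho : G -> 'M[A]_d) : Prop :=
  rho 1 = 1%:M /\ forall g h, rho (g * h) = rho g *m rho h.

(* Over a nonzero ring, the existence of M and its inverse N forces d1 = d2;
   allowing two different sizes avoids casts between equal dimensions. *)
Definition rep_equiv (A : comNzRingType) d1 d2
    (rho1 : G -> 'M[A]_d1) (rho2 : G -> 'M[A]_d2) : Prop :=
  exists (M : 'M[A]_(d1, d2)) (N : 'M[A]_(d2, d1)),
    [/\ M *m N = 1%:M, N *m M = 1%:M
      & forall g, rho1 g = M *m rho2 g *m N].

(* The rows of U generate a subspace of k^d, on which G acts by rho g on
   column vectors, hence by the transpose of rho g on rows. *)
Definition irreducible (k : fieldType) d (rho : G -> 'M[k]_d) : Prop :=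
  (0 < d)%N /\
  forall U : 'M[k]_d, (forall g, stablemx U (rho g)^T) ->
    U = 0%R \/ row_full U.

Definition absolutely_irreducible (k : fieldType) d
    (rho : G -> 'M[k]_d) : Prop :=
  forall (K : fieldType) (f : {rmorphism k -> K}),
    irreducible (fun g => map_mx f (rho g)).

Definition rep_sum (A : comNzRingType) r (d : 'I_r -> nat)
    (sigma : forall i, G -> 'M[A]_(d i)) : G -> 'M[A]_(\sum_i d i) :=
  fun g => \mxdiag_i sigma i g.

(* rho is equivalent to a block upper triangular representation whose diagonal
   blocks are irreducible, and rho' is the direct sum of these blocks. *)
Definition is_semisimplification (k : fieldType) d d'
    (rho : G -> 'M[k]_d) (rho' : G -> 'M[k]_d') : Prop :=
  exists r (e : 'I_r -> nat) (tau : G -> 'M[k]_(\sum_i e i)),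
    [/\ rep_equiv rho tau,
        forall g (i j : 'I_r), (j < i)%N -> submxblock (tau g) i j = 0%R,
        forall i, irreducible (fun g => submxblock (tau g) i i)
      & rep_equiv rho' (rep_sum (fun i g => submxblock (tau g) i i))].

End Representations.

Definition has_dim (k : fieldType) (V : lmodType k) (X : set V) (n : nat) : Prop :=
  exists b : 'I_n -> V,
    (forall c : 'I_n -> k, \sum_i c i *: b i = 0 -> forall i, c i = 0) /\
    (forall v, X v <-> exists c : 'I_n -> k, v = \sum_i c i *: b i).

Section QuotientModule.
Local Open Scope quotient_scope.
Variables (k : pzRingType) (V : lmodType k) (S : submodClosed V).

(* The library quotients by a zmodClosed predicate; closure under opposites
   follows here from closure under scaling. *)
Definition submod_pred : {pred V} := S.

HB.instance Definition _ := GRing.isSubmodClosed.Build k V submod_pred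
  (GRing.subsemimodClosedP S).

Definition lmod_quot : Type := Quotient.quot submod_pred.

HB.instance Definition _ := GRing.Zmodule.on lmod_quot.
HB.instance Definition _ :=
  EqQuotient.copy lmod_quot (Quotient.quot submod_pred).

Local Notation Q := lmod_quot.

Definition quot_scale (a : k) (v : Q) : Q := \pi_Q (a *: repr v).

Lemma pi_scale a v : quot_scale a (\pi_Q v) = \pi_Q (a *: v).
Proof.
have E := @Quotient.idealrBE V submod_pred.
apply/eqP; rewrite -[_ == _]E -scalerBr rpredZ //.
by rewrite E; apply/eqP; apply: reprK.
Qed.

Lemma quot_scaleA a b v : quot_scale a (quot_scale b v) = quot_scale (a * b) v.
Proof. by rewrite -[v]reprK !pi_scale scalerA reprK. Qed.
Lemma quot_scale1 : left_id 1 quot_scale.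
Proof. by move=> v; rewrite -[v]reprK pi_scale scale1r. Qed.
Lemma pi_additive (u v : V) : \pi_Q (u + v) = \pi_Q u + \pi_Q v.
Proof. exact: (raddfD (\pi_(Quotient.quot submod_pred))). Qed.
Lemma quot_scaleDr : right_distributive quot_scale +%R.
Proof.
move=> a u v; have [u' <-] : exists u', \pi_Q u' = u by exists (repr u); apply: reprK.
have [v' <-] : exists v', \pi_Q v' = v by exists (repr v); apply: reprK.
by rewrite -pi_additive !pi_scale -pi_additive scalerDr.
Qed.
Lemma quot_scaleDl v : {morph quot_scale^~ v : a b / a + b}.
Proof.
move=> a b; have [v' <-] : exists v', \pi_Q v' = v by exists (repr v); apply: reprK.
by rewrite !pi_scale -pi_additive scalerDl.
Qed.

HB.instance Definition _ := GRing.Zmodule_isLmodule.Build k lmod_quot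
  quot_scaleA quot_scale1 quot_scaleDr quot_scaleDl.

End QuotientModule.

Section GaloisRepresentations.
Variables (F E : fieldType) (iota : F -> E).
Local Notation G := (abs_gal iota).

(* Continuity for the Krull topology on G, in which the automorphisms agreeing
   with g on a finite set form a basis of neighbourhoods of g, and for the
   I-adic topology on matrices. *)
Definition adic_continuous (A : comNzRingType) (I : set A) d
    (f : G -> 'M[A]_d) : Prop :=
  forall (g : G) n, exists s : seq E, forall h : G, {in s, g =1 h} ->
    forall i j, ideal_pow I n (f h i j - f g i j).

(* The discrete topology is the adic topology of the zero ideal. *)
Definition discrete_continuous (A : comNzRingType) d (f : G -> 'M[A]_d) : Prop :=
  adic_continuous [set 0] f.

(* E is meant to contain a primitive l-th root of unity, so that the exponent a
   with sigma z = z ^+ a on all l-th roots of unity exists and is unique. *)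
Definition mod_cyclotomic (l : nat) (k : fieldType) (sigma : G) : k :=
  if [pick a : 'I_l | `[< forall z : E, z ^+ l = 1 -> sigma z = z ^+ a >]]
    is Some a then (a : nat)%:R else 0.

Definition twist (l : nat) (k : fieldType) d (theta : G -> 'M[k]_d) (r : int) :
    G -> 'M[k]_d :=
  fun g => (mod_cyclotomic l k g ^ r) *: theta g.

Section Cohomology.
Variables (k : fieldType) (d : nat) (rho : G -> 'M[k]_d).

Definition ad_action (g : G) (X : 'M[k]_d) : 'M[k]_d :=
  rho g *m X *m rho g^-1%g.

Definition H0_ad : set 'M[k]_d := [set X | forall g, ad_action g X = X].

Definition is_cocycle (c : G -> 'M[k]_d) : Prop :=
  (forall g h, c (g * h)%g = c g + ad_action g (c h)) /\ discrete_continuous c.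

Definition cocycle_pred : {pred (G -> 'M[k]_d)} := fun c => `[< is_cocycle c >].

Lemma ad_actionP g a X Y :
  ad_action g (a *: X + Y) = a *: ad_action g X + ad_action g Y.
Proof. by rewrite /ad_action mulmxDr mulmxDl -scalemxAr -scalemxAl. Qed.

Lemma cocycle_closed : submod_closed cocycle_pred.
Proof.
split.
  apply/asboolP; split=> [g h|g n]; last first.
    exists [::] => h _ i j; rewrite !mxE subrr.
    by have [] := ideal_pow_ideal [set (0 : k)] n.
  by rewrite /ad_action mulmx0 mul0mx addr0.
move=> a u v /asboolP[uM uC] /asboolP[vM vC]; apply/asboolP; split=> [g h|g n].
  have uvE x : (a *: u + v) x = a *: u x + v x by [].
  by rewrite !uvE uM vM ad_actionP scalerDr addrACA.
have [s hs] := uC g n; have [t ht] := vC g n.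
exists (s ++ t) => h gh i j; rewrite !mxE opprD addrACA -mulrBr.
have [_ JD JM] := ideal_pow_ideal [set (0 : k)] n; apply: JD.
  by apply/JM/hs => x xs; apply: gh; rewrite mem_cat xs.
by apply: ht => x xt; apply: gh; rewrite mem_cat xt orbT.
Qed.

HB.instance Definition _ :=
  GRing.isSubmodClosed.Build k (G -> 'M[k]_d) cocycle_pred
    (GRing.submod_closed_semi cocycle_closed).

Record cocycle : Type := Cocycle {
  cocycle_fun :> G -> 'M[k]_d;
  _ : cocycle_fun \in cocycle_pred
}.

HB.instance Definition _ := [isSub for cocycle_fun].
HB.instance Definition _ := [Choice of cocycle by <:].
HB.instance Definition _ := [SubChoice_isSubLmodule of cocycle by <:].

Definition coboundary_pred : {pred cocycle} := fun c =>
  `[< exists X, forall g, c g = ad_action g X - X >].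

Lemma coboundary_closed : submod_closed coboundary_pred.
Proof.
split; first by apply/asboolP; exists 0 => g; rewrite /ad_action mulmx0 mul0mx subrr.
move=> a u v /asboolP[X hX] /asboolP[Y hY]; apply/asboolP; exists (a *: X + Y) => g.
have uvE : (a *: u + v) g = a *: u g + v g by [].
by rewrite uvE ad_actionP hX hY opprD addrACA scalerBr.
Qed.

HB.instance Definition _ :=
  GRing.isSubSemiModClosed.Build k cocycle coboundary_pred
    (GRing.submod_closed_semi coboundary_closed).

Definition H1_ad := lmod_quot coboundary_pred.

End Cohomology.

End GaloisRepresentations.

Section Deformations.
Variables (F E : fieldType) (iota : F -> E).
Local Notation G := (abs_gal iota).
Variables (k : finFieldType) (W : comNzRingType) (red : {rmorphism W -> k}).
Variable d : nat.

Definition cnl_rep (A : cnl red) (rho : G -> 'M[A]_d) : Prop :=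
  is_rep rho /\ adic_continuous (@cnl_max _ _ _ A) rho.

(* A full subcategory of Rep_d(G; k), given by its class of objects. *)
Definition rep_class : Type := forall A : cnl red, (G -> 'M[A]_d) -> Prop.

Record deformation_condition (rhobar : G -> 'M[k]_d) (D : rep_class) : Prop := {
  dc_rep : forall A rho, D A rho -> cnl_rep rho;
  dc0_residual : D (residue_cnl red) rhobar;
  dc0_reduction : forall A rho, D A rho ->
    rep_equiv (fun g => map_mx (cnl_res A) (rho g)) rhobar;
  dc1 : forall (A B : cnl red) (f : {rmorphism A -> B}) (M : 'M[B]_d) rhoA rhoB,
    cnl_morphism f -> M \in unitmx -> D A rhoA -> cnl_rep rhoB ->
    (forall g, map_mx f (rhoA g) = M *m rhoB g *m invmx M) ->
    D B rhoB;
  dc2 : forall (A B C P : cnl red)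
      (alpha : {rmorphism A -> C}) (beta : {rmorphism B -> C})
      (p1 : {rmorphism P -> A}) (p2 : {rmorphism P -> B}) rho,
    artinian A -> artinian B -> artinian C ->
    cnl_morphism alpha -> cnl_morphism beta -> small_map beta ->
    cnl_morphism p1 -> cnl_morphism p2 -> fiber_product alpha beta p1 p2 ->
    cnl_rep rho ->
    D P rho <->
      D A (fun g => map_mx p1 (rho g)) /\ D B (fun g => map_mx p2 (rho g))
}.

Definition smooth (D : rep_class) : Prop :=
  forall (A B : cnl red) (f : {rmorphism A -> B}) rhoB,
    cnl_morphism f -> surjective_map f -> D B rhoB ->
    exists2 rhoA, D A rhoA & forall g, map_mx f (rhoA g) = rhoB g.

Definition first_order (rhobar c : G -> 'M[k]_d) (g : G) :
    'M[dual_number k]_d :=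
  (1%:M + dual_eps k *: map_mx (@dual_const k) (c g)) *m
    map_mx (@dual_const k) (rhobar g).

Definition tangent_space (rhobar : G -> 'M[k]_d) (D : rep_class) :
    set (H1_ad rhobar) :=
  [set xi | exists c : cocycle rhobar,
    xi = (\pi_(H1_ad rhobar) c)%qT /\ D (dual_cnl red) (first_order rhobar c)].

End Deformations.

Arguments H0_ad {F E iota k d} rho.
Arguments tangent_space {F E iota k W red d} rhobar D.

(* Main.v *)
Require Import Defs.
From HB Require Import structures.
From mathcomp Require Import all_boot all_order all_algebra all_fingroup all_solvable all_field.
From mathcomp Require Import boolp classical_sets functions.
From mathcomp Require Import mxtens generic_quotient ring_quotient.
From mathcomp Require Import zify ring.

Set Implicit Arguments.
Unset Strict Implicit.
Unset Printing Implicit Defensive.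

Import GRing.Theory.
Local Open Scope ring_scope.

                                          

(** The [l]-adic information about the Galois group sits in three functions: the cyclotomic
    character [eps] with values in Z_l, a Kummer cocycle [b] read off the l-power roots of p, and an
    additive map [kap], a rescaled logarithm of [eps], which vanishes on inertia. Where [eps] and
    [b] are close to 1 and 0, an automorphism has a power of exponent prime to l that fixes any
    prescribed finite set ([tame_kernel]). Such deep elements act on every finite object through a
    group of order prime to l, so averaging is available.

    Let X be an invertible intertwiner between theta and theta(s). Because theta is absolutely
    irreducible, l does not divide n and s is minimal, the matrices commuting with theta on a deep
    subgroup are the combinations of powers of X ([centralizer_span]), and conjugation by
    theta(sigma) scales X^i by chi(sigma)^(s i). Hence an element of this centralizer which is
    scaled by chi(sigma)^d with -s < d < s is a scalar, and it is 0 unless d = 0 ([weight_scalar]).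

    The inequality m <= s - 2 allows exponents w_i for the constituents theta(w_i) whose differences
    are at most s - 2, so only weights in that range occur. In a suitable basis rhobar is then the
    Kronecker product of exp(b N) y0^kap diag(chi^w_i) with theta, where N is nilpotent and shifts
    the grading by w by one, and y0 preserves the grading and commutes with N ([normal_form]). A
    graded Jordan form turns N into a matrix Pi of zeros and ones ([graded_jordan_form],
    [structure_k]).

    Every ingredient except y0 now has a canonical lift: Pi exists over any ring, [eps] and [b] take
    values in Z_l and therefore in W, and theta lifts to a homomorphism to GL_n(W) with finite
    image, built from torsion lifts of single elements ([thetaW_exists]). For a CNL algebra A and a
    lift y of y0 that preserves the grading and commutes with Pi, let R_y(g) be the Kronecker
    product of y^kap(g) exp(b(g) Pi) diag(eps(g)^w_i) with the lifted theta. The deformation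
    condition [defo] consists of the continuous representations conjugate over A to some R_y.

    The equations on y only say that some entries vanish and others coincide, so they lift along
    surjections; this is smoothness ([defo_smooth]). Over an Artinian A, a matrix intertwining R_y
    with R_y' is X tensor 1, with X graded, commuting with Pi and X y = y' X ([intertwiner]); this
    rigidity gives the gluing axiom ([defo_glue]). On inertia [kap] is 0 and [eps] is 1, so the
    determinant comes from the lifted theta alone; it is a root of unity, hence a Teichmüller lift
    ([defo_det]). Finally let Z be the space of graded matrices over k commuting with Pi. A tangent
    direction is a lift of y0 to the dual numbers, that is, an element X of Z. It is trivial in H^1
    exactly when X lies in the image of ad(y0) on Z, while the kernel of ad(y0) on Z is H^0. Kernel
    and cokernel of an endomorphism of a finite-dimensional space have the same dimension
    ([tangent_dim], [H0_dim]). *)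

Lemma exprD1_prime (R : comNzRingType) (X : R) p : prime p -> (2 < p)%N ->
  exists A, (1 + X) ^+ p = 1 + p%:R * X + p%:R * X ^+ 2 * A + X ^+ p.
Proof.
move=> p_pr p2; exists (\sum_(i < p.-2) ('C(p, i.+2) %/ p)%:R * X ^+ i).
have [k kE] : exists k, p = k.+2 by exists p.-2; lia.
rewrite addrC exprD1n {}kE /= in p_pr p2 *.
rewrite big_ord_recr !big_ord_recl /= binn mulr1n /bump /= bin1 !add1n expr1 -mulr_natl.
rewrite [X in _ = X](_ : _ = 1 + (k.+2%:R * X + k.+2%:R * X ^+ 2 * (\sum_(i < k) ('C(k.+2, i.+2) %/ k.+2)%:R * X ^+ i)) + X ^+ k.+2); last by ring.
congr (_ + _); congr (_ + _); congr (_ + _).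
rewrite mulr_sumr; apply: eq_bigr => i _; rewrite /bump /= !add1n.
have d : (k.+2 %| 'C(k.+2, i.+2))%N.
  by apply: prime_dvd_bin => //=; have := ltn_ord i; lia.
by rewrite -mulr_natl -{1}(divnK d) natrM exprSr exprSr expr2; ring.
Qed.

(** * Arithmetic of the [p]-adic integers: divisibility, compactness, torsion, logarithm *)

Section PadicArithmetic.
Variables (p : nat) (p_pr : prime p).
Local Notation Zp := (padic_int p_pr).
Implicit Types x y z : Zp.

Let pX_gt0 n : (0 < p ^ n)%N. Proof. by rewrite expn_gt0 prime_gt0. Qed.

Lemma padic_modn x n : (x n %% p ^ n)%N = x n.
Proof. by rewrite modn_small // padic_lt. Qed.

Lemma padic_addE x y n : (x + y) n = ((x n + y n) %% p ^ n)%N. Proof. by []. Qed.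

Lemma padic_mulE x y n : (x * y) n = ((x n * y n) %% p ^ n)%N. Proof. by []. Qed.

Lemma padic_natE a n : (a%:R : Zp) n = (a %% p ^ n)%N.
Proof.
elim: a => [|a IH]; first by rewrite /= !mod0n.
by rewrite -natr1 padic_addE IH /= modnDm addn1.
Qed.

Lemma padic_zeroE n : (0 : Zp) n = 0%N.
Proof. by rewrite (_ : 0 = 0%:R :> Zp) // padic_natE mod0n. Qed.

Lemma padic_ext x y : (forall n, x n = y n) -> x = y.
Proof. by move=> xy; apply: padicP => n; rewrite xy. Qed.

Lemma padic_level0 x : x 0%N = 0%N.
Proof. by rewrite -padic_modn expn0 modn1. Qed.

Lemma padic_congr_le x y m n : (m <= n)%N -> x n = y n -> x m = y m.
Proof.
move=> /subnK <- xy; have := padic_coh x m (n - m); have := padic_coh y m (n - m).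
by rewrite xy => -> /esym; rewrite !padic_modn.
Qed.

Lemma padic_congrD n x x' y y' : x n = x' n -> y n = y' n -> (x + y) n = (x' + y') n.
Proof. by rewrite !padic_addE => -> ->. Qed.

Lemma padic_congrM n x x' y y' : x n = x' n -> y n = y' n -> (x * y) n = (x' * y') n.
Proof. by rewrite !padic_mulE => -> ->. Qed.

Lemma padic_congrN n x x' : x n = x' n -> (- x) n = (- x') n.
Proof. by move=> /= ->. Qed.

Lemma padic_congrX n x x' i : x n = x' n -> (x ^+ i) n = (x' ^+ i) n.
Proof. by move=> e; elim: i => // i IH; rewrite !exprS; apply: padic_congrM. Qed.

Lemma padic_congr_nat x n : x n = ((x n)%:R : Zp) n.
Proof. by rewrite padic_natE padic_modn. Qed.

Lemma padic_congr_sub n x y : x n = y n <-> (x - y) n = 0%N.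
Proof.
split=> [xy|xy]; first by rewrite (padic_congrD xy (erefl ((- y) n))) subrr padic_zeroE.
rewrite -[x](subrK y); rewrite (@padic_congrD n (x - y) 0 y y) ?add0r //.
by rewrite xy padic_zeroE.
Qed.

Lemma padic_dvdP n x : x n = 0%N <-> exists y, x = (p ^ n)%:R * y.
Proof.
split=> [xn0|[y ->]]; last first.
  by rewrite padic_mulE padic_natE modnn mul0n mod0n.
have dv m : (p ^ n %| x (m + n))%N by rewrite /dvdn padic_coh xn0 mod0n.
have coh m : (x (m.+1 + n) %/ p ^ n = x (m + n) %/ p ^ n %[mod p ^ m])%N.
  apply/eqP; rewrite -(eqn_pmul2r (pX_gt0 n)) !muln_modl -!expnD !divnK //.
  by apply/eqP/padicS.
exists (@padic_of _ p_pr (fun m => x (m + n) %/ p ^ n)%N coh).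
apply: padicP => m; apply/esym; rewrite padic_mulE padic_natE modnMml modn_mod /=.
by rewrite modnMmr mulnC divnK // addnC padic_coh.
Qed.

Lemma padic_unitE x : (x \is a GRing.unit) = ~~ (p %| x 1%N)%N.
Proof.
apply/idP/idP => [ux|px].
  apply/negP => /dvdnP[q x1]; have := congr1 (fun y : Zp => y 1%N) (mulVr ux).
  rewrite padic_mulE x1 mulnA expn1 modnMl => /eqP; rewrite eq_sym (padic_natE 1) expn1.
  by rewrite modn_small ?prime_gt1.
have cop n : coprime (x n) (p ^ n).
  case: n => [|n]; first by rewrite expn0 coprimen1.
  rewrite coprimeXr // coprime_sym prime_coprime //.
  apply: contra px => d; have -> : x 1%N = (x n.+1 %% p ^ 1)%N.
    by rewrite -[n.+1]addn1 padic_coh padic_modn.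
  by rewrite expn1 /dvdn modn_mod -/(dvdn _ _).
have inv n : exists a, (a * x n = 1 %[mod p ^ n])%N.
  case: (posnP (x n)) => [x0|x0].
    by exists 1%N; have := cop n; rewrite x0 /coprime gcd0n => /eqP ->; rewrite !modn1.
  case: (egcdnP (p ^ n) x0) => a k e _.
  by exists a; rewrite e -modnDml modnMl add0n (eqP (cop n)).
have [v vP] := choice inv.
have coh n : v n.+1 = v n %[mod p ^ n].
  have e : (v n.+1 * x n = 1 %[mod p ^ n])%N.
    rewrite -modnMmr -padicS modnMmr -(@modn_dvdm (p ^ n.+1)) ?dvdn_exp2l //.
    by rewrite vP modn_dvdm ?dvdn_exp2l.
  rewrite -[LHS](congr1 (modn^~ _) (muln1 _)) -modnMmr -(vP n) modnMmr mulnCA.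
  by rewrite -modnMmr e modnMmr muln1.
apply/unitrP; exists (@padic_of _ p_pr v coh).
suff h : @padic_of _ p_pr v coh * x = 1 by split; rewrite // mulrC.
apply: padicP => n; rewrite padic_mulE modn_mod -modnMml padic_ofE modnMml vP.
by rewrite (padic_natE 1) modn_mod.
Qed.

Lemma padic_valP x : x != 0 -> exists n (u : Zp), u \is a GRing.unit /\ x = (p ^ n)%:R * u.
Proof.
move=> x0; have ex : exists n, x n.+1 != 0%N.
  apply: contrapT => /forallNP h; move/eqP: x0; apply; apply: padic_ext => -[|n].
    by rewrite !padic_level0.
  by rewrite padic_zeroE; apply/eqP; rewrite -[_ == _]negbK; apply/negP/h.
case: (ex_minnP ex) => n xn min; exists n.
have /padic_dvdP[u xu] : x n = 0%N.
  case: n xn min => [|n] xn min; first by rewrite padic_level0.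
  by apply/eqP; rewrite -[_ == _]negbK; apply/negP => /min; rewrite ltnn.
exists u; split => //; rewrite padic_unitE; apply: contra xn => /dvdnP[q uq].
have /padic_dvdP[w uw] : u 1%N = 0%N.
  by rewrite -padic_modn uq expn1 modnMl.
by apply/eqP/padic_dvdP; exists w; rewrite xu uw mulrA -natrM -expnD addn1.
Qed.

Lemma padic_nat_inj : injective (fun n : nat => n%:R : Zp).
Proof.
move=> m n /(congr1 (fun x : Zp => x (m + n).+1)); rewrite !padic_natE.
have lt a b : (a < p ^ (a + b).+1)%N.
  by apply: leq_ltn_trans (ltn_expl _ (prime_gt1 p_pr)); rewrite ltnW // ltnS leq_addr.
by rewrite modn_small // modn_small // addnC.
Qed.

(** Sequential compactness of a finite power of Z_p. At each level there are finitely many residues,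
    so one of them is shared by infinitely many terms, and the nested choices converge. *)
Lemma padic_compact (I : finType) (u : nat -> I -> Zp) :
  exists x : I -> Zp, forall n, exists2 k, (n <= k)%N & forall i, u k i n = x i n.
Proof.
pose T n := {ffun I -> 'I_(p ^ n)}.
pose lev n (y : I -> Zp) : T n := [ffun i => Ordinal (padic_lt (y i) n)].
have levP n (y z : I -> Zp) : lev n y = lev n z <-> forall i, y i n = z i n.
  split=> [/ffunP e i|e]; last by apply/ffunP => i; rewrite !ffunE; apply/val_inj/e.
  by have := congr1 val (e i); rewrite !ffunE.
pose inf (S : nat -> Prop) := forall n, exists2 k, (n <= k)%N & S k.
have pigeon n S : inf S -> exists t : T n, inf (fun k => S k /\ lev n (u k) = t).
  move=> infS; apply: contrapT => /forallNP h.
  have bound t : exists N, forall k, (N <= k)%N -> S k -> lev n (u k) <> t.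
    have /existsNP[N hN] := h t; exists N => k Nk Sk e.
    by apply: hN; exists k.
  have [N NP] := choice bound.
  have [k kN Sk] := infS (\max_t N t).
  by apply: (NP (lev n (u k)) k) => //; apply: leq_trans kN; apply: leq_bigmax.
pose next n (S : nat -> Prop) :=
  if pselect (inf S) is left h then
    (fun k => S k /\ lev n (u k) = sval (cid (pigeon n S h))) else S.
pose S := fix S n := if n is n'.+1 then next n (S n') else next 0%N (fun=> True).
have infnext n A : inf A -> inf (next n A) /\
    forall k k', next n A k -> next n A k' -> lev n (u k) = lev n (u k').
  move=> infA; rewrite /next; case: pselect => // h.
  case: cid => t /= tP; split=> // k k' [_ ->] [_ ->] //.
have infS n : inf (S n).
  by elim: n => [|n IH] /=; apply infnext => // m; exists m.
have subS n A k : next n A k -> A k by rewrite /next; case: pselect => // h [].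
have mono m n k : S (m + n)%N k -> S n k.
  by elim: m => // m IH /= /subS/IH.
have cst n k k' : S n k -> S n k' -> forall i, u k i n = u k' i n.
  move=> Sk Sk'; apply/levP; case: n Sk Sk' => [|n] /= Sk Sk'.
    by apply: (infnext 0%N (fun=> True) _).2 => // m; exists m.
  exact: (infnext n.+1 (S n) (infS n)).2.
have [k kP] := choice (fun n => let: ex_intro2 k a b := infS n n in
  ex_intro (fun k => (n <= k)%N /\ S n k) k (conj a b)).
have coh i n : u (k n.+1) i n.+1 = u (k n) i n %[mod p ^ n].
  rewrite padicS; congr (_ %% _)%N; apply: cst (kP n).2 _.
  by apply: (mono 1%N); apply: (kP n.+1).2.
exists (fun i => @padic_of _ p_pr _ (coh i)) => n; exists (k n); first exact: (kP n).1.
by move=> i /=; rewrite padic_modn.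
Qed.

(** The p-th power gains one digit: the cofactor of x - y in x^p - y^p is congruent to p y^(p-1)
    modulo p. *)
Lemma padic_congr_powp n x y : (0 < n)%N -> x n = y n -> (x ^+ p) n.+1 = (y ^+ p) n.+1.
Proof.
move=> n0 xy; apply/padic_congr_sub; rewrite subrXX.
have /padic_congr_sub/padic_dvdP[z ->] := xy.
have /padic_dvdP[w ->] : (\sum_(i < p) x ^+ (p.-1 - i) * y ^+ i) 1%N = 0%N.
  have xy1 : x 1%N = y 1%N := padic_congr_le n0 xy.
  transitivity ((\sum_(i < p) y ^+ (p.-1)) 1%N).
    elim/big_ind2: _ => // [a b c d|i _]; first exact: padic_congrD.
    rewrite -(@subnK i p.-1) ?addnK; last by rewrite -ltnS prednK ?prime_gt0.
    by rewrite exprD; apply: padic_congrM => //; apply: padic_congrX.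
  rewrite sumr_const card_ord -mulr_natr; apply/padic_dvdP.
  by exists (y ^+ p.-1); rewrite expn1 mulrC.
by apply/padic_dvdP; exists (z * w); rewrite mulrACA -natrM -expnD addn1.
Qed.

Lemma padic_torsion_uniq x y : x ^+ p = x -> y ^+ p = y -> x 1%N = y 1%N -> x = y.
Proof.
move=> xp yp xy; apply: padic_ext; elim=> [|n IH]; first by rewrite !padic_level0.
by case: n IH => // n IH; rewrite -xp -yp; apply: padic_congr_powp.
Qed.

Lemma padic_fermat x : x \is a GRing.unit -> (x ^+ p.-1) 1%N = (1 : Zp) 1%N.
Proof.
move=> ux; have xp : (x ^+ p) 1%N = x 1%N.
  rewrite (padic_congrX p (padic_congr_nat x 1)) -natrX padic_natE expn1.
  by rewrite fermat_little // -{2}(expn1 p) padic_modn.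
rewrite -[x ^+ p.-1](mulKr ux) -exprS prednK ?prime_gt0 // -[in RHS](mulVr ux).
exact: padic_congrM.
Qed.

Lemma padic_regular n x y : (p ^ n)%:R * x = (p ^ n)%:R * y -> x = y.
Proof.
apply: mulfI; apply/eqP => /(@padic_nat_inj _ 0%N) e; have := pX_gt0 n.
by rewrite e.
Qed.

(** Used to divide a character or a cocycle by the largest power of p common to all its values,
    after which some value is a unit. *)
Lemma padic_normalize (T : Type) (f : T -> Zp) : (exists t, f t <> 0) ->
  exists n (f' : T -> Zp) t, (forall s, f s = (p ^ n)%:R * f' s) /\ f' t \is a GRing.unit.
Proof.
move=> [t0 ft0]; have ex : exists n, `[< exists t, f t n.+1 <> 0%N >].
  apply: contrapT => /forallNP h; apply: ft0; apply: padic_ext => -[|n].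
    by rewrite !padic_level0.
  by rewrite padic_zeroE; apply: contrapT => e; apply: (h n); apply/asboolP; exists t0.
case: (ex_minnP ex) => n /asboolP[t ft] min; exists n.
have /choice[f' f'P] : forall s, exists y, f s = (p ^ n)%:R * y.
  move=> s; apply/padic_dvdP; case: n {ft} min => [|n] min; first exact: padic_level0.
  by apply: contrapT => e; have := min n; rewrite ltnn => h; suff : false by []; apply: h; apply/asboolP; exists s.
exists f', t; split=> //; rewrite padic_unitE; apply/negP => d; apply: ft.
have /padic_dvdP[y fy] : f' t 1%N = 0%N by rewrite -padic_modn expn1; apply/eqP.
by apply/padic_dvdP; exists y; rewrite f'P fy mulrA -natrM -expnD addn1.
Qed.

Section Logarithm.
Hypothesis p_gt2 : (2 < p)%N.

Lemma padic_log_step n (q : Zp) : exists r,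
  (1 + (p ^ n.+1)%:R * q) ^+ p = 1 + (p ^ n.+2)%:R * (q * (1 + (p ^ n.+1)%:R * r)).
Proof.
set X := _ * q.
have [A XA] := exprD1_prime X p_pr p_gt2.
exists (q * A + (p ^ n)%:R * q ^+ 2 * X ^+ (p - 3)).
rewrite XA (_ : X ^+ p = X ^+ (p - 3) * X ^+ 3); last by rewrite -exprD subnK.
set B := X ^+ (p - 3); rewrite /X !expnS !natrM.
ring.
Qed.

(** The limit of (u^(p^n) - 1) / p^(n+1), that is, log(u) divided by p. The clause on [w] records
    that all the quotients have the same valuation as the first one. *)
Definition padic_log_spec (u : Zp) : set Zp := fun L => exists q : nat -> Zp,
  (forall n, u ^+ (p ^ n) = 1 + (p ^ n.+1)%:R * q n) /\
  (forall n, L n.+1 = q n n.+1 /\ exists w, q n = q 0%N * w /\ w \is a GRing.unit).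

Lemma padic_log_exists (u : Zp) : u 1%N = (1 : Zp) 1%N -> exists L : Zp, padic_log_spec u L.
Proof.
move=> u1; have /padic_congr_sub/padic_dvdP[q0 q0E] := u1.
have /choice[r rP] : forall nq : nat * Zp, exists r,
  (1 + (p ^ nq.1.+1)%:R * nq.2) ^+ p = 1 + (p ^ nq.1.+2)%:R * (nq.2 * (1 + (p ^ nq.1.+1)%:R * r)).
  by move=> nq; apply: padic_log_step.
pose q := fix q n := if n is n'.+1 then q n' * (1 + (p ^ n'.+1)%:R * r (n', q n')) else q0.
have uq n : u ^+ (p ^ n) = 1 + (p ^ n.+1)%:R * q n.
  elim: n => [|n IH]; first by rewrite expn0 expr1 -q0E addrC subrK.
  by rewrite expnSr exprM IH (rP (n, q n)).
have qS n : q n.+1 n.+1 = q n n.+1.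
  apply/padic_congr_sub/padic_dvdP; exists (q n * r (n, q n)) => /=; ring.
have coh n : q n.+1 n.+1 = q n n %[mod p ^ n].
  by rewrite qS -(addn1 n) addnC padic_coh.
exists (@padic_of _ p_pr _ coh), q; split=> // n; split.
  by rewrite -[LHS]padic_modn padic_ofE padic_modn qS.
elim: n => [|n [w [qw uw]]]; first by exists 1; rewrite mulr1 unitr1.
exists (w * (1 + (p ^ n.+1)%:R * r (n, q n))); rewrite mulrA -qw; split=> //.
rewrite unitrM uw padic_unitE.
suff -> : (1 + (p ^ n.+1)%:R * r (n, q n)) 1%N = 1%N by rewrite dvdn1 neq_ltn prime_gt1 // orbT.
have -> : (1 + (p ^ n.+1)%:R * r (n, q n)) 1%N = (1 + 0 : Zp) 1%N.
  apply: padic_congrD => //; rewrite padic_zeroE; apply/padic_dvdP.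
  by exists ((p ^ n)%:R * r (n, q n)); rewrite mulrA -natrM -expnD add1n.
by rewrite addr0 (padic_natE 1) expn1 modn_small ?prime_gt1.
Qed.

Definition padic_log (u : Zp) : Zp := xget (0 : Zp) (padic_log_spec u).

Lemma padic_logP (u : Zp) : u 1%N = (1 : Zp) 1%N -> padic_log_spec u (padic_log u).
Proof.
move=> h; have := xgetPex (0 : Zp) (P := padic_log_spec u).
by apply; apply: padic_log_exists h.
Qed.

Lemma padic_logM (u v : Zp) : u 1%N = (1 : Zp) 1%N -> v 1%N = (1 : Zp) 1%N ->
  padic_log (u * v) = padic_log u + padic_log v.
Proof.
move=> u1 v1; have uv1 : (u * v) 1%N = (1 : Zp) 1%N by rewrite (padic_congrM u1 v1) mulr1.
have [q [qE qL]] := padic_logP u1; have [r [rE rL]] := padic_logP v1.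
have [s [sE sL]] := padic_logP uv1.
apply: padic_ext => -[|n]; first by rewrite !padic_level0.
rewrite (sL n).1 -(padic_congrD (esym (qL n).1) (esym (rL n).1)).
(* Expanding (uv)^(p^n) shows that the logarithm is additive up to a term divisible by p^(n+1). *)
have -> : s n = q n + r n + (p ^ n.+1)%:R * (q n * r n).
  apply: (@padic_regular n.+1); apply: (addrI 1); rewrite -sE exprMn qE rE; ring.
rewrite -[RHS](congr1 (fun z : Zp => z n.+1) (addr0 _)).
apply: padic_congrD => //; rewrite padic_zeroE; apply/padic_dvdP; by exists (q n * r n).
Qed.

Lemma padic_log_eq0 (u : Zp) n : u 1%N = (1 : Zp) 1%N ->
  padic_log u n = 0%N <-> u n.+1 = (1 : Zp) n.+1.
Proof.
case: n => [|n] u1; first by rewrite padic_level0.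
have [q [qE qL]] := padic_logP u1; have [-> [w [qw uw]]] := qL n.
have u0 : u = 1 + p%:R * q 0%N by rewrite -(expr1 u) -[in LHS](expn0 p) qE expn1.
split=> [/padic_dvdP[y qy]|/padic_congr_sub/padic_dvdP[y]].
  apply/padic_congr_sub/padic_dvdP; exists (y / w).
  rewrite u0 [1 + _]addrC addrK -[q 0%N](mulrK uw) -qw qy.
  by rewrite (expnS p n.+1) natrM; ring.
rewrite u0 [1 + _]addrC addrK expnS natrM -mulrA => e; apply/padic_dvdP; exists (y * w).
rewrite qw mulrA; congr (_ * _); move: e; exact: (@padic_regular 1).
Qed.

End Logarithm.

End PadicArithmetic.

(** * Conjugate elements of an algebraic closure are exchanged by an automorphism *)

Section ExtendingAutomorphisms.
Local Open Scope classical_set_scope.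
Variables (F : fieldType) (E : closedFieldType) (iota : {rmorphism F -> E}).
Hypothesis algE : forall x : E, algebraicOver iota x.

                                                                
(** An embedding over [F] of a subring of [E] into [E], encoded by its graph: the union of a chain
    is then a set union and the inverse is the swapped relation. *)
Record partial_iso (R : set (E * E)) : Prop := PartialIso {
  piso_base : forall c, R (iota c, iota c);
  pisoB : forall u v, R u -> R v -> R (u.1 - v.1, u.2 - v.2);
  pisoM : forall u v, R u -> R v -> R (u.1 * v.1, u.2 * v.2);
  piso_fun : forall y, R (0, y) -> y = 0
}.

Section OnePartialIso.
Variables (R : set (E * E)) (pR : partial_iso R).

Lemma piso0 : R (0, 0). Proof. by have := piso_base pR 0; rewrite rmorph0. Qed.
Lemma piso1 : R (1, 1). Proof. by have := piso_base pR 1; rewrite rmorph1. Qed.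

Lemma pisoN x y : R (x, y) -> R (- x, - y).
Proof. by move=> /(pisoB pR piso0) /=; rewrite !sub0r. Qed.

Lemma pisoD x y x' y' : R (x, y) -> R (x', y') -> R (x + x', y + y').
Proof. by move=> Rxy /pisoN /(pisoB pR Rxy) /=; rewrite !opprK. Qed.

Lemma pisoMM x y x' y' : R (x, y) -> R (x', y') -> R (x * x', y * y').
Proof. exact: pisoM. Qed.

Lemma piso_uniq x y y' : R (x, y) -> R (x, y') -> y = y'.
Proof.
move=> Rxy /(pisoB pR Rxy) /=; rewrite subrr => /(piso_fun pR) /eqP.
by rewrite subr_eq0 => /eqP.
Qed.

Lemma piso_horner (q : {poly F}) x y : R (x, y) ->
  R ((map_poly iota q).[x], (map_poly iota q).[y]).
Proof.
move=> Rxy; elim/poly_ind: q => [|q c IH]; first by rewrite rmorph0 !horner0; apply: piso0.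
rewrite rmorphD rmorphM /= map_polyX map_polyC !hornerMXaddC.
exact: pisoD (pisoMM IH Rxy) (piso_base pR c).
Qed.

Lemma pisoV x y : R (x, y) -> x != 0 -> y != 0 /\ R (x^-1, y^-1).
Proof.
move=> Rxy x0.
have [w Rw] : exists w, R (x^-1, w).
  have [q] := algE x; have [n] := ubnP (size q); elim: n q => // n IH q /ltnSE sq q0 qx.
  elim/poly_ind: q sq q0 qx => [|q c _] sq q0 qx; first by rewrite eqxx in q0.
  have [c0|c0] := eqVneq c 0.
    rewrite c0 addr0 in sq q0 qx; have qn0 : q != 0.
      by apply: contraNneq q0 => ->; rewrite mul0r.
    apply: (IH q) => //; first by rewrite size_mulX // in sq.
    move: qx; rewrite /root rmorphM /= map_polyX hornerMX mulf_eq0 (negPf x0) orbF //.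
  exists ((map_poly iota q).[y] * iota (- c^-1)).
  suff -> : x^-1 = (map_poly iota q).[x] * iota (- c^-1).
    exact: pisoMM (piso_horner q Rxy) (piso_base pR _).
  move: qx; rewrite /root rmorphD rmorphM /= map_polyX map_polyC hornerMXaddC.
  rewrite addr_eq0 => /eqP e; apply: (mulIf x0); rewrite mulVf // mulrAC e.
  by rewrite rmorphN fmorphV mulrNN mulfV // fmorph_eq0.
have yw : y * w = 1.
  by apply: (@piso_uniq 1) piso1; rewrite -(mulfV x0); apply: pisoMM.
have y0 : y != 0 by apply: contra_eqN yw => /eqP ->; rewrite mul0r eq_sym oner_eq0.
by split=> //; rewrite -[y^-1]mulr1 -yw mulKf.
Qed.

Lemma piso_sym : partial_iso [set u | R (u.2, u.1)].
Proof.
split=> [c|u v|u v|y] /=; first exact: piso_base.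
- exact: (@pisoB _ pR (u.2, u.1) (v.2, v.1)).
- exact: (@pisoM _ pR (u.2, u.1) (v.2, v.1)).
by move=> Ry; apply/eqP/negP => /negP /(pisoV Ry)[]; rewrite eqxx.
Qed.

(** Adjoins x by a pair of corresponding polynomials (P, Q) with P of least size among those
    vanishing at x; any root y of Q can serve as the image of x. *)
Lemma piso_extend x : exists (S : set (E * E)) y,
  [/\ partial_iso S, R `<=` S & S (x, y)].
Proof.
pose RP (P Q : {poly E}) := forall i, R (P`_i, Q`_i).
have RPB P Q P' Q' : RP P Q -> RP P' Q' -> RP (P - P') (Q - Q').
  by move=> h h' i; rewrite !coefB; apply: (pisoB pR (h i) (h' i)).
have RPM P Q P' Q' : RP P Q -> RP P' Q' -> RP (P * P') (Q * Q').
  move=> h h' i; rewrite !coefM; elim: (index_enum _) => [|j s IH].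
    by rewrite !big_nil; apply: piso0.
  by rewrite !big_cons; apply: pisoD IH; apply: pisoMM.
have RPC c d : R (c, d) -> RP c%:P d%:P.
  by move=> h [|i]; rewrite !coefC //=; apply: piso0.
have RPXn n : RP 'X^n 'X^n.
  by move=> i; rewrite coefXn; case: eqP => _; [apply: piso1 | apply: piso0].
have RPX : RP 'X 'X by rewrite -(expr1 'X).
have R0 c d : R (c, d) -> (c == 0) = (d == 0).
  move=> h; apply/eqP/eqP => e; first by move: h; rewrite e => /(piso_fun pR).
  by apply/eqP/negP => /negP /(pisoV h)[]; rewrite e eqxx.
have RPsize P Q : RP P Q -> size P = size Q.
  move=> h; apply/eqP; rewrite eqn_leq; apply/andP; split; apply/leq_sizeP => i.
    by move=> /leq_sizeP/(_ i (leqnn _)) e; apply/eqP; rewrite (R0 _ _ (h i)) e.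
  by move=> /leq_sizeP/(_ i (leqnn _)) e; apply/eqP; rewrite -(R0 _ _ (h i)) e.
have ex : exists n, `[< exists P Q : {poly E}, [/\ size P = n, RP P Q, P != 0 & root P x] >].
  have [q q0 qx] := algE x; exists (size q); apply/asboolP.
  exists (map_poly iota q), (map_poly iota q); rewrite size_map_poly map_poly_eq0.
  by split=> // i; rewrite coef_map; apply: piso_base.
case: (ex_minnP ex) => n /asboolP[P [Q [sP PQ P0 Px]]] min.
have sQ : size Q = n by rewrite -sP (RPsize _ _ PQ).
have n1 : (1 < n)%N.
  rewrite -sP ltnNge; apply: contra P0 => /size1_polyC e; move: Px; rewrite e.
  by rewrite /root hornerC polyC_eq0.
have /closed_rootP[y Qy] : size Q != 1%N by rewrite sQ gtn_eqF.
(* Both members of a pair are divided in parallel by P and Q, so the size drops; minimality of P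
   disposes of the remainder. *)
have vanish A B : RP A B -> root A x -> root B y.
  have [k] := ubnP (size A); elim: k A B => // k IH A B /ltnSE sA AB Ax.
  have [sAn|nsA] := ltnP (size A) n.
    have /eqP A0 : A == 0.
      apply: contraTT sAn => A0; rewrite -leqNgt; apply: min; apply/asboolP.
      by exists A, B.
    suff -> : B = 0 by rewrite root0.
    by apply/eqP; rewrite -size_poly_eq0 -(RPsize _ _ AB) A0 size_poly0.
  have A0 : A != 0 by rewrite -size_poly_gt0 (leq_trans _ nsA) // ltnW.
  pose c := lead_coef A / lead_coef P; pose d := lead_coef B / lead_coef Q.
  pose m := (size A - n)%N.
  have Rcd : R (c, d).
    apply: pisoMM; first by rewrite !lead_coefE -(RPsize _ _ AB).
    have RPQ : R (lead_coef P, lead_coef Q) by rewrite !lead_coefE -(RPsize _ _ PQ).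
    by apply: (pisoV RPQ _).2; rewrite lead_coef_eq0.
  have cC : RP (A - c%:P * 'X^m * P) (B - d%:P * 'X^m * Q).
    by apply: RPB => //; apply: (RPM) => //; apply: (RPM) => //; apply: RPC.
  have c0 : c != 0 by rewrite mulf_neq0 ?invr_eq0 ?lead_coef_eq0.
  have sz : (size (A - c%:P * 'X^m * P)%R < size A)%N.
    have sT : size (c%:P * 'X^m * P) = size A.
      rewrite -mulrA size_Cmul // size_monicM ?monicXn // size_polyXn sP /m.
      by rewrite addSn /= subnK.
    have lT : lead_coef (c%:P * 'X^m * P) = lead_coef A.
      by rewrite !lead_coefM lead_coefC lead_coefXn mulr1 divfK ?lead_coef_eq0.
    have A1 : (0 < size A)%N by rewrite size_poly_gt0.
    rewrite -(prednK A1) ltnS; apply/leq_sizeP => i; rewrite leq_eqVlt => /orP[/eqP <-|i1].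
      rewrite coefB -{2}sT -!lead_coefE lT subrr //.
    by rewrite coefB !nth_default ?subrr // ?sT -(prednK A1).
  have := IH _ _ (leq_trans sz sA) cC; rewrite !rootE !hornerE (rootP Px) (rootP Qy).
  by rewrite !mulr0 !subr0 -!rootE; apply.
exists [set u | exists A B, RP A B /\ u = (A.[x], B.[y])], y; split.
- split.
  + by move=> c; exists (iota c)%:P, (iota c)%:P; rewrite !hornerC; split=> //; apply: RPC; apply: piso_base.
  + move=> _ _ [A [B [AB ->]]] [A' [B' [AB' ->]]]; exists (A - A'), (B - B').
    by rewrite !hornerE; split=> //; apply: RPB.
  + move=> _ _ [A [B [AB ->]]] [A' [B' [AB' ->]]]; exists (A * A'), (B * B').
    by rewrite !hornerE; split=> //; apply: RPM.
  + by move=> z [A [B [AB [/esym/rootP Ax ->]]]]; apply/rootP/(vanish A).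
- by move=> [u v] Ruv; exists u%:P, v%:P; rewrite !hornerC; split=> //; apply: RPC.
by exists 'X, 'X; rewrite !hornerX.
Qed.

End OnePartialIso.

(** By Zorn there is a maximal partial isomorphism sending x to y. It is total by [piso_extend], and
    onto by [piso_extend] applied to its inverse. *)
Lemma abs_gal_conjugate (x y : E) :
  (forall q : {poly F}, root (map_poly iota q) x -> root (map_poly iota q) y) ->
  exists g : abs_gal iota, g x = y.
Proof.
move=> xy.
pose good R := R = set0 \/ partial_iso R /\ R (x, y).
pose R0 := [set u | exists q : {poly F}, u = ((map_poly iota q).[x], (map_poly iota q).[y])].
have gR0 : partial_iso R0 /\ R0 (x, y).
  split; last by exists 'X; rewrite map_polyX !hornerX.
  split.
  - by move=> c; exists c%:P; rewrite map_polyC !hornerC.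
  - by move=> _ _ [q ->] [r ->]; exists (q - r); rewrite rmorphB !hornerE.
  - by move=> _ _ [q ->] [r ->]; exists (q * r); rewrite rmorphM !hornerE.
  by move=> z [q [/esym/rootP/xy/rootP -> ->]].
have [|R [gR maxR]] := @Zorn_bigcup _ good.
  move=> C Cgood Ctot.
  have [C0|] := pselect (forall R, C R -> R = set0).
    by left; rewrite bigcup0.
  move=> /existsNP[R /not_implyP[CR /eqP/set0P Rn0]]; right.
  have piC S u : C S -> S u -> partial_iso S /\ S (x, y).
    by move=> /Cgood[->|].
  have [u0 Ru0] := Rn0; have [pR Rxy] := piC _ _ CR Ru0.
  split; last by exists R.
  have join u v : (\bigcup_(X in C) X) u -> (\bigcup_(X in C) X) v ->
      exists S, [/\ C S, partial_iso S, S u & S v].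
    move=> [S CS Su] [S' CS' Sv]; have [SS'|S'S] := Ctot _ _ CS CS'.
      by exists S'; split=> //; [apply: (piC _ _ CS' Sv).1 | apply: SS'].
    by exists S; split=> //; [apply: (piC _ _ CS Su).1 | apply: S'S].
  split=> [c|u v Su Sv|u v Su Sv|z [S CS Sz]].
  - by exists R => //; apply: piso_base.
  - by have [S [CS pS Su' Sv']] := join u v Su Sv; exists S => //; apply: pisoB.
  - by have [S [CS pS Su' Sv']] := join u v Su Sv; exists S => //; apply: pisoM.
  exact: (piso_fun (piC _ _ CS Sz).1 Sz).
have {gR}[pR Rxy] : partial_iso R /\ R (x, y).
  case: gR => // Re; case: (maxR R0); last by right.
  by rewrite Re; split=> [z //|sub]; apply: (sub _ gR0.2).
have maximal S : partial_iso S -> R `<=` S -> S `<=` R.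
  move=> pS RS; apply: contrapT => nSR; apply: (maxR S); first by split.
  by right; split=> //; apply: RS.
have total u : exists v, R (u, v).
  have [S [v [pS RS Suv]]] := piso_extend pR u; exists v.
  exact: maximal pS RS _ Suv.
have surj v : exists u, R (u, v).
  have [S [u [pS RS Svu]]] := piso_extend (piso_sym pR) v; exists u.
  apply: (maximal _ (piso_sym pS)) => // -[a b] Rab /=; exact: (RS (b, a)).
have [g gP] := choice total; have [h hP] := choice surj.
have gE u v : R (u, v) -> g u = v by move=> Ruv; apply: piso_uniq (gP u) Ruv.
have hE u v : R (u, v) -> h v = u.
  by move=> Ruv; apply: (piso_uniq (piso_sym pR) (x := v)) => /=; first exact: hP.
have gD : {morph g : u v / u + v} by move=> u v; apply: gE; apply: pisoD.
have gM : {morph g : u v / u * v} by move=> u v; apply: gE; apply: pisoMM.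
have gB : bijective g.
  by exists h => u; [apply: hE | apply: gE].
have gF c : g (iota c) = iota c by apply: gE; apply: piso_base pR c.
by exists (AbsGal gD gM gB gF); apply: gE.
Qed.

End ExtendingAutomorphisms.

                                                   

(** * Integrality over Z_p through matrices: units, powers of p, congruences modulo p *)

Lemma horner_mx_comp (R : comNzRingType) d (A : 'M[R]_d.+1) (q r : {poly R}) :
  horner_mx A (q \Po r) = horner_mx (horner_mx A r) q.
Proof.
elim/poly_ind: q => [|q c IH]; first by rewrite comp_poly0 !rmorph0.
rewrite comp_poly_MXaddC [LHS]rmorphD [RHS]rmorphD /= ![horner_mx _ (_ * _)]rmorphM /= IH.
by rewrite !horner_mx_C horner_mx_X.
Qed.

Section PadicNumbers.
Variables (p : nat) (p_pr : prime p).
Local Notation Zp := (padic_int p_pr).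
Local Notation Qp := (padic_num p_pr).
Local Notation tofrac := (@FracField.tofrac Zp).

Lemma padic_num_frac (x : Qp) : exists a b : Zp, b != 0 /\ x = tofrac a / tofrac b.
Proof.
have : x = \pi_(FracField.type Zp)%qT (repr x) by rewrite reprK.
move: (repr x) => r ->; exists (frac r).1, (frac r).2; have d0 := denom_ratioP r.
split=> //; apply: (canRL (mulfK _)); first by rewrite tofrac_eq0.
rewrite !piE; apply/eqP; rewrite piE /= /FracField.mulf FracField.equivfE.
by rewrite !numden_Ratio ?mulr1 ?oner_neq0 // mulrC.
Qed.

Let pnz : tofrac p%:R != 0.
Proof.
rewrite tofrac_eq0; apply/eqP => /(@padic_nat_inj _ p_pr p 0) e.
by move: p_pr; rewrite e.
Qed.

Lemma tofrac_unit (u : Zp) : u \is a GRing.unit -> (tofrac u)^-1 = tofrac u^-1.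
Proof.
move=> uu; apply: (mulfI (x := tofrac u)).
  by rewrite tofrac_eq0; apply: contraTneq uu => ->; rewrite unitr0.
rewrite mulfV; first by rewrite -tofracM divrr // tofrac1.
by rewrite tofrac_eq0; apply: contraTneq uu => ->; rewrite unitr0.
Qed.

Lemma padic_num_scale (x : Qp) : exists a z, tofrac p%:R ^+ a * x = tofrac z.
Proof.
have [n [d [d0 ->]]] := padic_num_frac x.
have [a [u [uu ->]]] := padic_valP d0; exists a, (n * u^-1).
by rewrite !tofracM natrX tofracXn invfM tofrac_unit // mulrCA mulVKf // expf_neq0.
Qed.

Lemma padic_num_val (x : Qp) : x != 0 ->
  exists a b (u : Zp), u \is a GRing.unit /\ tofrac p%:R ^+ a * x = tofrac p%:R ^+ b * tofrac u.
Proof.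
move=> x0; have [a [z e]] := padic_num_scale x.
have z0 : z != 0 by rewrite -tofrac_eq0 -e; apply: mulf_neq0 => //; apply: expf_neq0.
have [b [u [uu zu]]] := padic_valP z0; exists a, b, u; split=> //.
by rewrite e zu tofracM natrX tofracXn.
Qed.

Section IntegralMatrices.
Variable d : nat.
Implicit Types M : 'M[Qp]_d.
Local Notation "M ^F" := (map_mx tofrac M) (at level 2).

Lemma integral_mx_scale M : exists a (M0 : 'M[Zp]_d), tofrac p%:R ^+ a *: M = M0^F.
Proof.
have /choice[a aP] : forall ij : 'I_d * 'I_d, exists a, exists z,
    tofrac p%:R ^+ a * M ij.1 ij.2 = tofrac z.
  by move=> ij; apply: padic_num_scale.
have /choice[z zP] := aP; pose b := \max_ij a ij; exists b.
exists (\matrix_(i, j) (p%:R ^+ (b - a (i, j)) * z (i, j))).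
apply/matrixP => i j; rewrite !mxE tofracM tofracXn -(zP (i, j)) mulrA -exprD subnK //.
exact: (leq_bigmax (i, j)).
Qed.

Lemma primitive_mx (M0 : 'M[Zp]_d) : M0 != 0 ->
  exists b (M1 : 'M[Zp]_d), M0 = p%:R ^+ b *: M1 /\ exists i j, M1 i j 1%N <> 0%N.
Proof.
move=> M0n0; have ex : exists n, `[< exists i j, M0 i j n.+1 <> 0%N >].
  apply: contrapT => /forallNP h; move/eqP: M0n0; apply; apply/matrixP => i j.
  rewrite mxE; apply: padic_ext => -[|n]; first by rewrite !padic_level0.
  rewrite padic_zeroE; apply: contrapT => e; apply: (h n); apply/asboolP; by exists i, j.
case: (ex_minnP ex) => n /asboolP[i [j Mij]] min.
have /choice[f fP] : forall ij : 'I_d * 'I_d, exists y, M0 ij.1 ij.2 = (p ^ n)%:R * y.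
  move=> ij; apply/padic_dvdP; case: n {Mij} min => [|n] min; first exact: padic_level0.
  apply: contrapT => e; have : (n.+1 <= n)%N by apply: min; apply/asboolP; exists ij.1, ij.2.
  by rewrite ltnn.
exists n, (\matrix_(i, j) f (i, j)); split.
  by apply/matrixP => i' j'; rewrite !mxE (fP (i', j')) natrX.
exists i, j; rewrite mxE => /padic_dvdP[y fy]; apply: Mij; apply/padic_dvdP.
by exists y; rewrite (fP (i, j)) fy mulrA -natrM -expnD addn1.
Qed.

End IntegralMatrices.

Section IrreducibleMatrix.
Variable d : nat.
Local Notation "M ^F" := (map_mx tofrac M) (at level 2).
Variable Y : 'M[Qp]_d.+1.
Hypothesis irrY : forall q : {poly Qp}, q != 0 -> (size q <= d.+1)%N -> horner_mx Y q \in unitmx.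

(** Irreducibility of Y makes v, vY, ..., vY^d a basis; a matrix that commutes with Y and kills v
    kills all of it. *)
Lemma commute_kernel_irr (W : 'M[Qp]_d.+1) (v : 'rV_d.+1) :
  v != 0 -> Y *m W = W *m Y -> v *m W = 0 -> W = 0.
Proof.
move=> v0 YW vW; pose K := \matrix_(i < d.+1) (v *m Y ^+ i).
have Kq u : u *m K = v *m horner_mx Y (rVpoly u).
  rewrite mulmx_sum_row /rVpoly poly_def rmorph_sum /= mulmx_sumr.
  apply: eq_bigr => i _; rewrite rowK linearZ /= rmorphXn /= horner_mx_X -scalemxAr.
  by case: insubP => [j _ /val_inj ->|]; rewrite ?ltn_ord.
have fK : row_free K.
  apply/inj_row_free => u; rewrite Kq; have [//|u0 e] := eqVneq u 0.
  have qu : rVpoly u != 0 by apply: contra_neq u0 => e'; rewrite -[u]rVpolyK e' linear0.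
  have := irrY qu (size_poly _ _); move=> /mulmxK/(_ v); rewrite e mul0mx => /esym /eqP.
  by rewrite (negPf v0).
have KW : K *m W = 0.
  apply/row_matrixP => i; rewrite row_mul rowK row0 -mulmxA.
  have -> : Y ^+ i *m W = W *m Y ^+ i.
    by apply/esym; exact: (@commrX _ W Y i (esym YW)).
  by rewrite mulmxA vW mul0mx.
by rewrite row_free_unit in fK; rewrite -(mulKmx fK W) KW mulmx0.
Qed.

Variable Z : 'M[Qp]_d.+1.
Hypotheses (YZ : Y *m Z = Z *m Y) (u : Zp) (uu : u \is a GRing.unit) (detZu : \det Z = tofrac u).

Let tofracI (x y : Zp) : tofrac x = tofrac y -> x = y.
Proof. by move/eqP; rewrite tofrac_eq => /eqP. Qed.

Let pX0 a : tofrac p%:R ^+ a != 0. Proof. by rewrite expf_neq0. Qed.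

Lemma detX (R : comNzRingType) (M : 'M[R]_d.+1) j : \det (M ^+ j) = \det M ^+ j.
Proof. by elim: j => [|j IH]; rewrite ?expr0 ?det1 // !exprS det_mulmx IH. Qed.

(** If the denominators were unbounded, rescaling powers of Z to primitive integral matrices would
    give determinants tending to 0, because det Z is a unit. A limit point is a nonzero singular
    matrix commuting with Y, which [commute_kernel_irr] forbids. *)
Lemma bounded_powers : exists a, forall j, exists M0 : 'M[Zp]_d.+1,
  tofrac p%:R ^+ a *: Z ^+ j = M0^F.
Proof.
apply: contrapT => /forallNP unb.
have Zu j : \det (Z ^+ j) = tofrac (u ^+ j) by rewrite detX detZu tofracXn.
have Zn0 j : \det (Z ^+ j) != 0.
  by rewrite Zu tofrac_eq0 expf_neq0 //; apply: contraTneq uu => ->; rewrite unitr0.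
have {unb} prim k : exists W : 'M[Zp]_d.+1, [/\ Y *m W^F = W^F *m Y,
    \det W k = 0%N & exists i j, W i j 1%N <> 0%N].
  have /existsNP[j Zj] := unb k.
  have [a [M0 aZ]] := integral_mx_scale (Z ^+ j).
  have M0n0 : M0 != 0.
    apply: contraTneq (Zn0 j) => M00; move: aZ; rewrite M00 map_mx0 => /eqP.
    by rewrite scaler_eq0 (negPf (pX0 a)) /= => /eqP ->; rewrite det0 eqxx.
  have [b [W [M0W Wprim]]] := primitive_mx M0n0.
  have aZ' : tofrac p%:R ^+ a *: Z ^+ j = tofrac p%:R ^+ b *: W^F.
    by rewrite aZ M0W map_mxZ /= tofracXn.
  have ba : (b + k < a)%N.
    rewrite ltnNge; apply/negP => ab; apply: Zj; exists (p%:R ^+ (b + k - a) *: W).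
    rewrite map_mxZ /= tofracXn; apply: (scalerI (pX0 a)).
    rewrite !scalerA -!exprD subnKC // (addnC a) (addnC b) !exprD -!scalerA aZ'.
    by rewrite scalerA.
  exists W; split=> //.
    apply: (scalerI (pX0 b)); rewrite scalemxAr -aZ' -scalemxAr [RHS]scalemxAl -aZ'.
    rewrite -scalemxAl; congr (_ *: _); exact: (@commrX _ Y Z j YZ).
  have ab : a = (b + (k + (a - b - k)))%N by lia.
  set c := (a - b - k)%N in ab.
  have {aZ'} ZW : tofrac p%:R ^+ (k + c) *: Z ^+ j = W^F.
    by apply: (scalerI (pX0 b)); rewrite scalerA -exprD -ab.
  apply/(padic_dvdP k); have := congr1 determinant ZW; rewrite detZ Zu det_map_mx.
  rewrite -exprM -tofracXn -tofracM => /tofracI <-.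
  exists (p%:R ^+ (k * d + c * d.+1) * u ^+ j); rewrite mulrA natrX -exprD.
  by congr (_ ^+ _ * _); lia.
have [W WP] := choice prim.
have [x xP] := padic_compact (fun k (ij : 'I_d.+1 * 'I_d.+1) => W k ij.1 ij.2).
pose W' : 'M[Zp]_d.+1 := \matrix_(i, j) x (i, j).
have W'P n : exists2 k, (n <= k)%N & forall i j, W k i j n = W' i j n.
  by have [k nk e] := xP n; exists k => // i j; rewrite mxE -(e (i, j)).
have congr_sum n (I : finType) (f g : I -> Zp) :
    (forall i, f i n = g i n) -> (\sum_i f i) n = (\sum_i g i) n.
  move=> fg; elim/big_ind2: _ => // x1 x2 y1 y2; exact: padic_congrD.
have congr_prod n (I : finType) (f g : I -> Zp) :
    (forall i, f i n = g i n) -> (\prod_i f i) n = (\prod_i g i) n.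
  move=> fg; elim/big_ind2: _ => // x1 x2 y1 y2; exact: padic_congrM.
have detW' : \det W' = 0.
  apply: padic_ext => n; have [k nk e] := W'P n; rewrite padic_zeroE.
  have [_ dk _] := WP k; transitivity (\det (W k) n).
    by apply: congr_sum => s; apply: padic_congrM => //; apply: congr_prod => i.
  by rewrite (padic_congr_le nk (y := 0)) ?padic_zeroE.
have YW' : Y *m W'^F = W'^F *m Y.
  have [a [Y0 aY]] := integral_mx_scale Y.
  apply: (scalerI (pX0 a)); rewrite scalemxAl scalemxAr aY -!map_mxM; congr (_^F).
  apply/matrixP => i j; apply: padic_ext => n; have [k nk e] := W'P n.
  have YW : Y0 *m W k = W k *m Y0.
    have [YW _ _] := WP k; have YWF : (Y0 *m W k)^F = (W k *m Y0)^F.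
      by rewrite !map_mxM -aY -scalemxAl YW scalemxAr.
    apply/matrixP => s t; apply: tofracI; move/matrixP/(_ s t): YWF.
    by rewrite [LHS]mxE [RHS]mxE.
  transitivity ((Y0 *m W k) i j n); last rewrite YW.
    by rewrite !mxE; apply: congr_sum => l; apply: padic_congrM.
  by rewrite !mxE; apply: congr_sum => l; apply: padic_congrM.
have W'0 : W'^F = 0.
  have /eqP/det0P[v v0 vW] : \det (W'^F) = 0 by rewrite det_map_mx detW' rmorph0.
  exact: commute_kernel_irr v0 YW' vW.
have [k k1 e] := W'P 1%N; have [_ _ [i [j Wij]]] := WP k; apply: Wij; rewrite e.
have := congr1 (fun M : 'M_d.+1 => M i j) W'0; rewrite mxE [in RHS]mxE -tofrac0 => /tofracI ->.
exact: padic_zeroE.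
Qed.

(** An element whose norm is a unit is integral; this replaces the uniqueness of the extension of
    the valuation. By compactness two powers of Z differ by an integral matrix, and its
    characteristic polynomial composed with X^j - X^i annihilates Z. *)
Lemma integral_mx_of_det : exists2 g : {poly Zp}, g \is monic & horner_mx Z (map_poly tofrac g) = 0.
Proof.
have [a /choice[M MP]] := bounded_powers.
have [x xP] := padic_compact (fun k (ij : 'I_d.+1 * 'I_d.+1) => M k ij.1 ij.2).
have [i ai ei] := xP a; have [j ij ej] := xP (i.+1 + a)%N.
have lt : (i < j)%N by apply: leq_trans ij; rewrite leq_addr.
have /choice[E EP] : forall st : 'I_d.+1 * 'I_d.+1, exists y,
    M j st.1 st.2 - M i st.1 st.2 = (p ^ a)%:R * y.
  move=> st; apply/padic_dvdP/padic_congr_sub.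
  by rewrite ei; apply: (@padic_congr_le _ _ _ _ _ (i.+1 + a)); rewrite ?leq_addl.
pose E' : 'M[Zp]_d.+1 := \matrix_(s, t) E (s, t).
have ZE : Z ^+ j - Z ^+ i = E'^F.
  apply: (scalerI (pX0 a)); rewrite scalerBr !MP; apply/matrixP => s t.
  by rewrite !mxE -tofracB (EP (s, t)) tofracM natrX tofracXn.
pose g0 : {poly Zp} := 'X^j - 'X^i.
have s0 : (1 < size g0)%N.
  by rewrite size_polyDl ?size_polyN ?size_polyXn ?ltnS // (leq_ltn_trans _ lt).
have g0m : g0 \is monic.
  by rewrite monicE lead_coefDl ?lead_coefXn // size_polyN !size_polyXn ltnS.
have Zg0 : horner_mx Z (map_poly tofrac g0) = E'^F.
  by rewrite -ZE rmorphB /= !map_polyXn rmorphB /= !rmorphXn /= horner_mx_X.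
exists (char_poly E' \Po g0).
  by rewrite monicE lead_coef_comp // (monicP g0m) (monicP (char_poly_monic _)) expr1n mul1r.
rewrite map_comp_poly map_char_poly.
by rewrite horner_mx_comp Zg0 Cayley_Hamilton.
Qed.

End IrreducibleMatrix.
Section IntegralClosure.
Variables (F : fieldExtType Qp) (E : fieldType) (iota : {rmorphism F -> E}).

Definition padic_scalar : {rmorphism Qp -> E} := iota \o in_alg F.
Definition padic_int_scalar : {rmorphism Zp -> E} := padic_scalar \o tofrac.
Local Notation j := padic_scalar.
Local Notation O := (int_closure (p_pr := p_pr) iota).

Lemma int_scalar z : O (padic_int_scalar z). Proof. exact: integral_id. Qed.
Lemma int_nat n : O n%:R. Proof. exact: (integral_nat padic_int_scalar). Qed.
Lemma int0 : O 0. Proof. exact: (int_nat 0). Qed.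
Lemma int1 : O 1. Proof. exact: (int_nat 1). Qed.
Lemma intD x y : O x -> O y -> O (x + y).
Proof. exact: (integral_add (RtoK := padic_int_scalar)). Qed.
Lemma intB x y : O x -> O y -> O (x - y).
Proof. exact: (integral_sub (RtoK := padic_int_scalar)). Qed.
Lemma intM x y : O x -> O y -> O (x * y).
Proof. exact: (integral_mul (RtoK := padic_int_scalar)). Qed.
Lemma intX x n : O x -> O (x ^+ n).
Proof. by move=> Ox; elim: n => [|n IH]; rewrite ?expr0 ?exprS; [apply: int1 | apply: intM]. Qed.
Lemma intN x : O x -> O (- x). Proof. by move=> Ox; rewrite -sub0r; apply: intB; first exact: int0. Qed.
Lemma int_sum (I : Type) (r : seq I) (P : pred I) (f : I -> E) :
  (forall i, O (f i)) -> O (\sum_(i <- r | P i) f i).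
Proof. by move=> h; elim/big_ind: _ => //; [apply: int0 | apply: intD]. Qed.

Lemma int_root x n : (0 < n)%N -> O (x ^+ n) -> O x.
Proof.
move=> n0 Oxn; apply: (@integral_root_monic _ _ padic_int_scalar x ('X^n - (x ^+ n)%:P)).
- by rewrite monicE lead_coefDl ?lead_coefXn // size_polyN size_polyXn size_polyC ltnS; case: eqP.
- by rewrite rootE !hornerE subrr.
by apply/integral_poly => i; rewrite coefB coefXn coefC; apply: intB; [apply: int_nat | case: eqP => // _; apply: int0].
Qed.

Lemma int_unit_nat n : ~~ (p %| n)%N -> O n%:R^-1.
Proof.
move=> pn; have un : (n%:R : Zp) \is a GRing.unit.
  by rewrite padic_unitE padic_natE expn1 /dvdn modn_mod.
suff -> : n%:R^-1 = padic_int_scalar (n%:R)^-1 by apply: int_scalar.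
by rewrite rmorphV // rmorph_nat.
Qed.

Lemma padic_int_scalar_inj : injective padic_int_scalar.
Proof.
move=> x y e; have e1 : in_alg F (tofrac x) = in_alg F (tofrac y) := fmorph_inj iota e.
by apply/eqP; rewrite -tofrac_eq; apply/eqP; apply: (fmorph_inj (in_alg F)) e1.
Qed.

Lemma pnat_neq0 n : (0 < n)%N -> n%:R != 0 :> E.
Proof.
move=> n0; rewrite -(rmorph_nat padic_int_scalar) -(rmorph0 padic_int_scalar).
by apply/eqP => /padic_int_scalar_inj /(@padic_nat_inj _ p_pr n 0) e; rewrite e in n0.
Qed.

Lemma invp_not_int : ~ O p%:R^-1.
Proof.
move=> [q qm qr].
have p0 : (p%:R : E) != 0 by rewrite pnat_neq0 // prime_gt0.
have sq : (size q).-1.+1 = size q by rewrite prednK // size_poly_gt0 monic_neq0.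
pose n := (size q).-1.
have e : \sum_(i < size q) q`_i * p%:R ^+ (n - i) = 0.
  have qr' : root (map_poly padic_int_scalar q) p%:R^-1 := qr.
  apply: padic_int_scalar_inj; rewrite rmorph0 rmorph_sum.
  have /(congr1 (fun z => z * p%:R ^+ n)) := rootP qr'.
  rewrite mul0r (@horner_coef_wide _ (size q)); last exact: size_poly.
  rewrite mulr_suml => e0; rewrite -[RHS]e0; apply: eq_bigr => i _.
  rewrite rmorphM rmorphXn rmorph_nat coef_map -mulrA; congr (_ * _).
  have ni : (i <= n)%N by rewrite -ltnS sq.
  by rewrite exprVn -[in RHS](subnK ni) exprD mulrCA mulVf ?mulr1 // expf_neq0.
have : (\sum_(i < size q) q`_i * p%:R ^+ (n - i)) 1%N = 1%N.
  have -> : \sum_(i < size q) q`_i * p%:R ^+ (n - i) = \sum_(i < n) q`_i * p%:R ^+ (n - i) + 1.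
    rewrite -sq big_ord_recr /= subnn expr0 mulr1; congr (_ + _).
    by have := monicP qm; rewrite lead_coefE.
  transitivity ((0 + 1 : Zp) 1%N).
    apply: padic_congrD => //; elim/big_rec: _ => // i x _ <-.
    rewrite -[RHS](congr1 (fun z : Zp => z 1%N) (add0r x)).
    apply: padic_congrD => //; rewrite padic_zeroE; apply/padic_dvdP.
    by exists (q`_i * p%:R ^+ (n - i).-1); rewrite expn1 mulrCA -exprS prednK // subn_gt0.
  by rewrite add0r (padic_natE p_pr 1) expn1 modn_small ?prime_gt1.
by rewrite e padic_zeroE.
Qed.

(** The sum of the 1 - z^i over i < n equals n, so 1 - z divides n, which is a unit. *)
Lemma int_one_sub_unity z n : ~~ (p %| n)%N -> (0 < n)%N -> z ^+ n = 1 -> z != 1 -> O (1 - z)^-1.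
Proof.
move=> pn n0 zn z1; have Oz : O z by apply: (@int_root _ n) => //; rewrite zn; apply: int1.
have z10 : 1 - z != 0 by rewrite subr_eq0 eq_sym.
have geo m : (1 - z) * \sum_(i < m) z ^+ i = 1 - z ^+ m.
  by rewrite -opprB mulNr -subrX1 opprB.
have sum0 : \sum_(i < n) z ^+ i = 0 by apply: (mulfI z10); rewrite mulr0 geo zn subrr.
have nE : n%:R = (1 - z) * \sum_(i < n) \sum_(k < i) z ^+ k.
  transitivity (\sum_(i < n) (1 - z ^+ i)); first by rewrite sumrB sumr_const card_ord sum0 subr0.
  by rewrite mulr_sumr; apply: eq_bigr => i _; rewrite geo.
have -> : (1 - z)^-1 = (\sum_(i < n) \sum_(k < i) z ^+ k) / n%:R.
  by apply: (mulfI z10); rewrite mulfV // mulrA -nE mulfV // (pnat_neq0 n0).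
by apply: intM; [do 2 (apply: int_sum => ?); apply: intX | apply: int_unit_nat].
Qed.

                                                                            
                                                
(** The radical of the ideal generated by p in the integral closure. It plays the part of the
    maximal ideal of the valuation ring. *)
Definition radp x := O x /\ exists n, O (x ^+ n / p%:R).

Lemma radpM x y : O x -> radp y -> radp (x * y).
Proof.
move=> Ox [Oy [n yn]]; split; first exact: intM.
by exists n; rewrite exprMn -mulrA; apply: intM => //; apply: intX.
Qed.

Lemma radp_le x n m : O x -> (n <= m)%N -> O (x ^+ n / p%:R) -> O (x ^+ m / p%:R).
Proof. by move=> Ox /subnK <- h; rewrite exprD -mulrA; apply: intM => //; apply: intX. Qed.

Lemma radpB x y : radp x -> radp y -> radp (x - y).
Proof.
move=> [Ox [n xn]] [Oy [m ym]]; split; first exact: intB.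
exists (n + m)%N; rewrite exprBn mulr_suml; apply: int_sum => i.
rewrite mulrnAl -mulr_natr; apply: intM; last exact: int_nat.
have O1 : O ((-1) ^+ i) by apply/intX/intN/int1.
have [ni|mi] : (n <= n + m - i)%N \/ (m <= i)%N by lia.
  rewrite mulrAC -(mulrA _ (x ^+ _)); apply: intM; last exact: intX.
  by apply: intM; [exact: O1 | apply: radp_le xn].
have -> : (-1) ^+ i * x ^+ (n + m - i) * y ^+ i / p%:R =
    ((-1) ^+ i * x ^+ (n + m - i)) * (y ^+ i / p%:R) by rewrite !mulrA.
by apply: intM; [apply: (intM O1); apply: intX | apply: radp_le ym].
Qed.

Lemma radp_unit x : O x^-1 -> x != 0 -> ~ radp x.
Proof.
move=> Ox' x0 [_ [n h]]; apply: invp_not_int.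
by rewrite -[_^-1](mulKf (expf_neq0 n x0)) -exprVn; apply: intM => //; apply: intX.
Qed.

Definition padic_deg_le D (x : E) :=
  exists q : {poly Qp}, [/\ q != 0, (size q <= D.+1)%N & root (map_poly j q) x].

(** Let Y be the companion matrix of the minimal polynomial of y over Q_p. The power of p that makes
    det Y a unit also makes the determinant of the rescaled y^n a unit, with n the degree of y, and
    [integral_mx_of_det] applies to this element and to its inverse. *)
Lemma normalize_to_unit D (y : E) : padic_deg_le D y -> y != 0 -> exists n a b,
  [/\ (0 < n <= D)%N, O (y ^+ n * p%:R ^+ a / p%:R ^+ b) & O (y ^+ n * p%:R ^+ a / p%:R ^+ b)^-1].
Proof.
have arith (a b c : nat) : (0 < a -> c = (b + a).-1 -> c <= b -> a == 1)%N by lia.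
move=> Dy y0.
have [q0 [q0n q0s q0y]] := Dy.
have ex : exists n, `[< exists q : {poly Qp}, [/\ size q = n, q != 0 & root (map_poly j q) y] >].
  by exists (size q0); apply/asboolP; exists q0.
case: (ex_minnP ex) => n /asboolP[f' [sf' f'0 f'y]] min {ex}.
pose f := (lead_coef f')^-1 *: f'.
have l0 : (lead_coef f')^-1 != 0 by rewrite invr_eq0 lead_coef_eq0.
have sf : size f = n by rewrite size_scale.
have fy : root (map_poly j f) y by rewrite map_polyZ rootZ ?fmorph_eq0.
have fm : f \is monic.
  by apply/monicP; rewrite lead_coefZ; apply: mulVf; rewrite lead_coef_eq0.
have min' (q : {poly Qp}) : q != 0 -> root (map_poly j q) y -> (n <= size q)%N.
  by move=> qn qy; apply: min; apply/asboolP; exists q.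
have n1 : (1 < n)%N.
  rewrite ltnNge -sf; apply/negP => /size1_polyC e; move: fm fy; rewrite e.
  rewrite monicE lead_coefC => /eqP ->.
  by rewrite map_polyC rootC fmorph_eq0 oner_eq0.
(* A nonzero polynomial of smaller degree is prime to the minimal polynomial, so it acts invertibly
   both on Y and on y. *)
have cop (q : {poly Qp}) : q != 0 -> (size q < n)%N -> exists r s, r * q + s * f = 1.
  move=> qn qs; have : coprimep q f.
    rewrite /coprimep; have g0 : gcdp q f != 0 by rewrite gcdp_eq0 negb_and qn.
    have gq : (size (gcdp q f) < n)%N by apply: leq_ltn_trans (leq_gcdpl f qn) qs.
    have := dvdp_gcdr q f => /dvdpP[h fh].
    have : root (map_poly j h) y || root (map_poly j (gcdp q f)) y.
      by rewrite -rootM -rmorphM -fh.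
    case/orP => [hy|gy]; last by have := min' _ g0 gy; rewrite leqNgt gq.
    have h0 : h != 0 by apply: contraNneq (monic_neq0 fm) => h0; rewrite fh h0 mul0r.
    have := min' _ h0 hy; have : size f = (size h + size (gcdp q f)).-1 by rewrite {1}fh size_mul.
    have : (0 < size (gcdp q f))%N by rewrite size_poly_gt0.
    by rewrite sf; apply: arith.
  case/Bezout_coprimepP => -[r s] /= /eqpP[[c1 c2] /= /andP[c10 c20] e].
  exists ((c1 / c2) *: r), ((c1 / c2) *: s); rewrite -!scalerAl -scalerDr.
  by rewrite mulrC -scalerA e scalerA mulVf // scale1r.
pose d := n.-2; have nd : n = d.+2 by rewrite /d; case: (n) n1 => [|[|]].
have [Y Yf] : exists Y : 'M[Qp]_d.+1, char_poly Y = f.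
  have := companionmxK fm; move: (companionmx f); rewrite sf nd /= => Y e; by exists Y.
have Yf0 : horner_mx Y f = 0 by rewrite -Yf Cayley_Hamilton.
have inv (q : {poly Qp}) : ~~ root (map_poly j q) y -> exists2 r, horner_mx Y r * horner_mx Y q = 1 &
    (map_poly j r).[y] * (map_poly j q).[y] = 1.
  move=> qy; have qE := divp_eq q f.
  have Yq : horner_mx Y q = horner_mx Y (q %% f).
    by rewrite {1}qE rmorphD rmorphM /= Yf0 mulr0 add0r.
  have yq : (map_poly j q).[y] = (map_poly j (q %% f)).[y].
    by rewrite {1}qE rmorphD rmorphM /= hornerD hornerM (rootP fy) mulr0 add0r.
  have [||r [s e]] := cop (q %% f).
  - by apply: contraNneq qy => e; rewrite /root yq e rmorph0 horner0.
  - by rewrite -sf ltn_modp monic_neq0.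
  exists r; rewrite ?Yq ?yq.
    by rewrite -[LHS]addr0 -[X in _ + X](mulr0 (horner_mx Y s)) -Yf0 -!rmorphM -rmorphD e rmorph1.
  rewrite -hornerM -rmorphM -[LHS]addr0 -[X in _ + X](mulr0 (map_poly j s).[y]) -(rootP fy).
  by rewrite -hornerM -rmorphM -hornerD -rmorphD e rmorph1 hornerC.
have irrY (q : {poly Qp}) : q != 0 -> (size q <= d.+1)%N -> horner_mx Y q \in unitmx.
  move=> qn qs; have [|r] := inv q; last by move=> /mulmx1_unit[].
  by apply/negP => /(min' _ qn); rewrite nd leqNgt ltnS qs.
have transfer (h : {poly Qp}) : horner_mx Y h = 0 -> root (map_poly j h) y.
  move=> Yh; apply: contraT => /inv[r]; rewrite Yh mulr0 => /esym/eqP.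
  by rewrite oner_eq0.
have intdet (q : {poly Qp}) (u : Zp) : u \is a GRing.unit ->
    \det (horner_mx Y q) = tofrac u -> O (map_poly j q).[y].
  move=> uu du; have YZ : Y *m horner_mx Y q = horner_mx Y q *m Y.
    by apply: comm_mx_horner.
  have [g gm gZ] := integral_mx_of_det irrY YZ uu du; exists g => //.
  rewrite -horner_mx_comp in gZ; have := transfer _ gZ.
  by rewrite /root map_comp_poly horner_comp -map_poly_comp.
have Yn0 : \det Y != 0.
  have [|r] := inv 'X; first by rewrite map_polyX rootX.
  by rewrite horner_mx_X => /mulmx1_unit[_]; rewrite unitmxE unitfE.
have [a [b [u [uu dY]]]] := padic_num_val Yn0.
have pb0 : tofrac p%:R ^+ b != 0 by apply: expf_neq0.
pose c := tofrac p%:R ^+ a / tofrac p%:R ^+ b.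
have cdY : c * \det Y = tofrac u by rewrite /c mulrAC dY mulrC mulKf.
have jc : j c = p%:R ^+ a / p%:R ^+ b.
  have jp : j (tofrac p%:R) = p%:R := rmorph_nat padic_int_scalar p.
  by rewrite fmorph_div !rmorphXn jp.
(* Since Y has size d + 1, the matrix c Y^(d+1) has determinant (c det Y)^(d+1), a power of the unit
   u. *)
pose q1 : {poly Qp} := c%:P * 'X^(d.+1).
have q1y : (map_poly j q1).[y] = y ^+ d.+1 * p%:R ^+ a / p%:R ^+ b.
  have -> : map_poly j q1 = (j c)%:P * 'X^(d.+1) by rewrite rmorphM /= map_polyC map_polyXn.
  by rewrite hornerM hornerC hornerXn jc mulrC mulrA.
have dq1 : \det (horner_mx Y q1) = tofrac (u ^+ d.+1).
  have -> : horner_mx Y q1 = c%:M *m Y ^+ d.+1.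
    by rewrite rmorphM /= horner_mx_C rmorphXn /= horner_mx_X.
  by rewrite det_mulmx det_scalar detX -exprMn cdY tofracXn.
have uu1 : u ^+ d.+1 \is a GRing.unit by rewrite unitrX.
have pE0 n' : (p%:R : E) ^+ n' != 0 by rewrite expf_neq0 // pnat_neq0 // prime_gt0.
have q1y0 : (map_poly j q1).[y] != 0.
  by rewrite q1y !mulf_neq0 ?invr_eq0 ?expf_neq0 // pnat_neq0 // prime_gt0.
exists d.+1, a, b; split.
- by have := min' _ q0n q0y; rewrite nd => /leq_trans/(_ q0s).
- by rewrite -q1y; apply: intdet uu1 dq1.
rewrite -q1y; have [//|r rY ry] := inv q1.
have -> : (map_poly j q1).[y]^-1 = (map_poly j r).[y].
  by apply: (mulIf q1y0); rewrite mulVf // ry.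
apply: (intdet r (u ^+ d.+1)^-1); first by rewrite unitrV.
have := congr1 determinant rY; rewrite det_mulmx dq1 det1 => e.
by rewrite -tofrac_unit // -[LHS]mulr1 -(mulfV (_ : tofrac (u ^+ d.+1) != 0)) ?mulrA ?e ?mul1r //
  tofrac_eq0; apply: contraTneq uu1 => ->; rewrite unitr0.
Qed.

Lemma int_horner (r : {poly Zp}) x : O x -> O (map_poly padic_int_scalar r).[x].
Proof.
move=> Ox; rewrite horner_coef; apply: int_sum => i; rewrite coef_map.
by apply: intM; [apply: int_scalar | apply: intX].
Qed.

Lemma int_div_p (z : Zp) : z 1%N = 0%N -> O (padic_int_scalar z / p%:R).
Proof.
move=> /padic_dvdP[y ->]; rewrite expn1 rmorphM rmorph_nat mulrAC mulfV.
  by rewrite mul1r; apply: int_scalar.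
by rewrite pnat_neq0 // prime_gt0.
Qed.

(** A relation over Q_p is scaled to a primitive integral one; cutting it at its last coefficient
    that is nonzero modulo p and dividing by that coefficient gives a monic relation modulo p. *)
Lemma padic_relation_mod_p D x : padic_deg_le D x -> O x ->
  exists m : {poly Zp}, [/\ m \is monic, (size m <= D.+1)%N
    & O ((map_poly padic_int_scalar m).[x] / p%:R)].
Proof.
move=> [q [q0 sq qx]] Ox.
have [a [M0 aM]] := integral_mx_scale (\matrix_(_ < D.+1, k < D.+1) q`_k).
have M0n0 : M0 != 0.
  apply: contraNneq q0 => M00; apply/eqP/polyP => k; rewrite coef0.
  have [kD|Dk] := ltnP k D.+1; last by rewrite nth_default // (leq_trans sq).
  have := congr1 (fun M : 'M[Qp]_D.+1 => M ord0 (Ordinal kD)) aM.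
  rewrite M00 map_mx0 !mxE => /eqP; rewrite mulf_eq0 expf_eq0 (negPf pnz) andbF.
  by move/eqP.
have [b [M1 [M0E [i [l Mil]]]]] := primitive_mx M0n0.
have rel : \sum_(k < D.+1) padic_int_scalar (M1 i k) * x ^+ k = 0.
  have pa0 : (p%:R : E) ^+ a != 0 by rewrite expf_neq0 // pnat_neq0 // prime_gt0.
  have pb0 : (p%:R : E) ^+ b != 0 by rewrite expf_neq0 // pnat_neq0 // prime_gt0.
  have jp : j (tofrac p%:R) = p%:R := rmorph_nat padic_int_scalar p.
  have e k : p%:R ^+ b * padic_int_scalar (M1 i k) = p%:R ^+ a * j q`_k.
    have := congr1 (fun M : 'M[Qp]_D.+1 => j (M i k)) aM.
    rewrite M0E !mxE rmorphM rmorphXn jp => ->.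
    by rewrite tofracM tofracXn rmorphM rmorphXn jp.
  apply: (mulfI pb0); rewrite mulr0 mulr_sumr.
  under eq_bigr => k _ do rewrite mulrA e -mulrA -coef_map.
  rewrite -mulr_sumr -(@horner_coef_wide _ D.+1) ?(rootP qx) ?mulr0 //.
  by rewrite size_map_poly.
pose P k := (k < D.+1)%N && (M1 i (inord k) 1%N != 0%N).
have exP : exists k, P k by exists l; rewrite /P ltn_ord inord_val; apply/eqP.
have bP k : P k -> (k <= D.+1)%N by move=> /andP[/ltnW].
case: (ex_maxnP exP bP) => J /andP[JD cJ] maxJ.
pose c : Zp := M1 i (inord J).
have uc : c \is a GRing.unit.
  by rewrite padic_unitE; apply: contra cJ; rewrite -{2}padic_modn expn1.
pose m : {poly Zp} := \poly_(k < J.+1) (c^-1 * M1 i (inord k)).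
have mJ : m`_J = 1 by rewrite coef_poly ltnSn mulVr.
have sm : size m = J.+1.
  apply/eqP; rewrite eqn_leq size_poly /= ltnNge; apply/negP => /leq_sizeP/(_ J (leqnn _)).
  by rewrite mJ => /eqP; rewrite oner_eq0.
exists m; split; [by rewrite monicE lead_coefE sm mJ | by rewrite sm |].
rewrite (@horner_coef_wide _ J.+1); last by rewrite -sm size_poly.
set S1 := \sum_(k < D.+1 | (J < k)%N) padic_int_scalar (M1 i k) * x ^+ k.
have -> : \sum_(k < J.+1) (map_poly padic_int_scalar m)`_k * x ^+ k = - (padic_int_scalar c^-1 * S1).
  rewrite (bigID (fun k : 'I_D.+1 => (J < k)%N)) -/S1 in rel.
  rewrite -mulrN -[- S1]add0r -[in RHS]rel addrAC subrr add0r mulr_sumr.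
  rewrite (big_ord_widen D.+1 (fun k => (map_poly padic_int_scalar m)`_k * x ^+ k)) //.
  apply: eq_big => [k|k kJ]; first by rewrite ltnS leqNgt.
  have mk : m`_k = c^-1 * M1 i k by rewrite coef_poly kJ inord_val.
  by rewrite coef_map mk mulrA; congr (_ * _); apply: (rmorphM padic_int_scalar).
rewrite mulNr; apply: intN; rewrite -mulrA mulr_suml; apply: intM; first exact: int_scalar.
rewrite big_mkcond; apply: int_sum => k; case: ifP => Jk; last exact: int0.
rewrite mulrAC; apply: intM; last exact: intX.
apply: int_div_p; apply: contraTeq Jk => Mk; rewrite -leqNgt; apply: maxJ.
by rewrite /P ltn_ord inord_val.
Qed.

                                                                           
(** Modulo p every power of x is one of p^D combinations of 1, ..., x^(D-1), so two of the first p^D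
    + 1 powers agree. *)
Lemma power_periodic_mod_p D x : padic_deg_le D x -> O x ->
  exists i f, (0 < f <= p ^ D)%N /\ O ((x ^+ (i + f) - x ^+ i) / p%:R).
Proof.
move=> Dx Ox; have [m [mm sm Om]] := padic_relation_mod_p Dx Ox.
pose r (i : nat) := Pdiv.Ring.rmodp 'X^i m.
have sr i k : (D <= k)%N -> (r i)`_k = 0.
  move=> Dk; rewrite nth_default // -ltnS (leq_trans _ (leq_ltn_trans Dk (ltnSn _))) //.
  by rewrite (leq_trans _ sm) // Pdiv.Ring.ltn_rmodpN0 // monic_neq0.
have xr i : O ((x ^+ i - (map_poly padic_int_scalar (r i)).[x]) / p%:R).
  have := Pdiv.RingMonic.rdivp_eq mm 'X^i => /(congr1 (fun q => (map_poly padic_int_scalar q).[x])).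
  rewrite map_polyXn hornerXn rmorphD rmorphM /= hornerD hornerM => ->.
  by rewrite addrK -mulrA; apply: intM => //; apply: int_horner.
pose cls (i : 'I_(p ^ D).+1) : {ffun 'I_D -> 'I_(p ^ 1)} :=
  [ffun k : 'I_D => Ordinal (padic_lt ((r i)`_k) 1)].
have /injectivePn[i1 [i2 i12 e]] : ~~ injectiveb cls.
  by apply/negP => /injectiveP /leq_card; rewrite card_ffun !card_ord expn1 ltnn.
have rr : O ((x ^+ i1 - x ^+ i2) / p%:R).
  have -> : x ^+ i1 - x ^+ i2 = (x ^+ i1 - (map_poly padic_int_scalar (r i1)).[x])
     - (x ^+ i2 - (map_poly padic_int_scalar (r i2)).[x])
     + (map_poly padic_int_scalar (r i1 - r i2)).[x].
    by rewrite rmorphB hornerD hornerN; ring.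
  rewrite mulrDl mulrBl; apply: intD; first by apply: intB.
  rewrite horner_coef mulr_suml; apply: int_sum => k; rewrite mulrAC.
  apply: intM; last exact: intX.
  rewrite coef_map coefB; apply: int_div_p; apply/padic_congr_sub.
  have [kD|Dk] := ltnP k D; last by rewrite !sr.
  by have /ffunP/(_ (Ordinal kD)) := e; rewrite !ffunE => /(congr1 val).
have [lt|lt|e'] := ltngtP i1 i2; last by case/eqP: i12; apply: val_inj.
  exists i1, (i2 - i1)%N; rewrite subn_gt0 lt subnKC ?(ltnW lt) //; split.
    by rewrite (leq_trans (leq_subr _ _)) // -ltnS.
  by rewrite -opprB mulNr; apply: intN.
exists i2, (i1 - i2)%N; rewrite subn_gt0 lt subnKC ?(ltnW lt) //; split => //.
by rewrite (leq_trans (leq_subr _ _)) // -ltnS.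
Qed.

End IntegralClosure.
End PadicNumbers.

                          

(** * Automorphisms as ring morphisms, and subrings of finite degree over Q_p *)

Section AbsGalMorphism.
Variables (F E : fieldType) (iota : F -> E).
Implicit Types g : abs_gal iota.

Fact abs_gal_zmod g : zmod_morphism g.
Proof.
have g0 : g 0 = 0 by apply: (addrI (g 0)); rewrite -abs_galD !addr0.
by move=> x y; rewrite abs_galD; congr (_ + _); apply/eqP; rewrite -addr_eq0 -abs_galD addNr g0.
Qed.

Fact abs_gal_monoid g : monoid_morphism g.
Proof.
split; last exact: abs_galM; have [f fK gK] := abs_gal_bij g.
have := abs_galM g 1 (f 1); rewrite mul1r gK mulr1 => e.
exact: esym e.
Qed.

HB.instance Definition _ g := GRing.isZmodMorphism.Build E E g (abs_gal_zmod g).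
HB.instance Definition _ g := GRing.isMonoidMorphism.Build E E g (abs_gal_monoid g).

Lemma abs_gal_mulE g h x : (g * h)%g x = g (h x). Proof. by []. Qed.
Lemma abs_gal_expE g n x : (g ^+ n)%g x = iter n g x.
Proof. by elim: n => // n IH; rewrite expgS abs_gal_mulE IH. Qed.

End AbsGalMorphism.

Section FiniteDegree.
Variables (p : nat) (p_pr : prime p).
Local Notation Qp := (padic_num p_pr).
Variables (F : fieldExtType Qp) (E : fieldType) (iota : {rmorphism F -> E}).
Local Notation j := (padic_scalar iota).

(** Such a ring serves to bound in advance the degree over Q_p of every element formed inside it
    ([finite_subring_deg]). *)
Record finite_subring (L : E -> Prop) (D : nat) : Prop := FiniteSubring {
  fsub_base : forall c, L (iota c);
  fsubD : forall x y, L x -> L y -> L (x + y);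
  fsubM : forall x y, L x -> L y -> L (x * y);
  fsub_span : exists (I : finType) (e : I -> E), #|I| = D /\
    forall x, L x -> exists c : I -> Qp, x = \sum_i j (c i) * e i
}.

Lemma fsub_sum L D (fL : finite_subring L D) (I : Type) (r : seq I) (P : pred I) (f : I -> E) :
  (forall i, L (f i)) -> L (\sum_(i <- r | P i) f i).
Proof.
move=> h; elim/big_ind: _ => //; first by rewrite -(rmorph0 iota); apply: fsub_base fL 0.
exact: fsubD fL.
Qed.

Lemma fsubX L D (fL : finite_subring L D) x n : L x -> L (x ^+ n).
Proof.
move=> Lx; elim: n => [|n IH]; first by rewrite expr0 -(rmorph1 iota); apply: fsub_base fL 1.
by rewrite exprS; apply: (fsubM fL).
Qed.

Lemma finite_subring_base : finite_subring (fun x => exists c, x = iota c) (\dim {:F}).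
Proof.
split.
- by move=> c; exists c.
- by move=> _ _ [c ->] [d ->]; exists (c + d); rewrite rmorphD.
- by move=> _ _ [c ->] [d ->]; exists (c * d); rewrite rmorphM.
exists 'I_(\dim {:F}), (fun i : 'I_(\dim {:F}) => iota (vbasis {:F})`_i); rewrite card_ord; split=> // _ [c ->].
exists (fun i => coord (vbasis {:F}) i c).
rewrite {1}(coord_vbasis (memvf c)) rmorph_sum; apply: eq_bigr => i _.
by rewrite -mulr_algl rmorphM.
Qed.

Lemma finite_subring_adjoin L D x (q : {poly F}) : finite_subring L D ->
  q \is monic -> root (map_poly iota q) x ->
  exists L', [/\ finite_subring L' ((size q).-1 * D), L' x & forall y, L y -> L' y].
Proof.
move=> fL qm qx; pose d := (size q).-1.
have sq : size q = d.+1 by rewrite prednK // size_poly_gt0 monic_neq0.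
have L0 : L 0 by rewrite -(rmorph0 iota); apply: fsub_base fL 0.
pose L' v := exists a : 'I_d -> E, (forall i, L (a i)) /\ v = \sum_i a i * x ^+ i.
have L'D u v : L' u -> L' v -> L' (u + v).
  move=> [a [La ->]] [b [Lb ->]]; exists (fun i => a i + b i); split=> [i|].
    exact: fsubD fL _ _ (La i) (Lb i).
  by rewrite -big_split; apply: eq_bigr => i _; rewrite mulrDl.
have L'0 : L' 0 by exists (fun=> 0); split=> //; rewrite big1 // => i _; rewrite mul0r.
have L'L c v : L c -> L' v -> L' (c * v).
  move=> Lc [a [La ->]]; exists (fun i => c * a i); split=> [i|]; first exact: fsubM fL _ _ Lc (La i).
  by rewrite mulr_sumr; apply: eq_bigr => i _; rewrite mulrA.
have L'sum (I : Type) (r : seq I) (f : I -> E) : (forall i, L' (f i)) -> L' (\sum_(i <- r) f i).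
  by move=> h; elim/big_ind: _.
have L'lt i : (i < d)%N -> L' (x ^+ i).
  move=> id; exists (fun k => (k == i :> nat)%:R); split=> [k|].
    by rewrite -(rmorph_nat iota); apply: fsub_base fL _.
  rewrite (bigD1 (Ordinal id)) //= eqxx mul1r big1 ?addr0 // => k.
  by rewrite -val_eqE /= => /negPf ->; rewrite mul0r.
have xd : x ^+ d = - \sum_(i < d) iota q`_i * x ^+ i.
  have := rootP qx; rewrite horner_coef size_map_poly sq big_ord_recr /= coef_map /=.
  have -> : q`_d = 1 by have := monicP qm; rewrite lead_coefE sq.
  rewrite rmorph1 mul1r addrC => /eqP; rewrite addr_eq0 => /eqP ->; congr (- _).
  by apply: eq_bigr => i _; rewrite coef_map.
have L'x v : L' v -> L' (x * v).
  move=> [a [La ->]]; rewrite mulr_sumr; apply: (L'sum) => i.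
  rewrite mulrCA -exprS; apply: (L'L) => //.
  have [lt|] := ltnP i.+1 d; first exact: L'lt.
  move=> le; have -> : i.+1 = d by apply/eqP; rewrite eqn_leq ltn_ord.
  rewrite xd -mulN1r mulr_sumr; apply: (L'sum) => k; rewrite mulrA; apply: (L'L); last exact: L'lt.
  by rewrite -(rmorph1 iota) -rmorphN -rmorphM; apply: fsub_base fL _.
have L'X i v : L' v -> L' (x ^+ i * v).
  by move=> L'v; elim: i => [|i IH]; rewrite ?expr0 ?mul1r // exprS -mulrA; apply: L'x.
have L'M u v : L' u -> L' v -> L' (u * v).
  move=> [a [La ->]] L'v; rewrite mulr_suml; apply: L'sum => i.
  by rewrite -mulrA; apply: L'L => //; apply: L'X.
have L'1 : L' 1.
  have [d0|d0] := posnP d; last by have := L'lt 0%N d0; rewrite expr0.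
  suff -> : (1 : E) = 0 by [].
  by have := xd; rewrite d0 expr0 big_ord0 oppr0.
have LL' y : L y -> L' y by move=> Ly; rewrite -[y]mulr1; apply: L'L.
exists L'; split=> //; last by rewrite -[x]mulr1; apply: L'x.
split=> // [c|]; first by apply/LL'/(fsub_base fL).
have [I [e [cI span]]] := fsub_span fL.
exists ('I_d * I)%type, (fun ik : 'I_d * I => x ^+ ik.1 * e ik.2).
rewrite card_prod card_ord cI; split=> // _ [a [La ->]].
have /choice[c cP] := fun i => span _ (La i).
exists (fun ik => c ik.1 ik.2); rewrite -(pair_bigA _ (fun i k => j (c i k) * (x ^+ i * e k))) /=.
apply: eq_bigr => i _; rewrite {1}cP mulr_suml; apply: eq_bigr => k _.
by rewrite -mulrA (mulrC (e k)).
Qed.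

Lemma finite_subring_deg L D x : finite_subring L D -> L x -> padic_deg_le iota D x.
Proof.
move=> fL Lx; have [I [e [cI span]]] := fsub_span fL.
have /choice[c cP] := fun i => span _ (fsubX fL i Lx).
pose M : 'M[Qp]_(D.+1, #|I|) := \matrix_(i, k) c i (enum_val k).
have rM : (\rank M < D.+1)%N by rewrite ltnS; apply: leq_trans (rank_leq_col M) _; rewrite cI.
have : kermx M != 0 by rewrite -mxrank_eq0 mxrank_ker subn_eq0 -ltnNge.
move=> /rowV0Pn[u /sub_kermxP uM u0]; exists (rVpoly u); split.
- by apply: contra_neq u0 => e'; rewrite -[u]rVpolyK e' linear0.
- exact: size_poly.
rewrite /root (@horner_coef_wide _ D.+1) ?size_map_poly ?size_poly //.
under eq_bigr => i _ do rewrite coef_map coef_rVpoly_ord cP mulr_sumr.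
rewrite exchange_big /= big1 // => k _.
under eq_bigr => i _ do rewrite mulrA -(rmorphM j).
rewrite -mulr_suml -(rmorph_sum j).
have := congr1 (fun v : 'rV_#|I| => v 0 (enum_rank k)) uM; rewrite !mxE => uMk.
apply/eqP; rewrite mulf_eq0 (fmorph_eq0 j); apply/orP; left; apply/eqP.
by apply: etrans uMk; apply: eq_bigr => i _; rewrite mxE enum_rankK.
Qed.

Hypothesis algE : forall x : E, algebraicOver iota x.

Lemma monic_algebraic x : exists2 q : {poly F}, q \is monic & root (map_poly iota q) x.
Proof.
have [q q0 qx] := algE x; exists ((lead_coef q)^-1 *: q).
  by rewrite monicE lead_coefZ mulVf // lead_coef_eq0.
by rewrite map_polyZ rootZ // fmorph_eq0 invr_eq0 lead_coef_eq0.
Qed.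

Lemma finite_subring_exists (s : seq E) : exists L D, finite_subring L D /\ forall x, x \in s -> L x.
Proof.
elim: s => [|x s [L [D [fL Ls]]]].
  by exists (fun x => exists c, x = iota c), (\dim {:F}); split=> //; apply: finite_subring_base.
have [q qm qx] := monic_algebraic x.
have [L' [fL' L'x LL']] := finite_subring_adjoin fL qm qx.
exists L', ((size q).-1 * D)%N; split=> // y; rewrite inE => /orP[/eqP -> //|/Ls]; exact: LL'.
Qed.

End FiniteDegree.

(** * The cyclotomic character, the Kummer cocycle of p and the tame kernel *)

Section CyclotomicKummer.
Variables (p : nat) (p_pr : prime p) (l : nat) (l_pr : prime l) (l_neq_p : l <> p).
Local Notation Qp := (padic_num p_pr).
Local Notation Zl := (padic_int l_pr).
Variables (F : fieldExtType Qp) (E : closedFieldType) (iota : {rmorphism F -> E}).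
Hypothesis algE : forall x : E, algebraicOver iota x.
Local Notation G := (abs_gal iota).
Local Notation O := (int_closure (p_pr := p_pr) iota).
Implicit Types g h : G.

Lemma nat_neq0 n : (0 < n)%N -> n%:R != 0 :> E.
Proof. exact: (pnat_neq0 iota). Qed.

Let l_gt0 : (0 < l)%N. Proof. exact: prime_gt0. Qed.
Let lX_gt0 n : (0 < l ^ n)%N. Proof. by rewrite expn_gt0 l_gt0. Qed.
Let p_ndvd_lX n : ~~ (p %| l ^ n)%N.
Proof.
case: n => [|n]; first by rewrite expn0 dvdn1 neq_ltn prime_gt1 // orbT.
by rewrite Euclid_dvdX // dvdn_prime2 //; apply/negP => /andP[/eqP e _]; apply: l_neq_p.
Qed.

Lemma root_exists (x : E) : exists y, y ^+ l = x.
Proof.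
have /closed_rootP[y] : size ('X^l - x%:P) != 1%N by rewrite size_XnsubC // eqSS -lt0n.
by rewrite rootE !hornerE subr_eq0 => /eqP; exists y.
Qed.

Lemma primitive_root_exists : exists z : E, z ^+ l = 1 /\ z != 1.
Proof.
have /closed_rootP[z] : size (\poly_(i < l) (1 : E)) != 1%N.
  by rewrite size_poly_eq ?oner_neq0 // neq_ltn prime_gt1 // orbT.
rewrite /root horner_poly; under eq_bigr => i _ do rewrite mul1r.
move=> /eqP s0; exists z; split.
  by apply/eqP; rewrite -subr_eq0 subrX1 s0 mulr0.
apply: contraTneq (nat_neq0 l_gt0) => z1; rewrite negbK -s0 z1.
by under eq_bigr => i _ do rewrite expr1n; rewrite sumr_const card_ord.
Qed.

Lemma zeta_system : exists z : nat -> E, [/\ z 0%N = 1, forall n, z n.+1 ^+ l = z n & z 1%N != 1].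
Proof.
have [z1 [z1l z1n]] := primitive_root_exists.
have /choice[rt rtP] := root_exists.
exists (fun n => if n is n'.+1 then iter n' rt z1 else 1); split=> // -[|n] //=.
Qed.

Definition zeta : nat -> E := sval (cid zeta_system).
Lemma zetaS n : zeta n.+1 ^+ l = zeta n. Proof. by rewrite /zeta; case: cid => z []. Qed.
Lemma zeta0 : zeta 0 = 1. Proof. by rewrite /zeta; case: cid => z []. Qed.
Lemma zeta1_neq1 : zeta 1 != 1. Proof. by rewrite /zeta; case: cid => z []. Qed.

Lemma zeta_expl n m : zeta (n + m) ^+ (l ^ m) = zeta n.
Proof.
elim: m => [|m IH]; first by rewrite addn0 expn0 expr1.
by rewrite addnS expnS exprM zetaS.
Qed.

Lemma zeta_exp n : zeta n ^+ (l ^ n) = 1. Proof. by rewrite -[n in zeta n]add0n zeta_expl zeta0. Qed.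

Lemma zeta_prim n : (l ^ n).-primitive_root (zeta n).
Proof.
have [m mz ml] := prim_order_exists (lX_gt0 n) (zeta_exp n).
have /dvdn_pfactor := ml => /(_ l_pr)[k kn mE].
move: mz; rewrite mE; have [-> //|nk] := eqVneq k n => kz.
have : (k < n)%N by rewrite ltn_neqAle nk.
case: n kz {ml kn nk} => // n kz kn; have : zeta n.+1 ^+ (l ^ n) = 1.
  by apply/eqP; rewrite -(prim_order_dvd kz) dvdn_exp2l.
by rewrite -add1n zeta_expl => /eqP; rewrite (negPf zeta1_neq1).
Qed.

Lemma zeta_neq0 n : zeta n != 0.
Proof.
apply: contraTneq (oner_neq0 E) => z0.
by rewrite -(zeta_exp n) z0 expr0n eqn0Ngt lX_gt0 /= eqxx.
Qed.

Lemma varpi_system : exists w : nat -> E, w 0%N = p%:R /\ forall n, w n.+1 ^+ l = w n.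
Proof.
have /choice[rt rtP] := root_exists; exists (fun n => iter n rt p%:R); split=> // n /=.
by rewrite rtP.
Qed.

Definition varpi : nat -> E := sval (cid varpi_system).
Lemma varpiS n : varpi n.+1 ^+ l = varpi n. Proof. by rewrite /varpi; case: cid => z []. Qed.
Lemma varpi0 : varpi 0 = p%:R. Proof. by rewrite /varpi; case: cid => z []. Qed.

Lemma varpi_exp n : varpi n ^+ (l ^ n) = p%:R.
Proof.
elim: n => [|n IH]; first by rewrite expn0 expr1 varpi0.
by rewrite expnS exprM varpiS.
Qed.

Lemma varpi_neq0 n : varpi n != 0.
Proof.
apply: contraTneq (nat_neq0 (prime_gt0 p_pr)) => w0.
by rewrite -(varpi_exp n) w0 expr0n eqn0Ngt lX_gt0 /= eqxx.
Qed.

Lemma zeta_log_exists g n : exists a, g (zeta n) = zeta n ^+ a.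
Proof.
have : g (zeta n) ^+ (l ^ n) = 1 by rewrite -rmorphXn zeta_exp rmorph1.
by move=> /(prim_rootP (zeta_prim n))[i ->]; exists i.
Qed.

Lemma varpi_log_exists g n : exists a, g (varpi n) = zeta n ^+ a * varpi n.
Proof.
have : (g (varpi n) / varpi n) ^+ (l ^ n) = 1.
  by rewrite exprMn exprVn -rmorphXn varpi_exp rmorph_nat mulfV // nat_neq0 // prime_gt0.
by move=> /(prim_rootP (zeta_prim n))[i e]; exists i; rewrite -e divfK // varpi_neq0.
Qed.

Lemma zeta_eq n a b : zeta n ^+ a = zeta n ^+ b -> a = b %[mod l ^ n].
Proof. by move=> /eqP; rewrite (eq_prim_root_expr (zeta_prim n)) => /eqP. Qed.

Let eps_seq g n : nat := sval (cid (zeta_log_exists g n)).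
Let b_seq g n : nat := sval (cid (varpi_log_exists g n)).

Let eps_seqP g n : g (zeta n) = zeta n ^+ eps_seq g n.
Proof. by rewrite /eps_seq; case: cid. Qed.
Let b_seqP g n : g (varpi n) = zeta n ^+ b_seq g n * varpi n.
Proof. by rewrite /b_seq; case: cid. Qed.

Let eps_coh g n : eps_seq g n.+1 = eps_seq g n %[mod l ^ n].
Proof. by apply: zeta_eq; rewrite -[RHS]eps_seqP -zetaS rmorphXn /= eps_seqP -!exprM mulnC. Qed.

Let b_coh g n : b_seq g n.+1 = b_seq g n %[mod l ^ n].
Proof.
apply: zeta_eq; apply: (mulIf (varpi_neq0 n)).
by rewrite -[RHS]b_seqP -varpiS -zetaS rmorphXn /= b_seqP exprMn -!exprM mulnC.
Qed.

(** The [l]-adic cyclotomic character, read digit by digit off the compatible system [zeta];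
    [kummer] does the same with the l-power roots [varpi] of p. *)
Definition cyclo g : Zl := @padic_of _ l_pr _ (eps_coh g).
Definition kummer g : Zl := @padic_of _ l_pr _ (b_coh g).

Lemma cycloP g n : g (zeta n) = zeta n ^+ cyclo g n.
Proof. by rewrite (prim_expr_mod (zeta_prim n)) eps_seqP. Qed.

Lemma kummerP g n : g (varpi n) = zeta n ^+ kummer g n * varpi n.
Proof. by rewrite (prim_expr_mod (zeta_prim n)) b_seqP. Qed.

Lemma cyclo_uniq g n a : g (zeta n) = zeta n ^+ a -> cyclo g n = (a %% l ^ n)%N.
Proof. by rewrite cycloP => /zeta_eq; rewrite padic_modn. Qed.

Lemma kummer_uniq g n a : g (varpi n) = zeta n ^+ a * varpi n -> kummer g n = (a %% l ^ n)%N.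
Proof. by rewrite kummerP => /(mulIf (varpi_neq0 n)) /zeta_eq; rewrite padic_modn. Qed.

Lemma cycloM g h : cyclo (g * h)%g = cyclo g * cyclo h.
Proof.
apply: padic_ext => n; rewrite padic_mulE; apply: cyclo_uniq.
by rewrite abs_gal_mulE cycloP rmorphXn /= cycloP -exprM.
Qed.

Lemma kummerM g h : kummer (g * h)%g = kummer g + cyclo g * kummer h.
Proof.
apply: padic_ext => n; rewrite padic_addE padic_mulE modnDmr; apply: kummer_uniq.
by rewrite abs_gal_mulE kummerP rmorphM /= rmorphXn /= cycloP kummerP exprD exprM mulrA [_ * zeta n ^+ kummer g n]mulrC.
Qed.

Lemma cyclo1 : cyclo 1%g = 1.
Proof. by apply: padic_ext => n; rewrite (padic_natE l_pr 1); apply: cyclo_uniq; rewrite expr1. Qed.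

Lemma cyclo_continuous g h n : g (zeta n) = h (zeta n) -> cyclo g n = cyclo h n.
Proof. by move=> e; rewrite -[RHS]padic_modn; apply: cyclo_uniq; rewrite e cycloP. Qed.

Lemma kummer_continuous g h n : g (varpi n) = h (varpi n) -> kummer g n = kummer h n.
Proof. by move=> e; rewrite -[RHS]padic_modn; apply: kummer_uniq; rewrite e kummerP. Qed.

Lemma mod_cyclotomicE (k : fieldType) g : mod_cyclotomic l k g = (cyclo g 1%N)%:R.
Proof.
have lt : (cyclo g 1%N < l)%N by have := padic_lt (cyclo g) 1; rewrite expn1.
have zp := zeta_prim 1; rewrite expn1 in zp.
rewrite /mod_cyclotomic; case: pickP => [a /asboolP aP|/(_ (Ordinal lt)) /asboolP[]].
  by rewrite (@cyclo_uniq g 1 a) ?expn1 ?modn_small //; apply: aP; rewrite (prim_expr_order zp).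
by move=> z /(prim_rootP zp)[i ->] /=; rewrite rmorphXn /= cycloP -!exprM mulnC.
Qed.

Lemma int_abs_gal g x : O x -> O (g x).
Proof.
move=> [q qm qx]; exists q => //; apply/rootP; rewrite -[RHS](rmorph0 g) -(rootP qx).
rewrite -horner_map -map_poly_comp; congr (_.[_]).
by apply: eq_map_poly => z /=; rewrite abs_gal_fix.
Qed.

Lemma radp_abs_gal g x : radp iota x -> radp iota (g x).
Proof.
move=> [Ox [n xn]]; split; first exact: int_abs_gal.
by exists n; have := int_abs_gal g xn; rewrite fmorph_div rmorphXn rmorph_nat.
Qed.

Lemma int_zeta n : O (zeta n).
Proof. by apply: (@int_root _ _ _ _ _ _ (l ^ n)) => //; rewrite zeta_exp; apply: int1. Qed.

Lemma int_zetaV n : O (zeta n)^-1.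
Proof.
apply: (@int_root _ _ _ _ _ _ (l ^ n)) => //.
by rewrite exprVn zeta_exp invr1; apply: int1.
Qed.

(** Roots of unity of order a power of l are distinct modulo the maximal ideal: as l differs from p,
    one minus a nontrivial one is a unit. *)
Lemma cyclo_inertia g : inertia g -> cyclo g = 1.
Proof.
move=> ig; apply: padic_ext => n; rewrite (padic_natE l_pr 1); apply: cyclo_uniq; rewrite expr1.
have [_ [/eqP|h]] := ig _ (int_zeta n); first by rewrite subr_eq0 => /eqP.
apply/eqP/negP => /negP ne; apply: h.
have -> : g (zeta n) - zeta n = - (zeta n) * (1 - g (zeta n) / zeta n).
  by rewrite mulNr mulrBr mulr1 mulrCA mulfV ?zeta_neq0 // mulr1 opprB.
rewrite invfM invrN; apply: intM; first by apply/intN/int_zetaV.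
apply: (@int_one_sub_unity _ _ _ _ _ _ (l ^ n)) => //.
  by rewrite exprMn exprVn -rmorphXn zeta_exp rmorph1 invr1 mulr1.
by apply: contra ne => /eqP e; rewrite -[g _](divfK (zeta_neq0 n)) e mul1r.
Qed.

Lemma cyclo_fixes g N : cyclo g N = (1 : Zl) N -> g (zeta N) = zeta N.
Proof.
rewrite cycloP => ->; rewrite (padic_natE l_pr 1).
by rewrite (prim_expr_mod (zeta_prim N)) expr1.
Qed.

Lemma kummer_fixes g N : kummer g N = 0%N -> g (varpi N) = varpi N.
Proof. by rewrite kummerP => ->; rewrite expr0 mul1r. Qed.

(** The integral closure behaves as a local ring. Compare the two powers of p that normalize t to a
    unit: equality makes t a unit, one inequality puts t in the radical, the other would make 1/p
    integral. *)
Lemma unit_or_radp t : O t -> t != 0 -> O t^-1 \/ radp iota t.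
Proof.
move=> Ot t0; have [L [D [fL Ls]]] := finite_subring_exists algE [:: t].
have Lt : L t by apply: Ls; rewrite mem_head.
have [n [a [b [/andP[n0 _] e e']]]] := normalize_to_unit (finite_subring_deg fL Lt) t0.
have p0 k : (p%:R : E) ^+ k != 0 by rewrite expf_neq0 // nat_neq0 // prime_gt0.
have [ab|ba|ab] := ltngtP a b.
- right; split=> //; exists n.
  have -> : t ^+ n / p%:R = t ^+ n * p%:R ^+ a / p%:R ^+ b * p%:R ^+ (b - a).-1.
    have -> : (p%:R : E) ^+ b = p%:R ^+ a * p%:R ^+ (b - a).-1 * p%:R.
      by rewrite -exprD -exprSr; congr (_ ^+ _); lia.
    have aux (T A C P : E) : A != 0 -> C != 0 -> P != 0 -> T / P = T * A / (A * C * P) * C.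
      by move=> A0 C0 P0; field; rewrite P0 C0 A0.
    by apply: aux => //; rewrite -[p%:R]expr1.
  by apply: intM => //; apply: intX; apply: int_nat.
- exfalso; apply: (@invp_not_int _ p_pr _ _ iota).
  have tE : t ^+ n * p%:R ^+ a / p%:R ^+ b = t ^+ n * p%:R ^+ (a - b).-1 * p%:R.
    rewrite -!mulrA; congr (_ * _); rewrite -{1}(subnK (ltnW ba)) exprD mulfK // -exprSr.
    by rewrite prednK // subn_gt0.
  rewrite tE in e'; have tp0 : t ^+ n * p%:R ^+ (a - b).-1 != 0 by rewrite mulf_neq0 // expf_neq0.
  have -> : p%:R^-1 = t ^+ n * p%:R ^+ (a - b).-1 * (t ^+ n * p%:R ^+ (a - b).-1 * p%:R)^-1.
    by rewrite invfM mulrA mulfV // mul1r.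
  by apply: intM => //; apply: intM; apply: intX => //; apply: int_nat.
left; apply: (int_root n0).
by move: e'; rewrite ab mulfK // exprVn.
Qed.

Lemma unity_exp_neq1 (xi : E) m : xi ^+ l = 1 -> xi != 1 -> coprime l m -> xi ^+ m != 1.
Proof.
move=> xil xi1 lm; apply/eqP => e; case/eqP: xi1.
have m0 : (0 < m)%N.
  by rewrite lt0n; apply: contraTneq lm => ->; rewrite /coprime gcdn0 neq_ltn prime_gt1 // orbT.
case: (egcdnP l m0) => a b ab _.
move: ab; rewrite gcdnC (eqP lm) => /(congr1 (fun k => xi ^+ k)).
by rewrite mulnC exprM e expr1n exprD mulnC exprM xil expr1n mul1r expr1.
Qed.

                                                                            
                                                                            
                                                                           
                     
(** Kummer theory of units is unramified, hence accounted for by roots of unity. Modulo p some power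
    u^f is 1 with f bounded, so v = u^f2, f2 the part of f prime to l, is congruent to a root of
    unity fixed by h. Then h v = xi^f2 v forces xi^f2 to be congruent to 1, although 1 - xi^f2 is a
    unit. *)
Lemma no_kummer_unit D N h u xi : padic_deg_le iota D u -> (p ^ D <= N)%N ->
  h (zeta N) = zeta N -> O u -> O u^-1 -> u != 0 -> xi ^+ l = 1 -> xi != 1 -> h u <> xi * u.
Proof.
move=> Du pDN hz Ou Ou' u0 xil xi1 hu.
have [i [f [/andP[f0 fD] per]]] := power_periodic_mod_p Du Ou.
have {}per : O ((u ^+ f - 1) / p%:R).
  have -> : (u ^+ f - 1) / p%:R = u^-1 ^+ i * ((u ^+ (i + f) - u ^+ i) / p%:R).
    rewrite mulrA; congr (_ / _); rewrite exprD -{2}[u ^+ i]mulr1 -mulrBr mulrA -exprMn.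
    by rewrite mulVf // expr1n mul1r.
  by apply: intM => //; apply: intX.
have [f2 fl fE] := pfactor_coprime l_pr f0; set j' := logn l f in fE.
(* The l-part of f is at most p^D, so h fixes the roots of unity that factor v^(l^j') - 1. *)
have j'N : (j' <= N)%N.
  apply: leq_trans pDN; apply: leq_trans fD; apply: ltnW; apply: leq_trans (ltn_expl j' (prime_gt1 l_pr)) _.
  by apply: dvdn_leq => //; rewrite fE dvdn_mull.
have hzj : h (zeta j') = zeta j'.
  by rewrite -(subnKC j'N) in hz *; rewrite -(zeta_expl j' (N - j')) rmorphXn /= hz.
pose v := u ^+ f2; have Ov : O v by apply: intX.
have hv : h v = xi ^+ f2 * v by rewrite rmorphXn /= hu exprMn.
have xif : xi ^+ f2 != 1 by apply: unity_exp_neq1.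
have prod : \prod_(0 <= k < l ^ j') (v - zeta j' ^+ k) = u ^+ f - 1.
  have := factor_Xn_sub_1 (zeta_prim j') => /(congr1 (fun q => q.[v])).
  rewrite horner_prod !hornerE => e.
  by rewrite fE exprM -e; apply: eq_bigr => k _; rewrite !hornerE.
(* The product of these factors is divisible by p, so they cannot all be units. *)
have [k kr] : exists k, radp iota (v - zeta j' ^+ k).
  apply: contrapT => /forallNP nr.
  have tO k : O (v - zeta j' ^+ k) by apply: intB => //; apply/intX/int_zeta.
  have t0 k : v - zeta j' ^+ k != 0.
    apply/eqP => e; apply: (nr k); rewrite e; split; first exact: int0.
    by exists 1%N; rewrite expr1 mul0r; apply: int0.
  have tV k : O (v - zeta j' ^+ k)^-1 by case: (unit_or_radp (tO k) (t0 k)) => // /nr.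
  apply: (@invp_not_int _ p_pr _ _ iota).
  have e0 : u ^+ f - 1 != 0 by rewrite -prod; elim/big_ind: _ => //; [apply: oner_neq0 | apply: mulf_neq0].
  have -> : p%:R^-1 = (u ^+ f - 1)^-1 * ((u ^+ f - 1) / p%:R) by rewrite mulKf.
  apply: intM => //; rewrite -prod -prodfV; elim/big_ind: _ => //; first exact: int1.
  exact: intM.
have zk0 : zeta j' ^+ k != 0 by rewrite expf_neq0 // zeta_neq0.
have xi0 : xi ^+ f2 != 0.
  by apply: contraTneq (oner_neq0 E) => e; rewrite -(expr1n _ f2) -xil -exprM mulnC exprM e expr0n eqn0Ngt l_gt0 eqxx.
have xiO : O (xi ^+ f2) by apply: intX; apply: (int_root l_gt0); rewrite xil; apply: int1.
have : radp iota (zeta j' ^+ k * (1 - xi ^+ f2)).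
  have -> : zeta j' ^+ k * (1 - xi ^+ f2) = xi ^+ f2 * (v - zeta j' ^+ k) - h (v - zeta j' ^+ k).
    by rewrite rmorphB /= hv rmorphXn /= hzj; ring.
  by apply: radpB; [apply: radpM | apply: radp_abs_gal].
apply: radp_unit; last by rewrite mulf_neq0 // subr_eq0 eq_sym.
rewrite invfM; apply: intM; first by rewrite -exprVn; apply/intX/int_zetaV.
apply: (@int_one_sub_unity _ _ _ _ _ _ l) => //; first by have := p_ndvd_lX 1; rewrite expn1.
by rewrite exprAC xil expr1n.
Qed.

Lemma conjugates_finite (s : seq E) : exists s' : seq E, {subset s <= s'} /\
  forall g x, x \in s' -> g x \in s'.
Proof.
elim: s => [|x s [s1 [ss1 s1G]]]; first by exists [::].
have [q qm qx] := monic_algebraic algE x.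
have [r qE] := closed_field_poly_normal (map_poly iota q).
have rP y : (y \in r) = root (map_poly iota q) y.
  rewrite qE rootZ ?root_prod_XsubC // lead_coef_eq0 map_poly_eq0 monic_neq0 //.
exists (r ++ s1); split=> [y|g y].
  by rewrite inE mem_cat => /orP[/eqP ->|/ss1 ->]; rewrite ?rP ?qx ?orbT.
rewrite !mem_cat => /orP[|/s1G -> //]; last by rewrite orbT.
rewrite !rP => qy; apply/orP; left; apply/rootP; rewrite -[RHS](rmorph0 g) -(rootP qy).
rewrite -horner_map -map_poly_comp; congr (_.[_]).
by apply: eq_map_poly => z /=; rewrite abs_gal_fix.
Qed.

Lemma finite_order_on (s : seq E) g : exists k, (0 < k)%N /\ {in s, forall x, (g ^+ k)%g x = x}.
Proof.
elim: s => [|x s [k [k0 ks]]]; first by exists 1%N.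
have [s' [ss' s'G]] := conjugates_finite [:: x].
have inv i : (g ^+ i)%g x \in s' by apply: s'G; apply: ss'; rewrite mem_head.
have gI i : injective ((g ^+ i)%g) by apply: bij_inj; apply: abs_gal_bij.
have [a [a0 ax]] : exists a, (0 < a)%N /\ (g ^+ a)%g x = x.
  pose f (i : 'I_(size s').+1) := (g ^+ i)%g x.
  have /injectivePn[i1 [i2 i12 e]] : ~~ injectiveb f.
    apply/negP => /injectiveP fI.
    have := @uniq_leq_size _ [seq f i | i <- enum 'I_(size s').+1] s'.
    rewrite map_inj_uniq ?enum_uniq // size_map size_enum_ord ltnn => h.
    by have : false by apply: h => // _ /mapP[i _ ->]; apply: inv.
  wlog lt : i1 i2 {i12} e / (i1 < i2)%N => [hw|].
    have [lt|lt|e'] := ltngtP i1 i2; last by case/eqP: i12; apply: val_inj.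
    + exact: (hw _ _ e lt).
    + exact: (hw _ _ (esym e) lt).
  exists (i2 - i1)%N; rewrite subn_gt0; split=> //; apply: (gI i1).
  by rewrite -abs_gal_mulE -expgnDr subnKC ?(ltnW lt) // -[RHS]e.
exists (k * a)%N; rewrite muln_gt0 k0; split=> // y.
have mulfix c d z : (g ^+ c)%g z = z -> (g ^+ (c * d))%g z = z.
  by move=> e; rewrite expgnA abs_gal_expE; elim: d => //= d ->.
by rewrite inE => /orP[/eqP ->|/ks ?]; [rewrite mulnC|]; apply: mulfix.
Qed.

(** If no power of g prime to l fixes s, some power h of g has order exactly l on an element y, and
    a resolvent z satisfies h z = xi z with xi a nontrivial l-th root of unity. Multiplying a power
    of z by roots of p that h fixes gives a unit with the same property, against
    [no_kummer_unit]. *)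
Lemma tame_kernel (s : seq E) : exists N, forall g, cyclo g N = (1 : Zl) N -> kummer g N = 0%N ->
  exists m, ~~ (l %| m)%N /\ {in s, forall x, (g ^+ m)%g x = x}.
Proof.
have [s' [ss' s'G]] := conjugates_finite s.
(* D1 bounds the degree of the resolvent, hence the l-part of its normalizing exponent and the depth
   of the root of p needed. D2 then bounds the degree of the resulting unit. *)
have [L1 [D1 [fL1 L1s]]] := finite_subring_exists algE (zeta 1 :: s').
have [L2 [D2 [fL2 L2s]]] := finite_subring_exists algE [:: zeta 1, varpi D1, (varpi D1)^-1 & s'].
pose N := (D1 + p ^ D2).+1; exists N => g gz gw.
have {}gz : g (zeta N) = zeta N by apply: cyclo_fixes.
have {}gw : g (varpi N) = varpi N by apply: kummer_fixes.
have fixX m x : g x = x -> (g ^+ m)%g x = x by move=> e; rewrite abs_gal_expE; elim: m => //= m ->.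
have [k [k0 ks]] := finite_order_on s g.
have [k' kl kE] := pfactor_coprime l_pr k0; set e := logn l k in kE.
have lk' : ~~ (l %| k')%N by rewrite -prime_coprime.
have [sfix|] := pselect {in s, forall x, (g ^+ k')%g x = x}; first by exists k'.
move=> /existsNP[y /not_implyP[ys gy]].
pose P i := `[< (g ^+ (k' * l ^ i))%g y = y >].
have exP : exists i, P i by exists e; apply/asboolP; rewrite -kE; apply: ks.
case: (ex_minnP exP) => i /asboolP Pi min.
have i0 : (0 < i)%N by rewrite lt0n; apply/eqP => i0; apply: gy; move: Pi; rewrite i0 expn0 muln1.
pose h := (g ^+ (k' * l ^ i.-1))%g.
have hl : (h ^+ l)%g y = y by rewrite -expgnA -mulnA -expnSr prednK.
have hy : h y <> y by move=> e'; have := min i.-1; rewrite -ltnS prednK // ltnn => /(_ (asboolT e')).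
have hz : h (zeta N) = zeta N by apply: fixX.
have hw : h (varpi N) = varpi N by apply: fixX.
have hz1 : h (zeta 1) = zeta 1.
  by have := zeta_expl 1 (D1 + p ^ D2); rewrite add1n => <-; rewrite rmorphXn /= hz.
have hwD : h (varpi D1) = varpi D1.
  have wE m d : varpi (m + d) ^+ (l ^ d) = varpi m.
    by elim: d => [|d IH]; rewrite ?addn0 ?expn0 ?expr1 // addnS expnS exprM varpiS.
  have NE : N = (D1 + (p ^ D2).+1)%N by rewrite addnS.
  by rewrite -(wE D1 (p ^ D2).+1) -NE rmorphXn /= hw.
have z1l : zeta 1 ^+ l = 1 by have := zeta_exp 1; rewrite expn1.
have z1p : l.-primitive_root (zeta 1) by have := zeta_prim 1; rewrite expn1.
(* Lagrange resolvents: h scales [z c] by the inverse of zeta_1^c. Their sum is l y, so one with c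
   nonzero survives unless h fixes y. *)
pose z c := \sum_(m < l) zeta 1 ^+ (c * m) * (h ^+ m)%g y.
have hzc c : zeta 1 ^+ c * h (z c) = z c.
  rewrite rmorph_sum mulr_sumr /z.
  rewrite [RHS](reindex_inj (can_inj (@ordSK l))).
  apply: eq_bigr => m _; rewrite rmorphM rmorphXn /= hz1 mulrA -exprD -mulnS.
  rewrite -abs_gal_mulE -expgS.
  have [lm|ml] := ltnP m.+1 l; first by rewrite modn_small.
  have -> : m.+1 = l by apply/eqP; rewrite eqn_leq ltn_ord.
  by rewrite modnn muln0 hl mulnC exprM z1l expr1n.
have sumz : \sum_(c < l) z c = l%:R * y.
  rewrite exchange_big /= (bigD1 (Ordinal l_gt0)) //= [X in _ + X]big1 ?addr0 => [|m m0].
    under eq_bigr => c _ do rewrite muln0 expr0 mul1r.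
    by rewrite sumr_const card_ord mulr_natl.
  rewrite -mulr_suml; under eq_bigr => c _ do rewrite mulnC exprM.
  have zm1 : zeta 1 ^+ m != 1.
    rewrite -(prim_order_dvd z1p) gtnNdvd //.
    by move: m0; rewrite -val_eqE /= -lt0n.
  have : (zeta 1 ^+ m - 1) * \sum_(c < l) (zeta 1 ^+ m) ^+ c = 0.
    by rewrite -subrX1 -exprM mulnC exprM z1l expr1n subrr.
  by move/eqP; rewrite mulf_eq0 subr_eq0 (negPf zm1) => /eqP ->; rewrite mul0r.
have [c c0 zc0] : exists2 c : 'I_l, c != Ordinal l_gt0 & z c != 0.
  apply: contrapT => nc; apply: hy.
  have : l%:R * y = z 0%N.
    rewrite -sumz (bigD1 (Ordinal l_gt0)) //= big1 ?addr0 // => c c0.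
    by apply/eqP; apply: contrapT => /negP zc; apply: nc; exists c.
  move=> ly; have := hzc 0%N; rewrite -ly expr0 mul1r rmorphM rmorph_nat.
  by apply: mulfI; apply: nat_neq0.
pose xi := (zeta 1 ^+ c)^-1.
have z1c0 : zeta 1 ^+ c != 0 by rewrite expf_neq0 // zeta_neq0.
have hxi : h (z c) = xi * z c by rewrite -{2}(hzc c) mulKf.
have xil : xi ^+ l = 1 by rewrite exprVn -exprM mulnC exprM z1l expr1n invr1.
have xi1 : xi != 1.
  rewrite invr_eq1 -(prim_order_dvd z1p) gtnNdvd //.
  by move: c0; rewrite -val_eqE /= -lt0n.
have yG m : (h ^+ m)%g y \in s' by apply: s'G; apply: ss'.
have L1z : L1 (z c).
  apply: (fsub_sum fL1) => m; apply: (fsubM fL1).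
    by apply: (fsubX fL1); apply: L1s; rewrite mem_head.
  by apply: L1s; rewrite inE yG orbT.
have L2z : L2 (z c).
  apply: (fsub_sum fL2) => m; apply: (fsubM fL2).
    by apply: (fsubX fL2); apply: L2s; rewrite mem_head.
  by apply: L2s; rewrite !inE yG !orbT.
have [n [a [b [/andP[n0 nD1] On On']]]] := normalize_to_unit (finite_subring_deg fL1 L1z) zc0.
have [n2 nl nE] := pfactor_coprime l_pr n0; set j := logn l n in nE.
have jD1 : (j <= D1)%N.
  apply: leq_trans nD1; apply: ltnW; apply: leq_trans (ltn_expl j (prime_gt1 l_pr)) _.
  by apply: dvdn_leq => //; rewrite nE dvdn_mull.
(* w is an l^j-th root of p fixed by h, so u is an l^j-th root of the unit z^n p^a / p^b and is a
   unit itself. *)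
pose w := varpi D1 ^+ (l ^ (D1 - j)).
have wj : w ^+ (l ^ j) = p%:R by rewrite -exprM -expnD subnK // varpi_exp.
have w0 : w != 0 by rewrite expf_neq0 // varpi_neq0.
pose u := z c ^+ n2 * w ^+ a / w ^+ b.
have uE : u ^+ (l ^ j) = z c ^+ n * p%:R ^+ a / p%:R ^+ b.
  by rewrite !exprMn exprVn -!exprM nE ![(_ * l ^ j)%N]mulnC !exprM wj.
have lj0 : (0 < l ^ j)%N by [].
have L2w : L2 w by apply: (fsubX fL2); apply: L2s; rewrite !inE eqxx orbT.
have L2w' : L2 w^-1 by rewrite -exprVn; apply: (fsubX fL2); apply: L2s; rewrite !inE eqxx !orbT.
have L2u : L2 u.
  rewrite /u -exprVn; apply: (fsubM fL2); last exact: (fsubX fL2).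
  by apply: (fsubM fL2); apply: (fsubX fL2).
have u0 : u != 0.
  by apply: mulf_neq0; [apply: mulf_neq0; apply: expf_neq0 | rewrite invr_eq0 expf_neq0].
exfalso; apply: (@no_kummer_unit D2 N h u (xi ^+ n2)) => //.
- exact: finite_subring_deg fL2 L2u.
- by rewrite /N; apply: leqW; apply: leq_addl.
- by apply: (int_root lj0); rewrite uE.
- by apply: (int_root lj0); rewrite exprVn uE.
- by rewrite exprAC xil expr1n.
- exact: unity_exp_neq1.
rewrite /u fmorph_div rmorphM !rmorphXn /= hxi hwD exprMn.
by rewrite !mulrA.
Qed.

End CyclotomicKummer.

                                                                              
                                                                          
                                                          
(** What the matrix arguments use about the Galois group. [tp_eps] is the cyclotomic character,
    [tp_b] a Kummer cocycle normalized at [sigma] and at [tp_t], [tp_kap] an additive map taking the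
    value 1 at [tp_phi]. The alternative in [tp_b_t] covers the case where the Kummer cocycle is a
    coboundary. [tp_tame] says that what remains has order prime to l. *)
Record tame_parameters (F E : fieldType) (iota : F -> E) (l : nat) (l_pr : prime l)
    (sigma : abs_gal iota) (inert : abs_gal iota -> Prop) : Type := TameParameters {
  tp_eps : abs_gal iota -> padic_int l_pr;
  tp_b : abs_gal iota -> padic_int l_pr;
  tp_kap : abs_gal iota -> padic_int l_pr;
  tp_epsM : forall g h, tp_eps (g * h)%g = tp_eps g * tp_eps h;
  tp_bM : forall g h, tp_b (g * h)%g = tp_b g + tp_eps g * tp_b h;
  tp_kapM : forall g h, tp_kap (g * h)%g = tp_kap g + tp_kap h;
  tp_mod : forall (k : fieldType) g, mod_cyclotomic l k g = (tp_eps g 1)%:R;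
  tp_eps_cont : forall n, exists s : seq E, forall g h : abs_gal iota, {in s, g =1 h} -> tp_eps g n = tp_eps h n;
  tp_b_cont : forall n, exists s : seq E, forall g h : abs_gal iota, {in s, g =1 h} -> tp_b g n = tp_b h n;
  tp_kap_cont : forall n, exists s : seq E, forall g h : abs_gal iota, {in s, g =1 h} -> tp_kap g n = tp_kap h n;
  tp_inertia : forall g, inert g -> tp_eps g = 1;
  tp_bsigma : tp_b sigma = 0;
  tp_t : abs_gal iota;
  tp_eps_t : tp_eps tp_t = 1;
  tp_b_t : tp_b tp_t = 1 \/ (forall g, tp_b g = 0);
  tp_phi : abs_gal iota;
  tp_kap_phi : tp_kap tp_phi = 1;
  tp_eps1_kap : forall g, tp_eps g = 1 -> tp_kap g = 0;
  tp_kap_small : forall n, exists m, forall g, tp_kap g m = 0%N -> (tp_eps g ^+ l.-1) n = (1 : padic_int l_pr) n;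
  tp_tame : forall s : seq E, exists n, forall g, tp_eps g n = (1 : padic_int l_pr) n -> tp_b g n = 0%N ->
    exists m, ~~ (l %| m)%N /\ {in s, forall x, (g ^+ m)%g x = x}
}.

(** * Existence of the tame parameters *)

Section TameParameters.
Variables (p : nat) (p_pr : prime p) (l : nat) (l_pr : prime l) (l_neq_p : l <> p).
Local Notation Qp := (padic_num p_pr).
Local Notation Zl := (padic_int l_pr).
Variables (F : fieldExtType Qp) (E : closedFieldType) (iota : {rmorphism F -> E}).
Hypothesis algE : forall x : E, algebraicOver iota x.
Hypothesis l_gt2 : (2 < l)%N.
Local Notation G := (abs_gal iota).
Local Notation O := (int_closure (p_pr := p_pr) iota).
Local Notation eps := (cyclo l_pr).
Local Notation kum := (kummer l_pr).
Local Notation zeta := (zeta l_pr iota).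
Implicit Types g h : G.

(** If eps^(l-1) = 1 throughout, eps(g) is a Teichmüller element determined by its first digit, so
    zeta_N has at most l conjugates. *)
Lemma zeta_degree N : (forall g, eps g ^+ l.-1 = 1) -> exists q : {poly F},
  [/\ q \is monic, root (map_poly iota q) (zeta N) & ((size q).-1 <= l)%N].
Proof.
move=> fin; pose x := zeta N.
have exq : exists n, `[< exists q : {poly F}, [/\ q != 0, root (map_poly iota q) x & size q = n] >].
  by have [q qm qx] := monic_algebraic algE x; exists (size q); apply/asboolP; exists q; rewrite monic_neq0.
case: (ex_minnP exq) => n /asboolP[q [q0 qx qn]] min.
have qdiv r : root (map_poly iota r) x -> q %| r.
  move=> rx; apply: contraT => nd; have r0 : r %% q != 0 by move: nd; rewrite /dvdp.
  have := ltn_modp r q; rewrite q0 qn => lt.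
  have : (n <= size (r %% q)%R)%N; last by rewrite leqNgt lt.
  apply: min; apply/asboolP; exists (r %% q); split=> //.
  move: rx; rewrite {1}(divp_eq r q) rmorphD rmorphM /root !hornerE /=.
  by rewrite (rootP qx) mulr0 add0r.
exists ((lead_coef q)^-1 *: q).
have lq : lead_coef q != 0 by rewrite lead_coef_eq0.
rewrite monicE lead_coefZ mulVf // map_polyZ rootZ ?fmorph_eq0 ?invr_eq0 // size_scale ?invr_eq0 //.
split=> //.
have [rs rsE] := closed_field_poly_normal (map_poly iota q).
have lq' : lead_coef (map_poly iota q) != 0 by rewrite lead_coef_map fmorph_eq0.
have szq : size q = (size rs).+1.
  by rewrite -(size_map_poly iota) rsE size_scale // size_prod_XsubC.
rewrite szq /=.
have urs : uniq rs.
  rewrite -separable_prod_XsubC.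
  apply: (@dvdp_separable _ ('X^(l ^ N) - 1)); last first.
    by apply: separable_Xn_sub_1; apply: (nat_neq0 iota); rewrite expn_gt0 prime_gt0.
  have : map_poly iota q %| 'X^(l ^ N) - 1.
    have XE : map_poly iota ('X^(l ^ N) - 1) = 'X^(l ^ N) - 1.
      by rewrite rmorphB /= map_polyXn rmorph1.
    rewrite -XE dvdp_map; apply: qdiv.
    by rewrite XE /root !hornerE zeta_exp subrr.
  by rewrite rsE dvdpZl.
have conj y : y \in rs -> exists g : G, g x = y.
  move=> yr; apply: abs_gal_conjugate => // r /qdiv qr.
  have : map_poly iota q %| map_poly iota r by rewrite dvdp_map.
  move=> /dvdpP[c ->]; rewrite rootM; apply/orP; right.
  by rewrite rsE rootZ // root_prod_XsubC.
have lt g : (eps g 1%N < l)%N by have := padic_lt (eps g) 1; rewrite expn1.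
pose rep (a : 'I_l) : E := xget 0 [set y | exists g : G, g x = y /\ eps g 1%N = a]%classic.
have -> : l = size [seq rep a | a <- enum 'I_l] by rewrite size_map size_enum_ord.
apply: uniq_leq_size => // y /conj[g gy]; apply/mapP; exists (Ordinal (lt g)); rewrite ?mem_enum //.
rewrite /rep; case: xgetP => [z _ [h [hz hg]]|/(_ y)]; last by case; exists g.
have -> : y = g x by []. rewrite -hz !cycloP; congr (_ ^+ _); congr (padic_seq _ _).
have X g' : eps g' ^+ l = eps g'.
  have e : eps g' ^+ l = eps g' * eps g' ^+ l.-1 by rewrite -exprS prednK ?prime_gt0.
  by rewrite e fin mulr1.
by apply: padic_torsion_uniq.
Qed.

(** Otherwise all zeta_N would have degree at most D over Q_p. For N = p^D, some f <= N makes
    zeta_N^f congruent to 1 modulo p; but f < l^N, so zeta_N^f differs from 1 and 1 - zeta_N^f is a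
    unit. *)
Lemma cyclo_infinite : exists g, eps g ^+ l.-1 <> 1.
Proof.
apply: contrapT => /forallNP fin.
have {}fin g : eps g ^+ l.-1 = 1 by apply: contrapT; apply: fin.
pose D := (l * \dim {:F})%N; pose N := (p ^ D)%N; pose x := zeta N.
have Dx : padic_deg_le iota D x.
  have [q [qm qx sq]] := zeta_degree N fin.
  have [L' [fL' Lx _]] := finite_subring_adjoin (finite_subring_base iota) qm qx.
  have [r [r0 sr rx]] := finite_subring_deg fL' Lx; exists r; split=> //.
  by apply: leq_trans sr _; rewrite ltnS leq_mul2r sq orbT.
have [i [f [/andP[f0 fD] per]]] := power_periodic_mod_p Dx (int_zeta l_pr iota N).
have x0 : x != 0 := zeta_neq0 l_pr iota N.
have Ox' : O (x^-1 ^+ i) by apply/intX/int_zetaV.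
have {}per : O ((x ^+ f - 1) / p%:R).
  have -> : (x ^+ f - 1) / p%:R = x^-1 ^+ i * ((x ^+ (i + f) - x ^+ i) / p%:R).
    rewrite mulrA; congr (_ / _); rewrite exprD -{2}[x ^+ i]mulr1 -mulrBr mulrA -exprMn.
    by rewrite mulVf // expr1n mul1r.
  exact: intM.
have lX0 : (0 < l ^ N)%N by rewrite expn_gt0 prime_gt0.
have [xf|xf] := eqVneq (x ^+ f) 1.
  have : (l ^ N %| f)%N by rewrite (prim_order_dvd (zeta_prim l_pr iota N)) xf.
  move=> /(dvdn_leq f0) le; have := leq_trans (ltn_expl N (prime_gt1 l_pr)) (leq_trans le fD).
  by rewrite ltnn.
apply: (@invp_not_int _ p_pr _ _ iota).
have e0 : x ^+ f - 1 != 0 by rewrite subr_eq0.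
have -> : p%:R^-1 = - (1 - x ^+ f)^-1 * ((x ^+ f - 1) / p%:R).
  by rewrite -opprB invrN opprK mulrA mulVf // mul1r.
apply: intM => //; apply: intN; apply: (@int_one_sub_unity _ _ _ _ _ _ (l ^ N)) => //.
  case: (N) => [|n]; first by rewrite expn0 dvdn1 neq_ltn prime_gt1 // orbT.
  by rewrite Euclid_dvdX // dvdn_prime2 //; apply/negP => /andP[/eqP e _]; apply: l_neq_p.
by rewrite exprAC zeta_exp expr1n.
Qed.

Lemma cyclo_unit g : eps g \is a GRing.unit.
Proof. by apply/unitrP; exists (eps g^-1%g); rewrite -!cycloM mulVg mulgV cyclo1. Qed.

(** [kap] is the logarithm of eps^(l-1), nonzero by [cyclo_infinite], divided by the power of l
    common to its values and scaled to take the value 1. The last two clauses say that [eps]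
    controls [kap] at finite level and conversely. *)
Lemma unramified_log : exists kap : G -> Zl,
  [/\ forall g h, kap (g * h)%g = kap g + kap h,
      exists phi, kap phi = 1,
      forall g, eps g = 1 -> kap g = 0,
      forall n, exists m, forall g, eps g m = (1 : Zl) m -> kap g n = 0%N
    & forall n, exists m, forall g, kap g m = 0%N -> (eps g ^+ l.-1) n = (1 : Zl) n].
Proof.
pose u g := eps g ^+ l.-1; pose L g := padic_log (u g).
have u1 g : u g 1%N = (1 : Zl) 1%N by apply/padic_fermat/cyclo_unit.
have LM g h : L (g * h)%g = L g + L h by rewrite /L -padic_logM // /u cycloM exprMn.
have ex : exists g, L g <> 0.
  have [g ug] := cyclo_infinite; exists g => L0; apply: ug; apply: padic_ext => n.
  apply: (@padic_congr_le _ _ _ _ _ n.+1) => //.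
  by apply/(padic_log_eq0 l_gt2 _ (u1 g)); rewrite -/(L g) L0 padic_zeroE.
have [n0 [f [phi [fE uphi]]]] := padic_normalize ex.
have fM g h : f (g * h)%g = f g + f h.
  by apply: (@padic_regular _ l_pr n0); rewrite mulrDr -!fE LM.
have small g n : u g (n0 + n).+1 = (1 : Zl) (n0 + n).+1 -> f g n = 0%N.
  move=> /(padic_log_eq0 l_gt2 _ (u1 g)) /padic_dvdP[y]; rewrite -/(L g) fE expnD natrM -mulrA.
  by move=> /padic_regular e; apply/padic_dvdP; exists y.
have unitM0 n (x v : Zl) : x n = 0%N -> (x * v) n = 0%N.
  by move=> /padic_dvdP[y ->]; apply/padic_dvdP; exists (y * v); rewrite mulrA.
exists (fun g => f g / f phi); split.
- by move=> g h; rewrite fM mulrDl.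
- by exists phi; rewrite divrr.
- move=> g e1; suff -> : f g = 0 by rewrite mul0r.
  by apply: padic_ext => n; rewrite padic_zeroE; apply: small; rewrite /u e1 expr1n.
- move=> n; exists (n0 + n).+1 => g e1; apply: unitM0; apply: small.
  by rewrite /u (padic_congrX _ e1) expr1n.
move=> n; exists n => g /(unitM0 _ _ (f phi)); rewrite divrK // => f0.
apply: (@padic_congr_le _ _ _ _ _ n.+1) => //; apply/(padic_log_eq0 l_gt2 _ (u1 g)).
by rewrite -/(L g) fE mulrC; apply: unitM0.
Qed.

(** Since eps(sigma) - 1 is a unit, subtracting a coboundary makes the cocycle vanish at sigma.
    After division by the common power of l it is a unit at some g0, hence also at the commutator t
    of sigma and g0, where eps is 1. The last clause carries continuity and [tame_kernel] over from
    [kummer] to [b]. *)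
Lemma kummer_normalize (sigma : G) : eps sigma 1%N <> (1 : Zl) 1%N ->
  exists (b : G -> Zl) (x c : Zl) n0 t,
  [/\ forall g h, b (g * h)%g = b g + eps g * b h, b sigma = 0, eps t = 1,
      b t = 1 \/ forall g, b g = 0
    & forall g, kum g = (l ^ n0)%:R * (c * b g) + (eps g - 1) * x
        /\ (c \is a GRing.unit)].
Proof.
move=> es1; have us : eps sigma - 1 \is a GRing.unit.
  rewrite padic_unitE; apply/negP => d; apply: es1; apply/padic_congr_sub.
  by rewrite -padic_modn expn1; apply/eqP.
pose x := kum sigma / (eps sigma - 1); pose b0 g := kum g - (eps g - 1) * x.
have b0M g h : b0 (g * h)%g = b0 g + eps g * b0 h by rewrite /b0 kummerM cycloM; ring.
have b0s : b0 sigma = 0 by rewrite /b0 /x mulrC divrK // subrr.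
have kE g : kum g = b0 g + (eps g - 1) * x by rewrite /b0 subrK.
have [ex|nex] := pselect (exists g, b0 g <> 0); last first.
  have {}nex g : b0 g = 0 by apply: contrapT => ?; apply: nex; exists g.
  exists b0, x, 1, 0%N, 1%g; split; rewrite ?cyclo1 //; first by right.
  by move=> g; rewrite expn0 !mul1r unitr1 {1}kE.
have [n0 [f [g0 [fE ug0]]]] := padic_normalize ex.
have fM g h : f (g * h)%g = f g + eps g * f h.
  by apply: (@padic_regular _ l_pr n0); rewrite mulrDr mulrCA -!fE b0M.
have f1 : f 1%g = 0 by apply: (addrI (f 1%g)); rewrite addr0 -{1}[1%g in RHS]mulg1 fM cyclo1 mul1r.
have fs : f sigma = 0 by apply: (@padic_regular _ l_pr n0); rewrite mulr0 -fE.
have eV g : eps g * eps g^-1%g = 1 by rewrite -cycloM mulgV cyclo1.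
have fV g : eps g * f g^-1%g = - f g.
  by apply/eqP; rewrite -addr_eq0 addrC -fM mulgV f1.
pose t := (sigma * g0 * sigma^-1 * g0^-1)%g.
have et : eps t = 1 by rewrite !cycloM -mulrA mulrACA !eV mulr1.
have fsV : f sigma^-1%g = 0.
  by have := fV sigma; rewrite fs oppr0 => /eqP; rewrite mulf_eq0 => /orP[/eqP e|/eqP //]; have := cyclo_unit sigma; rewrite e unitr0.
have ft : f t = (eps sigma - 1) * f g0.
  rewrite !fM !cycloM fs fsV.
  transitivity (eps sigma * f g0 + (eps sigma * eps sigma^-1%g) * (eps g0 * f g0^-1%g)); first by ring.
  by rewrite eV fV; ring.
have uft : f t \is a GRing.unit by rewrite ft unitrM us.
exists (fun g => f g / f t), x, (f t), n0, t; split=> //.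
- by move=> g h; rewrite fM mulrDl mulrA.
- by rewrite fs mul0r.
- by left; rewrite divrr.
by move=> g; split=> //; rewrite [f t * _]mulrC divrK // -fE.
Qed.

Lemma tame_parameters_exist (sigma : G) : eps sigma 1%N <> (1 : Zl) 1%N ->
  inhabited (tame_parameters l_pr sigma (@inertia _ p_pr F E iota)).
Proof.
move=> es1; have [kap [kapM [phi kphi] kap1 kapc kaps]] := unramified_log.
have [b [x [c [n0 [t [bM bs et bt kE]]]]]] := kummer_normalize es1.
have uc := (kE 1%g).2; have {}kE g := (kE g).1.
have ec n : exists s : seq E, forall g h : abs_gal iota, {in s, g =1 h} -> eps g n = eps h n.
  by exists [:: zeta n] => g h gh; apply: cyclo_continuous; apply: gh; rewrite mem_head.
have bc n : exists s : seq E, forall g h : abs_gal iota, {in s, g =1 h} -> b g n = b h n.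
  exists [:: zeta (n0 + n); varpi p l_pr E (n0 + n)] => g h gh.
  have e1 : eps g (n0 + n) = eps h (n0 + n) by apply: cyclo_continuous; apply: gh; rewrite mem_head.
  have e2 : kum g (n0 + n) = kum h (n0 + n) by apply: kummer_continuous; apply: gh; rewrite !inE eqxx orbT.
  have bE q : (l ^ n0)%:R * (c * b q) = kum q - (eps q - 1) * x by rewrite kE addrK.
  have : ((l ^ n0)%:R * (c * b g) : Zl) (n0 + n)%N = ((l ^ n0)%:R * (c * b h) : Zl) (n0 + n)%N.
    rewrite !bE; apply: padic_congrD => //; apply: padic_congrN; apply: padic_congrM => //.
    exact: padic_congrD.
  move=> /padic_congr_sub/padic_dvdP[y]; rewrite -mulrBr expnD natrM -mulrA -mulrBr.
  move=> /padic_regular e; apply/padic_congr_sub/padic_dvdP; exists (y / c).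
  by rewrite mulrA -e mulrC mulKr.
have kc n : exists s : seq E, forall g h : abs_gal iota, {in s, g =1 h} -> kap g n = kap h n.
  have [m km] := kapc n; exists [:: zeta m] => g h gh.
  have e1 : eps (h^-1 * g)%g m = (1 : Zl) m.
    rewrite cycloM -(padic_congrM (erefl (eps h^-1%g m)) (_ : eps h m = eps g m)).
      by rewrite -cycloM mulVg cyclo1.
    by apply/esym/cyclo_continuous; apply: gh; rewrite mem_head.
  have gE : g = (h * (h^-1 * g))%g by rewrite mulgA mulgV mul1g.
  by rewrite {1}gE kapM (padic_congrD (erefl (kap h n)) (_ : _ n = (0 : Zl) n)) ?addr0 // padic_zeroE km.
have tame : forall s : seq E, exists n, forall g, eps g n = (1 : Zl) n -> b g n = 0%N ->
    exists m, ~~ (l %| m)%N /\ {in s, forall x, (g ^+ m)%g x = x}.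
  move=> s; have [n hn] := tame_kernel l_pr l_neq_p algE s; exists n => g e1 bg; apply: hn => //.
  have [y bE] := (padic_dvdP _ _).1 bg; have /padic_congr_sub/padic_dvdP[z zE] := e1.
  apply/padic_dvdP; exists ((l ^ n0)%:R * (c * y) + z * x); rewrite kE bE zE; ring.
constructor; exact: (TameParameters (@cycloM _ _ _ l_pr _ _ iota) bM kapM
  (fun k => @mod_cyclotomicE _ _ _ l_pr _ _ iota k) ec bc kc
  (@cyclo_inertia _ _ _ l_pr l_neq_p _ _ iota) bs et bt kphi kap1 kaps tame).
Qed.

End TameParameters.

                                 

(** * Schur's lemma and the centralizer of theta on a deep normal subgroup *)

Section Schur.
Variables (G : groupType) (k : fieldType).

Lemma schur d1 d2 (rho1 : G -> 'M[k]_d1) (rho2 : G -> 'M[k]_d2) (M : 'M[k]_(d1, d2)) :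
  irreducible rho1 -> irreducible rho2 -> (forall g, rho1 g *m M = M *m rho2 g) ->
  M = 0 \/ row_free M /\ row_full M.
Proof.
move=> [_ i1] [_ i2] MM.
case: (i1 <<M^T>>%MS) => [g|Z|full].
- rewrite (eqmxMr _ (genmxE _)) genmxE -trmx_mul MM trmx_mul.
  exact: submxMl.
- left; have : \rank M^T = 0%N by rewrite -mxrank_gen Z mxrank0.
  by move/eqP; rewrite mxrank_eq0 -(trmx0 k d1 d2) => /eqP/trmx_inj.
case: (i2 (kermx M^T)) => [g|Z|kfull].
- rewrite sub_kermx -mulmxA -trmx_mul -MM trmx_mul mulmxA.
  by rewrite mulmx_ker mul0mx.
- right; rewrite /row_free /row_full -[\rank M]mxrank_tr; move: full; rewrite /row_full mxrank_gen.
  have := mxrank_ker M^T; have := rank_leq_row M^T; rewrite Z mxrank0.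
  by move: (\rank _) => r; split; lia.
left; have : M^T = 0.
  apply: (row_full_inj kfull); by rewrite mulmx_ker mulmx0.
by rewrite -(trmx0 k d1 d2) => /trmx_inj.
Qed.

End Schur.

(** Over the algebraic closure x has an eigenvalue, and Schur's lemma makes x equal to it; the
    scalar is an entry of x, so it lies in [k]. *)
Lemma abs_irreducible_scalar (G : groupType) (k : finFieldType) d (rho : G -> 'M[k]_d)
    (x : 'M[k]_d) : absolutely_irreducible rho -> (forall g, rho g *m x = x *m rho g) ->
  exists c, x = c%:M.
Proof.
move=> irr xc; have [K [f _]] := countable_algebraic_closure k.
have [d0 irrK] := irr K f.
have [a ea] : exists a, eigenvalue (map_mx f x) a.
  have : size (char_poly (map_mx f x)) != 1%N by rewrite size_char_poly eqSS -lt0n.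
  by move=> /closed_rootP[a ra]; exists a; rewrite eigenvalue_root_char.
have xK g : map_mx f (rho g) *m (map_mx f x - a%:M) = (map_mx f x - a%:M) *m map_mx f (rho g).
  by rewrite mulmxBr mulmxBl -!map_mxM xc scalar_mxC.
have [h0|[fr _]] := schur (irr K f) (irr K f) xK; last first.
  have /eigenvalueP[v vx v0] := ea; case/eqP: v0; apply: (row_free_inj fr).
  by rewrite mul0mx mulmxBr vx mul_mx_scalar subrr.
have {}h0 i j : f (x i j) = a *+ (i == j).
  by have := congr1 (fun M : 'M_d => M i j) (subr0_eq h0); rewrite !mxE.
exists (x (Ordinal d0) (Ordinal d0)); apply/matrixP => i j; apply: (fmorph_inj f).
by rewrite h0 mxE rmorphMn h0 eqxx.
Qed.

Lemma scalar_mxX (R : comNzRingType) d (c : R) i : (c%:M : 'M[R]_d.+1) ^+ i = (c ^+ i)%:M.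
Proof. by elim: i => // i IH; rewrite !exprS IH -mulmxE -scalar_mxM. Qed.

Lemma trB (R : pzRingType) d (x y : 'M[R]_d) : \tr (x - y) = \tr x - \tr y.
Proof. exact: raddfB. Qed.

Lemma between_multiples q f : (0 < q * f < 2 * f)%N -> q = 1%N.
Proof. by case: q => [|[|q]] //; nia. Qed.

Section FixedPoints.
Variables (l : nat) (l_pr : prime l).

Lemma perm_lgroup_fix_mod (T : finType) (S : {set {perm T}}) M :
  group_set S -> (forall x, x \in S -> x ^+ (l ^ M) = 1)%g ->
  #|T| = #|[set t : T | [forall x in S, x t == t]]| %[mod l].
Proof.
move=> gS SM; pose A := Group gS.
have lA : (l.-group A)%g.
  apply/pgroupP => r r_pr /(Cauchy r_pr)[x xA xr].
  have : (r %| l ^ M)%N by rewrite -xr order_dvdn SM.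
  by rewrite Euclid_dvdX // => /andP[]; rewrite dvdn_prime2 // => /eqP ->; rewrite inE eqxx.
have act : [acts A, on [set: T] | 'P] by apply/actsP => a _ x; rewrite !inE.
have := pgroup_fix_mod lA act; rewrite cardsT => ->; congr (_ %% _)%N.
apply: eq_card => t; rewrite !inE /=.
by apply/idP/forall_inP => [/fintype.subsetP h x /h | h]; rewrite ?inE //; apply/fintype.subsetP => x /h; rewrite inE.
Qed.

End FixedPoints.

Section Centralizer.
Variables (G : groupType) (l : nat) (l_pr : prime l).
Variables (k : finFieldType) (chl : l \in [pchar k]) (n' : nat).
Local Notation n := n'.+1.
Variables (theta : G -> 'M[k]_n) (theta_rep : is_rep theta).
Hypothesis theta_irr : absolutely_irreducible theta.
Hypothesis l_ndvd_n : ~~ (l %| n)%N.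
Variables (chi : G -> k) (sigma : G).
Hypothesis chiM : forall g h, chi (g * h)%g = chi g * chi h.
Hypothesis chi_gen : forall g, exists i, chi g = chi sigma ^+ i.

(** z is an equivariant map from the twist theta(a) to theta; a is called its weight below. *)
Definition intertwines a (z : 'M[k]_n) := forall g, theta g * z = chi g ^+ a *: (z * theta g).

Variables (s : nat) (s_gt0 : (0 < s)%N) (X : 'M[k]_n).
Hypothesis X_unit : X \is a GRing.unit.
Hypothesis X_int : intertwines s X.
Hypothesis s_min : forall a z, (0 < a)%N -> z \is a GRing.unit -> intertwines a z -> (s <= a)%N.

Lemma thetaM g h : theta (g * h)%g = theta g * theta h.
Proof. by case: theta_rep => _ ->. Qed.

Lemma theta1 : theta 1%g = 1. Proof. by case: theta_rep. Qed.

Lemma thetaV g : theta g * theta g^-1%g = 1. Proof. by rewrite -thetaM mulgV theta1. Qed.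
Lemma thetaVl g : theta g^-1%g * theta g = 1. Proof. by rewrite -thetaM mulVg theta1. Qed.

Lemma theta_unit g : theta g \is a GRing.unit.
Proof. by apply/unitrP; exists (theta g^-1%g); rewrite thetaV thetaVl. Qed.

Lemma chi1 : chi 1%g = 1.
Proof.
have X1 := X_int 1%g; have [d0|] := eqVneq (chi 1%g) 0; last first.
  by move=> c0; apply: (mulfI c0); rewrite -chiM mulg1 mulr1.
move: X1; rewrite theta1 mul1r mulr1 d0 expr0n eqn0Ngt s_gt0 scale0r => X0.
by move: X_unit; rewrite X0 unitr0.
Qed.

Lemma chi_neq0 g : chi g != 0.
Proof.
apply: contraTneq (oner_neq0 k) => c0.
by rewrite -chi1 -(mulgV g) chiM c0 mul0r eqxx.
Qed.

Lemma chiX g i : chi (g ^+ i)%g = chi g ^+ i.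
Proof. by elim: i => [|i IH]; rewrite ?expg0 ?chi1 // expgS exprS chiM IH. Qed.

Lemma chiV g : chi g^-1%g = (chi g)^-1.
Proof. by apply: (mulfI (chi_neq0 g)); rewrite -chiM mulgV chi1 divff ?chi_neq0. Qed.

Lemma intertwinesM a b y z : intertwines a y -> intertwines b z -> intertwines (a + b) (y * z).
Proof.
move=> ya zb g; rewrite mulrA ya -scalerAl -[y * theta g * z]mulrA zb -scalerAr scalerA mulrA.
by rewrite exprD.
Qed.

Lemma intertwines0 z : intertwines 0 z -> exists c, z = c%:M.
Proof. by move=> z0; apply: abs_irreducible_scalar theta_irr _ => g; have := z0 g; rewrite scale1r. Qed.

Lemma XE_int i : intertwines (s * i) (X ^+ i).
Proof.
elim: i => [|i IH]; first by move=> g; rewrite muln0 !expr0 mulr1 mul1r scale1r.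
by rewrite exprS mulnS; apply: intertwinesM.
Qed.

Lemma intertwines_unit a z : intertwines a z -> z = 0 \/ z \is a GRing.unit.
Proof.
move=> za; have [i0 irr] : irreducible theta.
  have := theta_irr idfun; congr irreducible; apply/funext => g; apply/matrixP => i j.
  by rewrite mxE.
have irr' : irreducible (fun g => chi g ^+ a *: theta g).
  split=> // U US; apply: irr => g; have := US g.
  rewrite linearZ /= -scalemxAr eqmx_scale // expf_neq0 //; exact: chi_neq0.
have [|->|[_ fz]] := @schur _ _ _ _ theta _ z (conj i0 irr) irr'; [|by left|right].
  by move=> g; have := za g; rewrite -mulmxE -scalemxAr => ->; rewrite mulmxE.
by rewrite /GRing.unit /= -row_full_unit.
Qed.

Variables (f : nat) (f_prim : f.-primitive_root (chi sigma ^+ s)).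

Lemma f_gt0 : (0 < f)%N. Proof. exact: prim_order_gt0 f_prim. Qed.

Lemma chi_sf g : chi g ^+ (s * f) = 1.
Proof.
have [i ->] := chi_gen g; rewrite exprAC exprM.
by rewrite (prim_expr_order f_prim) expr1n.
Qed.

Lemma Xf_scalar : exists2 c, c != 0 & X ^+ f = c%:M.
Proof.
have [c Xc] : exists c, X ^+ f = c%:M.
  apply: intertwines0 => g; by rewrite XE_int chi_sf.
exists c => //; apply: contraTneq (unitrX f X_unit) => c0.
by rewrite Xc c0 raddf0 unitr0.
Qed.

Lemma mxtraceMC (x y : 'M[k]_n) : \tr (x * y) = \tr (y * x).
Proof. exact: mxtrace_mulC. Qed.

(** Conjugation by theta(sigma) preserves the trace but multiplies X^i by chi(sigma)^(s i), which is
    not 1. *)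
Lemma trX i : ~~ (f %| i)%N -> \tr (X ^+ i) = 0.
Proof.
move=> fi; have e : \tr (X ^+ i) = (chi sigma ^+ s) ^+ i * \tr (X ^+ i).
  have e := congr1 (fun M => \tr (theta sigma^-1%g * M)) (XE_int i sigma).
  by rewrite /= mulrA thetaVl mul1r -scalerAr mxtraceZ exprM mxtraceMC -mulrA thetaV mulr1 in e.
apply/eqP; apply: contraR fi => t0; rewrite (prim_order_dvd f_prim).
by apply/eqP; apply: (mulIf t0); rewrite mul1r -e.
Qed.

Lemma nat_unit a : ~~ (l %| a)%N -> (a%:R : k) != 0.
Proof. by rewrite (dvdn_pcharf chl). Qed.

Lemma s_dvd_int a z : intertwines a z -> z \is a GRing.unit -> (s %| a)%N.
Proof.
move=> za zu; have [e|r0] := posnP (a %% s)%N; first by rewrite /dvdn e.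
have lt : (a %% s < s)%N by rewrite ltn_mod.
suff : (s <= a %% s)%N by rewrite leqNgt lt.
pose q := (a %/ s)%N; pose u := X ^+ (q * f.-1) * z.
apply: (s_min (z := u)) => //; first by rewrite unitrMr ?unitrX.
move=> g; have := intertwinesM (XE_int (q * f.-1)%N) za g; rewrite -/u => ->; congr (_ *: _).
rewrite {1}(divn_eq a s) -/q addnA exprD -[RHS]mul1r; congr (_ * _).
have -> : (s * (q * f.-1) + q * s = s * f * q)%N by rewrite -{2}(prednK f_gt0); ring.
by rewrite exprM chi_sf expr1n.
Qed.

(** The weight is a multiple N s by minimality of s; multiplying by X^(N (f-1)) brings it to a
    multiple of s f, where chi is trivial, so the product is a scalar. *)
Lemma intertwines_XE a z : intertwines a z -> z \is a GRing.unit ->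
  exists c i, c != 0 /\ z = c *: X ^+ i.
Proof.
move=> za zu; have /dvdnP[N aN] := s_dvd_int za zu.
have [c zc] : exists c, X ^+ (N * f.-1) * z = c%:M.
  apply: intertwines0 => g; rewrite (intertwinesM (XE_int (N * f.-1)%N) za g); congr (_ *: _).
  have -> : (s * (N * f.-1) + a = s * f * N)%N by rewrite aN -{2}(prednK f_gt0); ring.
  by rewrite exprM chi_sf expr1n expr0.
have [c' c'0 Xc'] := Xf_scalar.
have zE : z = c / c' ^+ N *: X ^+ N.
  have : X ^+ N * (X ^+ (N * f.-1) * z) = X ^+ N * c%:M by rewrite zc.
  have XN : X ^+ N * X ^+ (N * f.-1) = (c' ^+ N)%:M.
    rewrite -exprD -mulnS prednK ?f_gt0 // mulnC exprM Xc'.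
    exact: scalar_mxX.
  rewrite mulrA XN -!mulmxE mul_scalar_mx mul_mx_scalar => /(congr1 (fun M => (c' ^+ N)^-1 *: M)).
  by rewrite !scalerA mulVf ?expf_neq0 // scale1r mulrC.
exists (c / c' ^+ N), N; split=> //; apply: contraTneq zu => e.
by rewrite zE e scale0r unitr0.
Qed.

Variable GN : G -> Prop.
Hypothesis GN_normal : forall g h, GN h -> GN (g * h * g^-1)%g.
Hypothesis GN_l : exists M, forall g, chi g = 1 -> GN (g ^+ (l ^ M))%g.

Definition centralizes (z : 'M[k]_n) := forall h, GN h -> theta h * z = z * theta h.
Definition conj_by g (z : 'M[k]_n) := theta g * z * theta g^-1%g.

Lemma conj_byM g h z : conj_by (g * h)%g z = conj_by g (conj_by h z).
Proof. by rewrite /conj_by invMg !thetaM !mulrA. Qed.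

Lemma conj_by1 z : conj_by 1%g z = z.
Proof. by rewrite /conj_by invg1 theta1 mul1r mulr1. Qed.

Lemma conj_byD g y z : conj_by g (y + z) = conj_by g y + conj_by g z.
Proof. by rewrite /conj_by mulrDr mulrDl. Qed.

Lemma conj_byZ g c z : conj_by g (c *: z) = c *: conj_by g z.
Proof. by rewrite /conj_by -scalerAr -scalerAl. Qed.

Lemma conj_by0 g : conj_by g 0 = 0. Proof. by rewrite /conj_by mulr0 mul0r. Qed.

Lemma conj_by_fix g z : theta g * z = z * theta g -> conj_by g z = z.
Proof. by move=> e; rewrite /conj_by e -mulrA thetaV mulr1. Qed.

Lemma conj_by_int g a z : conj_by g z = chi g ^+ a *: z -> theta g * z = chi g ^+ a *: (z * theta g).
Proof. by move=> e; rewrite scalerAl -e /conj_by -!mulrA thetaVl mulr1. Qed.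

(** The orthogonal of the powers of X for the trace form. The exponents 1..f form a full period, X^f
    being a scalar. *)
Definition trace_free (z : 'M[k]_n) := forall i, (0 < i <= f)%N -> \tr (z * X ^+ i) = 0.

Lemma centralizes_conj g z : centralizes z -> centralizes (conj_by g z).
Proof.
move=> zc h hN; have e := zc _ (GN_normal g^-1%g hN); rewrite invgK in e.
have {}e : conj_by (g^-1 * h * g)%g z = z by apply: conj_by_fix.
have : conj_by h (conj_by g z) = conj_by g z by rewrite -{2}e -!conj_byM !mulgA mulgV mul1g.
by rewrite {1}/conj_by => {2}<-; rewrite -mulrA thetaVl mulr1.
Qed.

Lemma trace_free_conj g z : trace_free z -> trace_free (conj_by g z).
Proof.
move=> zt i fi; have XV : X ^+ i * theta g = (chi g ^+ (s * i))^-1 *: (theta g * X ^+ i).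
  by rewrite XE_int scalerA mulVf ?scale1r // expf_neq0 // chi_neq0.
rewrite /conj_by mxtraceMC !mulrA XV -!scalerAl mxtraceZ -!mulrA mxtraceMC !mulrA.
rewrite -!mulrA mxtraceMC -!mulrA (mulrA (theta g^-1%g)) thetaVl mul1r.
by rewrite zt ?mulr0.
Qed.

(** The kernel of chi acts by conjugation on the finite space of trace-free centralizing matrices
    through an l-group, since GN acts trivially. The cardinal of a nonzero space is divisible by l,
    hence so is the number of fixed points, and 0 is not the only one. *)
Lemma fixed_exists : (exists2 z, z != 0 & centralizes z /\ trace_free z) ->
  exists2 z, z != 0 & [/\ centralizes z, trace_free z & forall g, chi g = 1 -> conj_by g z = z].
Proof.
move=> [z0 z00 [z0c z0t]].
pose Z (z : 'M[k]_n) := `[< centralizes z /\ trace_free z >].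
pose ZT := {z : 'M[k]_n | Z z}.
have Zconj g (z : ZT) : Z (conj_by g (val z)).
  by case: z => z /= /asboolP[zc zt]; apply/asboolP; split; [apply: centralizes_conj | apply: trace_free_conj].
pose cj g (z : ZT) : ZT := exist (fun z => is_true (Z z)) _ (Zconj g z).
have cjI g : injective (cj g).
  move=> y z /(congr1 val) /= e; apply: val_inj.
  by rewrite -[val y]conj_by1 -[val z]conj_by1 -(mulVg g) !conj_byM e.
pose pg g := perm (cjI g).
have pgM g h : (pg g * pg h)%g = pg (h * g)%g.
  by apply/permP => z; rewrite permM !permE; apply: val_inj; rewrite /= conj_byM.
have pgX g i : (pg g ^+ i)%g = pg (g ^+ i)%g.
  elim: i => [|i IH]; last by rewrite expgSr IH pgM -expgS.
  by apply/permP => z; rewrite perm1 permE; apply: val_inj; rewrite /= conj_by1.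
have [M MP] := GN_l.
pose S := [set x : {perm ZT} | `[< exists g, chi g = 1 /\ x = pg g >]].
have SP x : (x \in S) = `[< exists g, chi g = 1 /\ x = pg g >] by rewrite inE.
have gS : group_set S.
  apply/group_setP; split=> [|x y].
    rewrite SP; apply/asboolP; exists 1%g; split; first exact: chi1.
    by apply/permP => z; rewrite perm1 permE; apply: val_inj; rewrite /= conj_by1.
  rewrite !SP => /asboolP[g gP] /asboolP[h hP]; apply/asboolP; case: gP hP => g1 -> [h1 ->].
  by exists (h * g)%g; rewrite pgM chiM g1 h1 mulr1.
have SM x : x \in S -> (x ^+ (l ^ M) = 1)%g.
  rewrite SP => /asboolP[g [g1 ->]]; rewrite pgX; apply/permP => -[z zZ].
  rewrite perm1 permE; apply: val_inj; apply: conj_by_fix.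
  by have /asboolP[zc _] := zZ; apply: zc; apply: MP.
have fixS := perm_lgroup_fix_mod l_pr gS SM.
have z0Z : Z z0 by apply/asboolP.
have ZD (z : ZT) : Z (val z + z0).
  case: z => z /= /asboolP[zc zt]; apply/asboolP; split=> [h hN|i fi].
    by rewrite mulrDr mulrDl zc // z0c.
  by rewrite mulrDl mxtraceD zt // z0t // addr0.
(* Translation by z0 has order l and no fixed point, which gives the divisibility by l. *)
pose tr (z : ZT) : ZT := exist (fun z => is_true (Z z)) _ (ZD z).
have trI : injective tr by move=> y z /(congr1 val) /= /addIr /val_inj.
have trX i z : val ((perm trI ^+ i)%g z) = val z + z0 *+ i.
  elim: i z => [|i IH] z; first by rewrite expg0 perm1 mulr0n addr0.
  by rewrite expgS permM IH permE /= mulrS addrA.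
have trl : (perm trI ^+ l = 1)%g.
  apply/permP => z; apply: val_inj; rewrite trX perm1 -mulr_natr.
  have -> : (l%:R : 'M[k]_n) = 0.
    by rewrite -[l%:R]/(1 *+ l) -scaler_nat (pcharf0 chl) scale0r.
  by rewrite mulr0 addr0.
have cardZ : #|{: ZT}| = 0 %[mod l].
  rewrite (@perm_lgroup_fix_mod l l_pr _ <[perm trI]>%g 1) ?groupP //; last first.
    move=> x /cycleP[i ->]; by rewrite expn1 -expgnA mulnC expgnA trl expg1n.
  congr (_ %% _)%N; apply: eq_card0 => z; rewrite !inE; apply/negP => /forall_inP/(_ (perm trI)).
  rewrite cycle_id => /(_ isT)/eqP/(congr1 val); rewrite permE /= -[RHS]addr0 => /addrI e.
  by move: z00; rewrite e eqxx.
have Z0 : Z 0.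
  apply/asboolP; split=> [h _|i _]; first by rewrite mulr0 mul0r.
  by rewrite mul0r mxtrace0.
have [z /andP[zn zf]] : exists z : ZT, (val z != 0) && [forall x in S, x z == z].
  apply: contrapT => /forallNP nz.
  have : #|[set t : ZT | [forall x in S, x t == t]]| = 1%N.
    rewrite -(cards1 (exist (fun z => is_true (Z z)) _ Z0 : ZT)); apply: eq_card => z; rewrite !inE.
    apply/idP/eqP => [zf|->].
      apply: val_inj => /=; apply/eqP; apply: contraT => zn.
      by case: (nz z); rewrite zn.
    apply/forall_inP => x; rewrite SP => /asboolP[g [_ ->]]; apply/eqP; apply: val_inj.
    by rewrite permE /= conj_by0.
  move=> c1; move: fixS; rewrite c1 cardZ mod0n => /esym/eqP.
  by rewrite modn_small ?prime_gt1.
exists (val z) => //; have /asboolP[zc zt] := valP z; split=> // g g1.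
have : pg g \in S by rewrite SP; apply/asboolP; exists g.
by move=> /(forall_inP zf)/eqP/(congr1 val); rewrite permE.
Qed.

Variables (s' : nat) (s'_prim : s'.-primitive_root (chi sigma)).
Hypothesis l_ndvd_s' : ~~ (l %| s')%N.
Local Notation om := (chi sigma).

Lemma s'_unit : s'%:R != 0 :> k. Proof. exact: nat_unit. Qed.

Lemma chi_s' : om ^+ s' = 1. Proof. exact: prim_expr_order s'_prim. Qed.
Lemma s'_gt0 : (0 < s')%N. Proof. exact: prim_order_gt0 s'_prim. Qed.

Lemma conj_by_sum (I : Type) (r : seq I) g (F : I -> 'M[k]_n) :
  conj_by g (\sum_(i <- r) F i) = \sum_(i <- r) conj_by g (F i).
Proof. by elim/big_ind2: _ => [|a b c d <- <-|//]; [rewrite conj_by0 | rewrite conj_byD]. Qed.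

(** A nonzero intertwiner is a multiple of some X^N; its product with X^(f - N mod f) is a nonzero
    scalar, whose trace is nonzero because l does not divide n. *)
Lemma trace_free_intertwines a z : intertwines a z -> trace_free z -> z = 0.
Proof.
move=> za zt; have [//|zu] := intertwines_unit za.
have [c [N [c0 zE]]] := intertwines_XE za zu.
have fr : (N %% f < f)%N by rewrite ltn_mod f_gt0.
have := zt (f - N %% f)%N; rewrite subn_gt0 fr leq_subr => /(_ isT).
rewrite zE -scalerAl -exprD {1}(divn_eq N f) -addnA subnKC ?(ltnW fr) // -mulSnr mulnC exprM.
have [c' c'0 ->] := Xf_scalar.
rewrite scalar_mxX.
rewrite mxtraceZ mxtrace_scalar => /eqP; rewrite -mulr_natr !mulf_eq0 (negPf c0) expf_eq0 (negPf c'0) andbF.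
by rewrite /= (negPf (nat_unit l_ndvd_n)).
Qed.

(** Take y fixed by the kernel of chi. The cyclic group generated by sigma acts on y with period s',
    prime to l, so y is the average of its Fourier components w_j; each w_j is an intertwiner of
    weight j, hence 0. *)
Lemma centralizes_trace_free z : centralizes z -> trace_free z -> z = 0.
Proof.
move=> zc zt; apply: contrapT => /eqP z0.
have [y y0 [yc yt y1]] := fixed_exists (ex_intro2 _ _ z z0 (conj zc zt)).
have om0 : om != 0 := chi_neq0 sigma.
pose Y i := conj_by (sigma ^+ i)%g y.
have Ys' : Y s' = y by apply: y1; rewrite chiX chi_s'.
pose w (j : nat) := \sum_(i < s') om ^- (i * j) *: Y i.
have wt j : trace_free (w j).
  move=> i fi; rewrite /w mulr_suml raddf_sum big1 //= => a _.
  by rewrite -scalerAl mxtraceZ trace_free_conj ?mulr0.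
have w1 j g : chi g = 1 -> conj_by g (w j) = w j.
  move=> g1; rewrite conj_by_sum; apply: eq_bigr => i _; rewrite conj_byZ; congr (_ *: _).
  rewrite /Y -conj_byM; have -> : (g * sigma ^+ i = sigma ^+ i * ((sigma ^+ i)^-1 * g * sigma ^+ i))%g.
    by rewrite !mulgA mulgV mul1g.
  rewrite conj_byM y1 // !chiM g1 mulr1 -chiM mulVg; exact: chi1.
have ws j : conj_by sigma (w j) = om ^+ j *: w j.
  rewrite conj_by_sum scaler_sumr [RHS](reindex_inj (can_inj (@ordSK s'))).
  apply: eq_bigr => i _; rewrite conj_byZ scalerA /Y -conj_byM -expgS /=.
  have [lt|ge] := ltnP i.+1 s'.
    rewrite modn_small //; congr (_ *: _); rewrite mulSn exprD invfM mulrA mulfV ?mul1r //.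
    exact: expf_neq0.
  have -> : i.+1 = s' by apply/eqP; rewrite eqn_leq ltn_ord.
  rewrite modnn -/(Y s') Ys' /Y expg0 conj_by1; congr (_ *: _).
  have e : (i * j + j = s' * j)%N by rewrite -mulSnr; congr (_ * _)%N; apply/eqP; rewrite eqn_leq ltn_ord.
  have : om ^+ (i * j) * om ^+ j = 1 by rewrite -exprD e exprM chi_s' expr1n.
  move=> e1; rewrite mul0n expr0 invr1 mulr1; apply: (mulfI (expf_neq0 (i * j) om0)).
  by rewrite mulfV ?expf_neq0.
have wi j : intertwines j (w j).
  move=> g; apply: conj_by_int; have [i gi] := chi_gen g.
  have -> : g = (sigma ^+ i * ((sigma ^+ i)^-1 * g))%g by rewrite mulgA mulgV mul1g.
  rewrite conj_byM w1; last by rewrite chiM chiV chiX gi mulVf // expf_neq0.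
  rewrite mulgA mulgV mul1g gi.
  elim: i {gi} => [|i IH]; first by rewrite expg0 conj_by1 expr0 expr1n scale1r.
  by rewrite expgSr conj_byM ws conj_byZ IH scalerA -exprMn -exprS.
have w0 j : w j = 0 by apply: trace_free_intertwines (wi j) (wt j).
case/eqP: y0; apply/eqP; rewrite -[y](scale1r) -(mulVf s'_unit) -scalerA.
suff -> : s'%:R *: y = \sum_(j < s') w j by rewrite big1 ?scaler0.
rewrite exchange_big /= (bigD1 (Ordinal s'_gt0)) //= [X in _ + X]big1 ?addr0 => [|i i0].
  under eq_bigr => j _ do rewrite mul0n expr0 invr1 scale1r.
  by rewrite /Y expg0 conj_by1 sumr_const card_ord -scaler_nat.
rewrite -scaler_suml; under eq_bigr => j _ do rewrite exprM -exprVn.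
have oi : om ^- i != 1.
  rewrite invr_eq1 -(prim_order_dvd s'_prim) gtnNdvd //.
  by move: i0; rewrite -val_eqE /= -lt0n.
have : (om ^- i - 1) * \sum_(j < s') (om ^- i) ^+ j = 0.
  by rewrite -subrX1 exprVn -exprM mulnC exprM chi_s' expr1n invr1 subrr.
by move/eqP; rewrite mulf_eq0 subr_eq0 (negPf oi) => /eqP ->; rewrite scale0r.
Qed.

Lemma X_centralizes i : (forall h, GN h -> chi h = 1) -> centralizes (X ^+ i).
Proof. by move=> N1 h /N1 h1; rewrite XE_int h1 expr1n scale1r. Qed.

Lemma tr_span (c : 'I_f -> k) i : \tr ((\sum_j c j *: X ^+ j) * X ^+ i) = \sum_j c j * \tr (X ^+ (j + i)).
Proof.
rewrite mulr_suml raddf_sum; apply: eq_bigr => j _ /=.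
by rewrite -scalerAl mxtraceZ -exprD.
Qed.

(** Subtracting from z its projection to the powers of X for the trace form leaves a trace-free
    element. The denominator n c' is nonzero because l does not divide n. *)
Lemma centralizer_span z : (forall h, GN h -> chi h = 1) -> centralizes z ->
  exists c : 'I_f -> k, z = \sum_i c i *: X ^+ i.
Proof.
move=> N1 zc; have [c' c'0 Xf] := Xf_scalar.
have n0 := nat_unit l_ndvd_n.
pose c (i : 'I_f) := \tr (z * X ^+ (f - i)) / (n%:R * c').
exists c; apply/eqP; rewrite -subr_eq0; apply/eqP; apply: centralizes_trace_free => [h hN|i /andP[i0 fi]].
  rewrite mulrBr mulrBl zc // mulr_sumr mulr_suml; congr (_ - _); apply: eq_bigr => j _.
  by rewrite -scalerAr -scalerAl X_centralizes.
have lt : (f - i < f)%N by rewrite ltn_subrL i0 f_gt0.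
rewrite mulrBl trB tr_span; apply/eqP; rewrite subr_eq0 eq_sym; apply/eqP.
rewrite (bigD1 (Ordinal lt)) //= big1 ?addr0 => [|j ji].
  by rewrite subnK // Xf mxtrace_scalar /c /= subKn // -(mulr_natl c') divfK // mulf_neq0.
rewrite trX ?mulr0 //; apply: contra ji => /dvdnP[q qE].
rewrite -val_eqE /=; have jf := ltn_ord j; have q1 : q = 1%N.
  by apply: (@between_multiples q f); rewrite -qE; lia.
by apply/eqP; move: qE; rewrite q1 mul1n; lia.
Qed.

Lemma s_dvd_s' : (s %| s')%N.
Proof.
apply: (@s_dvd_int s' 1); rewrite ?unitr1 // => g.
by have [i ->] := chi_gen g; rewrite exprAC chi_s' expr1n scale1r mulr1 mul1r.
Qed.

Lemma X_free (c : 'I_f -> k) : \sum_i c i *: X ^+ i = 0 -> forall i, c i = 0.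
Proof.
move=> e i; have [c' c'0 Xf] := Xf_scalar.
have := congr1 (fun z => \tr (z * X ^+ (f - i))) e; rewrite /= mul0r mxtrace0 tr_span.
rewrite (bigD1 i) //= big1 ?addr0 => [|j ji].
  rewrite subnKC ?(ltnW (ltn_ord i)) // Xf mxtrace_scalar => /eqP.
  by rewrite -mulr_natl !mulf_eq0 (negPf c'0) (negPf (nat_unit l_ndvd_n)) !orbF => /eqP.
rewrite trX ?mulr0 //; apply: contra ji => /dvdnP[q qE].
rewrite -val_eqE /=; have jf := ltn_ord j; have If := ltn_ord i; have q1 : q = 1%N.
  by apply: (@between_multiples q f); rewrite -qE; lia.
by apply/eqP; move: qE; rewrite q1 mul1n; lia.
Qed.

(** The coefficient of X^i survives only if chi(sigma)^(a + s i) = chi(sigma)^b. Modulo s this gives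
    a = b because |a - b| < s, and then f divides i. *)
Lemma weight_coef (c : 'I_f -> k) h a b : chi h = om -> (a < b + s)%N -> (b < a + s)%N ->
  om ^+ a *: (theta h * \sum_i c i *: X ^+ i) = om ^+ b *: ((\sum_i c i *: X ^+ i) * theta h) ->
  forall i : 'I_f, (a != b) || (i != 0 :> nat) -> c i = 0.
Proof.
move=> ch ab ba e i hi.
have e2 : \sum_i (c i * (om ^+ (a + s * i) - om ^+ b)) *: X ^+ i = 0.
  apply: (mulIr (theta_unit h)); rewrite mul0r mulr_suml.
  move/eqP: e; rewrite -subr_eq0 mulr_sumr mulr_suml !scaler_sumr -sumrB => /eqP {2}<-.
  apply: eq_bigr => j _; rewrite -scalerAr XE_int ch -!scalerAl !scalerA -scalerBl.
  by congr (_ *: _); rewrite exprD; ring.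
have := X_free e2 i => /eqP; rewrite mulf_eq0 => /orP[/eqP //|].
rewrite subr_eq0 (eq_prim_root_expr s'_prim) => ee.
have ab' : a = b.
  have : a = b %[mod s].
    have := eqP ee => /(congr1 (modn^~ s)); rewrite !(modn_dvdm _ s_dvd_s') => <-.
    by rewrite -modnDmr modnMr addn0.
  have [lt|lt|//] := ltngtP a b.
    by move=> /eqP; rewrite eq_sym eqn_mod_dvd ?(ltnW lt) // gtnNdvd // ?subn_gt0 //; lia.
  by move=> /eqP; rewrite eqn_mod_dvd ?(ltnW lt) // gtnNdvd // ?subn_gt0 //; lia.
move: hi; rewrite ab' eqxx /= => i0; exfalso; case/negP: i0.
have : (f %| i)%N.
  rewrite (prim_order_dvd f_prim) -exprM -(prim_order_dvd s'_prim).
  by move: ee; rewrite ab' -{2}[b]addn0 eqn_modDl mod0n.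
by rewrite /dvdn modn_small.
Qed.

Lemma weight_scalar z h a b : (forall h, GN h -> chi h = 1) -> centralizes z ->
  chi h = om -> (a < b + s)%N -> (b < a + s)%N ->
  om ^+ a *: (theta h * z) = om ^+ b *: (z * theta h) ->
  exists c, z = c%:M /\ (a != b -> c = 0).
Proof.
move=> N1 /(centralizer_span N1)[c zE] ch ab ba; rewrite zE => e.
have c0 := weight_coef ch ab ba e.
exists (c (Ordinal f_gt0)); split=> [|ne]; last by apply: c0; rewrite ne.
rewrite (bigD1 (Ordinal f_gt0)) //= big1 => [|j j0].
  by rewrite addr0 expr0 -[1]/(1%:M : 'M[k]_n) scalemx1.
by rewrite c0 ?scale0r //; move: j0; rewrite -val_eqE /= => ->; rewrite orbT.
Qed.

End Centralizer.

(** * Finite quotients, averaging, and matrices of blocks *)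

Section FiniteQuotients.
Variable G : groupType.

Lemma finite_image_quotient (k : finFieldType) d (rho : G -> 'M[k]_d) : is_rep rho ->
  exists (gT : finGroupType) (q : G -> gT),
    (forall g h, q (g * h)%g = (q g * q h)%g) /\ (forall g h, q g = q h <-> rho g = rho h).
Proof.
move=> [rho1 rhoM].
have rI g : injective (fun x : 'rV[k]_d => x *m rho g).
  by apply: can_inj (fun x => x *m rho g^-1%g) _ => x; rewrite -mulmxA -rhoM mulgV rho1 mulmx1.
exists {perm 'rV[k]_d}, (fun g => perm (rI g)); split=> g h.
  by apply/permP => x; rewrite permM !permE rhoM mulmxA.
split=> [e|e]; last by apply/permP => x; rewrite !permE e.
apply/row_matrixP => i; have := congr1 (fun s : {perm 'rV[k]_d} => s (delta_mx 0 i)) e.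
by rewrite !permE -!rowE.
Qed.

Variables (l : nat) (l_pr : prime l) (gT : finGroupType) (q : G -> gT).
Hypothesis qM : forall g h, q (g * h)%g = (q g * q h)%g.

Definition is_subgroup (P : G -> Prop) :=
  [/\ P 1%g, forall g h, P g -> P h -> P (g * h)%g & forall g, P g -> P g^-1%g].

Lemma averaging_seq (P : G -> Prop) : is_subgroup P ->
  (forall g, P g -> exists m, ~~ (l %| m)%N /\ q (g ^+ m)%g = 1%g) ->
  exists e : seq G, [/\ forall x, x \in e -> P x, ~~ (l %| size e)%N
    & forall (V : nmodType) (F : G -> V), (forall x y, q x = q y -> F x = F y) ->
      forall g, P g -> \sum_(x <- e) F (g * x)%g = \sum_(x <- e) F x
                    /\ \sum_(x <- e) F (x * g)%g = \sum_(x <- e) F x].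
Proof.
move=> [P1 PM PV] tors.
have q1 : q 1%g = 1%g by apply: (mulgI (q 1%g)); rewrite -qM !mulg1.
pose S := [set x : gT | `[< exists g, P g /\ q g = x >]].
have SP x : (x \in S) = `[< exists g, P g /\ q g = x >] by rewrite inE.
have gS : group_set S.
  apply/group_setP; split=> [|x y]; first by rewrite SP; apply/asboolP; exists 1%g.
  rewrite !SP => /asboolP[g gP] /asboolP[h hP]; apply/asboolP; case: gP hP => g1 <- [h1 <-].
  by exists (g * h)%g; rewrite qM; split=> //; apply: PM.
pose A := Group gS.
pose rep (x : gT) : G := xget 1%g [set g | P g /\ q g = x]%classic.
have repP x : x \in S -> P (rep x) /\ q (rep x) = x.
  by rewrite SP => /asboolP xS; apply: (xgetPex 1%g xS).
exists [seq rep x | x <- enum S]; split.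
- by move=> _ /mapP[x + ->]; rewrite mem_enum => /repP[].
- rewrite size_map -cardE; apply/negP => /(Cauchy l_pr (G := A))[x xA xl].
  have [m [lm]] := tors _ (repP _ xA).1.
  have qX g i : q (g ^+ i)%g = (q g ^+ i)%g.
    by elim: i => [|i IH]; rewrite ?expg0 // !expgS qM IH.
  rewrite qX (repP _ xA).2 => /eqP; rewrite -order_dvdn xl.
  exact/negP.
move=> V F Fq g gP.
have sumE (H : G -> V) : \sum_(x <- [seq rep x | x <- enum S]) H x = \sum_(x in S) H (rep x).
  by rewrite big_map big_enum.
rewrite !sumE; have gS' : q g \in A by rewrite SP; apply/asboolP; exists g.
split.
  rewrite [RHS](reindex_inj (mulgI (q g))) /=.
  have mem x : (q g * x \in S)%g = (x \in S) by rewrite -[S]/(gval A) groupMl.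
  apply: eq_big => [x|x xS]; [by rewrite mem | apply: Fq].
  by rewrite qM (repP _ xS).2 (repP _ _).2 ?mem.
rewrite [RHS](reindex_inj (mulIg (q g))) /=.
have mem x : (x * q g \in S)%g = (x \in S) by rewrite -[S]/(gval A) groupMr.
apply: eq_big => [x|x xS]; [by rewrite mem | apply: Fq].
by rewrite qM (repP _ xS).2 (repP _ _).2 ?mem.
Qed.

End FiniteQuotients.

Section Blocks.
Variables (R : pzRingType) (m n : nat).

Definition blk (M : 'M[R]_(m * n)) : 'M['M[R]_n]_m :=
  \matrix_(i, j) \matrix_(a, b) M (mxtens_index (i, a)) (mxtens_index (j, b)).
Definition unblk (M : 'M['M[R]_n]_m) : 'M[R]_(m * n) :=
  \matrix_(x, y) M (mxtens_unindex x).1 (mxtens_unindex y).1 (mxtens_unindex x).2 (mxtens_unindex y).2.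

Lemma blkE M i j a b : blk M i j a b = M (mxtens_index (i, a)) (mxtens_index (j, b)).
Proof. by rewrite !mxE. Qed.

Lemma unblkE M i j a b : unblk M (mxtens_index (i, a)) (mxtens_index (j, b)) = M i j a b.
Proof. by rewrite !mxE !mxtens_indexK. Qed.

Lemma blkK : cancel blk unblk.
Proof.
move=> M; apply/matrixP => x y.
by case: (mxtens_indexP x) => i a; case: (mxtens_indexP y) => j b; rewrite unblkE blkE.
Qed.

Lemma unblkK : cancel unblk blk.
Proof. by move=> M; apply/matrixP => i j; apply/matrixP => a b; rewrite blkE unblkE. Qed.

Lemma sum_mxtens (V : nmodType) (F : 'I_(m * n) -> V) :
  \sum_x F x = \sum_i \sum_a F (mxtens_index (i, a)).
Proof.
rewrite pair_big /= (reindex (@mxtens_index m n)) /=; last first.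
  by exists (@mxtens_unindex m n) => x _; [apply: mxtens_indexK | apply: mxtens_unindexK].
by apply: eq_bigr => -[].
Qed.

End Blocks.

Section BlockRing.
Variables (R : comNzRingType) (m' n' : nat).
Local Notation m := m'.+1.
Local Notation n := n'.+1.
Implicit Types A B : 'M[R]_(m * n).

Lemma blkM A B : blk (A *m B) = blk A * blk B.
Proof.
apply/matrixP => i j; apply/matrixP => a b; rewrite blkE !mxE summxE sum_mxtens.
by apply: eq_bigr => u _; rewrite mxE; apply: eq_bigr => c _; rewrite !blkE.
Qed.

Lemma blk1 : blk (1%:M : 'M[R]_(m * n)) = 1.
Proof.
apply/matrixP => i j; apply/matrixP => a b; rewrite blkE !mxE.
rewrite (can_eq (@mxtens_indexK m n)) xpair_eqE.
by case: (i == j); rewrite !mxE.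
Qed.

Lemma unblkM (A B : 'M['M[R]_n]_m) : unblk (A * B) = unblk A *m unblk B.
Proof. by apply: (can_inj (@blkK _ _ _)); rewrite blkM !unblkK. Qed.

Lemma unblk1 : unblk (1 : 'M['M[R]_n]_m) = 1%:M.
Proof. by apply: (can_inj (@blkK _ _ _)); rewrite blk1 unblkK. Qed.

(** In the ring of m by m matrices with n by n blocks, [outer c * inner z] is the Kronecker product
    of c and z. *)
Definition outer (c : 'M[R]_m) : 'M['M[R]_n]_m := map_mx (fun x => x%:M) c.
Definition inner (z : 'M[R]_n) : 'M['M[R]_n]_m := z%:M.

Lemma outerM c d : outer (c * d) = outer c * outer d.
Proof.
apply/matrixP => i j; rewrite !mxE raddf_sum; apply: eq_bigr => u _.
by rewrite !mxE /= -mulmxE -scalar_mxM.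
Qed.

Lemma outer1 : outer 1 = 1.
Proof. by apply/matrixP => i j; rewrite !mxE; case: (i == j); rewrite ?raddf0. Qed.

Lemma outerD c d : outer (c + d) = outer c + outer d.
Proof. by apply/matrixP => i j; rewrite !mxE raddfD. Qed.

Lemma outerX c i : outer (c ^+ i) = outer c ^+ i.
Proof. by elim: i => [|i IH]; rewrite ?expr0 ?outer1 // !exprS outerM IH. Qed.

Lemma outer_inj : injective outer.
Proof.
move=> c d e; apply/matrixP => i j; have := congr1 (fun M : 'M['M[R]_n]_m => M i j 0 0) e.
by rewrite !mxE.
Qed.

Lemma mulr_inner (A : 'M['M[R]_n]_m) z i j : (A * inner z) i j = A i j * z.
Proof.
rewrite mxE (bigD1 j) //= big1 ?addr0 => [|u uj]; first by rewrite mxE eqxx.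
by rewrite mxE (negPf uj) mulr0.
Qed.

Lemma inner_mulr (A : 'M['M[R]_n]_m) z i j : (inner z * A) i j = z * A i j.
Proof.
rewrite mxE (bigD1 i) //= big1 ?addr0 => [|u uj]; first by rewrite mxE eqxx.
by rewrite mxE eq_sym (negPf uj) mul0r.
Qed.

Lemma innerM y z : inner (y * z) = inner y * inner z.
Proof. exact: scalar_mxM. Qed.

Lemma inner1 : inner 1 = 1. Proof. by []. Qed.

Lemma outer_inner c z : outer c * inner z = inner z * outer c.
Proof.
apply/matrixP => i j; rewrite mulr_inner inner_mulr !mxE -!mulmxE.
by rewrite mul_scalar_mx mul_mx_scalar.
Qed.

Lemma outer_innerE c z i j : (outer c * inner z) i j = c i j *: z.
Proof. by rewrite mulr_inner mxE -mulmxE mul_scalar_mx. Qed.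

Lemma outer_sum (I : Type) (r : seq I) (P : pred I) (F : I -> 'M[R]_m) :
  outer (\sum_(i <- r | P i) F i) = \sum_(i <- r | P i) outer (F i).
Proof.
elim/big_ind2: _ => [|a b c d <- <-|//]; last by rewrite outerD.
by apply/matrixP => i j; rewrite !mxE raddf0.
Qed.

End BlockRing.

Section BlockForm.
Variables (G : groupType) (k : fieldType).

(** An invertible matrix between the two direct sums has a nonzero block in each block column, and
    Schur's lemma makes this block an isomorphism. *)
Lemma constituent m (d : 'I_m -> nat) (s : forall i, G -> 'M[k]_(d i)) r (e : 'I_r -> nat)
    (t : forall i, G -> 'M[k]_(e i)) : (forall i, irreducible (s i)) -> (forall i, irreducible (t i)) ->
  rep_equiv (rep_sum s) (rep_sum t) ->
  forall i, exists j (T : 'M[k]_(d j, e i)), [/\ row_free T, row_full T & forall g, s j g *m T = T *m t i g].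
Proof.
move=> si ti [M [N [MN NM e1]]] i.
have eM g : rep_sum s g *m M = M *m rep_sum t g by rewrite e1 -mulmxA NM mulmx1.
have eT g j : s j g *m submxblock M j i = submxblock M j i *m t i g.
  have := eM g; rewrite -{1 2}(submxblockK M) /rep_sum mul_mxdiag_mxblock mul_mxblock_mxdiag.
  by move=> /eq_mxblockP/(_ j i).
have [j Tj] : exists j, submxblock M j i != 0.
  apply: contrapT => /forallNP h; have [ei _] := ti i.
  have h0 j : submxblock M j i = 0 by apply/eqP; rewrite -[_ == _]negbK; apply/negP.
  have : submxblock (N *m M) i i = 0.
    rewrite -(submxblockK N) -{1}(submxblockK M) mul_mxblock mxblockK big1 // => j _.
    by rewrite h0 mulmx0.
  rewrite NM => /matrixP/(_ (Ordinal ei) (Ordinal ei)); rewrite !mxE eqxx => /eqP.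
  by rewrite oner_eq0.
exists j, (submxblock M j i).
by have [e0|[]] := schur (si j) (ti i) (eT^~ j); [rewrite e0 eqxx in Tj | split].
Qed.

Variables (n' m' : nat).
Local Notation n := n'.+1.
Local Notation m := m'.+1.

(** Each diagonal block of the triangular form is isomorphic to some [s j], so it has size n and
    there are m of them; only a reindexing remains. *)
Lemma block_form (rhobar : G -> 'M[k]_(m * n)) (s : 'I_m -> G -> 'M[k]_n) :
  (forall i, irreducible (s i)) -> is_semisimplification rhobar (rep_sum s) ->
  exists (P Q : 'M['M[k]_n]_m) (a : 'I_m -> 'I_m) (T : 'I_m -> 'M[k]_n), [/\ P * Q = 1, Q * P = 1,
    forall i, T i \is a GRing.unit
  & forall g (i j : 'I_m),
     ((j < i)%N -> (Q * blk (rhobar g) * P) i j = 0) /\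
     s (a i) g * T i = T i * (Q * blk (rhobar g) * P) i i].
Proof.
move=> si [r [e [tau [[M [N [MN NM MNE]]] up irr eq]]]].
have cst := constituent si irr eq.
have eE i : e i = n.
  by have [j [T [fr fu _]]] := cst i; move: fr fu; rewrite /row_free /row_full => /eqP -> /eqP.
have {eE} : e = fun=> n by apply/funext.
move=> ee; subst e.
have rm : (\sum_(i < r) n)%N = (m * n)%N.
  have := congr1 (fun A => \rank A) MN; have := congr1 (fun A => \rank A) NM; rewrite !mxrank1 => r1 r2.
  have h1 := leq_trans (mxrankM_maxl N M) (rank_leq_col N).
  have h2 := leq_trans (mxrankM_maxl M N) (rank_leq_col M).
  by rewrite r1 in h1; rewrite r2 in h2; apply/eqP; rewrite eqn_leq h1.
have {rm} rm : r = m by apply/eqP; rewrite -(@eqn_pmul2r n) //; rewrite -rm sum_nat_const card_ord.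
subst r.
(* Matches the Kronecker indexing with the indexing of a sum of m blocks of equal size n. *)
pose phi (x : 'I_(m * n)) : 'I_(\sum_(i < m) n) :=
  tagnat.Rank (mxtens_unindex x).1 (mxtens_unindex x).2.
have phiI : injective phi.
  move=> x y; case: (mxtens_indexP x) => i a; case: (mxtens_indexP y) => j b.
  rewrite /phi !mxtens_indexK /= => /tagnat.rank_inj /eqP; rewrite -tag_eqE => /andP[/= /eqP ij].
  by rewrite -ij tagged_asE => /eqP ->.
pose P := colsub phi M; pose Q := rowsub phi N.
have QP : Q *m P = 1%:M.
  by rewrite -mxsub_mul NM; apply/matrixP => x y; rewrite !mxE (inj_eq phiI).
have PQ : P *m Q = 1%:M by apply: mulmx1C.
have QRP g : Q *m rhobar g *m P = mxsub phi phi (tau g).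
  rewrite mul_rowsub_mx -mxsub_mul MNE; congr (mxsub _ _ _).
  by rewrite !mulmxA NM mul1mx -!mulmxA NM mulmx1.
have blkE' g i j : (blk Q * blk (rhobar g) * blk P) i j = submxblock (tau g) i j.
  rewrite -!blkM QRP; apply/matrixP => a b.
  by rewrite blkE !mxE /phi !mxtens_indexK.
have /choice[a /choice[T aT]] := cst.
exists (blk P), (blk Q), a, T; split.
- by rewrite -blkM PQ blk1.
- by rewrite -blkM QP blk1.
- by move=> i; rewrite /GRing.unit /= -row_full_unit; have [] := aT i.
move=> g i j; rewrite !blkE'; split; first by move=> ij; apply: up.
by have [_ _ /(_ g)] := aT i; rewrite -mulmxE.
Qed.

End BlockForm.

Lemma sum_ord_widen (V : nmodType) (F : nat -> V) m n : (m <= n)%N ->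
  (forall r, (m <= r)%N -> F r = 0) -> \sum_(r < m) F r = \sum_(r < n) F r.
Proof.
move=> mn F0; rewrite (big_ord_widen n F mn) big_mkcond; apply: eq_bigr => r _.
by case: ltnP => // /F0.
Qed.

(** * Unipotent elements: truncated logarithm and exponential *)

Section UnitSeries.
Variable B : nzRingType.

Lemma unit_1_add_nilpotent (V : B) m : V ^+ m = 0 ->
  (1 + V) * (\sum_(i < m) (- V) ^+ i) = 1 /\ (\sum_(i < m) (- V) ^+ i) * (1 + V) = 1.
Proof.
move=> Vm; have C : GRing.comm (1 + V) (\sum_(i < m) (- V) ^+ i).
  apply: commr_sum => i _; apply: commrX; apply: commrN; apply: commr_sym; apply: commrD => //.
  exact: commr1.
have R : (1 + V) * (\sum_(i < m) (- V) ^+ i) = 1.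
  have := subrX1 (- V) m; rewrite exprNn Vm mulr0 sub0r => /eqP.
  by rewrite eqr_oppLR -mulNr opprB opprK => /eqP <-.
by split=> //; rewrite -C.
Qed.

End UnitSeries.

Section TruncatedLog.
Variables (l : nat) (l_pr : prime l) (k : fieldType) (chl : l \in [pchar k]).

Lemma natr_neq0 a : (0 < a < l)%N -> (a%:R : k) != 0.
Proof. by move=> /andP[a0 al]; rewrite -(dvdn_pcharf chl) gtnNdvd. Qed.

Lemma fact_neq0 a : (a < l)%N -> (a`!%:R : k) != 0.
Proof.
elim: a => [|a IH] al; first by rewrite oner_neq0.
by rewrite factS natrM; apply: mulf_neq0; [apply: natr_neq0 | apply: IH; apply: ltnW].
Qed.

Lemma natr_inj a b : (a < l)%N -> (b < l)%N -> a%:R = b%:R :> k -> a = b.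
Proof.
wlog ab : a b / (a <= b)%N => [hw|].
  by case/orP: (leq_total a b) => ab al bl e; [| apply/esym]; apply: hw.
move=> al bl /eqP; rewrite eq_sym -subr_eq0 -natrB // => e.
apply/eqP; rewrite eqn_leq ab -subn_eq0 /= -[_ == _]negbK -lt0n; apply/negP => ba.
by move: e; rewrite (negPf (natr_neq0 _)) // ba; lia.
Qed.

Definition binpoly r : {poly k} := r`!%:R^-1 *: \prod_(i < r) ('X - i%:R%:P).

Lemma size_binpoly r : (size (binpoly r) <= r.+1)%N.
Proof.
by apply: leq_trans (size_scale_leq _ _) _; rewrite size_prod_XsubC /index_enum -enumT size_enum_ord.
Qed.

Lemma binpolyE r (a : nat) : (r < l)%N -> (binpoly r).[a%:R] = 'C(a, r)%:R.
Proof.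
move=> rl; apply: (mulfI (fact_neq0 rl)); rewrite hornerZ mulrA mulfV ?fact_neq0 // mul1r.
rewrite -natrM mulnC bin_ffact ffact_prod natr_prod horner_prod.
under eq_bigr => i _ do rewrite !hornerE.
have [ar|ra] := ltnP a r; last first.
  by apply: eq_bigr => i _; rewrite natrB //; apply: leq_trans (ltnW (ltn_ord i)) ra.
rewrite (bigD1 (Ordinal ar)) //= subrr mul0r.
by rewrite [RHS](bigD1 (Ordinal ar)) //= subnn mul0r.
Qed.

Variables (m : nat) (m_le : (m <= l)%N).

Lemma lagrange : exists L : 'I_m -> 'I_m -> k, forall i j : 'I_m,
  \sum_(x < m) L i x * (x%:R) ^+ j = (i == j)%:R.
Proof.
pose W : 'M[k]_m := \matrix_(x, j) (x%:R) ^+ (j : nat).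
have Wu : W \in unitmx.
  have Wf : row_free W^T; last by rewrite -unitmx_tr -row_free_unit.
  apply/row_freeP.
  suff /row_freeP[D WD] : row_free W^T by exists D.
  rewrite -kermx_eq0; apply/rowV0P => v /sub_kermxP vW.
  have pz : rVpoly v = 0.
    apply/eqP; apply: contraT => p0.
    have := max_poly_roots p0 (rs := [seq x%:R | x : 'I_m]) _ _.
    have -> : all (root (rVpoly v)) [seq x%:R | x : 'I_m].
      apply/allP => _ /mapP[x _ ->]; rewrite /root (@horner_coef_wide _ m) ?size_poly //.
      have := congr1 (fun u : 'rV_m => u 0 x) vW; rewrite !mxE => e; apply/eqP; apply: etrans e.
      by apply: eq_bigr => i _; rewrite !mxE coef_rVpoly_ord.
    have -> : uniq [seq (x%:R : k) | x : 'I_m].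
      rewrite map_inj_uniq ?enum_uniq // => x y /natr_inj e; apply/val_inj/e.
        exact: leq_trans (ltn_ord x) m_le.
      exact: leq_trans (ltn_ord y) m_le.
    move=> /(_ isT isT); rewrite size_map size_enum_ord => lt.
    by have := leq_trans lt (size_poly m _); rewrite ltnn.
  by rewrite -[v]rVpolyK pz linear0.
exists (fun i x => invmx W i x) => i j.
by have := congr1 (fun M : 'M_m => M i j) (mulVmx Wu); rewrite !mxE => <-; apply: eq_bigr => x _; rewrite !mxE.
Qed.

Variables (B : nzRingType) (iota : {rmorphism k -> B}).
Hypothesis iotaC : forall c x, iota c * x = x * iota c.
Hypothesis m_gt0 : (0 < m)%N.

                                                                       
                                                                             
                                    
(** As m <= l, the map sending a to (1+V)^a is a polynomial with coefficients P_i, i < m, by the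
    binomial series. N = P_1 is its derivative at 0, and Lagrange interpolation writes it as a
    combination of the powers (1+V)^x, x < m, with coefficients independent of V; so N inherits the
    commutation relations of 1+V. The functional equation gives (i+1) P_(i+1) = N P_i, hence the
    exponential series. *)
Lemma truncated_log : exists L : 'I_m -> k, 
  (forall j, (j < m)%N -> \sum_(x < m) L x * x%:R ^+ j = (j == 1%N)%:R) /\
  forall V : B, V ^+ m = 0 ->
  let N := \sum_(x < m) iota (L x) * (1 + V) ^+ x in
  N ^+ m = 0 /\ forall a : nat, (1 + V) ^+ a = \sum_(j < m) iota (a%:R ^+ j / j`!%:R) * N ^+ j.
Proof.
have [m1|m1] := leqP m 1.
  have mE : m = 1%N by apply/eqP; rewrite eqn_leq m1.
  move: (m) mE => _ ->; exists (fun=> 0); split=> [[|] //|V]; first by rewrite big1 // => x _; rewrite mul0r.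
  rewrite expr1 => -> N; have -> : N = 0 by rewrite /N big1 // => x _; rewrite rmorph0 mul0r.
  by rewrite expr1; split=> // a; rewrite addr0 expr1n big_ord1 !expr0 divr1 rmorph1 mul1r.
have [L LP] := lagrange; pose o1 := Ordinal m1.
exists (L o1); split=> [j jm|V Vm N].
  by rewrite (LP o1 (Ordinal jm)) -val_eqE /= eq_sym.
pose E a := (1 + V) ^+ a.
pose P i := \sum_(r < m) iota (binpoly r)`_i * V ^+ r.
have VE r : (m <= r)%N -> V ^+ r = 0 by move=> mr; rewrite -(subnK mr) exprD Vm mulr0.
have EP a : E a = \sum_(i < m) iota (a%:R ^+ i) * P i.
  under eq_bigr => i _ do rewrite mulr_sumr.
  rewrite exchange_big /=.
  transitivity (\sum_(r < m) 'C(a, r)%:R * V ^+ r).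
    rewrite /E exprDn_comm; last exact: commr_sym (commr1 _).
    under eq_bigr => i _ do rewrite expr1n mul1r -mulr_natl.
    rewrite (@sum_ord_widen _ (fun r => 'C(a, r)%:R * V ^+ r) a.+1 (maxn m a.+1)) ?leq_maxr //; last first.
      by move=> r ar; rewrite bin_small // mul0r.
    rewrite (@sum_ord_widen _ (fun r => 'C(a, r)%:R * V ^+ r) m (maxn m a.+1)) ?leq_maxl //.
    by move=> r /VE ->; rewrite mulr0.
  apply: eq_bigr => r _.
  under eq_bigr => i _ do rewrite mulrA -rmorphM.
  rewrite -mulr_suml -rmorph_sum /=; congr (_ * _).
  have rl : (r < l)%N by apply: leq_trans (ltn_ord r) m_le.
  rewrite -(rmorph_nat iota) -binpolyE // (@horner_coef_wide _ m).
    by congr (iota _); apply: eq_bigr => i _; rewrite mulrC.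
  by apply: leq_trans (size_binpoly _) _.
have F (i : 'I_m) (A : nat -> B) : \sum_(y < m) iota (L i y) * (\sum_(j < m) iota (y%:R ^+ j) * A j) = A i.
  under eq_bigr => y _ do rewrite mulr_sumr.
  rewrite exchange_big /= (eq_bigr (fun j : 'I_m => (i == j)%:R * A j)) => [|j _].
    by rewrite (bigD1 i) //= eqxx mul1r big1 ?addr0 // => j ji; rewrite eq_sym (negPf ji) mul0r.
  under eq_bigr => x _ do rewrite mulrA -rmorphM.
  by rewrite -mulr_suml -rmorph_sum LP rmorph_nat.
have PE (i : 'I_m) : P i = \sum_(x < m) iota (L i x) * E x.
  by rewrite -(F i); apply: eq_bigr => x _; rewrite EP.
have NE : N = P 1%N by rewrite (PE o1).
have P0 : P 0%N = 1.
  have := EP 0%N; rewrite /E expr0 (bigD1 (Ordinal m_gt0)) //= big1 ?addr0 => [|i i0].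
    by rewrite expr0 rmorph1 mul1r.
  by move: i0; rewrite -val_eqE /= expr0n => /negPf ->; rewrite rmorph0 mul0r.
have Pm : P m = 0.
  rewrite /P big1 // => r _; rewrite nth_default ?rmorph0 ?mul0r //.
  by apply: leq_trans (size_binpoly _) _.
have EM a b : E (a + b) = E a * E b by rewrite /E exprD.
(* The term linear in a of (1+V)^(a+y) = (1+V)^a (1+V)^y, as an identity between polynomials in
   y. *)
have step (y : nat) : \sum_(i < m) iota (y%:R ^+ i) * (i.+1%:R * P i.+1) = \sum_(j < m) iota (y%:R ^+ j) * (N * P j).
  transitivity (N * E y); last by rewrite EP mulr_sumr; apply: eq_bigr => j _; rewrite !mulrA iotaC.
  rewrite NE (PE o1) mulr_suml; under [RHS]eq_bigr => x _ do rewrite -mulrA -EM EP mulr_sumr.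
  rewrite exchange_big /=.
  have coefE (i : nat) : (i < m)%N -> \sum_(x < m) L o1 x * (x + y)%:R ^+ i = i%:R * y%:R ^+ i.-1.
    move=> im; transitivity (\sum_(j < i.+1) ('C(i, j)%:R * y%:R ^+ (i - j)) * (j == 1 :> nat)%:R : k).
      under eq_bigr => x _ do rewrite natrD addrC exprDn mulr_sumr.
      rewrite exchange_big /=; apply: eq_bigr => j _.
      have jm : (j < m)%N by apply: leq_ltn_trans im; rewrite -ltnS.
      have := LP o1 (Ordinal jm); rewrite -val_eqE /= eq_sym => <-; rewrite mulr_sumr.
      by apply: eq_bigr => x _; rewrite -mulr_natr; ring.
    case: i im => [|i] im; first by rewrite big_ord1 mulr0 mul0r.
    have i1 : (1 < i.+2)%N by [].
    rewrite (bigD1 (Ordinal i1)) //= mulr1 bin1 subn1 big1 ?addr0 // => j.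
    by rewrite -val_eqE /= => /negPf ->; rewrite mulr0.
  have E1 (i : 'I_m) : \sum_(x < m) iota (L o1 x) * (iota ((x + y)%:R ^+ i) * P i) = iota (i%:R * y%:R ^+ i.-1) * P i.
    rewrite -coefE // rmorph_sum mulr_suml; apply: eq_bigr => x _.
    by rewrite mulrA -rmorphM.
  under [RHS]eq_bigr => i _ do rewrite E1.
  rewrite -(prednK m_gt0) big_ord_recr /= prednK // Pm !mulr0 addr0.
  rewrite [RHS](_ : _ = \sum_(i < m.-1.+1) iota (i%:R * y%:R ^+ i.-1) * P i); last first.
    by rewrite prednK.
  rewrite [RHS]big_ord_recl /= mul0r rmorph0 mul0r add0r; apply: eq_bigr => i _.
  by rewrite /bump /= add1n add0n [i.+1%:R * _ ^+ _]mulrC rmorphM rmorph_nat mulrA.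
have PS (j : 'I_m) : j.+1%:R * P j.+1 = N * P j.
  rewrite -(F j (fun i => i.+1%:R * P i.+1)) -(F j (fun i => N * P i)).
  by apply: eq_bigr => y _; rewrite step.
have NX j : (j <= m)%N -> N ^+ j = j`!%:R * P j.
  elim: j => [|j IH] jm; first by rewrite P0 mulr1 expr0.
  have PSj : j.+1%:R * P j.+1 = N * P j := PS (Ordinal jm).
  rewrite exprS IH ?(ltnW jm) // factS mulnC natrM -[RHS]mulrA PSj !mulrA; congr (_ * _).
  by apply: commr_nat.
split; first by rewrite NX // Pm mulr0.
move=> a; rewrite -/(E a) EP; apply: eq_bigr => j _; rewrite NX ?(ltnW (ltn_ord j)) //.
rewrite -(rmorph_nat iota) mulrA -rmorphM divfK //.
by apply: fact_neq0; apply: leq_trans (ltn_ord j) m_le.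
Qed.

End TruncatedLog.

Section TruncatedExp.
Variables (R : comUnitRingType) (m' : nat).
Local Notation m := m'.+1.
Hypothesis fact_unit : forall j, (j < m)%N -> (j`!%:R : R) \is a GRing.unit.
Implicit Types (c d : R) (N D : 'M[R]_m).

Definition expm c N : 'M[R]_m := \sum_(j < m) (c ^+ j / j`!%:R) *: N ^+ j.

Lemma expm_c0 N : expm 0 N = 1.
Proof.
rewrite /expm big_ord_recl big1 ?addr0 => [|i _]; first by rewrite !expr0 divr1 scale1r.
by rewrite exprS mul0r mul0r scale0r.
Qed.

Lemma expm_twist c e N D : D * N = e *: (N * D) -> D * expm c N = expm (c * e) N * D.
Proof.
move=> DN; have DX j : D * N ^+ j = e ^+ j *: (N ^+ j * D).
  elim: j => [|j IH]; first by rewrite !expr0 mulr1 mul1r scale1r.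
  have e1 : N ^+ j * D * N = e *: (N ^+ j * N * D) by rewrite -[LHS]mulrA DN -scalerAr mulrA.
  by rewrite (exprSr N) (exprSr e) mulrA IH -scalerAl e1 scalerA.
rewrite /expm mulr_sumr mulr_suml; apply: eq_bigr => j _.
by rewrite -scalerAr DX scalerA exprMn -scalerAl; congr (_ *: _); ring.
Qed.

Lemma expm_comm c N D : D * N = N * D -> D * expm c N = expm c N * D.
Proof. by move=> e; rewrite (expm_twist c (e := 1)) ?mulr1 ?scale1r. Qed.

Lemma expmD c d N : N ^+ m = 0 -> expm (c + d) N = expm c N * expm d N.
Proof.
move=> Nm; have NE r : (m <= r)%N -> N ^+ r = 0 by move=> mr; rewrite -(subnK mr) exprD Nm mulr0.
rewrite /expm mulr_suml.
under [RHS]eq_bigr => i _ do rewrite mulr_sumr.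
under [RHS]eq_bigr => i _ do under eq_bigr => j _ do rewrite -scalerAl -scalerAr scalerA -exprD.
transitivity (\sum_(i < m) \sum_(r < m | (i <= r)%N)
    (c ^+ i / i`!%:R * (d ^+ (r - i) / (r - i)`!%:R)) *: N ^+ r); last first.
  apply: eq_bigr => i _.
  rewrite [RHS](bigID (fun j : 'I_m => (i + j < m)%N)) /= [X in _ = _ + X]big1 ?addr0; last first.
    by move=> j; rewrite -leqNgt => /NE ->; rewrite scaler0.
  rewrite -[LHS](big_mkord (fun r => (i <= r)%N) (fun r =>
     (c ^+ i / i`!%:R * (d ^+ (r - i) / (r - i)`!%:R)) *: N ^+ r)).
  rewrite -[RHS](big_mkord (fun j => (i + j < m)%N) (fun j =>
     (c ^+ i / i`!%:R * (d ^+ j / j`!%:R)) *: N ^+ (i + j))).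
  have im : (i <= m)%N by apply: ltnW.
  rewrite (big_cat_nat _ im) //= [X in X + _]big_nat_cond [X in X + _]big1 ?add0r; last first.
    by move=> r /andP[/andP[_ lt] le]; move: lt; rewrite ltnNge le.
  rewrite -{1}[nat_of_ord i]add0n big_addn.
  rewrite [RHS](big_cat_nat _ (leq_subr i m)) //= [X in _ = _ + X]big_nat_cond.
  rewrite [X in _ = _ + X]big1 ?addr0; last by move=> r; lia.
  rewrite big_nat_cond [RHS]big_nat_cond; apply: eq_big => [r|r _]; first by lia.
  by rewrite addnK addnC.
rewrite (exchange_big_dep predT) //=; apply: eq_bigr => r _.
rewrite -scaler_suml; congr (_ *: _).
rewrite addrC exprDn mulr_suml.
rewrite (eq_bigl (fun i : 'I_m => (i < r.+1)%N)) //.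
rewrite -(big_ord_widen m (fun i => c ^+ i / i`!%:R * (d ^+ (r - i) / (r - i)`!%:R)) (ltn_ord r)).
apply: eq_bigr => i _; have ir : (i <= r)%N by rewrite -ltnS.
have ur := fact_unit (ltn_ord r); have ui : (i`!%:R : R) \is a GRing.unit.
  by apply: fact_unit; apply: leq_ltn_trans ir _.
have ui' : ((r - i)`!%:R : R) \is a GRing.unit by apply: fact_unit; apply: leq_ltn_trans (leq_subr _ _) _.
have e : ('C(r, i)%:R : R) * (i`!%:R * (r - i)`!%:R) = r`!%:R by rewrite -!natrM bin_fact.
rewrite -mulr_natr; apply: (mulIr ur); rewrite divrK // -{1}e.
rewrite [d ^+ _ * _]mulrC -[c ^+ i / _ * _]mulrA; apply: esym.
transitivity (c ^+ i * d ^+ (r - i) * 'C(r, i)%:R * (i`!%:R / i`!%:R) * ((r - i)`!%:R / (r - i)`!%:R)).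
  by ring.
by rewrite !divrr // !mulr1 [c ^+ _ * _]mulrC.
Qed.

End TruncatedExp.

(** * Subgroups cut out by the tame parameters at finite level *)

Section TameGroups.
Variables (F E : fieldType) (iota : F -> E) (l : nat) (l_pr : prime l).
Variables (sigma : abs_gal iota) (inert : abs_gal iota -> Prop).
Variable T : tame_parameters l_pr sigma inert.
Local Notation G := (abs_gal iota).
Local Notation Zl := (padic_int l_pr).
Local Notation eps := (tp_eps T).
Local Notation b := (tp_b T).
Local Notation kap := (tp_kap T).
Local Notation t := (tp_t T).
Implicit Types g h : G.

Lemma eps1 : eps 1%g = 1.
Proof. by have := tp_epsM T t 1%g; rewrite mulg1 tp_eps_t mul1r => <-. Qed.

Lemma b1 : b 1%g = 0.
Proof. by apply: (addrI (b 1%g)); rewrite addr0 -{1}[1%g in RHS]mulg1 tp_bM eps1 mul1r. Qed.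

Lemma kap1 : kap 1%g = 0.
Proof. by apply: tp_eps1_kap; apply: eps1. Qed.

Lemma epsV g : eps g * eps g^-1%g = 1. Proof. by rewrite -tp_epsM mulgV eps1. Qed.
Lemma epsVl g : eps g^-1%g * eps g = 1. Proof. by rewrite -tp_epsM mulVg eps1. Qed.

Lemma epsX g i : eps (g ^+ i)%g = eps g ^+ i.
Proof. by elim: i => [|i IH]; rewrite ?expg0 ?eps1 // expgS exprS tp_epsM IH. Qed.

Lemma kapX g i : kap (g ^+ i)%g = i%:R * kap g.
Proof.
elim: i => [|i IH]; rewrite ?expg0 ?kap1 ?mul0r // expgS tp_kapM IH.
by rewrite -{1}[kap g]mul1r -mulrDl nat1r.
Qed.

Lemma kapV g : kap g^-1%g = - kap g.
Proof. by apply/eqP; rewrite -addr_eq0 -tp_kapM mulVg kap1. Qed.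

Lemma bV g : b g^-1%g = - eps g^-1%g * b g.
Proof.
have := tp_bM T g^-1%g g; rewrite mulVg b1 => /esym/eqP.
by rewrite addr_eq0 mulNr => /eqP.
Qed.

Lemma eps_unit g : eps g \is a GRing.unit.
Proof. by apply/unitrP; exists (eps g^-1%g); rewrite epsV epsVl. Qed.

Lemma b_sigmaX i : b (sigma ^+ i)%g = 0.
Proof. by elim: i => [|i IH]; rewrite ?expg0 ?b1 // expgS tp_bM tp_bsigma IH mulr0 addr0. Qed.

Definition in_GB N g := b g N = 0%N.
Definition in_GE N g := eps g N = (1 : Zl) N.
Definition in_GN N g := in_GE N g /\ in_GB N g.
(** Larger than [in_GN]: modulo l^N the character [eps] may keep its part of order prime to l, so
    that a power of sigma with the same [chi] belongs to it ([sigma_pow_GP]). *)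
Definition in_GP N g := (eps g ^+ l.-1) N = (1 : Zl) N /\ in_GB N g.

Lemma congr0 (x : Zl) N : x N = 0%N -> x N = (0 : Zl) N. Proof. by rewrite padic_zeroE. Qed.

Lemma in_GB1 N : in_GB N 1%g. Proof. by rewrite /in_GB b1 padic_zeroE. Qed.

Lemma in_GBM N g h : in_GB N g -> in_GB N h -> in_GB N (g * h)%g.
Proof.
move=> /congr0 gN /congr0 hN; rewrite /in_GB tp_bM.
by rewrite (padic_congrD gN (padic_congrM (erefl _) hN)) mulr0 addr0 padic_zeroE.
Qed.

Lemma in_GBV N g : in_GB N g -> in_GB N g^-1%g.
Proof.
move=> /congr0 gN; rewrite /in_GB bV (padic_congrM (erefl ((- eps g^-1%g) N)) gN).
by rewrite mulr0 padic_zeroE.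
Qed.

Lemma epsV_congr N g m : (eps g ^+ m) N = (1 : Zl) N -> (eps g^-1%g ^+ m) N = (1 : Zl) N.
Proof.
move=> gN; have := padic_congrM (erefl ((eps g^-1%g ^+ m) N)) gN.
by rewrite -exprMn epsVl expr1n mulr1.
Qed.

Lemma GP_subgroup N : is_subgroup (in_GP N).
Proof.
split=> [|g h [g1 g2] [h1 h2]|g [g1 g2]].
- by split; [rewrite eps1 expr1n | apply: in_GB1].
- split; last exact: in_GBM.
  by rewrite tp_epsM exprMn (padic_congrM g1 h1) mulr1.
- by split; [apply: epsV_congr | apply: in_GBV].
Qed.

Lemma GN_subgroup N : is_subgroup (in_GN N).
Proof.
split=> [|g h [g1 g2] [h1 h2]|g [g1 g2]].
- by split; [rewrite /in_GE eps1 | apply: in_GB1].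
- split; last exact: in_GBM.
  by rewrite /in_GE tp_epsM (padic_congrM g1 h1) mulr1.
- split; last exact: in_GBV.
  by rewrite /in_GE -[eps _]expr1; apply: epsV_congr; rewrite expr1.
Qed.

Lemma b_conj N g h : in_GE N h -> b (g * h * g^-1)%g N = (eps g * b h) N.
Proof.
move=> h1; rewrite !tp_bM bV.
transitivity ((b g + eps g * b h + eps g * 1 * (- eps g^-1%g * b g)) N).
  apply: padic_congrD => //; apply: padic_congrM => //; rewrite tp_epsM.
  exact: padic_congrM.
congr (padic_seq _ N); rewrite mulr1 mulrA mulrN epsV; ring.
Qed.

Lemma GN_normal N g h : in_GN N h -> in_GN N (g * h * g^-1)%g.
Proof.
move=> [h1 /congr0 h2]; split; last first.
  by rewrite /in_GB b_conj // (padic_congrM (erefl _) h2) mulr0 padic_zeroE.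
rewrite /in_GE !tp_epsM (padic_congrM (padic_congrM (erefl _) h1) (erefl _)).
by rewrite mulr1 epsV.
Qed.

Lemma GN_GP N g : in_GN N g -> in_GP N g.
Proof. by move=> [g1 g2]; split=> //; rewrite (padic_congrX _ g1) expr1n. Qed.

Lemma bX N h i : in_GE N h -> b (h ^+ i)%g N = (i%:R * b h) N.
Proof.
move=> h1; elim: i => [|i IH]; first by rewrite expg0 b1 mul0r.
rewrite expgS tp_bM (padic_congrD (erefl _) (padic_congrM h1 IH)).
by congr (padic_seq _ N); rewrite -nat1r; ring.
Qed.

Lemma GE_X N h i : in_GE N h -> in_GE N (h ^+ i)%g.
Proof. by move=> h1; rewrite /in_GE epsX (padic_congrX _ h1) expr1n. Qed.

Lemma GE_pow_GN N h : in_GE N h -> in_GN N (h ^+ (l ^ N))%g.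
Proof.
move=> h1; split; first exact: GE_X.
rewrite /in_GB bX //; apply/padic_dvdP; by exists (b h).
Qed.

Lemma eps_pow_l N g m : (eps g ^+ m) 1%N = (1 : Zl) 1%N -> (eps g ^+ m ^+ (l ^ N)) N.+1 = (1 : Zl) N.+1.
Proof.
move=> g1; elim: N => [|N IH]; first by rewrite expn0 expr1.
by rewrite expnSr exprM (@padic_congr_powp _ _ N.+1 _ 1) // expr1n.
Qed.

Lemma GN_pow N g : eps g 1%N = (1 : Zl) 1%N -> in_GN N (g ^+ (l ^ (N + N)))%g.
Proof.
move=> g1; rewrite expnD expgnA; apply: GE_pow_GN.
rewrite /in_GE epsX; apply: (@padic_congr_le _ _ _ _ _ N.+1) => //.
by rewrite -[eps g]expr1; apply: eps_pow_l; rewrite expr1.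
Qed.

Lemma GN_le M N g : (M <= N)%N -> in_GN N g -> in_GN M g.
Proof.
move=> MN [g1 g2]; split; first exact: padic_congr_le g1.
by rewrite /in_GB (@padic_congr_le _ _ _ 0 _ N) ?padic_zeroE.
Qed.

Variables (k : finFieldType) (chl : l \in [pchar k]).

Definition chi g : k := (eps g 1)%:R.

Lemma chi_def g : chi g = (eps g 1%N)%:R. Proof. by []. Qed.

Lemma natr_modl a : ((a %% l)%:R : k) = a%:R.
Proof. by rewrite [in RHS](divn_eq a l) natrD natrM (pcharf0 chl) mulr0 add0r. Qed.

Lemma level1_natr (x y : Zl) : ((x * y)%R 1%N)%:R = (x 1%N)%:R * (y 1%N)%:R :> k.
Proof. by rewrite padic_mulE expn1 natr_modl natrM. Qed.

Lemma level1_1 : ((1%R : Zl) 1%N)%:R = 1 :> k.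
Proof. by rewrite (padic_natE l_pr 1) expn1 natr_modl. Qed.

Lemma level1_X (x : Zl) i : ((x ^+ i)%R 1%N)%:R = (x 1%N)%:R ^+ i :> k.
Proof. by elim: i => [|i IH]; rewrite ?expr0 ?level1_1 // !exprS level1_natr IH. Qed.

Lemma chiM' g h : chi (g * h)%g = chi g * chi h.
Proof. by rewrite /chi tp_epsM level1_natr. Qed.

Lemma natr_inj_lt a c : (a < l)%N -> (c < l)%N -> a%:R = c%:R :> k -> a = c.
Proof.
wlog ac : a c / (a <= c)%N => [hw|].
  by case/orP: (leq_total a c) => ac al cl e; [| apply/esym]; apply: hw.
move=> al cl /eqP; rewrite eq_sym -subr_eq0 -natrB // -(dvdn_pcharf chl) => /dvdnP[[|q] e]; first by lia.
by have : (l <= c - a)%N; [rewrite e leq_pmull | lia].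
Qed.

Lemma level1_inj (x y : Zl) : (x 1%N)%:R = (y 1%N)%:R :> k -> x 1%N = y 1%N.
Proof.
move=> e; have lt (z : Zl) : (z 1%N < l)%N by have := padic_lt z 1; rewrite expn1.
exact: (natr_inj_lt (lt x) (lt y) e).
Qed.

Lemma chi_eq1 g : chi g = 1 -> eps g 1%N = (1 : Zl) 1%N.
Proof. by move=> e; apply: level1_inj; rewrite level1_1. Qed.

Lemma GN_chi N g : (0 < N)%N -> in_GN N g -> chi g = 1.
Proof. by move=> N0 [g1 _]; rewrite /chi (padic_congr_le N0 g1) level1_1. Qed.

Lemma chi_l1 g : chi g ^+ l.-1 = 1.
Proof. by rewrite -level1_X padic_fermat ?eps_unit // level1_1. Qed.

Lemma chi_fixl g : chi g ^+ l = chi g.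
Proof. by rewrite -(prednK (prime_gt0 l_pr)) exprS chi_l1 mulr1. Qed.

(** Raising to the power l^N removes the pro-l part of eps(sigma) modulo l^N and leaves chi
    unchanged, because chi^l = chi. *)
Lemma sigma_pow_GP N : in_GP N (sigma ^+ (l ^ N))%g /\ chi (sigma ^+ (l ^ N))%g = chi sigma.
Proof.
split; last first.
  rewrite /chi epsX level1_X -/(chi sigma).
  by elim: N => [|N IH]; rewrite ?expn0 ?expr1 // expnS exprM chi_fixl.
split; last by rewrite /in_GB b_sigmaX padic_zeroE.
rewrite epsX exprAC; apply: (@padic_congr_le _ _ _ _ _ N.+1) => //.
by apply: eps_pow_l; apply: padic_fermat; apply: eps_unit.
Qed.

Lemma GN_l N : exists M, forall g, chi g = 1 -> in_GN N (g ^+ (l ^ M))%g.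
Proof. by exists (N + N)%N => g /chi_eq1; apply: GN_pow. Qed.

Lemma fixes_continuous (A : comNzRingType) d (f : G -> 'M[A]_d) : discrete_continuous f ->
  exists s : seq E, forall g, {in s, forall x, g x = x} -> f g = f 1%g.
Proof.
move=> fc; have [s hs] := fc 1%g 1%N; exists s => g gs; apply/matrixP => i j.
have [r rP e] := hs g (fun x xs => esym (gs x xs)) i j.
apply/eqP; rewrite -subr_eq0 e big_seq big1 // => u ur.
have [v [vs v0 ->]] := rP u ur; case: v vs v0 => [|y [|]] //= _ y0.
by rewrite big_seq1 (y0 y (mem_head _ _)) mulr0.
Qed.

(** theta, rhobar and chi are put on the diagonal of one matrix representation over the finite field
    [k]; its image is finite, and by [tp_tame] the deep elements have an image of order prime to
    l. *)
Lemma joint_quotient n d (theta : G -> 'M[k]_n) (rhobar : G -> 'M[k]_d) :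
  is_rep theta -> discrete_continuous theta -> is_rep rhobar -> discrete_continuous rhobar ->
  exists (gT : finGroupType) (q : G -> gT) (N0 : nat),
  [/\ forall g h, q (g * h)%g = (q g * q h)%g,
      forall g h, q g = q h -> [/\ theta g = theta h, rhobar g = rhobar h & chi g = chi h],
      exists s : seq E, forall g, {in s, forall x, g x = x} -> q g = 1%g
    & forall N g, (N0 <= N)%N -> in_GP N g -> exists m, ~~ (l %| m)%N /\ q (g ^+ m)%g = 1%g].
Proof.
move=> [th1 thM] thc [rh1 rhM] rhc.
pose J g : 'M[k]_(n + d + 1) := block_mx (block_mx (theta g) 0 0 (rhobar g)) 0 0 (chi g)%:M.
have Jrep : is_rep J.
  split=> [|g h].
    by rewrite /J th1 rh1 /chi eps1 level1_1 -!scalar_mx_block.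
  by rewrite /J !mulmx_block !mulmx0 !mul0mx !addr0 !add0r -thM -rhM -scalar_mxM -chiM'.
have [gT [q [qM qJ]]] := finite_image_quotient Jrep.
have q1 : q 1%g = 1%g by apply: (mulgI (q 1%g)); rewrite -qM !mulg1.
have qc : exists s : seq E, forall g, {in s, forall x, g x = x} -> q g = 1%g.
  have [s1 h1] := fixes_continuous thc; have [s2 h2] := fixes_continuous rhc.
  have [s3 h3] := tp_eps_cont T 1; exists (s1 ++ s2 ++ s3) => g gs; rewrite -q1; apply/qJ.
  rewrite /J h1 => [|x xs]; last by apply: gs; rewrite mem_cat xs.
  rewrite h2 => [|x xs]; last by apply: gs; rewrite !mem_cat xs orbT.
  rewrite /chi (h3 g 1%g) // => x xs; by rewrite gs // !mem_cat xs !orbT.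
have [s hs] := qc; have [N0 N0P] := tp_tame T s.
exists gT, q, N0; split=> // [g h /qJ /eq_block_mx[/eq_block_mx[-> _ _ ->] _ _ e]|N g NN [g1 g2]].
  split=> //; have := congr1 (fun A : 'M_1 => A 0 0) e; by rewrite !mxE eqxx.
have gN : in_GN N (g ^+ l.-1)%g.
  split; first by rewrite /in_GE epsX.
  by elim: (l.-1) => [|i IH]; [rewrite expg0; apply: in_GB1 | rewrite expgS; apply: in_GBM].
have [gE gB] := GN_le NN gN.
have [m [lm ms]] := N0P _ gE gB; exists (l.-1 * m)%N; split.
  rewrite Euclid_dvdM // negb_or lm andbT gtnNdvd //; have := prime_gt1 l_pr; lia.
by apply: hs => x xs; rewrite expgnA ms.
Qed.

End TameGroups.

(** * Block triangular matrices and the normal form of the residual representation *)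

Section UpperBlocks.
Variables (B : nzRingType) (m' : nat).
Local Notation m := m'.+1.
Implicit Types A C : 'M[B]_m.

Definition upper A := forall i j : 'I_m, (j < i)%N -> A i j = 0.

Lemma upperM A C : upper A -> upper C -> upper (A * C).
Proof.
move=> uA uC i j ji; rewrite mxE big1 // => x _.
have [xi|ix] := ltnP x i; first by rewrite uA // mul0r.
by rewrite uC ?mulr0 //; apply: leq_trans ji ix.
Qed.

Lemma upper_diagM A C i : upper A -> upper C -> (A * C) i i = A i i * C i i.
Proof.
move=> uA uC; rewrite mxE (bigD1 i) //= big1 ?addr0 // => x.
by rewrite -val_eqE neq_ltn => /orP[xi|ix]; [rewrite uA // mul0r | rewrite uC ?mulr0].
Qed.

Lemma upper1 : upper 1.
Proof. by move=> i j ji; rewrite mxE; case: eqP => // e; rewrite e ltnn in ji. Qed.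

Lemma strict_upper_nilpotent A : (forall i j : 'I_m, (j <= i)%N -> A i j = 0) -> A ^+ m = 0.
Proof.
move=> uA; have h d : forall i j : 'I_m, (j < i + d)%N -> (A ^+ d) i j = 0.
  elim: d => [|d IH] i j.
    by rewrite addn0 expr0 mxE => ji; case: eqP => // e; rewrite e ltnn in ji.
  move=> jid; rewrite exprS mxE big1 // => x _.
  have [xi|ix] := leqP x i; first by rewrite uA // mul0r.
  by rewrite IH ?mulr0 //; apply: leq_trans jid _; rewrite addnS -addSn leq_add2r.
apply/matrixP => i j; rewrite h ?mxE //; apply: leq_trans (ltn_ord j) (leq_addl _ _).
Qed.

Lemma upper_unit A : upper A -> (forall i, A i i = 1) ->
  exists C, [/\ upper C, forall i, C i i = 1, A * C = 1 & C * A = 1].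
Proof.
move=> uA A1; have Vm : (A - 1) ^+ m = 0.
  apply: strict_upper_nilpotent => i j; rewrite leq_eqVlt => /orP[/eqP/val_inj ->|ji].
    by rewrite !mxE eqxx A1 subrr.
  by rewrite !mxE uA // sub0r; case: eqP => [e|]; [rewrite e ltnn in ji | rewrite oppr0].
have [e1 e2] := unit_1_add_nilpotent Vm; rewrite addrC subrK in e1 e2.
set C := \sum_(i < m) _ in e1 e2; have uC : upper C.
  rewrite /C; elim/big_ind: _ => [i j _|x y ux uy i j ji|r _]; first by rewrite mxE.
    by rewrite mxE ux // uy // addr0.
  elim: (nat_of_ord r) => [|a IH]; first by rewrite expr0; apply: upper1.
  rewrite exprS; apply: upperM => // i j ji; rewrite !mxE uA // sub0r opprK.
  by case: eqP => // e; rewrite e ltnn in ji.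
exists C; split=> // i; have := congr1 (fun M : 'M_m => M i i) e1.
by rewrite upper_diagM // A1 mul1r mxE eqxx.
Qed.

End UpperBlocks.

Section NormalForm.
Variables (F E : fieldType) (iota : F -> E) (l : nat) (l_pr : prime l).
Variables (sigma : abs_gal iota) (inert : abs_gal iota -> Prop).
Variable T : tame_parameters l_pr sigma inert.
Local Notation G := (abs_gal iota).
Local Notation Zl := (padic_int l_pr).
Local Notation eps := (tp_eps T).
Local Notation b := (tp_b T).
Local Notation kap := (tp_kap T).
Local Notation t := (tp_t T).
Variables (k : finFieldType) (chl : l \in [pchar k]) (m' n' : nat).
Local Notation m := m'.+1.
Local Notation n := n'.+1.
Local Notation BM := 'M['M[k]_n]_m.
Local Notation chi := (chi T k).
Local Notation om := (chi sigma).
Variables (theta : G -> 'M[k]_n) (theta_rep : is_rep theta).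
Hypothesis theta_irr : absolutely_irreducible theta.
Hypothesis l_ndvd_n : ~~ (l %| n)%N.
Hypothesis chi_gen : forall g, exists i, chi g = om ^+ i.
Variables (s : nat) (s_gt0 : (0 < s)%N) (X : 'M[k]_n).
Hypothesis X_unit : X \is a GRing.unit.
Hypothesis X_int : intertwines theta chi s X.
Hypothesis s_min : forall a z, (0 < a)%N -> z \is a GRing.unit -> intertwines theta chi a z -> (s <= a)%N.
Variables (f : nat) (f_prim : f.-primitive_root (om ^+ s)).
Variables (s' : nat) (s'_prim : s'.-primitive_root om).
Hypothesis l_ndvd_s' : ~~ (l %| s')%N.
Hypothesis m_le : (m <= l)%N.
Variables (w : 'I_m -> nat) (R0 : G -> BM).
Hypothesis w_window : forall i j, (w i + 2 <= w j + s)%N.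
Hypothesis R0_1 : R0 1%g = 1.
Hypothesis R0M : forall g h, R0 (g * h)%g = R0 g * R0 h.
Hypothesis R0_upper : forall g, upper (R0 g).
Hypothesis R0_diag : forall g i, R0 g i i = chi g ^+ w i *: theta g.
Variables (gT : finGroupType) (q : G -> gT) (N0 : nat).
Hypothesis qM : forall g h, q (g * h)%g = (q g * q h)%g.
Hypothesis qE : forall g h, q g = q h -> [/\ theta g = theta h, R0 g = R0 h & chi g = chi h].
Hypothesis q_tors : forall N g, (N0 <= N)%N -> in_GP T N g -> exists m, ~~ (l %| m)%N /\ q (g ^+ m)%g = 1%g.

Let N := maxn N0 1.
Let N_gt0 : (0 < N)%N. Proof. by rewrite leq_max orbT. Qed.
Let N0N : (N0 <= N)%N. Proof. by rewrite leq_max leqnn. Qed.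

Let chiM := chiM' T chl.
Let chi1 : chi 1%g = 1. Proof. by rewrite chi_def eps1 level1_1. Qed.
Let chiV g : chi g * chi g^-1%g = 1. Proof. by rewrite -chiM mulgV chi1. Qed.
Let chi0 g : chi g != 0.
Proof. by apply: contraTneq (oner_neq0 k) => c0; rewrite -(chiV g) c0 mul0r eqxx. Qed.

Let thM g h : theta (g * h)%g = theta g * theta h. Proof. exact: thetaM. Qed.
Let th1 : theta 1%g = 1. Proof. exact: theta1. Qed.
Let thV g : theta g * theta g^-1%g = 1. Proof. exact: thetaV. Qed.
Let thVl g : theta g^-1%g * theta g = 1. Proof. exact: thetaVl. Qed.

Definition weight_mx g : 'M[k]_m := diag_mx (\row_i chi g ^+ w i).
(** The direct sum of the twists theta(w_i), which is the block diagonal of [R0]. *)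
Definition model g : BM := outer n' (weight_mx g) * inner m' (theta g).

Lemma weight_mxM g h : weight_mx (g * h)%g = weight_mx g * weight_mx h.
Proof.
rewrite /weight_mx -mulmxE mulmx_diag; congr diag_mx; apply/rowP => i.
by rewrite !mxE chiM exprMn.
Qed.

Lemma weight_mx1 g : chi g = 1 -> weight_mx g = 1.
Proof.
move=> g1; apply/matrixP => i j; rewrite !mxE g1 expr1n.
by case: eqP => // ->.
Qed.

Lemma weight_mxE g i j : weight_mx g i j = (chi g ^+ w i) *+ (i == j).
Proof. by rewrite !mxE; case: eqP => // ->. Qed.

Lemma modelM g h : model (g * h)%g = model g * model h.
Proof.
rewrite /model weight_mxM thM outerM innerM !mulrA; congr (_ * _).
by rewrite -!mulrA outer_inner.
Qed.

Lemma modelE g i j : model g i j = (chi g ^+ w i) *+ (i == j) *: theta g.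
Proof. by rewrite outer_innerE weight_mxE. Qed.

Lemma model_mull g (A : BM) i j : (model g * A) i j = chi g ^+ w i *: (theta g * A i j).
Proof.
rewrite mxE (bigD1 i) //= big1 ?addr0 => [|x xi]; first by rewrite modelE eqxx scalerAl.
by rewrite modelE eq_sym (negPf xi) scale0r mul0r.
Qed.

Lemma model_mulr g (A : BM) i j : (A * model g) i j = chi g ^+ w j *: (A i j * theta g).
Proof.
rewrite mxE (bigD1 j) //= big1 ?addr0 => [|x xj]; first by rewrite modelE eqxx scalerAr.
by rewrite modelE (negPf xj) scale0r mulr0.
Qed.

Definition cst (c : k) : BM := inner m' c%:M.

Lemma cstC c (A : BM) : cst c * A = A * cst c.
Proof.
apply/matrixP => i j; rewrite inner_mulr mulr_inner -!mulmxE.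
by rewrite mul_scalar_mx mul_mx_scalar.
Qed.

Lemma cst1 : cst 1 = 1. Proof. by []. Qed.

Fact cst_zmod : zmod_morphism cst.
Proof. by move=> x y; rewrite /cst /inner !raddfB. Qed.
Fact cst_monoid : monoid_morphism cst.
Proof. by split=> // x y; rewrite /cst -innerM -mulmxE -scalar_mxM. Qed.
HB.instance Definition _ := GRing.isZmodMorphism.Build k BM cst cst_zmod.
HB.instance Definition _ := GRing.isMonoidMorphism.Build k BM cst cst_monoid.

(** The group [in_GP] acts through a finite group of order prime to l, so its representations over
    [k] are semisimple. Averaging R0(x) model(x)^-1 gives an explicit intertwiner, unitriangular
    after division by the length of the list. *)
Lemma diagonalize_tame : exists u u' : BM, [/\ u * u' = 1, u' * u = 1,
  upper u /\ upper u', (forall i, u i i = 1) /\ (forall i, u' i i = 1)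
  & forall g, in_GP T N g -> u' * R0 g * u = model g].
Proof.
have sub := GP_subgroup T N.
have [e [eP el eF]] := averaging_seq l_pr qM sub (fun g gN => q_tors N0N gN).
pose Fn x := R0 x * model x^-1%g; pose u1 := \sum_(x <- e) Fn x.
have q1 : q 1%g = 1%g by apply: (mulgI (q 1%g)); rewrite -qM !mulg1.
have qV g h : q g = q h -> q g^-1%g = q h^-1%g.
  by move=> gh; apply: (mulgI (q g)); rewrite -qM mulgV gh -qM mulgV.
have FnE x y : q x = q y -> Fn x = Fn y.
  move=> xy; have [_ e1 _] := qE xy; have [e2 _ e3] := qE (qV _ _ xy).
  by rewrite /Fn e1 /model e2 /weight_mx e3.
have Ru1 g : in_GP T N g -> R0 g * u1 = u1 * model g.
  move=> gP; have [e1 _] := eF _ Fn FnE g gP; rewrite /u1 mulr_sumr -e1 mulr_suml.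
  apply: eq_bigr => x _; rewrite /Fn R0M -(mulrA (R0 g * R0 x)) -modelM.
  by rewrite invMg -mulgA mulVg mulg1 mulrA.
have mup g : upper (model g).
  by move=> i j ji; rewrite modelE; case: eqP => [e'|]; [rewrite e' ltnn in ji | rewrite scale0r].
have u1up : upper u1.
  rewrite /u1; elim/big_ind: _ => [i j _|x y ux uy i j ji|x _]; first by rewrite mxE.
    by rewrite mxE ux // uy // addr0.
  by apply: upperM.
have u1d i : u1 i i = (size e)%:R.
  rewrite /u1 summxE (eq_bigr (fun=> 1)) => [|x _].
    by rewrite big_const_seq count_predT iter_addr_0.
  rewrite /Fn upper_diagM // R0_diag modelE eqxx -scalerAl -scalerAr scalerA thV.
  by rewrite -exprMn chiV expr1n scale1r.
pose a : k := (size e)%:R^-1; pose u := cst a * u1.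
have a0 : (size e)%:R != 0 :> k by rewrite -(dvdn_pcharf chl).
have uup : upper u by move=> i j ji; rewrite inner_mulr u1up // mulr0.
have ud i : u i i = 1.
  rewrite inner_mulr u1d -mulmxE mul_scalar_mx -[(size e)%:R]/(1 *+ size e) -scaler_nat scalerA.
  by rewrite mulVf // scale1r.
have [u' [u'up u'd uu' u'u]] := upper_unit uup ud.
exists u, u'; split=> // g gP.
have Ru : R0 g * u = u * model g by rewrite /u mulrA -cstC -mulrA Ru1 // mulrA.
by rewrite -mulrA Ru mulrA u'u mul1r.
Qed.

Variables (R : G -> BM).
Hypothesis R1 : R 1%g = 1.
Hypothesis RM : forall g h, R (g * h)%g = R g * R h.
Hypothesis R_upper : forall g, upper (R g).
Hypothesis R_diag : forall g i, R g i i = chi g ^+ w i *: theta g.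
Hypothesis R_model : forall g, in_GP T N g -> R g = model g.

Let thi g := inner m' (theta g).
Let thiM g h : thi (g * h)%g = thi g * thi h. Proof. by rewrite /thi thM innerM. Qed.
Let thiV g : thi g * thi g^-1%g = 1. Proof. by rewrite -thiM mulgV /thi th1. Qed.
Let thiVl g : thi g^-1%g * thi g = 1. Proof. by rewrite -thiM mulVg /thi th1. Qed.
Let thiI g (A B : BM) : A * thi g = B * thi g -> A = B.
Proof. by move=> e; rewrite -[A]mulr1 -[B]mulr1 -(thiV g) !mulrA e. Qed.
Let thiIl g (A B : BM) : thi g * A = thi g * B -> A = B.
Proof. by move=> e; rewrite -[A]mul1r -[B]mul1r -(thiVl g) -!mulrA e. Qed.

Let model_thi g : model g = outer n' (weight_mx g) * thi g. Proof. by []. Qed.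
Let thiO g (c : 'M[k]_m) : thi g * outer n' c = outer n' c * thi g. Proof. by rewrite outer_inner. Qed.

Let mulOT (a c : 'M[k]_m) g h : (outer n' a * thi g) * (outer n' c * thi h) = outer n' (a * c) * thi (g * h)%g.
Proof. by rewrite -mulrA (mulrA (thi g)) thiO outerM thiM !mulrA. Qed.

Let GNs := GN_subgroup T N.
Let sg := (sigma ^+ (l ^ N))%g.
Let sgP : in_GP T N sg := (sigma_pow_GP T chl N).1.
Let chi_sg : chi sg = om := (sigma_pow_GP T chl N).2.

Lemma R_GN h : in_GN T N h -> R h = thi h.
Proof.
by move=> hN; rewrite R_model; [rewrite /model weight_mx1 ?outer1 ?mul1r // (GN_chi chl N_gt0 hN) | apply: GN_GP].
Qed.

Definition ratio g : BM := R g * thi g^-1%g.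

Lemma ratioE g : R g = ratio g * thi g. Proof. by rewrite -mulrA thiVl mulr1. Qed.

(** On [in_GN] the representation R is theta in every block, so R(g) and theta(g) conjugate it in
    the same way. *)
Lemma ratio_centralizes g h : in_GN T N h -> ratio g * thi h = thi h * ratio g.
Proof.
move=> hN; have hN' : in_GN T N (g^-1 * h * g)%g by have := GN_normal g^-1%g hN; rewrite invgK.
apply: (thiI (g := g)); rewrite -!mulrA -!thiM.
have -> : (g^-1 * (h * g) = (g^-1 * h * g))%g by rewrite mulgA.
rewrite -(R_GN hN') -RM mulgA mulgA mulgV mul1g RM (R_GN hN).
by rewrite mulVg /thi th1 inner1 mulr1.
Qed.

Lemma centralizesP A : (forall h, in_GN T N h -> A * thi h = thi h * A) ->
  forall i j, centralizes theta (in_GN T N) (A i j).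
Proof.
move=> AC i j h /AC /(congr1 (fun M : BM => M i j)).
by rewrite mulr_inner inner_mulr => ->.
Qed.

Let weight_scalarN := weight_scalar l_pr chl theta_rep theta_irr l_ndvd_n chiM chi_gen s_gt0
  X_unit X_int s_min f_prim (@GN_normal _ _ _ _ _ _ _ T N) (GN_l T chl N) s'_prim l_ndvd_s'.

Let N_chi h : in_GN T N h -> chi h = 1. Proof. exact: GN_chi. Qed.

Definition graded d (c : 'M[k]_m) := forall i j, c i j != 0 -> w i = (w j + d)%N.

(** The window on w keeps w_i and w_j + d less than s apart for d <= 1, so [weight_scalar] applies
    to each block. *)
Lemma weight_outer d (A : BM) : (d <= 1)%N -> (forall i j, centralizes theta (in_GN T N) (A i j)) ->
  model sg * A = cst (om ^+ d) * (A * model sg) -> exists2 c, graded d c & A = outer n' c.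
Proof.
move=> d1 AC AS.
have ent i j : exists c : k, A i j = c%:M /\ ((w i != w j + d)%N -> c = 0).
  apply: (weight_scalarN (h := sg) N_chi (AC i j) chi_sg).
  - by have := w_window i j; lia.
  - by have := w_window j i; lia.
  have := congr1 (fun M : BM => M i j) AS.
  rewrite inner_mulr model_mull model_mulr chi_sg -mulmxE mul_scalar_mx scalerA -exprD.
  by rewrite addnC.
have /choice[c cP] : forall ij : 'I_m * 'I_m, exists c : k, A ij.1 ij.2 = c%:M /\ ((w ij.1 != w ij.2 + d)%N -> c = 0).
  by move=> [i j]; apply: ent.
exists (\matrix_(i, j) c (i, j)) => [i j|].
  by rewrite mxE => c0; apply/eqP; apply: contraTT c0 => ne; rewrite negbK (cP (i, j)).2.
by apply/matrixP => i j; rewrite !mxE (cP (i, j)).1.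
Qed.

(** When b(g) vanishes at level N, the commutator of g with the deep power of sigma lies in [in_GN].
    Thus [ratio g] commutes with the model of that power, which is weight 0. *)
Lemma degree0_part g : in_GB T N g -> exists2 c, graded 0 c & R g = outer n' c * thi g.
Proof.
move=> gB; pose c := (g * sg * g^-1 * sg^-1)%g.
have cN : in_GN T N c.
  split.
    rewrite /in_GE !tp_epsM (_ : _ * _ = (eps g * eps g^-1%g) * (eps sg * eps sg^-1%g)); last by ring.
    by rewrite !epsV mulr1.
  have sB : in_GB T N sg := sgP.2.
  exact: in_GBM (in_GBM (in_GBM gB sB) (in_GBV gB)) (in_GBV sB).
have rel : R g * model sg = thi c * model sg * R g.
  rewrite -(R_GN cN) -(R_model sgP) -!RM; congr R.
  by rewrite /c mulgKV mulgKV.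
have TH : thi g * model sg = thi c * model sg * thi g.
  rewrite model_thi mulrA (thiO g) mulrA (thiO c) -!(mulrA (outer n' _)) -!thiM; congr (_ * thi _).
  by rewrite /c mulgKV mulgKV.
have RQ := ratioE g; have QC := ratio_centralizes g cN; rewrite RQ in rel.
have [c0 c0g Rc] : exists2 c0, graded 0 c0 & ratio g = outer n' c0.
  apply: weight_outer => //; first by apply: centralizesP => h; apply: ratio_centralizes.
  move: (ratio g) {RQ} QC rel => Q QC rel.
  rewrite expr0 cst1 mul1r; apply: (thiIl (g := c)); apply: (thiI (g := g)).
  transitivity (thi c * model sg * (Q * thi g)); first by rewrite !mulrA.
  by rewrite -rel -(mulrA Q) TH !mulrA QC.
by exists c0 => //; rewrite ratioE Rc.
Qed.

Lemma centralizes_thi A g : (forall h, in_GN T N h -> A * thi h = thi h * A) -> chi g = 1 ->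
  A * thi g = thi g * A.
Proof.
move=> AC g1; apply/matrixP => i j; rewrite mulr_inner inner_mulr.
have [c ->] := centralizer_span l_pr chl theta_rep theta_irr l_ndvd_n chiM chi_gen s_gt0
  X_unit X_int s_min f_prim (@GN_normal _ _ _ _ _ _ _ T N) (GN_l T chl N) s'_prim l_ndvd_s'
  N_chi (centralizesP AC i j).
rewrite mulr_suml mulr_sumr; apply: eq_bigr => x _.
by rewrite -scalerAl -scalerAr (XE_int X_int) // g1 expr1n scale1r.
Qed.

Let fact_unit (j : nat) : (j < m)%N -> (j`!%:R : k) \is a GRing.unit.
Proof. by move=> jm; rewrite unitfE (fact_neq0 chl) //; apply: leq_trans jm m_le. Qed.

Definition bk g : k := (b g N)%:R.

Lemma level_natr (x : Zl) a : x N = a -> (a%:R : k) = (x 1%N)%:R.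
Proof.
move=> <-; have := @padic_congr_le _ _ x (x N)%:R 1 N N_gt0.
rewrite (padic_natE l_pr (x N)) padic_modn => /(_ erefl) ->.
by rewrite (padic_natE l_pr) expn1 (natr_modl chl).
Qed.

(** [Nn] is the truncated logarithm of the unipotent matrix attached to t. Conjugation by g sends t
    to t^eps(g) up to an element of [in_GN], hence multiplies the logarithm by chi(g); for the deep
    power of sigma this says that [Nn] has degree 1. If b vanishes identically, Nn = 0 serves. *)
Lemma unipotent_part : exists Nn : 'M[k]_m, [/\ graded 1 Nn, Nn ^+ m = 0,
  (forall g, exists x, [/\ in_GE T N x, kap x = 0, b x N = b g N & R x = outer n' (expm (bk g) Nn) * thi x])
  & forall g c, in_GB T N g -> R g = outer n' c * thi g -> c * Nn = chi g *: (Nn * c)].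
Proof.
have [bt|b0] := tp_b_t T; last first.
  exists 0; split=> [i j||g|g c _ _]; first by rewrite mxE eqxx.
  - by rewrite expr0n.
  - exists 1%g; rewrite /bk !b0 padic_zeroE expm_c0 outer1 mul1r R1 /thi th1; split=> //.
      by rewrite /in_GE eps1.
    exact: kap1.
  by rewrite mulr0 mul0r scaler0.
have [Q1 Q1E] : exists Q1, Q1 = ratio t by exists (ratio t).
have Q1C h : in_GN T N h -> Q1 * thi h = thi h * Q1 by rewrite Q1E; apply: ratio_centralizes.
have et : eps t = 1 := tp_eps_t T.
have chit : chi t = 1 by rewrite chi_def et level1_1.
have Q1t : Q1 * thi t = thi t * Q1 := centralizes_thi Q1C chit.
have Rt : R t = Q1 * thi t by rewrite Q1E -ratioE.
have tQX i : thi t * Q1 ^+ i = Q1 ^+ i * thi t := commrX i (esym Q1t).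
have tX i : eps (t ^+ i)%g = 1 by rewrite epsX et expr1n.
have btX i : b (t ^+ i)%g = i%:R.
  by elim: i => [|i IH]; rewrite ?expg0 ?b1 // expgS tp_bM bt et mul1r IH nat1r.
have RtX i : R (t ^+ i)%g = Q1 ^+ i * thi (t ^+ i)%g.
  elim: i => [|i IH]; first by rewrite !expg0 expr0 mul1r R1 /thi th1.
  by rewrite expgS RM IH Rt exprS thiM !mulrA -(mulrA Q1) tQX !mulrA.
have Q1up : upper Q1.
  rewrite Q1E; apply: upperM => // i j ji; rewrite mxE.
  by case: eqP => // e; rewrite e ltnn in ji.
have Q1d i : Q1 i i = 1 by rewrite Q1E mulr_inner R_diag chit expr1n scale1r thV.
have Vm : (Q1 - 1) ^+ m = 0.
  apply: strict_upper_nilpotent => i j; rewrite leq_eqVlt => /orP[/eqP/val_inj ->|ji].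
    by rewrite !mxE eqxx Q1d subrr.
  by rewrite !mxE Q1up // sub0r; case: eqP => [e|]; [rewrite e ltnn in ji | rewrite oppr0].
have [L [LP Llog]] := truncated_log l_pr chl m_le (iota := cst) cstC isT.
have [Nm NE] := Llog _ Vm; rewrite addrC subrK in Nm NE.
set Nb := \sum_(x < m) _ in Nm NE.
(* The logarithm of Q1^a is a times that of Q1. Among the moments of the interpolation coefficients
   L only the first is nonzero. *)
have LX a : \sum_(x < m) cst (L x) * Q1 ^+ (a * x) = cst a%:R * Nb.
  have key c : \sum_(x < m) cst (L x) * Q1 ^+ (c * x) = \sum_(j < m) cst (c%:R * (j == 1 :> nat)%:R) * Nb ^+ j.
    under eq_bigr => x _ do rewrite NE mulr_sumr.
    rewrite exchange_big /=; apply: eq_bigr => j _; rewrite -LP //.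
    have -> : c%:R * \sum_(x < m) L x * x%:R ^+ j = \sum_(x < m) L x * ((c * x)%:R ^+ j / j`!%:R) :> k.
      have [j1|j1] := eqVneq (j : nat) 1%N.
        rewrite j1 mulr_sumr; apply: eq_bigr => x _; rewrite !expr1 (_ : 1`!%:R = 1 :> k) // divr1 natrM; ring.
      have e0 : \sum_(x < m) L x * x%:R ^+ j = 0 by rewrite LP // (negPf j1).
      rewrite e0 mulr0; transitivity (\sum_(x < m) (L x * x%:R ^+ j) * (c%:R ^+ j / j`!%:R)).
        by rewrite -mulr_suml e0 mul0r.
      by apply: eq_bigr => x _; rewrite natrM exprMn; ring.
    rewrite rmorph_sum mulr_suml; apply: eq_bigr => x _.
    by rewrite mulrA -rmorphM.
  have [m1|m1] := leqP m 1.
    have z c : \sum_(x < m) cst (L x) * Q1 ^+ (c * x) = 0.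
      rewrite key big1 // => j _; have -> : (j == 1 :> nat) = false.
        by apply/negbTE; rewrite neq_ltn; have := ltn_ord j; lia.
      by rewrite mulr0 rmorph0 mul0r.
    have : Nb = 0 by rewrite -(z 1%N); apply: eq_bigr => x _; rewrite mul1n.
    by rewrite z => ->; rewrite mulr0.
  rewrite key (bigD1 (Ordinal m1)) //= mulr1 expr1 big1 ?addr0 // => j.
  by rewrite -val_eqE /= => /negPf ->; rewrite mulr0 rmorph0 mul0r.
have conj_rel g : in_GB T N g -> exists c, in_GN T N c /\
    (g * t = c * t ^+ (eps g N) * g)%g.
  move=> gB; exists (g * t * g^-1 * (t ^+ (eps g N))^-1)%g; split; last by rewrite !mulgKV.
  have tE : in_GE T N t by rewrite /in_GE et.
  have eV : eps (t ^+ eps g N)^-1%g = 1 by have := epsV T (t ^+ eps g N)%g; rewrite tX mul1r.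
  split; first by rewrite /in_GE !tp_epsM et mulr1 epsV mul1r eV.
  rewrite /in_GB tp_bM bV btX !tp_epsM et mulr1 epsV mul1r.
  rewrite eV -[RHS](padic_zeroE l_pr N); transitivity ((eps g * b t + (-1 * (eps g N)%:R)) N).
    by apply: padic_congrD => //; apply: b_conj.
  rewrite bt mulr1 mulN1r padic_zeroE; apply/padic_congr_sub.
  exact: padic_congr_nat.
(* [Nb] is a fixed combination of powers of [Q1], so a relation S Q1 = Q1^a S passes to S Nb = a Nb
   S. *)
have S_Nb (S : BM) a : S * Q1 = Q1 ^+ a * S -> S * Nb = cst a%:R * (Nb * S).
  move=> SQ; have SQX x : S * Q1 ^+ x = Q1 ^+ (a * x) * S.
    elim: x => [|x IH]; first by rewrite muln0 !expr0 mul1r mulr1.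
    by rewrite exprS mulrA SQ -mulrA IH mulrA -exprD -mulnS.
  rewrite mulrA -LX /Nb mulr_sumr mulr_suml; apply: eq_bigr => x _.
  by rewrite mulrA -cstC -mulrA SQX !mulrA.
have Q1cX c i : in_GN T N c -> thi c * Q1 ^+ i = Q1 ^+ i * thi c.
  by move=> cN; apply: commrX i (esym (Q1C c cN)).
have [Nn Nn1 NbE] : exists2 Nn, graded 1 Nn & Nb = outer n' Nn.
  apply: weight_outer => //.
    apply: centralizesP => h hN; rewrite /Nb mulr_suml mulr_sumr; apply: eq_bigr => x _.
    by rewrite mulrA -cstC -!mulrA Q1cX.
  have [c [cN rel]] := conj_rel sg sgP.2.
  have SQ : model sg * Q1 = Q1 ^+ (eps sg N) * model sg.
    apply: (thiI (g := t)).
    have e1 : model sg * (Q1 * thi t) = thi c * (Q1 ^+ (eps sg N) * thi (t ^+ (eps sg N))%g) * model sg.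
      by rewrite -Rt -(R_model sgP) -RM rel !RM (R_GN cN) RtX.
    rewrite -[LHS]mulrA e1 (mulrA (thi c)) Q1cX // -!(mulrA (Q1 ^+ _)); congr (_ * _).
    by rewrite -thiM model_thi mulrA thiO -!(mulrA (outer n' _)) -!thiM rel.
  rewrite (S_Nb _ _ SQ) expr1; congr (cst _ * _).
  by rewrite (level_natr (x := eps sg) erefl) -/(chi sg) chi_sg.
have Q1X a : Q1 ^+ a = outer n' (expm a%:R Nn).
  rewrite NE /expm outer_sum; apply: eq_bigr => j _; rewrite NbE -outerX.
  by apply/matrixP => x y; rewrite inner_mulr !mxE -mulmxE -scalar_mxM.
exists Nn; split=> //.
- by apply: (@outer_inj _ _ n'); rewrite outerX -NbE Nm; apply/matrixP => x y; rewrite !mxE raddf0.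
- move=> g; exists (t ^+ (b g N))%g; split.
  + by rewrite /in_GE tX.
  + by rewrite kapX (tp_eps1_kap et) mulr0.
  + by rewrite btX -padic_congr_nat.
  by rewrite RtX Q1X.
move=> g c gB Rg; have [c' [cN rel]] := conj_rel g gB.
have E1 : Q1 = outer n' (expm 1 Nn) by rewrite -(Q1X 1%N) expr1.
have cQ : outer n' c * Q1 = Q1 ^+ (eps g N) * outer n' c.
  apply: (thiI (g := (g * t)%g)).
  have e2 : thi c' * (Q1 ^+ (eps g N) * thi (t ^+ (eps g N))%g) * (outer n' c * thi g) =
      outer n' c * thi g * (Q1 * thi t) by rewrite -(R_GN cN) -RtX -Rg -Rt -!RM rel.
  have e3 : outer n' c * thi g * (Q1 * thi t) = outer n' c * Q1 * thi (g * t)%g.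
    by rewrite !mulrA -(mulrA (outer n' c)) {1}E1 thiO -E1 thiM !mulrA.
  rewrite -e3 -e2 (mulrA (thi c')) Q1cX // -!(mulrA (Q1 ^+ _)); congr (_ * _).
  by rewrite -thiM mulrA thiO -(mulrA (outer n' _)) -thiM rel.
have := S_Nb _ _ cQ; rewrite NbE (level_natr (x := eps g) erefl) -/(chi g) => e.
apply: (@outer_inj _ _ n'); rewrite outerM e -outerM.
by apply/matrixP => x y; rewrite inner_mulr !mxE -mulmxE -scalar_mxM.
Qed.

(** Every g is a power of t, times a power of a corrected phi, times an element where b and kap
    vanish at the relevant levels. The three factors contribute the exponential, the power of y0 and
    the weights. *)
Lemma normal_form : exists (Nn y0 : 'M[k]_m) M, [/\ graded 1 Nn /\ Nn ^+ m = 0,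
  graded 0 y0 /\ y0 * Nn = Nn * y0, y0 ^+ (l ^ M) = 1
  & forall g, R g = outer n' (expm (bk g) Nn * y0 ^+ (kap g M) * weight_mx g) * thi g].
Proof.
have [Nn [Nn1 Nm tau conj]] := unipotent_part.
have [M MP] := tp_kap_small T N.
have outer_thi_inj g c c' : outer n' c * thi g = outer n' c' * thi g -> c = c'.
  by move=> /thiI /outer_inj.
(* phi is corrected by x, on which [kap] vanishes, so that b becomes 0 at level N while [kap] stays
   1. *)
pose phi := tp_phi T; have [x [xE xk xb _]] := tau phi.
pose ph := (x^-1 * phi)%g.
have split_g g y : in_GE T N y -> b y N = b g N -> in_GB T N (y^-1 * g)%g.
  move=> yE yb; rewrite /in_GB tp_bM bV.
  transitivity ((- eps y^-1%g * b y + eps y^-1%g * b y) N).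
    by apply: padic_congrD => //; apply: padic_congrM.
  by rewrite mulNr addNr padic_zeroE.
have phB : in_GB T N ph by apply: split_g.
have phk : kap ph = 1 by rewrite tp_kapM kapV xk oppr0 add0r tp_kap_phi.
have [c0 c00 Rph] := degree0_part phB.
have wV g : weight_mx g * weight_mx g^-1%g = 1 by rewrite -weight_mxM mulgV weight_mx1.
have wVl g : weight_mx g^-1%g * weight_mx g = 1 by rewrite -weight_mxM mulVg weight_mx1.
pose y0 := c0 * weight_mx ph^-1%g.
have c0E : c0 = y0 * weight_mx ph by rewrite -mulrA wVl mulr1.
have y0g : graded 0 y0.
  move=> i j; rewrite /y0 -mulmxE mul_mx_diag mxE => h; apply: c00.
  by apply: contraNneq h => ->; rewrite mul0r.
clearbody y0.
have y0w g : weight_mx g * y0 = y0 * weight_mx g.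
  apply/matrixP => i j; rewrite -!mulmxE mul_mx_diag mul_diag_mx !mxE mulrC.
  by have [->|/y0g ->] := eqVneq (y0 i j) 0; rewrite ?mulr0 ?mul0r // addn0.
have y0wX g i : weight_mx g * y0 ^+ i = y0 ^+ i * weight_mx g := commrX i (y0w g).
have RphX i : R (ph ^+ i)%g = outer n' (y0 ^+ i * weight_mx (ph ^+ i)%g) * thi (ph ^+ i)%g.
  elim: i => [|i IH].
    by rewrite !expg0 R1 expr0 weight_mx1 // mulr1 outer1 mul1r /thi th1.
  rewrite expgS RM IH Rph mulOT c0E; congr (outer _ _ * _).
  transitivity (y0 * ((weight_mx ph * y0 ^+ i) * weight_mx (ph ^+ i)%g)); first by rewrite !mulrA.
  rewrite y0wX (weight_mxM ph) (exprS y0).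
  by rewrite -(mulrA (y0 ^+ i)) (mulrA y0).
have kap_GP g : in_GB T N g -> kap g M = 0%N -> R g = outer n' (weight_mx g) * thi g.
  by move=> gB /MP g1; rewrite R_model // model_thi.
have GBX i g : in_GB T N g -> in_GB T N (g ^+ i)%g.
  by move=> gB; elim: i => [|i IH]; rewrite ?expg0 ?expgS; [apply: in_GB1 | apply: in_GBM].
have RGB g : in_GB T N g -> R g = outer n' (y0 ^+ (kap g M) * weight_mx g) * thi g.
  move=> gB; pose r := kap g M; pose h := ((ph ^+ r)^-1 * g)%g.
  have gE : g = (ph ^+ r * h)%g by rewrite mulgA mulgV mul1g.
  have hB : in_GB T N h by apply: in_GBM => //; apply/in_GBV/GBX.
  have hk : kap h M = 0%N.
    rewrite tp_kapM kapV kapX phk mulr1 addrC; apply/(padic_congr_sub _ _ _).1.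
    exact: padic_congr_nat.
  rewrite -/r {1}gE RM RphX (kap_GP h hB hk) mulOT -gE -mulrA -weight_mxM -gE.
  by [].
have wW g : weight_mx g \is a GRing.unit by apply/unitrP; exists (weight_mx g^-1%g).
exists Nn, y0, M; split.
- by split.
(* Both y0 and the weights enter c0. The matrix c0 conjugates [Nn] by the factor chi(ph), and the
   weights account for all of it, so y0 commutes with [Nn]. *)
- split=> //; have := conj ph c0 phB Rph; rewrite c0E => e.
  have wN : weight_mx ph * Nn = chi ph *: (Nn * weight_mx ph).
    rewrite -!mulmxE /weight_mx mul_mx_diag mul_diag_mx; apply/matrixP => i j; rewrite !mxE.
    have [->|/Nn1 ->] := eqVneq (Nn i j) 0; first by rewrite !mulr0 mul0r mulr0.
    by rewrite exprD expr1; ring.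
  apply: (mulIr (wW ph)); apply: (scalerI (chi0 ph)).
  by rewrite -!mulrA -e -mulrA wN -scalerAr.
- have h : R (ph ^+ (l ^ M))%g = outer n' (weight_mx (ph ^+ (l ^ M))%g) * thi (ph ^+ (l ^ M))%g.
    apply: kap_GP; first exact: GBX.
    by rewrite kapX phk mulr1 (padic_natE l_pr) modnn.
  move: h; rewrite RphX => /outer_thi_inj; rewrite -[RHS]mul1r; exact: mulIr.
move=> g; have [y [yE yk yb Ry]] := tau g.
have gE : g = (y * (y^-1 * g))%g by rewrite mulgA mulgV mul1g.
have hB := split_g g y yE yb.
have kE : kap (y^-1 * g)%g = kap g by rewrite tp_kapM kapV yk oppr0 add0r.
have wE : weight_mx (y^-1 * g)%g = weight_mx g.
  have y1 : chi y = 1 by rewrite chi_def (padic_congr_le N_gt0 yE) level1_1.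
  by rewrite {2}gE weight_mxM (weight_mx1 y1) mul1r.
by rewrite {1}gE RM Ry (RGB _ hB) mulOT -gE kE wE mulrA.
Qed.

End NormalForm.

(** * Graded Jordan form of a nilpotent matrix *)

Section Strings.
Variables (k : fieldType) (m' : nat).
Local Notation m := m'.+1.
Local Notation rV := 'rV[k]_m.
Variables (w : 'I_m -> nat) (N : 'M[k]_m).
Hypothesis N_graded : forall i j, N i j != 0 -> w i = (w j + 1)%N.
Hypothesis N_nilp : N ^+ m = 0.
Implicit Types (u v : rV) (U : {vspace rV}) (X L : seq rV).

Definition homogeneous u := exists c, forall j, u 0 j != 0 -> w j = c.

Lemma homog_mulN c u : (forall j, u 0 j != 0 -> w j = c) ->
  forall j, (u *m N) 0 j != 0 -> (w j + 1)%N = c.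
Proof.
move=> uc j; rewrite mxE => h.
have [i] : exists i, u 0 i * N i j != 0.
  apply/existsP; apply: contraNT h; rewrite negb_exists => /forallP h0.
  by rewrite big1 // => i _; apply/eqP; rewrite -[_ == _]negbK.
by rewrite mulf_eq0 negb_or => /andP[/uc <- /N_graded ->].
Qed.

Lemma homog_mulX c u a : (forall j, u 0 j != 0 -> w j = c) ->
  forall j, (u *m N ^+ a) 0 j != 0 -> (w j + a)%N = c.
Proof.
elim: a c u => [|a IH] c u uc j; first by rewrite expr0 mulmx1 addn0; apply: uc.
rewrite exprS -mulmxE mulmxA => h; have := homog_mulN uc.
case: c uc => [|c] uc uc'.
  have z : u *m N = 0.
    by apply/rowP => i; rewrite [RHS]mxE; apply/eqP; apply: contraT => /uc'; lia.
  by move: h; rewrite z mul0mx mxE eqxx.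
have uc2 i : (u *m N) 0 i != 0 -> w i = c by move=> /uc'; lia.
by rewrite addnS (IH _ _ uc2 j h).
Qed.

Definition chain L := forall i, (i < size L)%N ->
  L`_i *m N = 0 \/ (i.+1 < size L)%N /\ L`_i *m N = L`_i.+1.

Lemma chain_cat L1 L2 : chain L1 -> chain L2 -> chain (L1 ++ L2).
Proof.
move=> c1 c2 i; rewrite size_cat !nth_cat => lt.
have [i1|i1] := ltnP i (size L1).
  have [->|[j1 ->]] := c1 i i1; [by left | right].
  by rewrite j1; split=> //; apply: leq_trans j1 (leq_addr _ _).
have lt2 : (i - size L1 < size L2)%N by rewrite ltn_subLR.
have [->|[j2 ->]] := c2 _ lt2; [by left | right].
have -> : (i.+1 < size L1)%N = false by lia.
by rewrite subSn //; split=> //; lia.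
Qed.

Lemma span_sumE X u : u \in <<X>>%VS -> u = \sum_(i < size X) coord (in_tuple X) i u *: X`_i.
Proof. by move=> uX; apply: (coord_span (X := in_tuple X)). Qed.

(** A longest string v, vN, ..., vN^p is split off and the induction runs on the complement of the
    vectors u with f(u N^j) = 0 for all j <= p. This complement is stable under N, and it is spanned
    by homogeneous vectors because f is a coordinate form. *)
Lemma string_basis d U X : (\dim U <= d)%N -> U = <<X>>%VS ->
  (forall x, x \in X -> homogeneous x) -> (forall x, x \in X -> x *m N \in U) ->
  exists L, [/\ basis_of U L, chain L & forall x, x \in L -> homogeneous x].
Proof.
elim: d U X => [|d IH] U X dU UX Xh XN.
  exists [::]; split=> //; rewrite basisEdim span_nil andbT.
  by rewrite subv0 -dimv_eq0 -leqn0 dU.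
have UN u : u \in U -> u *m N \in U.
  rewrite {1}UX => /span_sumE ->; rewrite mulmx_suml rpred_sum // => i _.
  by rewrite -scalemxAl rpredZ //; apply: XN; rewrite mem_nth.
have UNX a u : u \in U -> u *m N ^+ a \in U.
  by elim: a u => [|a IHa] u uU; rewrite ?expr0 ?mulmx1 // exprS -mulmxE mulmxA IHa // UN.
have [z|nz] := boolP (all (fun x => x == 0) X).
  exists [::]; split=> //; rewrite basisEdim span_nil andbT subv0 UX.
  rewrite -subv0; apply/span_subvP => x xX; by rewrite memv0 (allP z).
have exP : exists p, has (fun x => x *m N ^+ p != 0) X.
  by exists 0%N; rewrite -has_predC /= in nz; apply: sub_has nz => x; rewrite expr0 mulmx1.
have ubP p : has (fun x => x *m N ^+ p != 0) X -> (p <= m)%N.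
  move=> /hasP[x _ h]; rewrite leqNgt; apply: contra h => mp.
  by rewrite -(subnK (ltnW mp)) exprD N_nilp mulr0 mulmx0.
case: (ex_maxnP exP ubP) => p /hasP[v vX vp] maxp.
have Np u : u \in U -> u *m N ^+ p.+1 = 0.
  rewrite {1}UX => /span_sumE ->; rewrite mulmx_suml big1 // => i _.
  rewrite -scalemxAl; suff -> : X`_i *m N ^+ p.+1 = 0 by rewrite scaler0.
  apply/eqP; apply: contraT => h; suff : (p < p)%N by rewrite ltnn.
  by apply: maxp; apply/hasP; exists X`_i; rewrite ?mem_nth.
have [j0 vj0] : exists j0, (v *m N ^+ p) 0 j0 != 0.
  apply/existsP; apply: contraNT vp; rewrite negb_exists => /forallP h0.
  by apply/eqP/rowP => j; rewrite [RHS]mxE; apply/eqP; rewrite -[_ == _]negbK; apply: h0.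
have [c vc] := Xh v vX.
have wj0 : (w j0 + p)%N = c by apply: homog_mulX vc _ vj0.
(* The coordinate j0 has a definite weight, so f takes the value 1 at vN^p and 0 at the other
   vN^i. *)
pose f u := u 0 j0 / (v *m N ^+ p) 0 j0.
have fD u1 u2 : f (u1 + u2) = f u1 + f u2 by rewrite /f mxE mulrDl.
have fZ a u : f (a *: u) = a * f u by rewrite /f mxE mulrA.
have f0 : f 0 = 0 by rewrite /f mxE mul0r.
have fS (I : Type) (r : seq I) (P : pred I) (F : I -> rV) : f (\sum_(i <- r | P i) F i) = \sum_(i <- r | P i) f (F i).
  by elim/big_ind2: _ => [|x1 x2 y1 y2 <- <-|].
have fB u1 u2 : f (u1 - u2) = f u1 - f u2 by rewrite -scaleN1r fD fZ mulN1r.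
have fv i : f (v *m N ^+ i) = (i == p)%:R.
  rewrite /f; have [->|ip] := eqVneq i p; first by rewrite divff.
  have [->|h] := eqVneq ((v *m N ^+ i) 0 j0) 0; first by rewrite mul0r.
  by case/eqP: ip; have := homog_mulX vc h; lia.
have vU : v \in U by rewrite UX memv_span.
have vUN a : v *m N ^+ a \in U by apply: UNX.
(* The projection along the string onto that complement. It commutes with N, since N^(p+1) kills
   U. *)
pose pr u := u - \sum_(a < p.+1) f (u *m N ^+ (p - a)) *: (v *m N ^+ a).
have prD u1 u2 : pr (u1 + u2) = pr u1 + pr u2.
  rewrite /pr addrACA -opprD -big_split /=; congr (_ - _); apply: eq_bigr => a _.
  by rewrite mulmxDl fD scalerDl.
have prZ a u : pr (a *: u) = a *: pr u.
  rewrite /pr scalerBr scaler_sumr; congr (_ - _); apply: eq_bigr => i _.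
  by rewrite -scalemxAl fZ scalerA.
have prS (I : Type) (r : seq I) (P : pred I) (F : I -> rV) : pr (\sum_(i <- r | P i) F i) = \sum_(i <- r | P i) pr (F i).
  elim/big_ind2: _ => [|x1 x2 y1 y2 <- <-|] //.
  rewrite /pr big1 ?subr0 // => a _; by rewrite mul0mx f0 scale0r.
have prN u : u \in U -> pr u *m N = pr (u *m N).
  move=> uU; rewrite /pr mulmxBl mulmx_suml; congr (_ - _).
  rewrite big_ord_recr /= -scalemxAl -mulmxA mulmxE -exprSr Np // scaler0 addr0.
  rewrite [RHS]big_ord_recl /= subn0 -mulmxA mulmxE -exprS Np // f0 scale0r add0r.
  apply: eq_bigr => a _; rewrite /bump /= add1n -scalemxAl; congr (f _ *: _).
    by rewrite -mulmxA mulmxE -exprS subnSK.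
  by rewrite -mulmxA mulmxE -exprSr.
have fpr u j : (j <= p)%N -> u \in U -> f (pr u *m N ^+ j) = 0.
  move=> jp uU; rewrite mulmxBl fB mulmx_suml fS.
  have pj : (p - j < p.+1)%N by rewrite ltnS leq_subr.
  rewrite (bigD1 (Ordinal pj)) //= big1 => [|a aj].
    by rewrite -scalemxAl fZ -mulmxA mulmxE -exprD fv subnK // eqxx mulr1 subKn // addr0 subrr.
  rewrite -scalemxAl fZ -mulmxA mulmxE -exprD fv (_ : (_ == _) = false) ?mulr0 //.
  by apply/negbTE; apply: contra aj => /eqP e; rewrite -val_eqE /=; apply/eqP; lia.
pose X' := [seq pr x | x <- X]; pose U' := <<X'>>%VS.
have prU u : u \in U -> pr u \in U'.
  rewrite {1}UX => /span_sumE ->; rewrite prS rpred_sum // => i _; rewrite prZ rpredZ //.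
  by apply: memv_span; apply: map_f; rewrite mem_nth.
have U'U : (U' <= U)%VS.
  apply/span_subvP => _ /mapP[x xX ->]; have xU : x \in U by rewrite UX memv_span.
  by apply: rpredB xU _; apply: rpred_sum => a _; apply: rpredZ (vUN a).
have U'f u j : (j <= p)%N -> u \in U' -> f (u *m N ^+ j) = 0.
  move=> jp /span_sumE ->; rewrite mulmx_suml fS big1 // => i _; rewrite -scalemxAl fZ.
  have : X'`_i \in X' by rewrite mem_nth.
  by move=> /mapP[x xX ->]; rewrite fpr ?mulr0 // UX memv_span.
pose S := [seq v *m N ^+ a | a <- iota 0 p.+1].
have szS : size S = p.+1 by rewrite size_map size_iota.
have nthS a : (a <= p)%N -> S`_a = v *m N ^+ a.
  by move=> ap; rewrite (nth_map 0%N) ?size_iota // nth_iota.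
have fS' (cc : 'I_(size S) -> k) (a : 'I_(size S)) : f ((\sum_i cc i *: S`_i) *m N ^+ (p - a)) = cc a.
  have lt (i : 'I_(size S)) : (i <= p)%N by rewrite -ltnS -szS.
  rewrite mulmx_suml fS (bigD1 a) // big1 => [|i /andP[_ ia]].
    rewrite [LHS](addr0 (f _)) -scalemxAl fZ nthS // -mulmxA mulmxE -exprD fv.
    by rewrite subnKC // eqxx mulr1.
  rewrite -scalemxAl fZ nthS // -mulmxA mulmxE -exprD fv (_ : (_ == _) = false) ?mulr0 //.
  apply/negbTE; apply: contra ia => /eqP e; rewrite -val_eqE /=; apply/eqP.
  by move: (lt a) (lt i) e; move: (nat_of_ord a) (nat_of_ord i) => x y; lia.
have freeS : free (in_tuple S).
  apply/freeP => cc e a; rewrite -(fS' cc a) (_ : \sum_i _ = 0) ?mul0mx ?f0 //.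
have dir : directv (U' + <<S>>).
  apply/directv_addP/eqP; rewrite -subv0; apply/subvP => u; rewrite memv_cap => /andP[uU' /span_sumE uS].
  rewrite memv0 uS big1 // => a _.
  have ap : (a <= p)%N by rewrite -ltnS -szS.
  have := U'f u (p - a)%N (leq_subr _ _) uU'.
  rewrite {1}uS => h; have := fS' (fun i => coord (in_tuple S) i u) a.
  by rewrite h => <-; rewrite scale0r.
have UE : U = (U' + <<S>>)%VS.
  apply/eqP; rewrite eqEsubv; apply/andP; split; last first.
    rewrite subv_add U'U; apply/span_subvP => _ /mapP[a _ ->]; exact: vUN.
  apply/subvP => u uU; rewrite -[u](subrK (\sum_(a < p.+1) f (u *m N ^+ (p - a)) *: (v *m N ^+ a))).
  apply: memv_add; first exact: prU.
  rewrite rpred_sum // => a _; rewrite rpredZ //; apply: memv_span; apply/mapP; exists (a : nat) => //.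
  rewrite mem_iota leq0n add0n; exact: (ltn_ord a).
have dU' : (\dim U' <= d)%N.
  rewrite -ltnS; apply: leq_trans dU; rewrite UE (directvP dir) /= -[X in (X < _)%N]addn0 ltn_add2l.
  have /eqP e : \dim <<S>> == size S := freeS; by rewrite e szS.
have [L' [bL' cL' hL']] : exists L, [/\ basis_of U' L, chain L & forall x, x \in L -> homogeneous x].
  apply: IH dU' erefl _ _ => [_ /mapP[x xX ->]|_ /mapP[x xX ->]]; last first.
    by rewrite prN ?prU ?XN // UX memv_span.
  have [cx xc] := Xh x xX; exists cx => j; rewrite !mxE => h.
  have [xj|/xc //] := eqVneq (x 0 j) 0.
  move: h; rewrite xj add0r oppr_eq0 summxE => h.
  have [a] : exists a : 'I_p.+1, (f (x *m N ^+ (p - a)) *: (v *m N ^+ a)) 0 j != 0.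
    apply/existsP; apply: contraNT h; rewrite negb_exists => /forallP h0.
    by rewrite big1 // => a _; apply/eqP; rewrite -[_ == _]negbK.
  rewrite mxE mulf_eq0 negb_or => /andP[fx va].
  have := homog_mulX vc va; have ap : (a <= p)%N by rewrite -ltnS.
  have : (x *m N ^+ (p - a)) 0 j0 != 0 by apply: contraNneq fx => e; rewrite /f e mul0r.
  by move=> /(homog_mulX xc); move: ap wj0; clear; lia.
exists (L' ++ S); split.
- rewrite UE; apply: cat_basis => //.
  by rewrite basisEfree freeS subvv (eqP freeS) leqnn.
- apply: chain_cat => // i; rewrite szS ltnS => ip; rewrite nthS // -mulmxA mulmxE -exprSr.
  have [lt|] := ltnP i p; first by right; rewrite ltnS nthS.
  by move=> pi; left; have -> : i = p by [apply/eqP; rewrite eqn_leq ip]; apply: Np.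
move=> x; rewrite mem_cat => /orP[/hL' //|/mapP[a _ ->]].
exists (c - a)%N => j /(homog_mulX vc); lia.
Qed.

(** The rows of S are a basis made of strings of homogeneous vectors, w' i is the weight of row i,
    and d i tells whether N sends row i to the next one or to 0. *)
Lemma graded_jordan_form : exists (S : 'M[k]_m) (w' : 'I_m -> nat) (d : 'I_m -> bool),
  [/\ S \is a GRing.unit, forall i j, S i j != 0 -> w j = w' i
    & S * N = (\matrix_(i, j) (d i && (j == i.+1 :> nat))%:R) * S].
Proof.
pose X := [seq (delta_mx 0 j : rV) | j <- enum 'I_m].
have UX : fullv = <<X>>%VS.
  apply/eqP; rewrite eqEsubv subvf andbT; apply/subvP => u _; rewrite [u]row_sum_delta.
  by rewrite rpred_sum // => j _; rewrite rpredZ // memv_span // map_f // mem_enum.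
have [|||L [bL cL hL]] := @string_basis m fullv X _ UX.
- by rewrite dimvf /dim /= mul1n.
- move=> _ /mapP[j _ ->]; exists (w j) => i; rewrite mxE eqxx /=.
  by have [-> //|_] := eqVneq i j; rewrite eqxx.
- by move=> x _; rewrite memvf.
have sL : size L = m by have := size_basis (X := in_tuple L) bL; rewrite dimvf /dim /= mul1n.
pose S : 'M[k]_m := \matrix_(i < m) L`_i.
have rS i : row i S = L`_i by rewrite rowK.
have Lh (i : 'I_m) : homogeneous L`_i by apply: hL; rewrite mem_nth // sL.
have Su : S \is a GRing.unit.
  rewrite /GRing.unit /= -row_free_unit -kermx_eq0; apply/rowV0P => v /sub_kermxP vS.
  have fL := basis_free bL.
  have fT : free (tcast sL (in_tuple L)) by rewrite val_tcast.
  have h := (freeP fT) (fun i => v 0 i); apply/rowP => i; rewrite mxE; apply: h.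
  rewrite -[RHS]vS mulmx_sum_row; apply: eq_bigr => j _.
  by rewrite rS val_tcast.
have [w' w'P] : exists w' : 'I_m -> nat, forall i j : 'I_m, L`_i 0 j != 0 -> w j = w' i.
  exists (fun i : 'I_m => if [pick j | L`_i 0 j != 0] is Some j then w j else 0%N) => i j h.
  have [c hc] := Lh i; case: pickP => [j' h'|/(_ j)]; last by rewrite h.
  by rewrite (hc _ h) (hc _ h').
exists S, w', (fun i => L`_i *m N != 0); split=> //.
  by move=> i j; rewrite mxE => /w'P.
apply/row_matrixP => i; rewrite -!mulmxE !row_mul rS; apply/rowP => j.
rewrite [RHS]mxE; have iL : (i < size L)%N by rewrite sL.
have [e|[i1 e]] := cL i iL.
  by rewrite e [LHS]mxE big1 // => x _; rewrite !mxE e eqxx mul0r.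
rewrite sL in i1; rewrite (bigD1 (Ordinal i1)) //= big1 => [|x xi]; last first.
  by rewrite !mxE -[nat_of_ord x == _]/(x == Ordinal i1) (negPf xi) andbF mul0r.
rewrite addr0 e !mxE eqxx andbT e.
have -> : L`_i.+1 != 0; last by rewrite mul1r.
apply: contraTneq Su => z; apply/negP => Su.
have : row (Ordinal i1) S = 0 by rewrite rS.
move=> /(congr1 (fun r => r *m S^-1)); rewrite mul0mx -row_mul mulmxE divrr // => /rowP/(_ (Ordinal i1)).
by rewrite !mxE eqxx => /eqP; rewrite oner_eq0.
Qed.

End Strings.

(** A nilpotent Jordan matrix with entries 0 and 1, so that the same matrix exists over every
    coefficient ring. *)
Definition shift_mx (R : pzRingType) m (d : 'I_m -> bool) : 'M[R]_m :=
  \matrix_(i, j) (d i && (j == i.+1 :> nat))%:R.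

Definition hgraded (R : pzRingType) m (u v : 'I_m -> nat) d (A : 'M[R]_m) :=
  forall i j, A i j != 0 -> u i = (v j + d)%N.

Lemma hgradedM (R : pzRingType) m (u v x : 'I_m -> nat) d e (A B : 'M[R]_m) :
  hgraded u v d A -> hgraded v x e B -> hgraded u x (d + e) (A *m B).
Proof.
move=> hA hB i j; rewrite mxE => h; have [y] : exists y, A i y * B y j != 0.
  apply/existsP; apply: contraNT h; rewrite negb_exists => /forallP h0.
  by rewrite big1 // => y _; apply/eqP; rewrite -[_ == _]negbK.
move=> h'; have Ay : A i y != 0 by apply: contraNneq h' => ->; rewrite mul0r.
have By : B y j != 0 by apply: contraNneq h' => ->; rewrite mulr0.
by rewrite (hA _ _ Ay) (hB _ _ By); lia.
Qed.

Lemma hgraded_inv (R : comUnitRingType) m' (u v : 'I_m'.+1 -> nat) (S : 'M[R]_m'.+1) :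
  S \is a GRing.unit -> hgraded u v 0 S -> hgraded v u 0 S^-1.
Proof.
move=> Su Sg i j; pose D := diag_mx (\row_x (v x == v i)%:R : 'rV[R]_m'.+1).
pose D' := diag_mx (\row_x (u x == v i)%:R : 'rV[R]_m'.+1).
have SD : S * D = D' * S.
  rewrite -!mulmxE mul_mx_diag mul_diag_mx; apply/matrixP => x y; rewrite !mxE mulrC.
  by have [->|/Sg ->] := eqVneq (S x y) 0; rewrite ?mulr0 // addn0.
have : (D * S^-1) i j = (S^-1 * D') i j.
  by congr (fun A : 'M_m'.+1 => A i j); apply: (mulrI Su); rewrite !mulrA SD mulrK // divrr // mul1r.
rewrite -!mulmxE mul_mx_diag mul_diag_mx !mxE eqxx mul1r addn0 => e; apply: contraNeq => ne.
by rewrite eq_sym in ne; rewrite e (negPf ne) mulr0.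
Qed.

Lemma conj_mulr (R : pzRingType) (u u' x y : R) : u * u' = 1 ->
  u' * (x * y) * u = (u' * x * u) * (u' * y * u).
Proof. by move=> e; rewrite !mulrA -(mulrA _ u u') e mulr1. Qed.

Lemma missing_residue m (s : nat) (c : 'I_m -> nat) : (m < s)%N ->
  exists2 r, (r < s)%N & forall i, (c i %% s)%N != r.
Proof.
move=> ms; have s0 : (0 < s)%N by apply: leq_ltn_trans ms.
pose f (i : 'I_m) : 'I_s := Ordinal (ltn_pmod (c i) s0).
have [r rf] : exists r : 'I_s, r \notin codom f.
  apply/existsP; apply: contraLR ms; rewrite negb_exists => /forallP h; rewrite -leqNgt.
  have <- : #|codom f| = s.
    by rewrite (eq_card (B := 'I_s)) ?card_ord // => r; move: (h r); rewrite negbK inE => ->.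
  by apply: leq_trans (leq_image_card f _) _; rewrite card_ord.
exists r => // i; apply/negP => /eqP e; case/negP: rf.
have -> : r = f i by apply: val_inj.
exact: codom_f.
Qed.

Lemma irreducible_scale (G : groupType) (k : fieldType) d (rho : G -> 'M[k]_d) (c : G -> k) :
  (forall g, c g != 0) -> irreducible rho -> irreducible (fun g => c g *: rho g).
Proof.
move=> c0 [d0 irr]; split=> // U hU; apply: irr => g; have := hU g.
by rewrite linearZ /= -scalemxAr (eqmx_scale _ (c0 g)).
Qed.

(** * The structure of the residual representation *)

Section Glue.
Variables (F E : fieldType) (iota : F -> E) (l : nat) (l_pr : prime l).
Variables (sigma : abs_gal iota) (inert : abs_gal iota -> Prop).
Variable T : tame_parameters l_pr sigma inert.
Local Notation G := (abs_gal iota).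
Local Notation b := (tp_b T).
Local Notation kap := (tp_kap T).
Variables (k : finFieldType) (chl : l \in [pchar k]) (m' n' : nat).
Local Notation m := m'.+1.
Local Notation n := n'.+1.
Local Notation BM := 'M['M[k]_n]_m.
Local Notation chi := (chi T k).
Local Notation om := (chi sigma).
Variables (theta : G -> 'M[k]_n) (theta_rep : is_rep theta).
Hypothesis theta_cont : discrete_continuous theta.
Hypothesis theta_irr : absolutely_irreducible theta.
Hypothesis l_ndvd_n : ~~ (l %| n)%N.
Hypothesis chi_gen : forall g, exists i, chi g = om ^+ i.
Variables (s : nat) (s_gt0 : (0 < s)%N) (X : 'M[k]_n).
Hypothesis X_unit : X \is a GRing.unit.
Hypothesis X_int : intertwines theta chi s X.
Hypothesis s_min : forall a z, (0 < a)%N -> z \is a GRing.unit -> intertwines theta chi a z -> (s <= a)%N.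
Variables (f : nat) (f_prim : f.-primitive_root (om ^+ s)).
Variables (s' : nat) (s'_prim : s'.-primitive_root om).
Hypothesis l_ndvd_s' : ~~ (l %| s')%N.
Hypothesis m_le : (m <= l)%N.
Hypothesis m_s : (m + 2 <= s)%N.
Variables (rhobar : G -> 'M[k]_(m * n)) (rhobar_rep : is_rep rhobar).
Hypothesis rhobar_cont : discrete_continuous rhobar.
Variable a : 'I_m -> int.
Hypothesis rhobar_ss : is_semisimplification rhobar
  (rep_sum (fun (i : 'I_m) g => chi g ^ (a i) *: theta g)).

Let chi0 g : chi g != 0.
Proof.
apply: contraTneq (oner_neq0 k) => c0; rewrite -(level1_1 l_pr chl) -(epsV T g).
by rewrite level1_natr // -/(chi g) c0 mul0r eqxx.
Qed.

Lemma bkE N0 g : bk T k N0 g = (b g 1%N)%:R.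
Proof.
have N1 : (1 <= maxn N0 1)%N by rewrite leq_maxr.
rewrite /bk -(natr_modl chl (b g (maxn N0 1))) -[in RHS](natr_modl chl (b g 1%N)).
by have := padic_coh (b g) 1 (maxn N0 1 - 1); rewrite addnC subnKC // expn1 => ->.
Qed.

(** The m exponents leave some residue r modulo s free, so each has a representative w_i in r+1,
    ..., r+s-1 and any two of these differ by at most s - 2. The remaining factor chi^(s e) is
    absorbed by conjugating with X^e. *)
Lemma diagonal_form : exists (P Q : BM) (w : 'I_m -> nat) , [/\ P * Q = 1 /\ Q * P = 1,
  forall i j, (w i + 2 <= w j + s)%N, forall g, upper (Q * blk (rhobar g) * P)
  & forall g i, (Q * blk (rhobar g) * P) i i = chi g ^+ w i *: theta g].
Proof.
have irr (i : 'I_m) : irreducible (fun g => chi g ^ (a i) *: theta g).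
  apply: irreducible_scale => [g|]; first by rewrite expfz_eq0 negb_and chi0 orbT.
  have := theta_irr (GRing.RMorphism.clone _ _ (idfun : k -> k) _).
  have -> // : (fun g => map_mx idfun (theta g)) = theta.
  by apply/funext => g; rewrite map_mx_id.
have [P [Q [al [S [PQ QP Su blkP]]]]] := block_form irr rhobar_ss.
have sf0 : ((s * f)%:Z != 0)%R by rewrite -lt0n muln_gt0 s_gt0 (f_gt0 f_prim).
have s0 : (s%:Z != 0)%R by rewrite -lt0n.
pose res i := `|(a (al i) %% s)%Z|%N.
have resE i : ((res i)%:Z = (a (al i) %% s)%Z)%R by rewrite /res gez0_abs // modz_ge0.
have res_lt i : (res i < s)%N by rewrite -ltz_nat resE; have := ltz_pmod (a (al i)) (d := s%:Z); rewrite ltz_nat s_gt0 => /(_ isT).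
have [r rs rP] : exists2 r, (r < s)%N & forall i, (res i %% s)%N != r.
  by apply: missing_residue; lia.
pose w i := (r + 1 + ((res i + s - r - 1) %% s))%N.
have w_hi i : (w i <= r + s - 1)%N.
  have h := rP i; rewrite modn_small // in h; rewrite /w.
  have [lt|] := ltnP (res i) r.
    by rewrite modn_small; have := res_lt i; lia.
  rewrite leq_eqVlt eq_sym (negPf h) /= => lt.
  have -> : (res i + s - r - 1 = (res i - r - 1) + s)%N by lia.
  by rewrite modnDr modn_small; have := res_lt i; lia.
have w_lo j : (r + 1 <= w j)%N by apply: leq_addr.
have w_window i j : (w i + 2 <= w j + s)%N.
  move: (w_hi i) (w_lo j) m_s; move: (w i) (w j); clear; lia.
have [e eP] : exists e : 'I_m -> nat, forall g i, chi g ^ (a (al i)) = chi g ^+ w i * chi g ^+ (s * e i).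
  suff /choice[e eP] : forall i, exists e : nat, forall g, chi g ^ (a (al i)) = chi g ^+ w i * chi g ^+ (s * e).
    by exists e.
  move=> i; pose D := (a (al i) - (w i)%:Z)%R.
  have sD : (s%:Z %| D)%Z.
    have wE : exists c : nat, (w i + s * c = res i + s)%N.
      exists ((res i + s - r - 1) %/ s)%N; rewrite /w.
      by have := divn_eq (res i + s - r - 1) s; have := rs; rewrite (mulnC s); lia.
    have [c cE] := wE; have := divz_eq (a (al i)) s; rewrite -resE => aE.
    apply/dvdzP; exists ((a (al i) %/ s)%Z + c%:Z - 1)%R.
    have : ((w i)%:Z + s%:Z * c%:Z = (res i)%:Z + s%:Z)%R by rewrite -PoszM -!PoszD cE.
    rewrite /D {1}aE => h.
    have {h} -> : (res i)%:Z = ((w i)%:Z + s%:Z * c%:Z - s%:Z)%R by rewrite h addrK.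
    ring.
  (* D is reduced modulo s f, where chi is periodic, to make the exponent of X a natural number. *)
  have [q qE] : exists q : nat, ((s * q)%:Z = (D %% (s * f)%:Z)%Z)%R.
    have : (s%:Z %| (D %% (s * f)%:Z)%Z)%Z.
      have := divz_eq D (s * f)%:Z => DE.
      have /dvdzP[c cD] := sD; apply/dvdzP; exists (c - (D %/ (s * f)%:Z)%Z * f%:Z)%R.
      rewrite mulrBl -cD [in X in (X - _)%R]DE PoszM; ring.
    case/dvdzP => q qE; exists `|q|%N; rewrite qE PoszM gez0_abs 1?mulrC //.
    have := modz_ge0 D sf0; by rewrite qE Num.Theory.pmulr_lge0 // ltz_nat.
  exists q => g; have e1 : a (al i) = ((w i)%:Z + (s * q)%:Z + (s * f)%:Z * (D %/ (s * f)%:Z)%Z)%R.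
    have DE := divz_eq D (s * f)%:Z; rewrite -qE in DE.
    have -> : a (al i) = ((w i)%:Z + D)%R by rewrite /D addrC subrK.
    rewrite [in LHS]DE; ring.
  rewrite e1 !expfzDr ?chi0 // -exprz_exp.
  have -> : chi g ^ (s * f)%:Z = 1 := chi_sf chi_gen f_prim g.
  by rewrite exp1rz mulr1.
pose Z i := X ^+ e i * S i.
have Zu i : Z i \is a GRing.unit by rewrite unitrMl ?unitrX.
pose DZ : BM := diag_mx (\row_i Z i); pose DV : BM := diag_mx (\row_i (Z i)^-1).
have ZV : DZ * DV = 1.
  apply/matrixP => i j; rewrite -mulmxE mul_diag_mx !mxE.
  by case: eqP => [->|_]; rewrite ?mulr1n ?divrr // !mulr0n mulr0.
have VZ : DV * DZ = 1.
  apply/matrixP => i j; rewrite -mulmxE mul_diag_mx !mxE.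
  by case: eqP => [->|_]; rewrite ?mulr1n ?mulVr // !mulr0n mulr0.
have entry g i j : (DZ * Q * blk (rhobar g) * (P * DV)) i j = Z i * (Q * blk (rhobar g) * P) i j * (Z j)^-1.
  have ent (A : BM) : (DZ * A * DV) i j = Z i * A i j * (Z j)^-1.
    by rewrite -!mulmxE mul_mx_diag mul_diag_mx !mxE.
  by rewrite -ent !mulrA.
exists (P * DV), (DZ * Q), w; split=> //.
- by rewrite -(mulrA P) (mulrA DV) VZ mul1r PQ -(mulrA DZ) (mulrA Q) QP mul1r ZV.
- by move=> g i j ji; rewrite entry (blkP g i j).1 // mulr0 mul0r.
move=> g i; rewrite entry; have := (blkP g i i).2; set Di := (_ * P) i i => h.
have {}h : chi g ^+ w i *: theta g * Z i = Z i * Di.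
  rewrite /Z -(mulrA (X ^+ _)) -h eP -!scalerAl -scalerAr -scalerA; congr (_ *: _).
  by rewrite !mulrA (XE_int X_int) // -scalerAl.
by rewrite -h mulrK.
Qed.

(** The normal form, conjugated by the graded change of basis that puts the nilpotent matrix into
    Jordan form. *)
Lemma structure_k : exists (w : 'I_m -> nat) (d : 'I_m -> bool) (P Q : BM) (y0 : 'M[k]_m) (M : nat),
  let Pi := shift_mx k d in
  [/\ P * Q = 1 /\ Q * P = 1, forall i j, (w i + 2 <= w j + s)%N,
      graded w 1 Pi /\ (tp_b T (tp_t T) = 1 \/ Pi = 0 /\ forall g, b g = 0),
      [/\ graded w 0 y0, y0 * Pi = Pi * y0 & y0 ^+ (l ^ M) = 1]
    & forall g, blk (rhobar g) = P * (outer n' (expm (b g 1%N)%:R Pi * y0 ^+ (kap g M) * weight_mx T k w g)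
                   * inner m' (theta g)) * Q].
Proof.
have [P [Q [w [[PQ QP] w_window R0_upper R0_diag]]]] := diagonal_form.
have [gT [q [N0 [qM qE qc q_tors]]]] := joint_quotient T chl theta_rep theta_cont rhobar_rep rhobar_cont.
have [rh1 rhM] := rhobar_rep.
pose R0 g := Q * blk (rhobar g) * P.
have R0M g h : R0 (g * h)%g = R0 g * R0 h.
  by rewrite /R0 rhM blkM; apply: conj_mulr.
have R01 : R0 1%g = 1 by rewrite /R0 rh1 blk1 mulr1.
have qE' g h : q g = q h -> [/\ theta g = theta h, R0 g = R0 h & chi g = chi h].
  by case/qE => e1 e2 e3; split=> //; rewrite /R0 e2.
have [u [u' [uu' u'u [uup u'up] [ud u'd] um]]] := diagonalize_tame chl theta_rep R0M R0_upper R0_diag qM qE' q_tors.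
pose R g := u' * R0 g * u.
have R1' : R 1%g = 1 by rewrite /R R01 mulr1.
have RM g h : R (g * h)%g = R g * R h.
  by rewrite /R R0M; apply: conj_mulr.
have Rup g : upper (R g) by apply: upperM => //; apply: upperM => //; apply: R0_upper.
have Rd g i : R g i i = chi g ^+ w i *: theta g.
  have R0u : upper (R0 g) by apply: R0_upper.
  have uR : upper (u' * R0 g) by apply: upperM.
  by rewrite /R upper_diagM // upper_diagM // u'd ud mul1r mulr1 R0_diag.
have [Nn [y0 [M [[Nn1 Nm] [y00 yN] yM RE]]]] := normal_form chl theta_rep theta_irr l_ndvd_n chi_gen s_gt0 X_unit X_int
  s_min f_prim s'_prim l_ndvd_s' m_le w_window R1' RM Rup Rd um.
have {RE} RE g : R g = outer n' (expm (b g 1%N)%:R Nn * y0 ^+ kap g M * weight_mx T k w g) * inner m' (theta g).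
  by rewrite -(bkE N0 g); exact: RE.
(* When b vanishes identically the nilpotent matrix does not occur in R and is replaced by 0. This
   gives the alternative on Pi that [intertwiner] relies on. *)
have [N' [N'1 N'm yN' bN' {}RE]] : exists N', [/\ graded w 1 N', N' ^+ m = 0, y0 * N' = N' * y0,
    b (tp_t T) = 1 \/ N' = 0 /\ forall g, b g = 0 &
    forall g, R g = outer n' (expm (b g 1%N)%:R N' * y0 ^+ kap g M * weight_mx T k w g) * inner m' (theta g)].
  case: (tp_b_t T) => bt; first by exists Nn; split=> //; left.
  exists 0; split; [by move=> i j; rewrite mxE eqxx | by rewrite expr0n | by rewrite mulr0 mul0r | by right|].
  by move=> g; rewrite RE bt padic_zeroE !expm_c0.
have [S [w' [d [Su Sw SN]]]] := graded_jordan_form N'1 N'm.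
pose Pi := shift_mx k d; rewrite -/(shift_mx k d) -/Pi in SN.
have Sg : hgraded w' w 0 S by move=> i j /Sw; rewrite addn0.
have SVg : hgraded w w' 0 S^-1 := hgraded_inv Su Sg.
have SP : Pi = S * N' * S^-1 by rewrite SN mulrK.
have expS c : S * expm c N' = expm c Pi * S.
  have SX i : S * N' ^+ i = Pi ^+ i * S.
    by elim: i => [|i IH]; rewrite ?expr0 ?mul1r ?mulr1 // !exprS mulrA SN -!mulrA IH.
  rewrite /expm mulr_sumr mulr_suml; apply: eq_bigr => i _.
  by rewrite -scalerAr SX scalerAl.
pose y := S * y0 * S^-1.
have Sy : S * y0 = y * S by rewrite /y divrK.
have SyX i : S * y0 ^+ i = y ^+ i * S.
  by elim: i => [|i IH]; rewrite ?expr0 ?mul1r ?mulr1 // !exprS mulrA Sy -!mulrA IH.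
have SW g : S * weight_mx T k w g = weight_mx T k w' g * S.
  rewrite -!mulmxE mul_mx_diag mul_diag_mx; apply/matrixP => x z; rewrite !mxE mulrC.
  by have [->|/Sw ->] := eqVneq (S x z) 0; rewrite ?mulr0.
have oSV : outer n' S * outer n' S^-1 = 1 by rewrite -outerM divrr // outer1.
have oVS : outer n' S^-1 * outer n' S = 1 by rewrite -outerM mulVr // outer1.
exists w', d, (P * (u * outer n' S^-1)), (outer n' S * u' * Q), y, M; split.
- split; rewrite !mulrA.
    by rewrite -!mulrA (mulrA (outer _ _)) oVS mul1r (mulrA u) uu' mul1r.
  by rewrite -!mulrA (mulrA Q) QP mul1r (mulrA u') u'u mul1r.
- have ex i : exists j, w' i = w j.
    have [j h] : exists j, S i j != 0.
      apply/existsP; apply: contraTT Su; rewrite negb_exists => /forallP h0.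
      apply/negP => Su; have := congr1 (fun A : 'M_m => A i i) (divrr Su).
      rewrite !mxE eqxx big1 => [/eqP|x _]; first by rewrite eq_sym oner_eq0.
      by rewrite (eqP (negPn (h0 x))) mul0r.
    by exists j; rewrite (Sw _ _ h).
  by move=> i j; have [i' ->] := ex i; have [j' ->] := ex j.
- split; last by case: bN' => [|[z bz]]; [left|right; rewrite -/Pi SP z mulr0 mul0r].
  by move=> i j; rewrite -/Pi SP => h; have := hgradedM (hgradedM Sg N'1) SVg h; rewrite add0n addn0.
- split.
  + by move=> i j h; have := hgradedM (hgradedM Sg y00) SVg h; rewrite !addn0.
  + by rewrite -/Pi /y SP !mulrA !mulrVK // -!(mulrA S) yN'.
  by apply: (mulIr Su); rewrite -SyX yM mul1r mulr1.
move=> g; rewrite -/Pi.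
transitivity (P * u * R g * u' * Q).
  have c1 x : u * (u' * x) = x by rewrite mulrA uu' mul1r.
  have c2 x : P * (Q * x) = x by rewrite mulrA PQ mul1r.
  by rewrite /R /R0 -!mulrA !c1 c2 PQ mulr1.
rewrite RE -!mulrA; congr (_ * (_ * _)); rewrite !mulrA; congr (_ * _ * _).
rewrite -(mulrA _ (inner _ _)) -outer_inner !mulrA; congr (_ * _).
rewrite -!outerM; congr (outer _ _).
apply: (mulrI Su); rewrite -(mulrA S^-1) [in RHS]mulrA divrr // mul1r.
rewrite -(mulrA _ (weight_mx T k w' g)) -SW !mulrA expS -(mulrA _ S) SyX.
by rewrite !mulrA.
Qed.

End Glue.

                                       

(** * Congruences modulo powers of l and the arithmetic of the Witt ring *)

Section Divisible.
Variable l : nat.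

(** Used on differences, as congruence modulo l^j, both for ring elements and for matrices. *)
Definition divl (V : zmodType) j (x : V) := exists y, x = y *+ l ^ j.

Section Zmodule.
Variable V : zmodType.
Implicit Types x y : V.

Lemma divl0 j : divl j (0 : V). Proof. by exists 0; rewrite mul0rn. Qed.
Lemma divl_all x : divl 0 x. Proof. by exists x. Qed.
Lemma divlD j x y : divl j x -> divl j y -> divl j (x + y).
Proof. by move=> [u ->] [v ->]; exists (u + v); rewrite mulrnDl. Qed.
Lemma divlN j x : divl j x -> divl j (- x).
Proof. by move=> [u ->]; exists (- u); rewrite mulNrn. Qed.
Lemma divlB j x y : divl j x -> divl j y -> divl j (x - y).
Proof. by move=> xj yj; apply/divlD/divlN. Qed.
Lemma divlC j x y : divl j (x - y) -> divl j (y - x).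
Proof. by move=> /divlN; rewrite opprB. Qed.
Lemma divl_trans j y x z : divl j (x - y) -> divl j (y - z) -> divl j (x - z).
Proof. by move=> xy yz; rewrite -(subrKA y); apply: divlD. Qed.
Lemma divl_sum j (I : Type) (r : seq I) (P : pred I) (F : I -> V) :
  (forall i, P i -> divl j (F i)) -> divl j (\sum_(i <- r | P i) F i).
Proof. by move=> h; elim/big_ind: _ => //; [apply: divl0 | apply: divlD]. Qed.
Lemma divl_le i j x : (i <= j)%N -> divl j x -> divl i x.
Proof. by move=> ij [u ->]; exists (u *+ l ^ (j - i)); rewrite -mulrnA -expnD subnK. Qed.
Lemma divl_mulrn j x i : divl j x -> divl j (x *+ i).
Proof. by move=> [u ->]; exists (u *+ i); rewrite -!mulrnA mulnC. Qed.
Lemma divl_mulrl j i x : (l ^ i %| j)%N -> divl i (x *+ j).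
Proof. by move=> /dvdnP[c ->]; exists (x *+ c); rewrite mulrnA. Qed.

End Zmodule.

Lemma divlM (R : pzRingType) i j (x y : R) : divl i x -> divl j y -> divl (i + j) (x * y).
Proof. by move=> [u ->] [v ->]; exists (u * v); rewrite mulrnAl mulrnAr -mulrnA -expnD addnC. Qed.

Lemma divlMl (R : pzRingType) j (x y : R) : divl j y -> divl j (x * y).
Proof. by move=> [v ->]; exists (x * v); rewrite mulrnAr. Qed.

Lemma divlMr (R : pzRingType) j (x y : R) : divl j x -> divl j (x * y).
Proof. by move=> [v ->]; exists (v * y); rewrite mulrnAl. Qed.

Lemma divlX (R : pzRingType) j (x : R) i : divl j x -> divl (i * j) (x ^+ i).
Proof.
move=> xj; elim: i => [|i IH]; first exact: divl_all.
by rewrite exprS mulSn; apply: divlM.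
Qed.

Lemma divl_pow_l (R : comPzRingType) j (x y : R) : (0 < j)%N -> divl j (x - y) -> divl j.+1 (x ^+ l - y ^+ l).
Proof.
move=> j0 xy; rewrite subrXX -addn1; apply: divlM => //.
have xyX i : divl 1 (x ^+ i - y ^+ i).
  by rewrite subrXX; apply/divlMr/(divl_le j0).
rewrite (_ : \sum_(i < l) _ = \sum_(i < l) (x ^+ (l.-1 - i) * y ^+ i - y ^+ l.-1) + y ^+ l.-1 *+ l); last first.
  rewrite big_split /= sumrN sumr_const card_ord subrK; apply: eq_bigr => i _.
  by rewrite -subn1 -subnDA add1n.
apply: divlD; last by apply: divl_mulrl.
apply: divl_sum => i _; have -> : y ^+ l.-1 = y ^+ (l.-1 - i) * y ^+ i.
  by rewrite -exprD subnK // -ltnS (leq_trans (ltn_ord i)) // leqSpred.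
by rewrite -mulrBl; apply: divlMr.
Qed.

Lemma divl_pow_lX (R : comPzRingType) j (x y : R) r : (0 < j)%N -> divl j (x - y) ->
  divl (j + r) (x ^+ (l ^ r) - y ^+ (l ^ r)).
Proof.
move=> j0 xy; elim: r => [|r IH]; first by rewrite addn0.
by rewrite expnSr !exprM addnS; apply: divl_pow_l => //; rewrite addn_gt0 j0.
Qed.

End Divisible.

Lemma mulrn_mxE (V : nmodType) a b (A : 'M[V]_(a, b)) j x y : (A *+ j) x y = A x y *+ j.
Proof. by elim: j => [|j IH]; rewrite ?mxE // !mulrSr mxE IH. Qed.

Section Witt.
Variables (l : nat) (l_pr : prime l) (k : finFieldType) (chl : l \in [pchar k]).
Local Notation divl := (divl l).

Section Complete.
Variables (W : comNzRingType) (red : {rmorphism W -> k}) (witt_W : is_witt_ring l red).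

Lemma red_surj x : exists w, red w = x. Proof. by case: witt_W. Qed.

Lemma red_eq0 w : red w = 0 <-> divl 1 w.
Proof.
have [_ h _ _] := witt_W; rewrite h; split=> -[v ->]; exists v.
  by rewrite expn1 mulr_natl.
by rewrite expn1 mulr_natl.
Qed.

Lemma witt_regular j (w : W) : w *+ l ^ j = 0 -> w = 0.
Proof.
have [_ _ h _] := witt_W; elim: j => [|j IH] //; rewrite expnSr mulrnA => e.
by apply: IH; apply: h; rewrite mulr_natl.
Qed.

Lemma witt_ideal_pow n x : ideal_pow [set w | red w = 0] n x <-> divl n x.
Proof.
split=> [[s hs ->]|[v ->]].
  rewrite big_seq; apply: divl_sum => t /hs [r [sr hr ->]]; apply: divlMl.
  elim: r n sr hr {hs s} => [|y r IH] [|n] //= sr hr; first by rewrite big_nil; apply: divl_all.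
  rewrite big_cons -add1n; apply: divlM; first by apply/red_eq0/hr/mem_head.
  by apply: IH; [case: sr | move=> z zr; apply: hr; rewrite inE zr orbT].
exists [:: (v, (l ^ n)%:R)]; last by rewrite big_seq1 /= mulr_natr.
move=> _ /[!inE] /eqP -> /=; exists (nseq n l%:R); split; rewrite ?size_nseq //.
  by move=> y /nseqP[-> _]; apply/red_eq0; exists 1; rewrite expn1.
by rewrite big_nseq_cond /= natrX; elim: n => [|n IH] //=; rewrite exprS IH.
Qed.

Lemma witt_separated (x : W) : (forall n, divl n x) -> x = 0.
Proof. by have [_ _ _ [h _]] := witt_W => hx; apply: h => n; apply/witt_ideal_pow. Qed.

Lemma witt_limit (u : nat -> W) : (forall n, divl n (u n.+1 - u n)) ->
  exists x, forall n, divl n (x - u n).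
Proof.
have [_ _ _ [_ h]] := witt_W => hu.
by have [|x hx] := h u; [move=> n; apply/witt_ideal_pow | exists x => n; apply/witt_ideal_pow].
Qed.

Lemma witt_unit w : red w != 0 -> exists v, v * w = 1.
Proof.
move=> w0; have [v0 v0E] := red_surj (red w)^-1.
have z1 : divl 1 (1 - v0 * w) by apply/red_eq0; rewrite rmorphB rmorphM v0E mulVf // rmorph1 subrr.
pose z := 1 - v0 * w; pose u n := \sum_(i < n) z ^+ i.
have [x xu] : exists x, forall n, divl n (x - u n).
  apply: witt_limit => n; rewrite /u big_ord_recr /= (addrC _ (z ^+ n)) addrK -[n in divl n]muln1.
  exact: divlX.
exists (x * v0); apply/eqP; rewrite -subr_eq0; apply/eqP/witt_separated => n.
have -> : x * v0 * w - 1 = (x - u n) * (1 - z) - z ^+ n.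
  rewrite mulrBl; have -> : u n * (1 - z) = 1 - z ^+ n.
    by rewrite mulrC -opprB -[in RHS](opprB _ 1) subrX1 mulNr.
  by rewrite /z subKr mulrA; ring.
by apply: divlB; [apply: divlMr | rewrite -[n in divl n]muln1; apply: divlX].
Qed.

Lemma witt_sep_eq (x y : W) : (forall n, divl n.+1 (x - y)) -> x = y.
Proof.
move=> h; apply/eqP; rewrite -subr_eq0; apply/eqP/witt_separated => n.
exact: divl_le (h n).
Qed.

Lemma card_k : exists2 r, (0 < r)%N & #|k| = (l ^ r)%N.
Proof.
have e : #|k| = (l ^ logn l #|k|)%N := card_pprimeChar chl.
exists (logn l #|k|) => //; rewrite lt0n; apply/eqP => d0.
by have := card_finNzRing_gt1 k; rewrite e d0.
Qed.

Lemma teich_unique w w' : red w = red w' -> w ^+ #|k| = w -> w' ^+ #|k| = w' -> w = w'.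
Proof.
move=> e wq w'q; apply: witt_sep_eq; have [r r0 kE] := card_k.
elim=> [|n IH]; first by apply/red_eq0; rewrite rmorphB e subrr.
rewrite -wq -w'q kE; apply: (@divl_le _ _ _ (n.+1 + r)); first by lia.
exact: divl_pow_lX.
Qed.

Lemma teich_exists x : exists w, red w = x /\ w ^+ #|k| = w.
Proof.
have [w0 w0E] := red_surj x; have [r r0 kE] := card_k.
pose u n := w0 ^+ (#|k| ^ n).
have uS n : divl n.+1 (u n.+1 - u n).
  elim: n => [|n IH].
    by apply/red_eq0; rewrite /u expn0 expn1 rmorphB rmorphXn rmorphXn expr1 expf_card subrr.
  have := divl_pow_lX r (ltn0Sn n) IH; rewrite -kE -!exprM -!expnSr.
  by apply: divl_le; lia.
have [w wu] : exists x, forall n, divl n (x - u n).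
  by apply: witt_limit => n; apply: divl_le (uS n).
exists w; split.
  have /red_eq0 : divl 1 (w - u 1%N) by apply: wu.
  by rewrite rmorphB /u expn1 rmorphXn w0E expf_card => /eqP; rewrite subr_eq0 => /eqP.
apply: witt_sep_eq => n; apply: (@divl_trans _ _ _ (u n.+2)).
  have := divl_pow_lX r (ltn0Sn n) (wu n.+1); rewrite -kE /u -exprM -expnSr.
  by apply: divl_le; lia.
by apply: divlC; apply: divl_le (wu n.+2).
Qed.

Lemma teichmullerP x : red (teichmuller red x) = x /\ teichmuller red x ^+ #|k| = teichmuller red x.
Proof.
by have [w wP] := teich_exists x; apply: (xgetPex 0 (P := [set w | red w = x /\ w ^+ #|k| = w])); exists w.
Qed.

Lemma teichmullerE w : w ^+ #|k| = w -> w = teichmuller red (red w).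
Proof. by move=> wq; have [e1 e2] := teichmullerP (red w); apply: teich_unique. Qed.

Lemma teichmullerM x y : teichmuller red (x * y) = teichmuller red x * teichmuller red y.
Proof.
have [x1 x2] := teichmullerP x; have [y1 y2] := teichmullerP y.
by rewrite [RHS]teichmullerE ?exprMn ?x2 ?y2 // rmorphM x1 y1.
Qed.

Lemma teichmuller1 : teichmuller red 1 = 1.
Proof. by rewrite [RHS]teichmullerE ?expr1n // rmorph1. Qed.

Section Matrices.
Variables (a b : nat).
Implicit Types A B : 'M[W]_(a, b).

Lemma divl_mx j A : divl j A <-> forall x y, divl j (A x y).
Proof.
split=> [[B ->] x y|h]; first by exists (B x y); rewrite mulrn_mxE.
have /choice[B BE] : forall xy : 'I_a * 'I_b, exists z, A xy.1 xy.2 = z *+ l ^ j by move=> [x y]; apply: h.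
by exists (\matrix_(x, y) B (x, y)); apply/matrixP => x y; rewrite mulrn_mxE mxE (BE (x, y)).
Qed.

Lemma red_mx_eq0 A : map_mx red A = 0 <-> divl 1 A.
Proof.
rewrite divl_mx; split=> [/matrixP h x y|h].
  by apply/red_eq0; have := h x y; rewrite !mxE.
by apply/matrixP => x y; rewrite !mxE; apply/red_eq0.
Qed.

Lemma red_mx_eq A B : map_mx red A = map_mx red B <-> divl 1 (A - B).
Proof.
rewrite -red_mx_eq0 map_mxB; split=> [->|/eqP]; first by rewrite subrr.
by rewrite subr_eq0 => /eqP.
Qed.

Lemma mx_regular j A : A *+ l ^ j = 0 -> A = 0.
Proof.
move=> /matrixP e; apply/matrixP => x y; rewrite mxE; apply: (@witt_regular j).
by rewrite -mulrn_mxE e mxE.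
Qed.

Lemma mx_separated A B : (forall n, divl n.+1 (A - B)) -> A = B.
Proof.
move=> h; apply/matrixP => x y; apply: witt_sep_eq => n.
by have /divl_mx/(_ x y) := h n; rewrite !mxE.
Qed.

Lemma mx_limit (u : nat -> 'M[W]_(a, b)) : (forall n, divl n (u n.+1 - u n)) ->
  exists x, forall n, divl n (x - u n).
Proof.
move=> hu; have /choice[B BE] : forall xy : 'I_a * 'I_b, exists z, forall n, divl n (z - u n xy.1 xy.2).
  by move=> [x y]; apply: witt_limit => n; have /divl_mx/(_ x y) := hu n; rewrite !mxE.
exists (\matrix_(x, y) B (x, y)) => n; apply/divl_mx => x y; rewrite !mxE; exact: (BE (x, y)).
Qed.

Lemma mx_lift (C : 'M[k]_(a, b)) : exists A, map_mx red A = C.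
Proof.
have /choice[B BE] : forall xy : 'I_a * 'I_b, exists z, red z = C xy.1 xy.2 by move=> [x y]; apply: red_surj.
by exists (\matrix_(x, y) B (x, y)); apply/matrixP => x y; rewrite !mxE (BE (x, y)).
Qed.

End Matrices.

Lemma divl_cancel n (Z : 'M[W]_n) i : ~~ (l %| i)%N -> forall j, divl j (Z *+ i) -> divl j Z.
Proof.
move=> li j h; have co : coprime (l ^ j) i by rewrite coprimeXl // prime_coprime.
have [[u v] _ uv] : exists2 uv : nat * nat, true & (uv.1 * i = uv.2 * l ^ j + 1)%N.
  have i0 : (0 < i)%N by case: i li {h co} => //; rewrite dvdn0.
  have [u v e _] := egcdnP (l ^ j) i0; exists (u, v) => //=; rewrite e gcdnC.
  by have := co; rewrite /coprime => /eqP ->.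
rewrite -[Z](addKr (Z *+ (v * l ^ j))) -[X in _ + X]mulrSr -addn1 -uv mulnC mulrnA addrC.
apply: divlB; last by apply: divl_mulrl; rewrite dvdn_mulr.
by rewrite /= -mulrnA mulnC mulrnA; apply: divl_mulrn.
Qed.

Lemma binom_tail (R : nzRingType) (Z : R) r r' : r = r'.+2 -> (1 + Z) ^+ r = 1 ->
  Z *+ r = - \sum_(x < r'.+1) Z ^+ x.+2 *+ 'C(r, x.+2).
Proof.
move=> ->; rewrite exprDn_comm; last exact: commr_sym (commr1 _).
under eq_bigr => x _ do rewrite expr1n mul1r.
rewrite big_ord_recl big_ord_recl /= bin0 expr0 mulr1n bin1 expr1.
by rewrite -[X in _ = X]addr0 => /addrI /eqP; rewrite addr_eq0 => /eqP ->.
Qed.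

Section Torsion.
Variables (n : nat) (l_gt2 : (2 < l)%N).
Local Notation MW := 'M[W]_n.+1.

(** For l > 2 the matrices congruent to 1 modulo l form a torsion-free group. Reduce to prime order
    r; if d = 1 + Z with Z divisible by l^(j+1), the higher terms of the binomial expansion force
    one more power of l on Z. *)
Lemma torsion_free (c : MW) i : (0 < i)%N -> divl 1 (c - 1) -> c ^+ i = 1 -> c = 1.
Proof.
elim/ltn_ind: i => i IH i0 c1 ci.
have [i1|i1] := leqP i 1.
  by rewrite -[c]expr1 -ci; congr (_ ^+ _); lia.
have [r r_pr /dvdnP[i' iE]] := pdivP i1.
suff pw (d : MW) : divl 1 (d - 1) -> d ^+ r = 1 -> d = 1.
  have i'0 : (0 < i')%N by case: i' iE i0 => // ->.
  apply: (IH i') => //; first by rewrite iE ltn_Pmulr // prime_gt1.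
  apply: pw; last by rewrite -exprM -iE.
  have -> : c ^+ i' - 1 = (c - 1) * (\sum_(x < i') c ^+ x) by rewrite subrX1.
  exact: divlMr.
move=> d1 dr; apply: mx_separated; elim=> [|j IHj] //.
pose Z := d - 1; have Zj : divl j.+1 Z by [].
have dE : d = 1 + Z by rewrite addrC subrK.
have r2 : r = r.-2.+2 by have := prime_gt1 r_pr; lia.
have sumE := binom_tail r2 (etrans (congr1 (fun x => x ^+ r) (esym dE)) dr).
have tail2 x : divl (2 * j.+1) (Z ^+ x.+2 *+ 'C(r, x.+2)).
  apply/divl_mulrn/(@divl_le _ _ _ (x.+2 * j.+1)); first by rewrite leq_mul2r.
  exact: divlX.
have [rl|rl] := eqVneq r l; last first.
  apply: (@divl_cancel _ _ r); first by rewrite dvdn_prime2 // eq_sym.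
  apply: (@divl_le _ _ _ (2 * j.+1)); first by lia.
  by rewrite -/Z sumE; apply/divlN/divl_sum.
(* For r = l the middle binomial coefficients bring a factor l and the last term is Z^l with l >= 3;
   both are divisible by l^(j+3), and dividing by l still gains a digit. *)
suff [Y YE] : divl j.+3 (Z *+ l).
  exists Y; apply/eqP; rewrite -subr_eq0; apply/eqP/(@mx_regular _ _ 1).
  by rewrite expn1 mulrnBl -mulrnA -expnSr -/Z YE subrr.
rewrite -[X in Z *+ X]rl sumE; apply/divlN/divl_sum => x _.
have [xr|xr] := eqVneq x.+2 r.
  apply/divl_mulrn; rewrite xr; apply: (@divl_le _ _ _ (r * j.+1)); last exact: divlX.
  by rewrite rl; apply: (@leq_trans (3 * j.+1)); [lia | rewrite leq_mul2r l_gt2 orbT].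
have [b bE] : exists b, 'C(r, x.+2) = (b * l)%N.
  by apply/dvdnP; rewrite -rl prime_dvd_bin // /= ltn_neqAle xr; have := ltn_ord x; lia.
rewrite bE mulrnA -[l in _ *+ l]expn1.
have [Y ->] : divl (2 * j.+1) (Z ^+ x.+2 *+ b).
  apply/divl_mulrn/(@divl_le _ _ _ (x.+2 * j.+1)); last exact: divlX.
  by rewrite leq_mul2r.
rewrite -mulrnA -expnD; apply: divl_mulrl; rewrite dvdn_exp2l //; lia.
Qed.

End Torsion.

End Complete.

(** A copy of [W] equipped with inverses, so that the lemmas about unit rings apply to it. *)
Definition unitized (W : comNzRingType) : Type := W.
HB.instance Definition _ (W : comNzRingType) := GRing.ComNzRing.on (unitized W).

Section Unitized.
Variable W : comNzRingType.
Local Notation U := (unitized W).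

Definition unitized_unit : {pred U} := fun x => `[< exists y : U, y * x = 1 >].
Definition unitized_inv (x : U) : U := xget x [set y | y * x = 1].

Lemma unitized_mulVx : {in unitized_unit, left_inverse 1 unitized_inv *%R}.
Proof. by move=> x /asboolP hx; apply: (xgetPex x hx). Qed.
Lemma unitized_unitPl (x y : U) : y * x = 1 -> unitized_unit x.
Proof. by move=> yx; apply/asboolP; exists y. Qed.
Lemma unitized_inv_out : {in [predC unitized_unit], unitized_inv =1 id}.
Proof.
move=> x /negP hx; rewrite /unitized_inv; case: xgetP => // y _ yx.
by case: hx; apply: unitized_unitPl yx.
Qed.

HB.instance Definition _ := GRing.ComNzRing_hasMulInverse.Build U
  unitized_mulVx unitized_unitPl unitized_inv_out.

End Unitized.

Section Units.
Variables (W : comUnitRingType) (red : {rmorphism W -> k}) (witt_W : is_witt_ring l red).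

Lemma witt_unitE w : (w \is a GRing.unit) = (red w != 0).
Proof.
apply/idP/idP => [/(rmorph_unit red)|/(witt_unit witt_W)[v vw]]; first by rewrite unitfE.
by apply/unitrPr; exists v; rewrite mulrC; exact: vw.
Qed.

Lemma witt_mx_unitE n (A : 'M[W]_n.+1) : (A \is a GRing.unit) = (map_mx red A \is a GRing.unit).
Proof. by rewrite -[LHS]/(\det A \is a GRing.unit) witt_unitE -det_map_mx -unitfE. Qed.

Lemma witt_nat_unit i : ~~ (l %| i)%N -> (i%:R : W) \is a GRing.unit.
Proof. by move=> li; rewrite witt_unitE rmorph_nat -(dvdn_pcharf chl). Qed.

End Units.

End Witt.

Section DetOnePlus.
Variables (R : comNzRingType) (n : nat).

Lemma prod_1_add (I : Type) (r : seq I) (t : R) (F : I -> R) :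
  exists c, \prod_(i <- r) (1 + t * F i) = 1 + t * (\sum_(i <- r) F i) + t ^+ 2 * c.
Proof.
elim: r => [|i r [c IH]]; first by exists 0; rewrite !big_nil !mulr0 !addr0.
exists (F i * (\sum_(j <- r) F j) + c * (1 + t * F i)); rewrite !big_cons IH.
by move: (\sum_(j <- r) F j) (F i) => x y; rewrite expr2; ring.
Qed.

Lemma det_1_add (t : R) (B : 'M[R]_n) :
  exists c, \det (1%:M + t *: B) = 1 + t * \tr B + t ^+ 2 * c.
Proof.
rewrite /determinant (bigD1 1%g) //=.
have [c1 c1E] := prod_1_add (index_enum 'I_n) t (fun i => B i i).
have -> : \prod_i (1%:M + t *: B) i ((1 : {perm 'I_n})%g i) = 1 + t * \tr B + t ^+ 2 * c1.
  by rewrite -c1E; apply: eq_bigr => i _; rewrite perm1 !mxE eqxx.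
have [c2 ->] : exists c2, \sum_(s : {perm 'I_n} | s != 1%g)
    (-1) ^+ s * \prod_i (1%:M + t *: B) i (s i) = t ^+ 2 * c2.
  elim/big_ind: _ => [|_ _ [x ->] [y ->]|s s1].
  - by exists 0; rewrite mulr0.
  - by exists (x + y); rewrite mulrDr.
  have [i si] : exists i, s i != i.
    apply/existsP; apply: contraNT s1; rewrite negb_exists => /forallP h.
    by apply/eqP/permP => i; rewrite perm1; apply/eqP; rewrite -[_ == _]negbK.
  have sj : s (s i) != s i by rewrite (inj_eq perm_inj).
  rewrite (bigD1 i) //= (bigD1 (s i)) //= !mxE [i == s i]eq_sym (negPf si).
  rewrite [s i == s (s i)]eq_sym (negPf sj) !add0r.
  move: (\prod_(_ | _) _) ((-1) ^+ s) (B i (s i)) (B (s i) _) => P u x y.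
  by exists (u * (x * y * P)); rewrite expr2; ring.
by rewrite odd_perm1 expr0 mul1r; exists (c1 + c2); rewrite mulrDr addrA.
Qed.

End DetOnePlus.

(** * Lifting theta to W compatibly with a subgroup of order prime to l *)

Section Lift.
Variables (l : nat) (l_pr : prime l) (k : finFieldType) (chl : l \in [pchar k]).
Variables (W : comUnitRingType) (red : {rmorphism W -> k}) (witt_W : is_witt_ring l red).
Local Notation divl := (divl l).
Variable G : groupType.
Variables (gT : finGroupType) (q : G -> gT).
Hypothesis qM : forall g h, q (g * h)%g = (q g * q h)%g.
Variables (n' : nat).
Local Notation n := n'.+1.
Local Notation MW := 'M[W]_n.
Variables (theta : G -> 'M[k]_n) (theta_rep : is_rep theta).
Hypothesis theta_q : forall g h, q g = q h -> theta g = theta h.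
Variables (S : G -> Prop) (S_group : is_subgroup S).
Variables (e : seq G) (eS : forall x, x \in e -> S x) (el : ~~ (l %| size e)%N).
Hypothesis eF : forall (V : nmodType) (F : G -> V), (forall x y, q x = q y -> F x = F y) ->
  forall g, S g -> \sum_(x <- e) F (g * x)%g = \sum_(x <- e) F x
                /\ \sum_(x <- e) F (x * g)%g = \sum_(x <- e) F x.

Let c : W := (size e)%:R^-1.
Let cE : c * (size e)%:R = 1. Proof. by rewrite mulVr // (witt_nat_unit chl witt_W). Qed.

Lemma redM (A B : MW) : map_mx red (A * B) = map_mx red A * map_mx red B.
Proof. exact: map_mxM. Qed.

Lemma divlZ (V : lmodType W) j (a : W) (x : V) : divl j x -> divl j (a *: x).
Proof. by move=> [y ->]; exists (a *: y); rewrite scalerMnr. Qed.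

Definition avg (V : lmodType W) (F : G -> V) : V := c *: \sum_(x <- e) F x.

Lemma avg_cst (V : lmodType W) (v : V) : avg (fun=> v) = v.
Proof.
by rewrite /avg big_const_seq count_predT iter_addr_0 -scaler_nat scalerA cE scale1r.
Qed.

Lemma avgB (V : lmodType W) (F1 F2 : G -> V) : avg (fun x => F1 x - F2 x) = avg F1 - avg F2.
Proof. by rewrite /avg sumrB scalerBr. Qed.

Lemma avg_divl (V : lmodType W) j (F : G -> V) : (forall x, S x -> divl j (F x)) -> divl j (avg F).
Proof.
move=> h; apply: divlZ; rewrite big_seq; apply: divl_sum => x xe; exact/h/eS.
Qed.

Lemma avg_eq (V : lmodType W) (F1 F2 : G -> V) : (forall x, S x -> F1 x = F2 x) -> avg F1 = avg F2.
Proof.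
move=> h; rewrite /avg big_seq [in RHS]big_seq; congr (_ *: _); apply: eq_bigr => x xe; exact/h/eS.
Qed.

Lemma avg_mull (F : G -> MW) A : A * avg F = avg (fun x => A * F x).
Proof. by rewrite /avg -scalerAr mulr_sumr. Qed.

Lemma avg_mulr (F : G -> MW) A : avg F * A = avg (fun x => F x * A).
Proof. by rewrite /avg -scalerAl mulr_suml. Qed.

Lemma avgZ (V : lmodType W) (a : W) (F : G -> V) : a *: avg F = avg (fun x => a *: F x).
Proof. by rewrite /avg scalerA mulrC -scalerA scaler_sumr. Qed.

Lemma avg_shift (V : lmodType W) (F : G -> V) g : (forall x y, q x = q y -> F x = F y) -> S g ->
  avg (fun x => F (g * x)%g) = avg F.
Proof. by move=> hF Sg; rewrite /avg (eF hF Sg).1. Qed.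

Lemma avg_shiftr (V : lmodType W) (F : G -> V) g : (forall x y, q x = q y -> F x = F y) -> S g ->
  avg (fun x => F (x * g)%g) = avg F.
Proof. by move=> hF Sg; rewrite /avg (eF hF Sg).2. Qed.

Lemma red_avg (F : G -> MW) C : (forall x, S x -> map_mx red (F x) = C) -> map_mx red (avg F) = C.
Proof.
move=> h; have [A AE] := mx_lift witt_W C; rewrite -AE; apply/(red_mx_eq witt_W).
rewrite -[X in _ - X](avg_cst A) -avgB; apply: avg_divl => x Sx.
by apply/(red_mx_eq witt_W); rewrite h // AE.
Qed.

Let S1 : S 1%g. Proof. by case: S_group. Qed.
Let SM g h : S g -> S h -> S (g * h)%g. Proof. by case: S_group => _ h' _; apply: h'. Qed.
Let SV g : S g -> S g^-1%g. Proof. by case: S_group => _ _ h; apply: h. Qed.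
Let thM g h : theta (g * h)%g = theta g * theta h. Proof. exact: thetaM. Qed.
Let th_unit g : theta g \is a GRing.unit. Proof. exact: theta_unit. Qed.

(** Multiplicativity is asked only when the right factor lies in S, the left one being arbitrary. *)
Definition approx j (phi : G -> MW) := [/\ forall g, map_mx red (phi g) = theta g,
  forall g h, q g = q h -> phi g = phi h & forall g h, S h -> divl j (phi (g * h)%g - phi g * phi h)].

Lemma approx_unit j phi g : approx j phi -> phi g \is a GRing.unit.
Proof. by move=> [h _ _]; rewrite (witt_mx_unitE witt_W) h. Qed.

(** Averaging phi(g x) phi(x)^-1 over S squares the error: psi(gh) - psi(g) psi(h) becomes a
    covariance of two quantities, each divisible by l^j. *)
Lemma approx_step j phi : (0 < j)%N -> approx j phi ->
  exists2 psi, approx j.+1 psi & forall g, divl j (psi g - phi g).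
Proof.
move=> j0 ap; have [pr pq pM] := ap; have pu g : phi g \is a GRing.unit := approx_unit g ap.
pose psi g := avg (fun x => phi (g * x)%g / phi x).
have qMl g x y : q x = q y -> q (g * x)%g = q (g * y)%g by rewrite !qM => ->.
have qMr g x y : q x = q y -> q (x * g)%g = q (y * g)%g by rewrite !qM => ->.
have Fq g x y : q x = q y -> phi (g * x)%g / phi x = phi (g * y)%g / phi y.
  by move=> xy; rewrite (pq _ _ xy) (pq _ _ (qMl g _ _ xy)).
have close g x : S x -> divl j (phi (g * x)%g / phi x - phi g).
  move=> Sx; have -> : phi (g * x)%g / phi x - phi g = (phi (g * x)%g - phi g * phi x) / phi x.
    by rewrite mulrBl mulrK.
  by apply: divlMr; apply: pM.
have psi_close g : divl j (psi g - phi g).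
  by rewrite -[X in _ - X](avg_cst (phi g)) -avgB; apply: avg_divl => x; apply: close.
exists psi => //; split.
- move=> g; apply: red_avg => x Sx; apply: (mulIr (th_unit x)).
  by rewrite -{1}(pr x) -redM divrK // pr thM.
- move=> g h gh; congr (c *: _); apply: eq_bigr => x _.
  by rewrite (pq (g * x)%g (h * x)%g) //; apply: qMr.
move=> g h Sh; pose al x := phi (g * (h * x))%g / phi (h * x)%g; pose be x := phi (h * x)%g / phi x.
have alE : psi g = avg al by rewrite /psi -(avg_shift (Fq g) Sh).
have -> : psi (g * h)%g = avg (fun x => al x * be x).
  by congr (c *: _); apply: eq_bigr => x _; rewrite /al /be mulrA divrK // -mulgA.
have -> : avg (fun x => al x * be x) - psi g * psi h =
    avg (fun x => (al x - phi g) * (be x - phi h)) - (psi g - phi g) * (psi h - phi h).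
  have -> : avg (fun x => (al x - phi g) * (be x - phi h)) =
     avg (fun x => al x * be x) - psi g * phi h - (phi g * psi h - phi g * phi h).
    rewrite alE avg_mulr avg_mull -[X in _ - (_ - X)](avg_cst (phi g * phi h)) -!avgB; apply: avg_eq => x _.
    by rewrite mulrBl !mulrBr.
  rewrite mulrBl !mulrBr; move: (avg _) (psi g * _) (phi g * psi h) (phi g * phi h) (psi g * psi h) => x1 x2 x3 x4 x5.
  by rewrite (opprB (x5 - x2)) subrKA opprB subrKA.
apply: (@divl_le _ _ _ (j + j)); first by lia.
apply: divlB; last exact: divlM.
by apply: avg_divl => x Sx; apply: divlM; apply: close => //; apply: SM.
Qed.

Lemma lift_l'group : exists phi : G -> MW, [/\ forall g, map_mx red (phi g) = theta g,
  forall g h, q g = q h -> phi g = phi h & forall g h, S h -> phi (g * h)%g = phi g * phi h].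
Proof.
have [phi0 phi0P] : exists phi, approx 1 phi.
  have /choice[L LE] : forall C : 'M[k]_n, exists A, map_mx red A = C by move=> C; apply: (mx_lift witt_W).
  exists (fun g => L (theta g)); split=> [g|g h /theta_q -> //|g h Sh]; first exact: LE.
  by apply/(red_mx_eq witt_W); rewrite -mulmxE map_mxM !LE thM.
have /choice[next nextP] : forall jphi : nat * (G -> MW), exists psi,
    (0 < jphi.1)%N -> approx jphi.1 jphi.2 -> approx jphi.1.+1 psi /\ forall g, divl jphi.1 (psi g - jphi.2 g).
  move=> [[|j] phi]; first by exists phi.
  have [/(approx_step (ltn0Sn j))[psi p1 p2]|np] := pselect (approx j.+1 phi); last by exists phi.
  by exists psi.
pose u := fix u j := if j is j'.+1 then next (j, u j') else phi0.
have uP j : approx j.+1 (u j) by elim: j => [|j IH] //; have [] := nextP (j.+1, u j) isT IH.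
have uS j g : divl j.+1 (u j.+1 g - u j g) by have [_] := nextP (j.+1, u j) isT (uP j); apply.
have /choice[phi phiP] : forall g, exists x, forall j, divl j (x - u j g).
  by move=> g; apply: (mx_limit witt_W) => j; apply: divl_le (uS j g).
have phiP' g j : divl j.+1 (phi g - u j g).
  by apply: (@divl_trans _ _ _ (u j.+1 g)) => //; apply: phiP.
exists phi; split=> [g|g h gh|g h Sh].
- have [<- _ _] := uP 0%N; apply/(red_mx_eq witt_W); exact: phiP'.
- apply: (mx_separated witt_W) => j; apply: (@divl_trans _ _ _ (u j g)) => //.
  by have [_ uq _] := uP j; rewrite (uq _ _ gh); apply: divlC.
apply: (mx_separated witt_W) => j; have [_ _ /(_ g h Sh) uM] := uP j.
apply: (divl_trans (phiP' _ _)); apply: (divl_trans uM).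
have -> : u j g * u j h - phi g * phi h = (u j g - phi g) * u j h + phi g * (u j h - phi h).
  by rewrite mulrBl mulrBr addrA subrK.
by apply: divlD; [apply/divlMr/divlC | apply/divlMl/divlC].
Qed.

End Lift.

Lemma pow_1_add (R : pzRingType) (x : R) (P : R -> Prop) Q : P 0 -> P 1 ->
  (forall y z, P y -> P z -> P (y + z)) -> (forall y z, P y -> P z -> P (y * z)) -> P x ->
  (forall y, P y -> y * x = x * y) ->
  exists2 y, P y & (1 + x) ^+ Q = 1 + x *+ Q + x * x * y.
Proof.
move=> P0 P1 PD PM Px comm; elim: Q => [|Q [y Py IH]].
  by exists 0 => //; rewrite expr0 mulr0n mulr0 !addr0.
have PQ : P Q%:R by elim: Q {IH} => [|i IH] //; rewrite -natr1; apply: PD.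
exists (y + (Q%:R + x * y)); first by apply: (PD) => //; apply: (PD) => //; apply: PM.
rewrite exprS IH mulrDl mul1r mulrS !mulrDr mulr1 mulrA mulr_natr -(mulrA x x (x * y)) (mulrA x x y).
rewrite [x * (x *+ Q)]mulrnAr -!addrA; congr (_ + _).
by rewrite [RHS]addrCA; congr (_ + _); rewrite [RHS]addrCA; congr (_ + (_ + (_ + _))); rewrite !mulrA.
Qed.

Lemma dvd_complement f i x : (i < f)%N -> (x < f)%N -> (f %| x + (f - i) %% f)%N -> x = i.
Proof.
move=> lti ltx; have [->|i0] := posnP i.
  by rewrite subn0 modnn addn0 /dvdn modn_small // => /eqP.
rewrite modn_small ?ltn_subrL ?i0 ?(leq_ltn_trans _ lti) // => /dvdnP[a aE].
by case: a aE => [|[|a]]; rewrite ?mulSn ?mul0n; lia.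
Qed.

Section PolyFrobenius.
Variables (l : nat) (k : finFieldType) (chl : l \in [pchar k]).

Lemma poly_frobenius (P : {poly k}) i r : #|k| = (l ^ r)%N -> P ^+ (#|k| ^ i) = P \Po 'X^(#|k| ^ i).
Proof.
move=> kE; set q := (#|k| ^ i)%N; have qn : l.-nat q by rewrite /q kE -expnM pnatX pnat_id ?(pcharf_prime chl).
have cP : l \in [pchar {poly k}] by rewrite pchar_poly.
elim/poly_ind: P => [|P c IH].
  rewrite comp_poly0 expr0n (_ : (q == 0%N) = false) //; apply/negbTE.
  by rewrite -lt0n expn_gt0 (ltnW (card_finNzRing_gt1 k)).
rewrite (exprDn_pchar (R := {poly k})) ?(eq_pnat _ (pcharf_eq cP)) //.
rewrite exprMn IH comp_polyD comp_polyM comp_polyX comp_polyC -polyC_exp; congr (_ + _%:P).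
by rewrite /q; elim: i {q qn IH} => [|i IH]; rewrite ?expr1 // expnSr exprM IH expf_card.
Qed.

(** With q the cardinal of [k], raising P(X) to the power q^f amounts to replacing X by X^(q^f).
    This is X again, because X^f is a scalar and f divides q - 1. *)
Lemma horner_torsion n (X : 'M[k]_n.+1) f (la : k) r (P : {poly k}) : #|k| = (l ^ r)%N -> (f %| #|k|.-1)%N ->
  la != 0 -> X ^+ f = la%:M -> horner_mx X P \is a GRing.unit ->
  (horner_mx X P) ^+ (#|k| ^ f).-1 = 1.
Proof.
move=> kE fq la0 Xf Pu; have k0 : (0 < #|k|)%N := ltnW (card_finNzRing_gt1 k).
have kf : (0 < #|k| ^ f)%N by rewrite expn_gt0 k0.
have Xq : X ^+ (#|k| ^ f) = X.
  rewrite -(prednK kf) exprS predn_exp.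
  have [a ->] : exists a, (\sum_(i < f) #|k| ^ i = a * f)%N.
    apply/dvdnP; rewrite /dvdn -modn_summ (eq_bigr (fun=> 1 %% f)%N) => [|i _].
      by rewrite modn_summ sum_nat_const card_ord muln1 modnn.
    apply/eqP; rewrite eqn_mod_dvd ?expn_gt0 ?k0 //.
    by apply: dvdn_trans fq _; rewrite subn1 predn_exp dvdn_mulr.
  have l1 : la ^+ #|k|.-1 = 1.
    by apply: (mulIf la0); rewrite mul1r -exprSr prednK // expf_card.
  by rewrite (mulnC a) mulnCA exprM Xf scalar_mxX exprM l1 expr1n; apply: mulr1.
apply: (mulIr Pu); rewrite mul1r -exprSr prednK // -rmorphXn /= (poly_frobenius _ _ kE).
rewrite -[RHS](_ : horner_mx (X ^+ (#|k| ^ f)) P = _) ?Xq //.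
elim/poly_ind: P {Pu} => [|P c IH]; first by rewrite comp_poly0 !rmorph0.
rewrite comp_polyD comp_polyM comp_polyX comp_polyC !rmorphD !rmorphM /= IH.
by rewrite rmorphXn /= !horner_mx_X !horner_mx_C Xq.
Qed.

End PolyFrobenius.

Definition averaging (G : groupType) (gT : finGroupType) (q : G -> gT) l (P : G -> Prop) (e : seq G) :=
  [/\ forall x, x \in e -> P x, ~~ (l %| size e)%N &
  forall (V : nmodType) (F : G -> V), (forall x y, q x = q y -> F x = F y) ->
  forall g, P g -> \sum_(x <- e) F (g * x)%g = \sum_(x <- e) F x
                /\ \sum_(x <- e) F (x * g)%g = \sum_(x <- e) F x].

(** * The canonical lift of theta: torsion lifts and a determinant over W[X] *)

Section CanonicalLift.
Variables (l : nat) (l_pr : prime l) (l_gt2 : (2 < l)%N) (k : finFieldType) (chl : l \in [pchar k]).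
Variables (W : comUnitRingType) (red : {rmorphism W -> k}) (witt_W : is_witt_ring l red).
Local Notation divl := (divl l).
Variable G : groupType.
Variables (gT : finGroupType) (q : G -> gT).
Hypothesis qM : forall g h, q (g * h)%g = (q g * q h)%g.
Variables (n' : nat).
Local Notation n := n'.+1.
Local Notation MW := 'M[W]_n.
Local Notation redm := (map_mx red).
Variables (theta : G -> 'M[k]_n) (theta_rep : is_rep theta).
Hypothesis l_ndvd_n : ~~ (l %| n)%N.
Hypothesis theta_q : forall g h, q g = q h -> theta g = theta h.
Variable chi : G -> k.
Hypothesis chiM : forall g h, chi (g * h)%g = chi g * chi h.
Hypothesis chi_q : forall g h, q g = q h -> chi g = chi h.
Variables (S GN : G -> Prop) (S_group : is_subgroup S) (GN_group : is_subgroup GN).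
Hypothesis GN_normal : forall g h, GN h -> GN (g * h * g^-1)%g.
Hypothesis GN_S : forall h, GN h -> S h.
Hypothesis GN_chi : forall h, GN h -> chi h = 1.
Hypothesis S_chi : forall h, S h -> chi h = 1 -> GN h.
Variables (e eN : seq G) (eP : averaging q l S e) (eNP : averaging q l GN eN).
Variables (sg : G) (sgS : S sg).
Local Notation om := (chi sg).
Hypothesis chi_gen : forall g, exists i, chi g = om ^+ i.
Variables (s f : nat) (X : 'M[k]_n) (X_unit : X \is a GRing.unit).
Hypothesis X_int : forall g, theta g * X = chi g ^+ s *: (X * theta g).
Hypothesis f_prim : f.-primitive_root (om ^+ s).
Hypothesis trX : forall i, ~~ (f %| i)%N -> \tr (X ^+ i) = 0.
Variables (la : k) (la0 : la != 0) (Xf : X ^+ f = la%:M).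
Hypothesis centralizer_X : forall z, (forall h, GN h -> theta h * z = z * theta h) ->
  exists c : 'I_f -> k, z = \sum_i c i *: X ^+ i.

Hypothesis l_ndvd_f : ~~ (l %| f)%N.

Let f_gt0 : (0 < f)%N. Proof. exact: prim_order_gt0 f_prim. Qed.
Let thM g h : theta (g * h)%g = theta g * theta h. Proof. exact: thetaM. Qed.
Let th1 : theta 1%g = 1. Proof. exact: theta1. Qed.
Let th_unit g : theta g \is a GRing.unit. Proof. exact: theta_unit. Qed.
Let chi1 : chi 1%g = 1. Proof. by apply: GN_chi; case: GN_group. Qed.
Let chiV g : chi g * chi g^-1%g = 1. Proof. by rewrite -chiM mulgV. Qed.
Let S1 : S 1%g. Proof. by case: S_group. Qed.
Let SM g h : S g -> S h -> S (g * h)%g. Proof. by case: S_group => _ h' _; apply: h'. Qed.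
Let SV g : S g -> S g^-1%g. Proof. by case: S_group => _ _ h; apply: h. Qed.
Let N1 : GN 1%g. Proof. by case: GN_group. Qed.
Let NM g h : GN g -> GN h -> GN (g * h)%g. Proof. by case: GN_group => _ h' _; apply: h'. Qed.
Let NV g : GN g -> GN g^-1%g. Proof. by case: GN_group => _ _ h; apply: h. Qed.
Let redMM (A B : MW) : redm (A * B) = redm A * redm B. Proof. exact: map_mxM. Qed.
Let redX (A : MW) i : redm (A ^+ i) = redm A ^+ i.
Proof. by elim: i => [|i IH]; rewrite ?expr0 ?map_mx1 // !exprS redMM IH. Qed.

Variables (phi : G -> MW) (phi_red : forall g, redm (phi g) = theta g).
Hypothesis phi_q : forall g h, q g = q h -> phi g = phi h.
Hypothesis phiM : forall g h, S h -> phi (g * h)%g = phi g * phi h.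

Local Notation tau := (teichmuller red).
Let tauM := teichmullerM l_pr chl witt_W.

Let mulZr (A B : MW) c : A * (c *: B) = c *: (A * B). Proof. by rewrite -scalerAr. Qed.
Let mulZl (A B : MW) c : (c *: A) * B = c *: (A * B). Proof. by rewrite -scalerAl. Qed.

Let zz (a b : W) (A B : MW) : a = b -> A = B -> a *: A = b *: B. Proof. by move=> -> ->. Qed.

Lemma phi_unit g : phi g \is a GRing.unit.
Proof. by rewrite (witt_mx_unitE witt_W) phi_red th_unit. Qed.

Lemma phi1 : phi 1%g = 1.
Proof. by apply: (mulrI (phi_unit 1%g)); rewrite -phiM // mulg1 mulr1. Qed.

Lemma phiX g i : S g -> phi (g ^+ i)%g = phi g ^+ i.
Proof. by move=> Sg; elim: i => [|i IH]; rewrite ?expg0 ?phi1 // expgSr exprSr phiM // IH. Qed.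

Lemma phiVE g : S g -> phi g^-1%g * phi g = 1.
Proof. by move=> Sg; rewrite -phiM // mulVg phi1. Qed.

Definition chiW g : W := tau (chi g).

Lemma chiW_red g : red (chiW g) = chi g. Proof. by have [] := teichmullerP l_pr chl witt_W (chi g). Qed.
Lemma chiWM g h : chiW (g * h)%g = chiW g * chiW h. Proof. by rewrite /chiW chiM tauM. Qed.
Lemma chiW1 g : chi g = 1 -> chiW g = 1. Proof. by rewrite /chiW => ->; apply: (teichmuller1 l_pr chl witt_W). Qed.
Lemma chiWV g : chiW g * chiW g^-1%g = 1. Proof. by rewrite -chiWM mulgV chiW1. Qed.

(** The average over S of the conjugates of any lift of X, twisted by the s-th power of the
    Teichmüller lift of chi. *)
Lemma X_lift : exists Xw : MW, redm Xw = X /\ forall g, S g -> phi g * Xw = chiW g ^+ s *: (Xw * phi g).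
Proof.
have [eS el eF] := eP; have [X0 X0E] := mx_lift witt_W X.
pose F x : MW := chiW x^-1%g ^+ s *: (phi x * X0 * phi x^-1%g).
have qV g h : q g = q h -> q g^-1%g = q h^-1%g.
  have q1 : q 1%g = 1%g by apply: (mulgI (q 1%g)); rewrite -qM !mulg1.
  by move=> gh; apply: (mulgI (q g)); rewrite -qM mulgV gh -qM mulgV.
exists (avg e F); split=> [|g Sg].
  apply: (red_avg chl witt_W eS el) => x Sx; rewrite /F map_mxZ !redMM !phi_red X0E rmorphXn /= chiW_red.
  rewrite X_int -scalerAl -mulrA -thM mulgV th1 mulr1 scalerA -exprMn mulrC chiV expr1n scale1r //.
rewrite avg_mull -[X in _ *: (X * _)](avg_shift (F := F) eF _ Sg) => [|x y xy]; last first.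
  by rewrite /F /chiW (chi_q (qV _ _ xy)) (phi_q (qV _ _ xy)) (phi_q xy).
rewrite avg_mulr avgZ; apply: (avg_eq eS) => x Sx.
transitivity (chiW x^-1%g ^+ s *: (phi g * (phi x * X0 * phi x^-1%g))); first exact: mulZr.
symmetry; transitivity (chiW g ^+ s *: (chiW (g * x)^-1%g ^+ s *: (phi (g * x)%g * X0 * phi (g * x)^-1%g * phi g))).
  by apply: zz => //; exact: mulZl.
apply: etrans (scalerA _ _ _) _; apply: zz.
  by rewrite invMg chiWM exprMn mulrCA -exprMn chiWV expr1n mulr1.
have -> : phi (g * x)^-1%g = phi x^-1%g * phi g^-1%g by rewrite invMg phiM //; apply: SV.
have -> : phi (g * x)%g = phi g * phi x by rewrite phiM.
by rewrite -!mulrA (phiVE Sg) mulr1.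
Qed.

Variables (Xw : MW) (Xw_red : redm Xw = X).
Hypothesis Xw_int : forall g, S g -> phi g * Xw = chiW g ^+ s *: (Xw * phi g).

Definition cent (Z : MW) := forall h, GN h -> phi h * Z = Z * phi h.

Lemma cent0 : cent 0. Proof. by move=> h _; rewrite mulr0 mul0r. Qed.
Lemma cent1 : cent 1. Proof. by move=> h _; rewrite mulr1 mul1r. Qed.
Lemma centD Y Z : cent Y -> cent Z -> cent (Y + Z).
Proof. by move=> cY cZ h hN; rewrite mulrDr mulrDl cY ?cZ. Qed.
Lemma centM Y Z : cent Y -> cent Z -> cent (Y * Z).
Proof. by move=> cY cZ h hN; rewrite mulrA cY // -!mulrA cZ. Qed.
Lemma centZ c Z : cent Z -> cent (c *: Z).
Proof. by move=> cZ h hN; rewrite mulZr mulZl cZ. Qed.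
Lemma centX : cent Xw.
Proof. by move=> h hN; rewrite Xw_int ?chiW1 ?expr1n ?scale1r //; [apply: GN_chi | apply: GN_S]. Qed.
Lemma centXn Z i : cent Z -> cent (Z ^+ i).
Proof. by move=> cZ; elim: i => [|i IH]; [apply: cent1 | rewrite exprS; apply: centM]. Qed.
Lemma cent_div j Z : cent (Z *+ l ^ j) -> cent Z.
Proof.
move=> cZ h /cZ; rewrite mulrnAr mulrnAl => e'; apply/eqP; rewrite -subr_eq0; apply/eqP.
by apply: (mx_regular witt_W (j := j)); rewrite mulrnBl e' subrr.
Qed.
Lemma cent_mulrn j Z : cent Z -> cent (Z *+ j).
Proof. by move=> cZ h hN; rewrite mulrnAr mulrnAl cZ. Qed.
Lemma centN Z : cent Z -> cent (- Z).
Proof. by move=> cZ h hN; rewrite mulrN mulNr cZ. Qed.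
Lemma centV Z : Z \is a GRing.unit -> cent Z -> cent Z^-1.
Proof. by move=> Zu cZ h hN; apply: (mulrI Zu); rewrite mulrA -cZ // mulrK // mulrA divrr // mul1r. Qed.

Let om_prim i : (om ^+ (s * i) == 1) = (f %| i)%N.
Proof. by rewrite exprM -(prim_order_dvd f_prim). Qed.

Lemma XwX_int g i : S g -> phi g * Xw ^+ i = chiW g ^+ (s * i) *: (Xw ^+ i * phi g).
Proof.
move=> Sg; elim: i => [|i IH]; first by rewrite muln0 !expr0 mulr1 mul1r scale1r.
rewrite exprS mulrA Xw_int // mulZl -mulrA IH mulZr scalerA -exprD -mulnS mulrA.
by rewrite -exprS.
Qed.

Let trC (A B : MW) : \tr (A * B) = \tr (B * A). Proof. exact: mxtrace_mulC. Qed.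

Lemma tr_Xw i : ~~ (f %| i)%N -> \tr (Xw ^+ i) = 0.
Proof.
move=> fi; have := XwX_int i sgS; set c := chiW _ ^+ _ => /(congr1 (fun A => phi sg^-1%g * A)).
rewrite mulrA phiVE // mul1r mulZr => /(congr1 mxtrace).
rewrite mxtraceZ trC -mulrA -phiM; last exact: SV.
rewrite mulgV phi1 mulr1 => h.
have cu : 1 - c \is a GRing.unit.
  rewrite (witt_unitE witt_W) rmorphB rmorph1 rmorphXn /= chiW_red subr_eq0 eq_sym om_prim //.
by apply: (mulrI cu); rewrite mulr0 mulrBl mul1r -h subrr.
Qed.

Lemma red_tr (A : MW) : red (\tr A) = \tr (redm A).
Proof. by rewrite /mxtrace rmorph_sum; apply: eq_bigr => i _; rewrite mxE. Qed.

Let nu : n%:R != 0 :> k. Proof. by rewrite -(dvdn_pcharf chl). Qed.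
Let tr1 : \tr (1 : 'M[k]_n) = n%:R. Proof. exact: mxtrace1. Qed.

(** Modulo l such a matrix is a combination of powers of X orthogonal to all of them, hence 0. So Z
    can be divided by l, and again without end. *)
Lemma cent_trace0 Z : cent Z -> (forall j, (j < f)%N -> \tr (Z * Xw ^+ j) = 0) -> Z = 0.
Proof.
move=> cZ tZ; suff h : forall j, exists Y, [/\ Z = Y *+ l ^ j, cent Y & forall i, (i < f)%N -> \tr (Y * Xw ^+ i) = 0].
  by apply: (mx_separated witt_W) => j; have [Y [-> _ _]] := h j.+1; rewrite subr0; exists Y.
elim=> [|j [Y [YE cY tY]]]; first by exists Z.
have rY : redm Y = 0.
  have [c cE] : exists c : 'I_f -> k, redm Y = \sum_i c i *: X ^+ i.
    by apply: centralizer_X => h hN; rewrite -phi_red -!redMM cY.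
  have tc (i : 'I_f) : \tr (X ^+ (i + (f - i) %% f)) != 0.
    have [->|i0] := eqVneq (i : nat) 0%N; first by rewrite subn0 modnn expr0 tr1.
    have fi : (f - i < f)%N by rewrite ltn_subrL lt0n i0.
    by rewrite (modn_small fi) subnKC 1?ltnW // Xf mxtrace_scalar -mulr_natr mulf_neq0.
  rewrite cE big1 // => i _; suff -> : c i = 0 by rewrite scale0r.
  have lt : ((f - i) %% f < f)%N by rewrite ltn_mod.
  have := congr1 red (tY _ lt); rewrite rmorph0 red_tr redMM redX Xw_red cE mulr_suml.
  rewrite raddf_sum (bigD1 i) //= big1 => [|x xi].
    by rewrite addr0 -scalerAl -exprD mxtraceZ => /eqP; rewrite mulf_eq0 (negPf (tc i)) orbF => /eqP.
  rewrite -scalerAl -exprD mxtraceZ trX ?mulr0 //.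
  by apply: contra xi => d; rewrite -val_eqE /=; apply/eqP/(dvd_complement (ltn_ord i) (ltn_ord x)).
have [Y' Y'E] := (red_mx_eq0 witt_W Y).1 rY; rewrite expn1 in Y'E.
exists Y'; split.
- by rewrite YE Y'E -mulrnA expnS.
- by apply: (@cent_div 1); rewrite expn1 -Y'E.
move=> i /tY; rewrite Y'E mulrnAl raddfMn /= -[l in _ *+ l]expn1; exact: (witt_regular witt_W).
Qed.

Let nw : (n%:R : W) \is a GRing.unit. Proof. exact: (witt_nat_unit chl witt_W). Qed.
Let trw1 : \tr (1 : MW) = n%:R. Proof. exact: mxtrace1. Qed.
Let trB' (A B : MW) : \tr (A - B) = \tr A - \tr B. Proof. exact: trB. Qed.

Lemma Xwf : exists2 mu : W, mu \is a GRing.unit & Xw ^+ f = mu%:M.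
Proof.
pose mu := \tr (Xw ^+ f) / n%:R.
have e' : Xw ^+ f = mu%:M.
  apply/eqP; rewrite -subr_eq0; apply/eqP/cent_trace0.
    apply: centD; first exact: centXn centX.
    by apply: centN => h _; rewrite -!mulmxE scalar_mxC.
  move=> j jf; rewrite mulrBl trB' -[mu%:M]scalemx1 -[1%:M]/(1 : MW) mulZl mul1r mxtraceZ -exprD.
  have [->|j0] := eqVneq j 0%N; first by rewrite addn0 expr0 trw1 divrK // subrr.
  by rewrite !tr_Xw ?mulr0 ?subrr // ?dvdn_addr // gtnNdvd // lt0n.
exists mu => //; rewrite (witt_unitE witt_W).
have : redm (Xw ^+ f) = la%:M by rewrite redX Xw_red Xf.
by rewrite e' => /matrixP/(_ 0 0); rewrite !mxE eqxx !mulr1n => ->.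
Qed.

Lemma cent_horner Z : cent Z -> exists P, Z = horner_mx Xw P.
Proof.
move=> cZ; have [mu muu muE] := Xwf.
pose c i := \tr (Z * Xw ^+ (f - i)) / (n%:R * mu).
pose P := \sum_(i < f) c i *: 'X^i; exists P.
have PE : horner_mx Xw P = \sum_(i < f) c i *: Xw ^+ i.
  by rewrite linear_sum; apply: eq_bigr => i _; rewrite linearZ /= rmorphXn /= horner_mx_X.
have muM A : Xw ^+ f * A = mu *: A by rewrite muE -mulmxE mul_scalar_mx.
have nmu : n%:R * mu \is a GRing.unit by rewrite unitrM nw.
apply/eqP; rewrite -subr_eq0; apply/eqP/cent_trace0.
  apply/centD/centN => //; rewrite PE; elim/big_ind: _ => [||i _]; [exact: cent0|exact: centD|].
  exact: centZ (centXn _ centX).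
move=> j jf; rewrite mulrBl trB' PE.
have -> : \tr ((\sum_(i < f) c i *: Xw ^+ i) * Xw ^+ j) = \sum_(i < f) c i * \tr (Xw ^+ (i + j)).
  by rewrite mulr_suml raddf_sum; apply: eq_bigr => i _; rewrite /= mulZl -exprD mxtraceZ.
suff -> : \sum_(i < f) c i * \tr (Xw ^+ (i + j)) = \tr (Z * Xw ^+ j) by rewrite subrr.
have [j0|j0] := eqVneq j 0%N.
  rewrite (bigD1 (Ordinal f_gt0)) //= [X in _ + X]big1 => [|i].
    rewrite addr0 /= j0 addn0 expr0 mulr1 trw1 /c subn0 trC muM mxtraceZ.
    by rewrite mulrAC (_ : mu * \tr Z * n%:R = \tr Z * (n%:R * mu)) ?mulrK //; ring.
  rewrite -val_eqE /= => i0; rewrite j0 addn0 tr_Xw ?mulr0 // gtnNdvd // lt0n //.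
have fj : (f - j < f)%N by rewrite ltn_subrL lt0n j0.
rewrite (bigD1 (Ordinal fj)) //= [X in _ + X]big1 => [|i].
  rewrite addr0 /= subnK 1?ltnW // muE mxtrace_scalar /c subKn 1?ltnW //.
  by rewrite -[mu *+ n]mulr_natl divrK.
rewrite -val_eqE /= => ij; rewrite tr_Xw ?mulr0 //.
apply: contra ij => /dvdnP[a aE]; apply/eqP.
move: aE (ltn_ord i) jf (f_gt0); move: (nat_of_ord i) => y; case: a => [|[|a]]; rewrite ?mulSn ?mul0n; lia.
Qed.

Lemma horner_cent P : cent (horner_mx Xw P).
Proof.
elim/poly_ind: P => [|P c IH]; first by rewrite rmorph0; apply: cent0.
rewrite rmorphD rmorphM /= horner_mx_X horner_mx_C; apply: centD; first exact: centM centX.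
by move=> h _; rewrite -!mulmxE scalar_mxC.
Qed.

Lemma cent_comm Y Z : Y * Xw = Xw * Y -> cent Z -> Y * Z = Z * Y.
Proof.
move=> YX /cent_horner[P ->]; elim/poly_ind: P => [|P c IH]; first by rewrite rmorph0 mulr0 mul0r.
rewrite rmorphD rmorphM /= horner_mx_X horner_mx_C mulrDr mulrDl mulrA IH -mulrA YX mulrA.
by congr (_ + _); rewrite -!mulmxE scalar_mxC.
Qed.

Lemma cent_commXw Z : cent Z -> Z * Xw = Xw * Z.
Proof. by move=> cZ; rewrite (cent_comm (Y := Xw)). Qed.

(** Candidates for the value at g of the lifted representation. Two of them differ by an element of
    the centralizer congruent to 1 modulo l ([lifts_ratio]). *)
Definition lifts g (U : MW) := [/\ redm U = theta g,
  forall h, GN h -> phi (g * h * g^-1)%g * U = U * phi h & U * Xw = Xw * U].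

Lemma lifts_unit g U : lifts g U -> U \is a GRing.unit.
Proof. by move=> [e' _ _]; rewrite (witt_mx_unitE witt_W) e' th_unit. Qed.

Lemma liftsM g h U V : lifts g U -> lifts h V -> lifts (g * h)%g (U * V).
Proof.
move=> [rU iU xU] [rV iV xV]; split.
- by rewrite redMM rU rV thM.
- move=> x xN; have xN' := GN_normal h xN.
  have -> : (g * h * x * (g * h)^-1 = g * (h * x * h^-1) * g^-1)%g by rewrite invMg !mulgA.
  by rewrite mulrA iU // -mulrA iV // mulrA.
by rewrite -mulrA xV mulrA xU -mulrA.
Qed.

Lemma lifts1_cent g c : theta g = 1 -> (forall h, GN h -> phi (g * h * g^-1)%g = phi h) ->
  lifts g c -> cent c /\ divl 1 (c - 1).
Proof.
move=> tg pg [rc ic _]; split; first by move=> h hN; rewrite -ic // pg.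
by apply/(red_mx_eq witt_W); rewrite rc tg map_mx1.
Qed.

Lemma lifts_cent g U c : lifts g U -> cent c -> divl 1 (c - 1) -> lifts g (U * c).
Proof.
move=> [rU iU xU] cc c1; split.
- have e' : redm c = 1 by rewrite -[RHS](map_mx1 red); apply/(red_mx_eq witt_W).
  by rewrite redMM rU e' mulr1.
- by move=> h hN; rewrite mulrA iU // -!mulrA cc.
by rewrite -mulrA (cent_commXw cc) !mulrA xU.
Qed.

Lemma lifts_ratio g U V : lifts g U -> lifts g V -> exists2 c, cent c /\ divl 1 (c - 1) & V = U * c.
Proof.
move=> LU LV; have Uu := lifts_unit LU; case: LU LV => [rU iU xU] [rV iV xV].
exists (U^-1 * V); last by rewrite mulrA divrr // mul1r.
split.
  move=> h hN; apply: (mulrI Uu); rewrite !mulrA -iU // -(mulrA (phi _)) divrr // mulr1 iV //.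
  by rewrite mul1r.
apply/(red_mx_eq witt_W); apply: (mulrI (th_unit g)); rewrite -{1}rU -redMM mulrA divrr // mul1r.
by rewrite rV map_mx1 mulr1.
Qed.

(** Two averages: one over GN gives the conjugation property, the other, over the operators Xw^i U
    Xw^(f-i), makes U commute with Xw and keeps the first property. *)
Lemma lifts_exists g : chi g = 1 -> exists U, lifts g U.
Proof.
move=> g1; have [eS el eF] := eNP; have [U0 U0E] := mx_lift witt_W (theta g).
pose F x : MW := phi (g * x^-1 * g^-1)%g * U0 * phi x.
have q1 : q 1%g = 1%g by apply: (mulgI (q 1%g)); rewrite -qM !mulg1.
have qV x y : q x = q y -> q x^-1%g = q y^-1%g.
  by move=> xy; apply: (mulgI (q x)); rewrite -qM mulgV xy -qM mulgV.
have qF x y : q x = q y -> F x = F y.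
  move=> xy; rewrite /F (phi_q xy); congr (_ * _ * _); apply: phi_q.
  by rewrite !qM (qV _ _ xy).
pose U1 : MW := avg eN F.
have rU1 : redm U1 = theta g.
  apply: (red_avg chl witt_W eS el) => x Sx; rewrite /F !redMM !phi_red U0E -!thM.
  by rewrite mulgKV mulgKV.
have iU1 h : GN h -> phi (g * h * g^-1)%g * U1 = U1 * phi h.
  move=> hN; have h' : redm U1 = redm U1 by [].
  transitivity (avg eN (fun x => phi (g * h * g^-1)%g * F x)); first exact: avg_mull.
  transitivity (avg eN (fun x => F x * phi h)); last by symmetry; exact: avg_mulr.
  transitivity (avg eN (fun x => phi (g * h * g^-1)%g * F (x * h)%g)).
    symmetry; apply: (avg_shiftr (F := fun x => phi (g * h * g^-1)%g * F x : MW) eF) => // x y xy.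
    by rewrite (qF _ _ xy).
  apply: (avg_eq eS) => x xN.
  have e1 : phi (x * h)%g = phi x * phi h by rewrite phiM //; apply: GN_S.
  have e2 : phi (g * h * g^-1)%g * phi (g * (x * h)^-1 * g^-1)%g = phi (g * x^-1 * g^-1)%g.
    rewrite -phiM; last by apply/GN_S/GN_normal/NV/NM.
    by congr phi; rewrite invMg !mulgA mulgKV -!mulgA mulKVg.
  by rewrite /F e1 !mulrA e2.
have [mu muu muE] := Xwf.
have fu : (f%:R : W) \is a GRing.unit := witt_nat_unit chl witt_W l_ndvd_f.
have fmu : f%:R * mu \is a GRing.unit by rewrite unitrM fu.
pose H i j : MW := Xw ^+ i * U1 * Xw ^+ j.
have tX i : theta g * X ^+ i = X ^+ i * theta g.
  by apply: commrX; rewrite /GRing.comm X_int g1 expr1n scale1r.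
exists ((f%:R * mu)^-1 *: \sum_(i < f) H i (f - i)%N); split.
- rewrite map_mxZ /= raddf_sum /= (eq_bigr (fun=> red mu *: theta g)) => [|i _]; last first.
    rewrite !redMM !redX rU1 Xw_red -tX -mulrA -exprD subnKC 1?ltnW //.
    have : redm (Xw ^+ f) = (red mu)%:M by rewrite muE map_scalar_mx.
    by rewrite redX Xw_red => ->; rewrite -mulmxE mul_mx_scalar.
  rewrite sumr_const card_ord -scaler_nat !scalerA -(rmorph_nat red) -!rmorphM -mulrA mulVr //.
  by rewrite rmorph1 scale1r.
- move=> h hN; rewrite mulZr mulZl; congr (_ *: _); rewrite mulr_sumr mulr_suml; apply: eq_bigr => i _.
  have c1 := centXn i centX (GN_normal g hN); have c2 := centXn (f - i) centX hN.
  by rewrite /H !mulrA c1 -(mulrA (Xw ^+ i)) iU1 // -!mulrA -c2.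
rewrite mulZr mulZl; congr (_ *: _); rewrite mulr_sumr mulr_suml.
case: (f) f_gt0 muE => // f' _ muE'; rewrite big_ord_recl [RHS]big_ord_recr /= subSnn subn0.
have a1 : H 0%N f'.+1 * Xw = mu%:M * U1 * Xw.
  by rewrite /H expr0 mul1r muE'; congr (_ * _); rewrite -!mulmxE scalar_mxC.
have a2 : Xw * H f' 1%N = mu%:M * U1 * Xw by rewrite /H expr1 !mulrA -exprS muE'.
rewrite a1 a2 addrC; congr (_ + _); apply: eq_bigr => i _.
rewrite /bump /= add1n subSS /H -mulrA -exprSr [RHS]mulrA (mulrA Xw) -exprS.
by rewrite subSn // ltnW.
Qed.

Variables (mu : W) (mu_unit : mu \is a GRing.unit) (Xwf_mu : Xw ^+ f = mu%:M).

Local Notation ev := (horner_mx Xw).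
Let cf : W := (f%:R * mu)^-1.
Let fu : (f%:R : W) \is a GRing.unit. Proof. exact: (witt_nat_unit chl witt_W). Qed.
Let cfE : cf * (f%:R * mu) = 1. Proof. by rewrite mulVr // unitrM fu. Qed.

                                                                             
                                                                               
                                                                    
(** The separability idempotent of W[Xw], with Xw^f = mu, in polynomial form; [eb] is its value at
    Xw. *)
Definition ep : 'M[{poly W}]_n := \sum_(i < f) (cf *: 'X^i) *: map_mx polyC (Xw ^+ (f - i)).
Definition eb : 'M[MW]_n := \sum_(i < f) inner n' (cf *: Xw ^+ i) * outer n' (Xw ^+ (f - i)).
(** The determinant of U as a W[Xw]-linear endomorphism of W^n: the matrix acts as U on the image of
    the idempotent and as 1 on the complement. It is computed over the commutative ring of
    polynomials and evaluated at Xw afterwards. *)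
Definition delta (U : MW) : MW := ev (\det (1%:M + map_mx polyC (U - 1) *m ep)).

Lemma ev_ep : map_mx ev ep = eb.
Proof.
apply/matrixP => a b; rewrite mxE !summxE rmorph_sum; apply: eq_bigr => i _.
rewrite inner_mulr !mxE rmorphM /= horner_mx_C linearZ /= rmorphXn /= horner_mx_X.
by [].
Qed.

Lemma delta_ext (A B : 'M[{poly W}]_n) : map_mx ev A = map_mx ev B -> ev (\det A) = ev (\det B).
Proof.
move=> AB; rewrite /determinant !rmorph_sum; apply: eq_bigr => s0 _; rewrite !rmorphM !rmorph_prod /=.
by congr (_ * _); apply: eq_bigr => i _; have := congr1 (fun C : 'M[MW]_n => C i (s0 i)) AB; rewrite !mxE.
Qed.

Lemma ev_delta U : map_mx ev (1%:M + map_mx polyC (U - 1) *m ep) = 1 + outer n' (U - 1) * eb.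
Proof.
rewrite map_mxD map_mx1 map_mxM ev_ep; congr (_ + _ * _).
by apply/matrixP => a b; rewrite !mxE; exact: horner_mx_C.
Qed.

Lemma inner_comm (Y Z : MW) : Y * Z = Z * Y -> inner n' Y * inner n' Z = inner n' Z * inner n' Y.
Proof. by move=> YZ; rewrite -!innerM YZ. Qed.

Lemma eb_comm U : U * Xw = Xw * U -> outer n' U * eb = eb * outer n' U.
Proof.
move=> UX; rewrite /eb mulr_sumr mulr_suml; apply: eq_bigr => i _.
by rewrite mulrA outer_inner -!mulrA -!outerM (commrX _ UX).
Qed.

Lemma innerX_eb c : c * Xw = Xw * c -> inner n' c * eb = eb * inner n' c.
Proof.
move=> cX; rewrite /eb mulr_sumr mulr_suml; apply: eq_bigr => i _.
rewrite -mulrA outer_inner !mulrA; congr (_ * _); apply: inner_comm.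
by rewrite mulZr mulZl (commrX _ cX).
Qed.

Lemma outerZ c (A : MW) : outer n' (c *: A) = inner n' c%:M * outer n' A.
Proof. by apply/matrixP => a b; rewrite inner_mulr !mxE -mulmxE -scalar_mxM. Qed.

Lemma eb_shift : outer n' Xw * eb = inner n' Xw * eb.
Proof.
rewrite /eb !mulr_sumr; case: (f) f_gt0 Xwf_mu => // f' _ Xf'.
rewrite big_ord_recl [RHS]big_ord_recr /= addrC subSnn subn0; congr (_ + _).
  rewrite mulrA outer_inner -mulrA -outerM [RHS]mulrA -innerM mulZr -exprS !Xf' expr0 expr1.
  have -> : Xw * mu%:M = mu *: Xw by rewrite -mulmxE mul_mx_scalar.
  by rewrite outerZ mulrA -innerM mulZl mul1r.
apply: eq_bigr => i _; rewrite /bump /= add1n subSS mulrA outer_inner -mulrA -outerM -exprS.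
by rewrite [RHS]mulrA -innerM mulZr -exprS subSn // ltnW.
Qed.

(** On the image of the idempotent, a polynomial in Xw acting on the module coincides with the same
    element acting as a scalar. *)
Lemma outer_eb P : outer n' (ev P) * eb = inner n' (ev P) * eb.
Proof.
elim/poly_ind: P => [|P c IH].
  by rewrite rmorph0; congr (_ * _); apply/matrixP => a b; rewrite !mxE mul0rn raddf0.
have oc : outer n' (c%:M : MW) = inner n' c%:M.
  by apply/matrixP => a b; rewrite !mxE; case: eqP => _; rewrite ?mulr1n // !mulr0n raddf0.
have XevP : ev P * Xw = Xw * ev P by apply: cent_commXw; apply: horner_cent.
rewrite rmorphD rmorphM /= horner_mx_X horner_mx_C outerD mulrDl oc outerM -mulrA eb_shift.
rewrite innerX_eb // mulrA IH -mulrA -innerX_eb // mulrA -innerM -mulrDl; congr (_ * _).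
by rewrite /inner raddfD.
Qed.

Lemma eb_idem : eb * eb = eb.
Proof.
rewrite {1}/eb mulr_suml (eq_bigr (fun=> inner n' (cf * mu)%:M * eb)) => [|i _].
  rewrite -mulr_suml sumr_const card_ord -[X in _ = X]mul1r; congr (_ * _).
  rewrite -inner1 /inner -raddfMn /=; congr (_%:M).
  by rewrite -raddfMn /= -mulr_natl mulrCA cfE.
rewrite -mulrA; have -> : Xw ^+ (f - i) = ev ('X^(f - i)) by rewrite rmorphXn /= horner_mx_X.
rewrite outer_eb rmorphXn /= horner_mx_X mulrA -innerM mulZl -exprD subnKC 1?ltnW // Xwf_mu.
by rewrite scale_scalar_mx.
Qed.

(** After evaluation the factors are 1 + (U-1)e and 1 + (V-1)e, with e an idempotent that commutes
    with V; they multiply to 1 + (UV-1)e. *)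
Lemma deltaM U V : V * Xw = Xw * V -> delta (U * V) = delta U * delta V.
Proof.
move=> VX; rewrite /delta -rmorphM -det_mulmx; apply: delta_ext; rewrite map_mxM !ev_delta.
have V1 : (V - 1) * Xw = Xw * (V - 1) by rewrite mulrBl mulrBr VX mulr1 mul1r.
rewrite mulmxE mulrDl mul1r mulrDr mulr1 -addrA; congr (_ + _).
rewrite -(mulrA (outer _ _) eb) (mulrA eb) -(eb_comm V1) -(mulrA (outer _ _) eb) eb_idem.
rewrite mulrA -outerM -!mulrDl -!outerD; congr (outer _ _ * _).
have -> : U - 1 + (U - 1) * (V - 1) = (U - 1) * V by rewrite mulrBr mulr1 addrC subrK.
by rewrite mulrBl mul1r [RHS]addrC subrKA.
Qed.

Lemma delta_cent U : cent (delta U). Proof. exact: horner_cent. Qed.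

Lemma delta1 : delta 1 = 1.
Proof.
have e1 : ev (\det (1%:M : 'M[{poly W}]_n)) = 1 by rewrite det1 rmorph1.
rewrite /delta -[RHS]e1; apply: delta_ext; apply: etrans (ev_delta _) _; rewrite map_mx1 subrr.
have -> : outer n' (0 : MW) = 0 by apply/matrixP => a b; rewrite !mxE raddf0.
by rewrite mul0r addr0.
Qed.

Lemma ev_tr_ep : ev (\tr ep) = (n%:R / f%:R)%:M.
Proof.
have -> : \tr ep = \sum_(i < f) (cf *: 'X^i) * (\tr (Xw ^+ (f - i)))%:P.
  rewrite /ep raddf_sum; apply: eq_bigr => i _; rewrite /= mxtraceZ; congr (_ * _).
  by rewrite /mxtrace rmorph_sum; apply: eq_bigr => a _; rewrite mxE.
rewrite rmorph_sum (bigD1 (Ordinal f_gt0)) //= big1 => [|i].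
  rewrite addr0 subn0 Xwf_mu mxtrace_scalar rmorphM /= horner_mx_C linearZ /= expr0 rmorph1 mulZl mul1r.
  rewrite scale_scalar_mx; congr (_%:M); apply: (mulIr fu); rewrite divrK //.
  transitivity (n%:R * (cf * (f%:R * mu))); last by rewrite cfE mulr1.
  rewrite -[mu *+ n]mulr_natl; ring.
rewrite -val_eqE /= => i0; rewrite tr_Xw ?mulr0 ?rmorph0 // gtnNdvd ?subn_gt0 //.
by rewrite ltn_subrL lt0n i0.
Qed.

(** W^n has rank n/f over W[Xw], so the first-order term is the trace of the scalar c, namely (n/f)
    c. *)
Lemma delta_1_add c j : cent c -> exists2 c2, cent c2 &
  delta (1 + c *+ l ^ j) = 1 + ((n%:R / f%:R) *: c) *+ l ^ j + c2 *+ l ^ (j + j).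
Proof.
move=> cc; have [P PE] := cent_horner cc; pose t : {poly W} := (l ^ j)%:R.
have tPep : map_mx ev (t *: (P *: ep)) = (inner n' (ev P) * map_mx ev ep) *+ l ^ j.
  apply/matrixP => a b; rewrite mulrn_mxE inner_mulr !mxE rmorphM rmorphM /= rmorph_nat.
  by rewrite mulr_natl.
have [D DE] := det_1_add t (P *: ep); exists (ev D); first exact: horner_cent.
have -> : delta (1 + c *+ l ^ j) = ev (\det (1%:M + t *: (P *: ep))).
  apply: delta_ext; apply: etrans (ev_delta _) _.
  rewrite [X in outer _ X]addrAC subrr add0r map_mxD map_mx1; congr (_ + _).
  have -> : outer n' (c *+ l ^ j) = outer n' c *+ l ^ j.
    by apply/matrixP => a b; rewrite mulrn_mxE !mxE mulrn_mxE raddfMn.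
  by rewrite mulrnAl PE outer_eb -ev_ep -tPep.
rewrite DE !rmorphD rmorph1 !rmorphM /= mxtraceZ rmorphM /= ev_tr_ep -PE !rmorph_nat.
rewrite -mulrA !mulr_natl -mulrnA -expnD.
by rewrite -mulmxE mul_mx_scalar.
Qed.

Hypothesis f_dvd_k : (f %| #|k|.-1)%N.
Local Notation Q := (#|k| ^ f).-1.

Lemma Q_prime_l : ~~ (l %| Q)%N.
Proof.
have [r r0 kE] := card_k chl; have fr : (0 < r * f)%N by rewrite muln_gt0 r0.
rewrite kE -expnM -(prednK fr) expnS; apply/negP => d.
have p0 : (0 < l * l ^ (r * f).-1)%N by rewrite muln_gt0 prime_gt0 // expn_gt0 prime_gt0.
have : (l %| (l * l ^ (r * f).-1).-1.+1)%N by rewrite (prednK p0) dvdn_mulr.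
by rewrite -addn1 dvdn_addr // dvdn1 => /eqP l1; move: l_gt2; rewrite l1.
Qed.

(** The exponent q^f - 1, q the cardinal of [k], is prime to l and makes the determinant congruent
    to 1 modulo l ([dQ_unipotent]). *)
Definition dQ U := delta U ^+ Q.
Definition rr : W := n%:R / f%:R * Q%:R.

Lemma rr_unit : rr \is a GRing.unit.
Proof. by rewrite !unitrM unitrV nw fu (witt_nat_unit chl witt_W) // Q_prime_l. Qed.

Lemma dQ_cent U : cent (dQ U). Proof. exact: centXn (delta_cent U). Qed.

Lemma cent_cent Y Z : cent Y -> cent Z -> Y * Z = Z * Y.
Proof. by move=> /cent_commXw; apply: cent_comm. Qed.

Lemma dQM U V : V * Xw = Xw * V -> dQ (U * V) = dQ U * dQ V.
Proof.
move=> VX; rewrite /dQ deltaM // exprMn_comm //; apply: cent_cent; exact: delta_cent.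
Qed.

Lemma dQ1 : dQ 1 = 1. Proof. by rewrite /dQ delta1 expr1n. Qed.

Lemma dQX U i : U * Xw = Xw * U -> dQ (U ^+ i) = dQ U ^+ i.
Proof.
move=> UX; elim: i => [|i IH]; first by rewrite !expr0 dQ1.
by rewrite !exprS dQM ?IH //; apply/esym/commrX.
Qed.

Lemma dQ_1_add c j : (0 < j)%N -> cent c -> exists2 c2, cent c2 &
  dQ (1 + c *+ l ^ j) = 1 + (rr *: c) *+ l ^ j + c2 *+ l ^ j.+1.
Proof.
move=> j0 cc; have [c2 cc2 dE] := delta_1_add j cc.
pose x := ((n%:R / f%:R) *: c) *+ l ^ j + c2 *+ l ^ (j + j).
have cx : cent x by apply: centD; apply: cent_mulrn => //; apply: centZ.
have [y cy yE] := @pow_1_add MW x cent Q cent0 cent1 centD centM cx (fun y cy => cent_cent cy cx).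
have [z [cz zE]] : exists z, cent z /\ x = z *+ l ^ j.
  exists ((n%:R / f%:R) *: c + c2 *+ l ^ j); split; first by apply: centD; [apply: centZ | apply: cent_mulrn].
  by rewrite mulrnDl -mulrnA -expnD.
exists (c2 *+ l ^ j.-1 *+ Q + (z * z * y) *+ l ^ j.-1).
  by apply: centD; repeat apply: cent_mulrn => //; do 2 apply: centM => //.
rewrite /dQ dE -addrA -/x yE -!addrA; congr (_ + _); rewrite /x mulrnDl -addrA; congr (_ + _).
  by rewrite /rr mulr_natr -scalerMnl mulrnAC.
rewrite -/x zE mulrnDl; congr (_ + _).
  rewrite [RHS]mulrnAC -(mulrnA c2 (l ^ j.-1)) -expnD; congr (_ *+ _ ^ _ *+ _)%N; lia.
rewrite mulrnAl mulrnAr mulrnAl -!mulrnA mulrnAl -mulrnA; congr (_ *+ _).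
by rewrite -!expnD; congr (_ ^ _)%N; lia.
Qed.

(** To first order [dQ] multiplies c - 1 by the unit [rr], so dQ c = 1 pushes c - 1 into ever higher
    powers of l. *)
Lemma dQ_inj c : cent c -> divl 1 (c - 1) -> dQ c = 1 -> c = 1.
Proof.
move=> cc c1 dc; apply: (mx_separated witt_W); elim=> [|j [z zE]] //.
have cz : cent z by apply: (@cent_div j.+1); rewrite -zE; apply: centD => //; apply/centN/cent1.
have cE : c = 1 + z *+ l ^ j.+1 by rewrite -zE addrC subrK.
have [c2 _ dE] := dQ_1_add (ltn0Sn j) cz.
have e1 : (rr *: z) *+ l ^ j.+1 = (- c2 *+ l) *+ l ^ j.+1.
  apply/eqP; rewrite -mulrnA -expnS mulNrn -addr_eq0; apply/eqP/(addrI 1).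
  by rewrite addr0 -[RHS]dc cE dE addrA.
have {}e1 : rr *: z = - c2 *+ l.
  by apply/eqP; rewrite -subr_eq0; apply/eqP/(mx_regular witt_W (j := j.+1)); rewrite mulrnBl e1 subrr.
exists (rr^-1 *: (- c2)); rewrite zE [in RHS]expnS mulrnA; congr (_ *+ _).
by rewrite scalerMnr -e1 scalerA mulVr ?rr_unit // scale1r.
Qed.

Lemma cent_limit (u : nat -> MW) c : (forall j, cent (u j)) -> (forall j, divl j.+1 (c - u j)) -> cent c.
Proof.
move=> cu cl h hN; apply: (mx_separated witt_W) => j.
have -> : phi h * c - c * phi h = phi h * (c - u j) - (c - u j) * phi h.
  by rewrite mulrBr mulrBl cu // opprB addrA subrK.
by apply: divlB; [apply: divlMl | apply: divlMr].
Qed.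

(** Newton approximation inside the centralizer, the first-order factor [rr] being a unit. *)
Lemma dQ_surj y : cent y -> divl 1 (y - 1) -> exists c, [/\ cent c, divl 1 (c - 1) & dQ c = y].
Proof.
move=> cy y1; pose good j c := [/\ cent c, divl 1 (c - 1) & divl j.+1 (y - dQ c)].
have divl_unit (c : MW) : divl 1 (c - 1) -> c \is a GRing.unit.
  by move=> h; rewrite (witt_mx_unitE witt_W) ((red_mx_eq witt_W _ _).2 h) map_mx1 unitr1.
have good0 : good 0%N 1 by split; rewrite ?dQ1 // ?subrr; [apply: cent1 | apply: divl0].
have step j c : good j c -> exists c', good j.+1 c' /\ divl j.+1 (c' - c).
  case=> cc c1 [v vE]; have cv : cent v.
    by apply: (@cent_div j.+1); rewrite -vE; apply: centD => //; apply/centN/dQ_cent.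
  pose z := rr^-1 *: v; have cz : cent z by apply: centZ.
  have [c2 cc2 dE] := dQ_1_add (ltn0Sn j) cz.
  have zd : divl j.+1 (z *+ l ^ j.+1) by exists z.
  exists (c * (1 + z *+ l ^ j.+1)); split; last first.
    by rewrite mulrDr mulr1 addrC addKr; apply: divlMl.
  split.
  - by apply: centM => //; apply: centD; [apply: cent1 | apply: cent_mulrn].
  - rewrite mulrDr mulr1 addrAC; apply: divlD => //; apply/divlMl.
    by apply: (@divl_le _ _ _ j.+1).
  rewrite dQM; last first.
    by apply: cent_commXw; apply: centD; [apply: cent1 | apply: cent_mulrn].
  rewrite dE /z scalerA mulrV ?rr_unit // scale1r !mulrDr mulr1 !opprD !addrA vE.
  apply: divlB; last by apply: divlMl; exists c2.
  apply: (@divl_le _ _ _ (1 + j.+1)) => //; rewrite -[X in X - _]mul1r -mulrBl; apply: divlM; last by exists v.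
  by apply: divlC; rewrite -(subrKA y); apply: divlD => //; apply: divlC; exists (v *+ l ^ j); rewrite vE expn1 -mulrnA -expnSr.
have /choice[next nextP] : forall jc : nat * MW, exists c', good jc.1 jc.2 -> good jc.1.+1 c' /\ divl jc.1.+1 (c' - jc.2).
  move=> [j c]; have [/step[c' c'P]|] := pselect (good j c); [by exists c' | by exists 1].
pose u := fix u j := if j is j'.+1 then next (j', u j') else (1 : MW).
have uP j : good j (u j) by elim: j => [|j IH]; [exact: good0 | exact: (nextP (j, u j) IH).1].
have uS j : divl j.+1 (u j.+1 - u j) by have [] := nextP (j, u j) (uP j).
have [c cP] : exists x, forall j, divl j (x - u j).
  by apply: (mx_limit witt_W) => j; apply: divl_le (uS j).
have cP' j : divl j.+1 (c - u j) by apply: (@divl_trans _ _ _ (u j.+1)).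
have cc : cent c by apply: (cent_limit (u := u)) => // j; have [] := uP j.
have c1 : divl 1 (c - 1) := cP' 0%N.
exists c; split=> //.
apply: (mx_separated witt_W) => j; have [cu u1 uy] := uP j; have [w wE] := cP' j.
have uu := divl_unit _ u1; apply: (@divl_trans _ _ _ (dQ (u j))); last exact: divlC.
have cw : cent w by apply: (@cent_div j.+1); rewrite -wE; apply: centD => //; apply: centN.
have cz : cent ((u j)^-1 * w) by apply: centM => //; apply: centV.
have [c2 _ dE] := dQ_1_add (ltn0Sn j) cz.
have -> : c = u j * (1 + ((u j)^-1 * w) *+ l ^ j.+1).
  by rewrite mulrDr mulr1 mulrnAr mulrA divrr // mul1r -wE addrC subrK.
rewrite dQM; last by apply: cent_commXw; apply: centD; [apply: cent1 | apply: cent_mulrn].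
rewrite dE -addrA mulrDr mulr1 (addrC (dQ _)) addrK; apply/divlMl/divlD; first by exists (rr *: ((u j)^-1 * w)).
by apply: (@divl_le _ _ _ j.+2) => //; exists c2.
Qed.

Lemma red_horner P : redm (ev P) = horner_mx X (map_poly red P).
Proof.
elim/poly_ind: P => [|P c IH]; first by rewrite !rmorph0.
rewrite !rmorphD !rmorphM /= !horner_mx_X !horner_mx_C map_polyC map_polyX horner_mx_X horner_mx_C.
by rewrite IH Xw_red map_scalar_mx.
Qed.

Lemma dQ_unipotent U : U \is a GRing.unit -> U * Xw = Xw * U -> divl 1 (dQ U - 1).
Proof.
move=> Uu UX; have VX : U^-1 * Xw = Xw * U^-1 by apply/esym/commrV.
have du : delta U \is a GRing.unit.
  have e1 : delta U * delta U^-1 = 1 by rewrite -deltaM // divrr // delta1.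
  have e2 : delta U^-1 * delta U = 1 by rewrite -deltaM // mulVr // delta1.
  by apply/unitrP; exists (delta U^-1).
have [r _ kE] := card_k chl; apply/(red_mx_eq witt_W); rewrite map_mx1 redX red_horner.
apply: (horner_torsion chl kE f_dvd_k la0 Xf); rewrite -red_horner.
by rewrite -(witt_mx_unitE witt_W).
Qed.

Definition torsion (U : MW) := exists2 M, (0 < M)%N & U ^+ M = 1.

Let q1 : q 1%g = 1%g. Proof. by apply: (mulgI (q 1%g)); rewrite -qM !mulg1. Qed.
Let qX g i : q (g ^+ i)%g = (q g ^+ i)%g.
Proof. by elim: i => [|i IH]; rewrite ?expg0 // !expgS qM IH. Qed.

Lemma liftsX g U i : lifts g U -> lifts (g ^+ i)%g (U ^+ i).
Proof.
move=> LU; elim: i => [|i IH]; last by rewrite expgS exprS; apply: liftsM.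
rewrite expg0 expr0; split; rewrite ?map_mx1 ?th1 ?mul1r ?mulr1 // => h hN.
by rewrite mulr1 mul1r mul1g invg1 mulg1.
Qed.

(** If U is torsion, so is dQ U, which is congruent to 1 and hence equal to 1 by [torsion_free].
    Conversely the power of U by the order of [gT] is a lift at an element trivial in [gT], so
    [dQ_inj] applies to it. *)
Lemma lifts_torsion g U : lifts g U -> torsion U <-> dQ U = 1.
Proof.
move=> LU; have [_ _ UX] := LU; have Uu := lifts_unit LU; split=> [[M M0 UM]|dU].
  apply: (torsion_free l_pr chl witt_W l_gt2 M0); first exact: dQ_unipotent.
  by rewrite -dQX // UM dQ1.
exists #|[set: gT]|; first exact: cardG_gt0.
have qg : q (g ^+ #|[set: gT]|)%g = q 1%g by rewrite qX expg_cardG ?inE.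
have [|h hN|cU c1] := lifts1_cent _ _ (liftsX #|[set: gT]| LU).
- by rewrite (theta_q qg).
- by apply: phi_q; rewrite !qM qg q1 mul1g (_ : q (g ^+ #|[set: gT]|)^-1%g = 1%g) ?mulg1 //; apply: (mulgI (q (g ^+ #|[set: gT]|)%g)); rewrite -qM mulgV qg mulg1.
by apply: dQ_inj => //; rewrite dQX // dU expr1n.
Qed.

(** Any lift U0 is corrected by a centralizing c with dQ c = dQ(U0^-1). The result is torsion, and
    by [ucan_unique] it is the only torsion lift, which is why [ucan] turns out multiplicative. *)
Lemma ucan_exists g : chi g = 1 -> exists U, lifts g U /\ torsion U.
Proof.
move=> /lifts_exists[U0 LU]; have [_ _ UX] := LU; have Uu := lifts_unit LU.
have d1 := dQ_unipotent Uu UX; have VX : U0^-1 * Xw = Xw * U0^-1 by apply/esym/commrV.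
have dV : dQ U0 * dQ U0^-1 = 1 by rewrite -dQM // divrr // dQ1.
have dVl : dQ U0^-1 * dQ U0 = 1 by rewrite -dQM // mulVr // dQ1.
have [c [cc c1 cE]] := dQ_surj (dQ_cent U0^-1) (dQ_unipotent (etrans (unitrV _) Uu) VX).
exists (U0 * c); split; first exact: lifts_cent.
apply/(lifts_torsion (g := g)); first exact: lifts_cent.
by rewrite dQM ?cE //; apply: cent_commXw.
Qed.

Lemma ucan_unique g U V : lifts g U -> lifts g V -> torsion U -> torsion V -> U = V.
Proof.
move=> LU LV /(lifts_torsion LU) dU /(lifts_torsion LV) dV.
have [c [cc c1] cE] := lifts_ratio LU LV; suff c1' : c = 1 by rewrite cE c1' mulr1.
by apply: dQ_inj => //; have := dV; rewrite cE dQM ?dU ?mul1r //; apply: cent_commXw.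
Qed.

Definition ucan g : MW := xget 1 [set U | lifts g U /\ torsion U]%classic.

Lemma ucanP g : chi g = 1 -> lifts g (ucan g) /\ torsion (ucan g).
Proof. by move=> /ucan_exists[U UP]; apply: (xgetPex 1 (P := [set U | lifts g U /\ torsion U]%classic)); exists U. Qed.

Lemma ucanE g U : chi g = 1 -> lifts g U -> torsion U -> ucan g = U.
Proof. by move=> /ucanP[LV tV] LU tU; apply: ucan_unique LV LU tV tU. Qed.

Lemma ucanM g h : chi g = 1 -> chi h = 1 -> ucan (g * h)%g = ucan g * ucan h.
Proof.
move=> g1 h1; have [LU tU] := ucanP g1; have [LV tV] := ucanP h1; have L := liftsM LU LV.
apply: ucanE => //; first by rewrite chiM g1 h1 mulr1.
apply/(lifts_torsion L); have [_ _ VX] := LV; rewrite dQM //.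
by rewrite (lifts_torsion LU).1 // (lifts_torsion LV).1 // mulr1.
Qed.

Lemma ucan_q g h : q g = q h -> chi g = 1 -> ucan g = ucan h.
Proof.
move=> gh g1; have h1 : chi h = 1 by rewrite -(chi_q gh).
have [[rV iV xV] tV] := ucanP h1; apply: ucanE => //; split=> // [|x xN].
  by rewrite (theta_q gh).
rewrite -iV //; congr (_ * _); apply: phi_q; rewrite !qM gh; congr (_ * _)%g.
by apply: (mulgI (q g)); rewrite -qM mulgV gh -qM mulgV.
Qed.

Lemma phi_torsion g : S g -> torsion (phi g).
Proof.
move=> Sg; exists #|[set: gT]|; first exact: cardG_gt0.
by rewrite -phiX // -phi1; apply: phi_q; rewrite qX expg_cardG ?inE.
Qed.

Lemma ucan_phi h : GN h -> ucan h = phi h.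
Proof.
move=> hN; apply: ucanE; [exact: GN_chi| split => // | exact: phi_torsion (GN_S hN)].
- by move=> x xN; rewrite -(phiM _ (GN_S hN)) -(phiM _ (GN_S xN)) mulgKV.
- exact: centX.
Qed.

Lemma ucan_conj x g : S x -> chi g = 1 -> ucan (x * g * x^-1)%g = phi x * ucan g * phi x^-1%g.
Proof.
move=> Sx g1; have [[rU iU xU] [M M0 tU]] := ucanP g1.
have xx : phi x^-1%g * phi x = 1 by apply: phiVE.
have xx' : phi x * phi x^-1%g = 1 by rewrite -phiM ?mulgV ?phi1 //; apply: SV.
apply: ucanE; first by rewrite !chiM g1 mulr1 chiV.
  split.
  - by rewrite !redMM !phi_red rU -!thM.
  - move=> h hN; have h'N : GN (x^-1 * h * x)%g by have := GN_normal x^-1%g hN; rewrite invgK.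
    have -> : (x * g * x^-1 * h * (x * g * x^-1)^-1 = x * (g * (x^-1 * h * x) * g^-1) * x^-1)%g.
      by rewrite !invMg invgK !mulgA.
    have N2 := GN_normal g h'N.
    have e1 y : S y -> phi (x * y * x^-1)%g * phi x = phi x * phi y.
      by move=> Sy; rewrite -(phiM _ Sx) -(phiM _ Sy) mulgKV.
    have e2 : phi (x^-1 * h * x)%g * phi x^-1%g = phi x^-1%g * phi h.
      by rewrite -(phiM _ (SV Sx)) -(phiM _ (GN_S hN)) mulgK.
    rewrite !mulrA (e1 _ (GN_S N2)) -(mulrA (phi x)) iU //.
    by rewrite -!mulrA e2.
  have X1 : phi x^-1%g * Xw = chiW x^-1%g ^+ s *: (Xw * phi x^-1%g) by apply/Xw_int/SV.
  rewrite -mulrA X1 mulZr !mulrA -(mulrA (phi x)) xU mulrA Xw_int // mulZl mulZl scalerA.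
  by rewrite -exprMn mulrC chiWV expr1n scale1r -!mulrA.
exists M => //; have -> : (phi x * ucan g * phi x^-1%g) ^+ M = phi x * ucan g ^+ M * phi x^-1%g.
  elim: (M) => [|i IH]; first by rewrite !expr0 mulr1 xx'.
  by rewrite !exprS IH !mulrA -(mulrA _ (phi x^-1%g) (phi x)) xx mulr1.
by rewrite tU mulr1.
Qed.

(** Write g as an element of the kernel of chi times a power of [sg], and use [ucan] on the first
    factor and phi on the second. The value does not depend on the power, because the two
    constructions agree on GN. *)
Lemma thetaW_exists : exists tW : G -> MW, [/\ tW 1%g = 1,
  forall g h, tW (g * h)%g = tW g * tW h, forall g, redm (tW g) = theta g,
  forall g h, q g = q h -> tW g = tW h
  & forall g, tW g * Xw = chiW g ^+ s *: (Xw * tW g)].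
Proof.
have /choice[j jE] := chi_gen; have sgX i : S (sg ^+ i)%g.
  by elim: i => [|i IH]; rewrite ?expg0 // expgS; apply: SM.
have chiX g i : chi (g ^+ i)%g = chi g ^+ i.
  by elim: i => [|i IH]; rewrite ?expg0 // expgS chiM IH exprS.
have om0 : om != 0 by apply: contraTneq (oner_neq0 k) => o0; rewrite -(chiV sg) o0 mul0r eqxx.
have chi_split g i : chi g = om ^+ i -> chi (g * (sg ^+ i)^-1)%g = 1.
  by move=> e1; rewrite chiM e1 -chiX chiV.
pose W' g i := ucan (g * (sg ^+ i)^-1)%g * phi (sg ^+ i)%g.
(* Two admissible exponents differ by one for which the power of [sg] lies in GN. *)
have W'E g i i' : (i <= i')%N -> chi g = om ^+ i -> chi g = om ^+ i' -> W' g i = W' g i'.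
  move=> ii e1 e2; have dN : GN (sg ^+ (i' - i))%g.
    apply: S_chi => //; rewrite chiX; apply: (mulIf (expf_neq0 i om0)).
    by rewrite mul1r -exprD subnK // -e1 -e2.
  have -> : W' g i = ucan (g * (sg ^+ i')^-1 * sg ^+ (i' - i))%g * phi (sg ^+ i)%g.
    by congr (ucan _ * _); rewrite -{1}(subnK ii) expgnDr invMg -!mulgA; congr (_ * _)%g; rewrite mulVg mulg1.
  by rewrite (ucanM (chi_split _ _ e2) (GN_chi dN)) (ucan_phi dN) -mulrA -phiM // -expgnDr subnK.
have W'any g i : chi g = om ^+ i -> W' g (j g) = W' g i.
  by move=> e1; case/orP: (leq_total i (j g)) => ii; [symmetry|]; apply: W'E.
pose tW g := W' g (j g).
have tWM g h : tW (g * h)%g = tW g * tW h.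
  have gg := chi_split _ _ (jE g); have hh := chi_split _ _ (jE h).
  have ghE : chi (g * h)%g = om ^+ (j g + j h) by rewrite chiM (jE g) (jE h) exprD.
  rewrite /tW (W'any _ _ ghE) /W' expgnDr.
  move: (sgX (j g)) (sgX (j h)) gg hh; move: (sg ^+ j g)%g (sg ^+ j h)%g => a b Sa Sb gg hh.
  have -> : (g * h * (a * b)^-1 = (g * a^-1) * (a * (h * b^-1) * a^-1))%g by rewrite invMg !mulgA mulgKV.
  have aa : chi (a * (h * b^-1) * a^-1)%g = 1 by rewrite chiM chiM hh mulr1 chiV.
  have VV : phi a^-1%g * phi a = 1 := phiVE Sa.
  rewrite (ucanM gg aa) (ucan_conj Sa hh) (phiM _ Sb) -!mulrA; congr (_ * (_ * (_ * _))).
  by rewrite mulrA VV mul1r.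
have tWr g : redm (tW g) = theta g.
  have [[rU _ _] _] := ucanP (chi_split _ _ (jE g)).
  by rewrite redMM rU phi_red -thM mulgKV.
have tWq g h : q g = q h -> tW g = tW h.
  move=> gh; have hE : chi h = om ^+ j g by rewrite -(chi_q gh).
  rewrite /tW (W'any h _ hE) /W'; congr (_ * _); apply: ucan_q; last exact: chi_split (jE g).
  by rewrite !qM gh.
exists tW; split=> //.
- have t1 : tW 1%g * tW 1%g = tW 1%g by rewrite -tWM mulg1.
  have u1 : tW 1%g \is a GRing.unit by rewrite (witt_mx_unitE witt_W) tWr th1 unitr1.
  by apply: (mulrI u1); rewrite t1 mulr1.
move=> g; have g1 := chi_split _ _ (jE g); have [[_ _ xU] _] := ucanP g1.
rewrite /tW /W' -mulrA Xw_int // mulZr !mulrA xU; congr (_ *: _); congr (_ ^+ _).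
by rewrite -[in RHS](mulgKV (sg ^+ j g)%g g) chiWM (chiW1 g1) mul1r.
Qed.

End CanonicalLift.

                                        

(** * The map from Z_l to W, powers of ideals, and Z_l-exponents over CNL algebras *)

Section PadicIntoWitt.
Variables (l : nat) (l_pr : prime l) (k : finFieldType) (chl : l \in [pchar k]).
Variables (W : comNzRingType) (red : {rmorphism W -> k}) (witt_W : is_witt_ring l red).
Local Notation Zl := (padic_int l_pr).
Local Notation divl := (divl l).
Implicit Types x y : Zl.

Lemma zl_exists x : exists w : W, forall n, divl n (w - (x n)%:R).
Proof.
apply: (witt_limit witt_W) => n; exists ((x n.+1 %/ l ^ n)%:R); rewrite -mulrnA.
have := divn_eq (x n.+1) (l ^ n); have := padicS x n; rewrite [in RHS]modn_small ?padic_lt // => ->.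
by move=> {1}->; rewrite natrD addrK natrM mulr_natr.
Qed.

(** The canonical ring morphism from Z_l to W, by limits of integers. *)
Definition zl x : W := xget 0 [set w : W | forall n, divl n (w - (x n)%:R)]%classic.

Lemma zlP x n : divl n (zl x - (x n)%:R).
Proof.
by move: n; apply: (xgetPex 0 (P := [set w : W | forall n, divl n (w - (x n)%:R)]%classic) (zl_exists x)).
Qed.

Lemma zl_unique x w : (forall n, divl n (w - (x n)%:R)) -> w = zl x.
Proof.
move=> wx; apply: (witt_sep_eq witt_W) => n.
by apply: (divl_trans (wx n.+1)); apply/divlC/zlP.
Qed.

Lemma divl_modn a n : divl n ((a %% l ^ n)%:R - a%:R : W).
Proof.
by rewrite [X in _ - X%:R](divn_eq a (l ^ n)) natrD opprD addrCA subrr addr0; apply/divlN; exists (a %/ l ^ n)%:R; rewrite natrM mulr_natr.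
Qed.

Lemma zlD x y : zl (x + y) = zl x + zl y.
Proof.
symmetry; apply: zl_unique => n; rewrite padic_addE.
apply: (@divl_trans _ _ _ ((x n)%:R + (y n)%:R)).
  by rewrite opprD addrACA; apply: divlD; apply: zlP.
by apply: divlC; rewrite -natrD; apply: divl_modn.
Qed.

Lemma zlM x y : zl (x * y) = zl x * zl y.
Proof.
symmetry; apply: zl_unique => n; rewrite padic_mulE.
apply: (@divl_trans _ _ _ ((x n)%:R * (y n)%:R)); last first.
  by apply: divlC; rewrite -natrM; apply: divl_modn.
have -> : zl x * zl y - (x n)%:R * (y n)%:R = (zl x - (x n)%:R) * zl y + (x n)%:R * (zl y - (y n)%:R) by ring.
by apply: divlD; [apply: divlMr | apply: divlMl]; apply: zlP.
Qed.

Lemma zl1 : zl 1 = 1.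
Proof.
symmetry; apply: zl_unique => n; have -> : (1 : Zl) n = (1 %% l ^ n)%N := padic_natE l_pr 1 n.
exact/divlC/divl_modn.
Qed.

Lemma zl0 : zl 0 = 0.
Proof. by apply: (addrI (zl 0)); rewrite addr0 -zlD addr0. Qed.

Lemma zl_congr x y n : x n = y n -> divl n (zl x - zl y).
Proof. by move=> xy; apply: (divl_trans (zlP x n)); rewrite xy; apply/divlC/zlP. Qed.

Lemma zl_red x : red (zl x) = (x 1%N)%:R.
Proof.
have /(red_eq0 witt_W) := zlP x 1; rewrite rmorphB rmorph_nat => /eqP.
by rewrite subr_eq0 => /eqP.
Qed.

End PadicIntoWitt.

Section IdealPowers.
Variables (A : comNzRingType) (I : set A).
Local Notation "I ^[ n ]" := (ideal_pow I n) (at level 2).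

Lemma ipow_ideal n : is_ideal I^[n]. Proof. exact: ideal_pow_ideal. Qed.
Lemma ipow0 n : I^[n] 0. Proof. by have [] := ipow_ideal n. Qed.
Lemma ipowD n x y : I^[n] x -> I^[n] y -> I^[n] (x + y). Proof. by have [_ h _] := ipow_ideal n; apply: h. Qed.
Lemma ipowMl n a x : I^[n] x -> I^[n] (a * x). Proof. by have [_ _ h] := ipow_ideal n; apply: h. Qed.
Lemma ipowMr n a x : I^[n] x -> I^[n] (x * a). Proof. by rewrite mulrC; apply: ipowMl. Qed.
Lemma ipowN n x : I^[n] x -> I^[n] (- x). Proof. by rewrite -mulN1r; apply: ipowMl. Qed.
Lemma ipow_sum n (T : Type) (r : seq T) (P : pred T) (F : T -> A) :
  (forall i, P i -> I^[n] (F i)) -> I^[n] (\sum_(i <- r | P i) F i).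
Proof. by move=> h; elim/big_ind: _ => //; [apply: ipow0 | apply: ipowD]. Qed.

Lemma ipow_le i j x : (i <= j)%N -> I^[j] x -> I^[i] x.
Proof.
move=> /subnK <-; elim: (j - i)%N => // d IH hx; apply: IH; exact: ideal_powS.
Qed.

Lemma ipowM a b x y : I^[a] x -> I^[b] y -> I^[a + b] (x * y).
Proof.
move=> [s hs ->] hy; rewrite big_seq mulr_suml; apply: ipow_sum => t /hs[r [sr hr ->]].
rewrite -mulrA; apply: ipowMl; case: hy => [u hu ->]; set p := \prod_(_ <- r) _; rewrite big_seq mulr_sumr; apply: ipow_sum => v vu.
have [r' [sr' hr' ->]] := hu v vu.
rewrite mulrCA; apply: ipowMl; rewrite /p -big_cat /=.
exists [:: (1, \prod_(z <- r ++ r') z)]; last by rewrite big_seq1 mul1r.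
move=> _ /[!inE] /eqP -> /=; exists (r ++ r'); split=> //; first by rewrite size_cat sr sr'.
by move=> z; rewrite mem_cat => /orP[/hr|/hr'].
Qed.

Lemma ipow1 x : I x -> I^[1] x.
Proof.
move=> Ix; exists [:: (1, x)]; last by rewrite big_seq1 mul1r.
move=> _ /[!inE] /eqP -> /=; exists [:: x]; split; rewrite ?big_seq1 //.
by move=> y /[!inE] /eqP ->.
Qed.

Lemma ipow1E : is_ideal I -> forall x, I^[1] x -> I x.
Proof.
case=> I0 ID IM x [s hs ->]; rewrite big_seq; elim/big_ind: _ => // t ts.
have [r [sr rI ->]] := hs t ts; case: r sr rI => [|y [|]] //= _ rI.
by rewrite big_seq1; apply/IM/rI/mem_head.
Qed.

Definition mxI n a b (M : 'M[A]_(a, b)) := forall i j, I^[n] (M i j).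

Lemma mxI0 n a b : mxI n (0 : 'M_(a, b)). Proof. by move=> i j; rewrite mxE; apply: ipow0. Qed.
Lemma mxID n a b (M N : 'M_(a, b)) : mxI n M -> mxI n N -> mxI n (M + N).
Proof. by move=> hM hN i j; rewrite mxE; apply: ipowD. Qed.
Lemma mxIN n a b (M : 'M_(a, b)) : mxI n M -> mxI n (- M).
Proof. by move=> hM i j; rewrite mxE; apply: ipowN. Qed.
Lemma mxIC n a b (M N : 'M_(a, b)) : mxI n (M - N) -> mxI n (N - M).
Proof. by move=> /mxIN; rewrite opprB. Qed.
Lemma mxI_trans n a b (N M L : 'M_(a, b)) : mxI n (M - N) -> mxI n (N - L) -> mxI n (M - L).
Proof. by move=> h1 h2; rewrite -(subrKA N); apply: mxID. Qed.
Lemma mxIM n n' a b c (M : 'M_(a, b)) (N : 'M_(b, c)) : mxI n M -> mxI n' N -> mxI (n + n') (M *m N).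
Proof. by move=> hM hN i j; rewrite mxE; apply: ipow_sum => x _; apply: ipowM. Qed.
Lemma mxIMl n a b c (M : 'M_(a, b)) (N : 'M_(b, c)) : mxI n N -> mxI n (M *m N).
Proof. by move=> hN i j; rewrite mxE; apply: ipow_sum => x _; apply: ipowMl. Qed.
Lemma mxIMr n a b c (M : 'M_(a, b)) (N : 'M_(b, c)) : mxI n M -> mxI n (M *m N).
Proof. by move=> hN i j; rewrite mxE; apply: ipow_sum => x _; apply: ipowMr. Qed.
Lemma mxI_le i j a b (M : 'M_(a, b)) : (i <= j)%N -> mxI j M -> mxI i M.
Proof. by move=> ij h x y; apply: ipow_le (h x y). Qed.
Lemma mxI_all a b (M : 'M_(a, b)) : mxI 0 M.
Proof.
move=> i j; exists [:: (M i j, 1)]; last by rewrite big_seq1 mulr1.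
by move=> _ /[!inE] /eqP -> /=; exists [::]; split=> //; rewrite big_nil.
Qed.

Section Powers.
Variables (l : nat) (lI : I l%:R) (m' : nat).
Local Notation MA := 'M[A]_m'.+1.
Implicit Types y z : MA.

Lemma mxI_pow_l n y : mxI n.+1 (y - 1) -> mxI n.+2 (y ^+ l - 1).
Proof.
move=> h; rewrite subrX1 -addn1; apply: mxIM => //.
rewrite -[X in mxI _ X](subrK (l%:R)) -[l in X in _ - X]card_ord -sumr_const -sumrB.
apply: mxID => [i j|].
  rewrite summxE; apply: ipow_sum => x _; suff : mxI 1 (y ^+ x - 1) by apply.
  by rewrite subrX1; apply/mxIMr/(mxI_le _ h).
move=> i j; have -> : (l%:R : MA) = (l%:R)%:M by rewrite rmorph_nat.
rewrite mxE; case: eqP => _; rewrite ?mulr1n ?mulr0n; [exact: ipow1 | exact: ipow0].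
Qed.

Lemma mxI_pow_lX n y : mxI 1 (y - 1) -> mxI n.+1 (y ^+ (l ^ n) - 1).
Proof.
move=> h; elim: n => [|n IH]; first by rewrite expn0 expr1.
by rewrite expnSr exprM; apply: mxI_pow_l.
Qed.

Lemma mxI_powX n y c : mxI n (y - 1) -> mxI n (y ^+ c - 1).
Proof. by move=> h; rewrite subrX1; apply: mxIMr. Qed.

End Powers.

End IdealPowers.

Section PadicPowers.
Variables (l : nat) (l_pr : prime l) (k : finFieldType) (chl : l \in [pchar k]).
Variables (W : comNzRingType) (red : {rmorphism W -> k}).
Hypothesis red_surj : forall x, exists w, red w = x.
Local Notation Zl := (padic_int l_pr).
Variables (m' M : nat).
Local Notation m := m'.+1.

Section OneRing.
Variable A : cnl red.
Local Notation I := (@cnl_max _ _ _ A).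
Local Notation mxI := (mxI I).
Implicit Types y : 'M[A]_m.

Lemma cnl_max_ideal : is_ideal I.
Proof.
split=> [|x y hx hy|a x hx]; rewrite /cnl_max /= ?rmorph0 //.
  by rewrite rmorphD hx hy addr0.
by rewrite rmorphM hx mulr0.
Qed.

Lemma cnl_max_l : I l%:R.
Proof. by rewrite /cnl_max /= rmorph_nat; apply: pcharf0. Qed.

Lemma mxI1E a b (B : 'M[A]_(a, b)) : mxI 1 B <-> map_mx (cnl_res A) B = 0.
Proof.
split=> [h|/matrixP h i j]; last by apply: ipow1; have := h i j; rewrite !mxE.
by apply/matrixP => i j; rewrite !mxE; have := ipow1E cnl_max_ideal (h i j).
Qed.

Lemma mxI_separated a b (B C : 'M[A]_(a, b)) : (forall n, mxI n (B - C)) -> B = C.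
Proof.
have [sep _] := cnl_complete A.
move=> h; apply/matrixP => i j; apply/eqP; rewrite -subr_eq0; apply/eqP/sep => n.
by have := h n i j; rewrite !mxE.
Qed.

                                                                        
                    
(** Under this condition y^a depends continuously on a for the l-adic topology ([unipotent_congr]),
    so exponents in Z_l make sense. *)
Definition unipotent_mod y := mxI 1 (y ^+ (l ^ M) - 1).

Lemma unipotent_congr y a b n : unipotent_mod y -> a = b %[mod l ^ (n + M)] ->
  mxI n (y ^+ a - y ^+ b).
Proof.
move=> yM; wlog ab : a b / (b <= a)%N => [hw|] e.
  by case/orP: (leq_total b a) => ab; [apply: hw | apply: mxIC; apply: hw].
have /dvdnP[c cE] : (l ^ (n + M) %| a - b)%N by rewrite -eqn_mod_dvd //; apply/eqP.
have -> : y ^+ a - y ^+ b = (y ^+ (l ^ (n + M)) ^+ c - 1) * y ^+ b.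
  by rewrite mulrBl mul1r -exprM -exprD mulnC -cE subnK.
apply/mxIMr/mxI_powX; rewrite addnC expnD exprM.
by apply: (@mxI_le _ _ _ n.+1) => //; apply: mxI_pow_lX => //; apply: cnl_max_l.
Qed.

(** The power y^z with z in Z_l. The shift by M accounts for the l^M steps before y becomes
    congruent to 1. *)
Definition pw y (z : Zl) : 'M[A]_m := xget 0 [set B : 'M[A]_m | forall n, mxI n (B - y ^+ z (n + M)%N)]%classic.

Lemma padic_congr_modn (z : Zl) i j : (i <= j)%N -> z j = z i %[mod l ^ i].
Proof. by move=> /subnK <-; apply: padic_coh. Qed.

Lemma pwP y z n : unipotent_mod y -> mxI n (pw y z - y ^+ z (n + M)%N).
Proof.
move=> yM; have [_ lim] := cnl_complete A.
have /choice[B BE] : forall ij : 'I_m * 'I_m, exists x, forall n, ideal_pow I n (x - (y ^+ z (n + M)%N) ij.1 ij.2).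
  move=> [i j]; apply: lim => n1; have := @unipotent_congr y (z (n1.+1 + M)%N) (z (n1 + M)%N) n1 yM.
  move=> h; have {h} := h _ i j; rewrite !mxE; apply; apply: padic_congr_modn; lia.
have ex : exists B : 'M[A]_m, forall n, mxI n (B - y ^+ z (n + M)%N).
  by exists (\matrix_(i, j) B (i, j)) => n1 i j; have := BE (i, j) n1; rewrite !mxE.
by move: n; apply: (xgetPex 0 (P := [set B : 'M[A]_m | forall n, mxI n (B - y ^+ z (n + M)%N)]%classic) ex).
Qed.

Lemma pw_congr y (z : Zl) a n : unipotent_mod y -> z (n + M)%N = a %[mod l ^ (n + M)] -> mxI n (pw y z - y ^+ a).
Proof.
by move=> yM e; apply: (mxI_trans (pwP z n yM)); apply: unipotent_congr.
Qed.

Lemma pw_unique y (z : Zl) B : unipotent_mod y -> (forall n, mxI n (B - y ^+ z (n + M)%N)) -> B = pw y z.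
Proof.
move=> yM h; apply: mxI_separated => n; apply: (mxI_trans (h n)); apply: mxIC; exact: pwP.
Qed.

Lemma pwD y z z' : unipotent_mod y -> pw y (z + z') = pw y z * pw y z'.
Proof.
move=> yM; apply: mxI_separated => n.
apply: (@mxI_trans _ _ _ _ _ (y ^+ (z (n + M)%N + z' (n + M)%N))).
  by apply: pw_congr => //; rewrite padic_addE modn_mod.
rewrite exprD; apply: mxIC; set u := pw y z; set v := pw y z'.
set a := y ^+ z _; set b := y ^+ z' _.
have -> : u * v - a * b = (u - a) * v + a * (v - b) by rewrite mulrBl mulrBr addrA subrK.
by apply: mxID; [apply: mxIMr | apply: mxIMl]; apply: pwP.
Qed.

Lemma pw0 y : unipotent_mod y -> pw y 0 = 1.
Proof. by move=> yM; symmetry; apply: pw_unique => // n; rewrite padic_zeroE expr0 subrr; apply: mxI0. Qed.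

Lemma pw1 y : unipotent_mod y -> pw y 1 = y.
Proof.
move=> yM; symmetry; apply: pw_unique => // n; rewrite -[X in X - _]expr1.
apply: unipotent_congr => //; have -> : (1 : Zl) (n + M)%N = (1 %% l ^ (n + M))%N := padic_natE l_pr 1 _.
by rewrite modn_mod.
Qed.

Lemma pw_small y (z : Zl) n : unipotent_mod y -> z (n + M)%N = 0%N -> mxI n (pw y z - 1).
Proof. by move=> yM z0; rewrite -(expr0 y); apply: pw_congr; rewrite ?z0. Qed.

Lemma pw_intertwine y y' (B : 'M[A]_m) z : unipotent_mod y -> unipotent_mod y' ->
  B * y = y' * B -> B * pw y z = pw y' z * B.
Proof.
move=> yM yM' e; have eX i : B * y ^+ i = y' ^+ i * B.
  by elim: i => [|i IH]; rewrite ?expr0 ?mulr1 ?mul1r // !exprS mulrA e -!mulrA IH.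
apply: mxI_separated => n.
have -> : B * pw y z - pw y' z * B = B * (pw y z - y ^+ z (n + M)%N) - (pw y' z - y' ^+ z (n + M)%N) * B.
  by rewrite mulrBr mulrBl eX opprB addrA subrK.
by apply: mxID; [apply: mxIMl | apply/mxIN/mxIMr]; apply: pwP.
Qed.

End OneRing.

Lemma cnl_res_morphism (A B : cnl red) (f : {rmorphism A -> B}) : cnl_morphism f ->
  forall x, cnl_res B (f x) = cnl_res A x.
Proof.
move=> [f1 f2] x; have [w wE] := red_surj (cnl_res A x).
have : cnl_max (f (x - cnl_alg A w)).
  by apply: f2; rewrite /cnl_max /= rmorphB cnl_algE wE subrr.
by rewrite /cnl_max /= !rmorphB f1 cnl_algE wE => /eqP; rewrite subr_eq0 => /eqP.
Qed.

Lemma cnl_morphism_pow (A B : cnl red) (f : {rmorphism A -> B}) n x : cnl_morphism f ->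
  ideal_pow (@cnl_max _ _ _ A) n x -> ideal_pow (@cnl_max _ _ _ B) n (f x).
Proof.
move=> [_ fm] [s hs ->]; rewrite big_seq rmorph_sum; apply: ipow_sum => t ts.
have [r [sr rI ->]] := hs t ts; rewrite rmorphM; apply: ipowMl.
exists [:: (1, f (\prod_(y <- r) y))]; last by rewrite big_seq1 mul1r.
move=> _ /[!inE] /eqP -> /=; exists [seq f y | y <- r]; split; rewrite ?size_map //.
  by move=> _ /mapP[y /rI/fm yB ->].
by rewrite rmorph_prod big_map.
Qed.

Lemma map_mxX_ring (A B : comNzRingType) (f : {rmorphism A -> B}) (y : 'M[A]_m) i :
  map_mx f (y ^+ i) = map_mx f y ^+ i.
Proof. by elim: i => [|i IH]; rewrite ?expr0 ?map_mx1 // !exprS -!mulmxE map_mxM IH. Qed.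

Lemma unipotent_map (A B : cnl red) (f : {rmorphism A -> B}) (y : 'M[A]_m) : cnl_morphism f ->
  unipotent_mod y -> unipotent_mod (map_mx f y).
Proof.
move=> fm h i j; have := cnl_morphism_pow fm (h i j).
by rewrite -map_mxX_ring !mxE rmorphB rmorph_nat.
Qed.

Lemma pw_map (A B : cnl red) (f : {rmorphism A -> B}) (y : 'M[A]_m) z : cnl_morphism f ->
  unipotent_mod y -> map_mx f (pw y z) = pw (map_mx f y) z.
Proof.
move=> fm yM; apply: pw_unique; first exact: unipotent_map.
move=> n i j; have := cnl_morphism_pow fm (pwP z n yM i j).
by rewrite -map_mxX_ring !mxE rmorphB.
Qed.

Lemma artinian_nilpotent (A : cnl red) : artinian A ->
  exists N, forall x, ideal_pow (@cnl_max _ _ _ A) N x -> x = 0.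
Proof.
move=> art; have [N NP] := art _ (ipow_ideal (@cnl_max _ _ _ A)) (@ideal_powS _ _).
exists N => x xN; have [sep _] := cnl_complete A; apply: sep => n.
have [Nn|nN] := leqP N n; first by rewrite NP.
by apply: ipow_le (ltnW nN) xN.
Qed.

End PadicPowers.

Lemma artinian_finite (R : comNzRingType) (e : seq R) : (forall x, x \in e) -> artinian R.
Proof.
move=> eR I Iid Idec.
have Ile i j x : (i <= j)%N -> I j x -> I i x.
  by move=> /subnK <-; elim: (j - i)%N => // c IH Ix; apply/IH/Idec.
have /choice[f fP] : forall x, exists N, I N x -> forall n, I n x.
  move=> x; have [h|/existsNP[N h]] := pselect (forall n, I n x); first by exists 0%N.
  by exists N.
exists (\max_(x <- e) f x)%N => n Nn; rewrite predeqE => x; split; first exact: Ile.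
move=> Ix; apply: (fP x); apply: Ile Ix; exact: leq_bigmax_seq.
Qed.

Lemma has_dim_image (k : fieldType) (V : vectType k) (U : {vspace V}) (X : lmodType k) (L : V -> X) (S : set X) :
  (forall c u v, u \in U -> v \in U -> L (c *: u + v) = c *: L u + L v) ->
  (forall u, u \in U -> L u = 0 -> u = 0) -> (forall x, S x <-> exists2 u, u \in U & x = L u) ->
  has_dim S (\dim U).
Proof.
move=> LL L0 LS; exists (fun i => L (vbasis U)`_i).
have eU (i : 'I_(\dim U)) : (vbasis U)`_i \in U.
  by apply: vbasis_mem; apply: mem_nth; rewrite size_tuple.
have L00 : L 0 = 0 by have := LL (-1) 0 0 (mem0v _) (mem0v _); rewrite addr0 scaler0 scaleN1r addNr.
have LE (c : 'I_(\dim U) -> k) : \sum_i c i *: (vbasis U)`_i \in U /\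
    L (\sum_i c i *: (vbasis U)`_i) = \sum_i c i *: L (vbasis U)`_i.
  elim: (index_enum _) => [|i r [IH1 IH2]]; first by rewrite !big_nil mem0v L00.
  by rewrite !big_cons LL // IH2; split=> //; apply: rpredD => //; apply: rpredZ.
split=> [c|v].
  have [cU <-] := LE c => /(L0 _ cU) c0.
  by have /freeP := basis_free (vbasisP U); apply.
rewrite LS; split=> [[u uU ->]|[c ->]]; last by have [cU <-] := LE c; exists (\sum_i c i *: (vbasis U)`_i).
by exists (fun i => coord (vbasis U) i u); have [_ <-] := LE (fun i => coord (vbasis U) i u); rewrite -coord_vbasis.
Qed.

Section QuotientModule.
Local Open Scope quotient_scope.
Variables (k : pzRingType) (V : lmodType k) (S : submodClosed V).

Lemma lquot_piP a u v : \pi_(lmod_quot S) (a *: u + v) = a *: \pi_(lmod_quot S) u + \pi_(lmod_quot S) v.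
Proof. by rewrite pi_additive -pi_scale. Qed.

Lemma lquot_pi_eq0 v : \pi_(lmod_quot S) v = 0 <-> v \in S.
Proof.
have <- : \pi_(lmod_quot S) 0 = 0 by exact: (raddf0 (\pi_(Quotient.quot (submod_pred S)))).
have E := @Quotient.idealrBE V (submod_pred S).
by split=> [/eqP|h]; last apply/eqP; rewrite -[_ == _]E subr0.
Qed.

End QuotientModule.

(** * Matrices over the dual numbers and first-order deformations *)

Section DualMatrices.
Variable k : finFieldType.

Definition dual_mx a b (A B : 'M[k]_(a, b)) : 'M[dual_number k]_(a, b) :=
  \matrix_(i, j) ((A i j, B i j) : dual_number k).

Lemma dual_sum (T : Type) (r : seq T) (F : T -> dual_number k) :
  \sum_(i <- r) F i = (\sum_(i <- r) (F i).1, \sum_(i <- r) (F i).2) :> dual_number k.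
Proof. by elim: r => [|x r IH]; rewrite ?big_nil // !big_cons IH. Qed.

Lemma dual_mxM a b c (A B : 'M[k]_(a, b)) (A' B' : 'M[k]_(b, c)) :
  dual_mx A B *m dual_mx A' B' = dual_mx (A *m A') (A *m B' + B *m A').
Proof.
apply/matrixP => i j; rewrite !mxE dual_sum -big_split; congr pair; apply: eq_bigr => x _; by rewrite !mxE.
Qed.

Lemma dual_mx_inj a b (A B A' B' : 'M[k]_(a, b)) : dual_mx A B = dual_mx A' B' -> A = A' /\ B = B'.
Proof. by move=> /matrixP e; split; apply/matrixP => i j; have := e i j; rewrite !mxE => -[]. Qed.

Lemma dual_mx_eta a b (X : 'M[dual_number k]_(a, b)) : X = dual_mx (map_mx (@dual_res k) X) (map_mx snd X).
Proof. by apply/matrixP => i j; rewrite !mxE -surjective_pairing. Qed.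

Lemma dual_mx_res a b (A B : 'M[k]_(a, b)) : map_mx (@dual_res k) (dual_mx A B) = A.
Proof. by apply/matrixP => i j; rewrite !mxE. Qed.

Lemma dual_mx_snd a b (A B : 'M[k]_(a, b)) : map_mx snd (dual_mx A B) = B.
Proof. by apply/matrixP => i j; rewrite !mxE. Qed.

Lemma dual_mx_const a b (A : 'M[k]_(a, b)) : map_mx (@dual_const k) A = dual_mx A 0.
Proof. by apply/matrixP => i j; rewrite !mxE. Qed.

Lemma dual_mx1 a : 1%:M = dual_mx 1%:M 0 :> 'M_a.
Proof. by rewrite -dual_mx_const map_mx1. Qed.

Variables (F E : fieldType) (iota : F -> E) (d : nat).
Local Notation G := (abs_gal iota).
Implicit Types rho c : G -> 'M[k]_d.

Lemma first_orderE rho c g : first_order rho c g = dual_mx (rho g) (c g *m rho g).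
Proof.
rewrite /first_order dual_mx_const dual_mx_const.
have -> : 1%:M + dual_eps k *: dual_mx (c g) 0 = dual_mx 1%:M (c g).
  by apply/matrixP => i j; rewrite dual_mx1 !mxE; congr pair => /=; ring.
by rewrite dual_mxM mulmx0 add0r mul1mx.
Qed.

Variables (W : comNzRingType) (red : {rmorphism W -> k}).

Lemma first_order_cocycle rho c : is_rep rho ->
  @cnl_rep _ _ _ _ _ _ _ (dual_cnl red) (first_order rho c) -> is_cocycle rho c.
Proof.
move=> [r1 rM] [[_ cM] cC]; have rV g : rho g *m rho g^-1%g = 1%:M by rewrite -rM mulgV r1.
split=> [g h|g n].
  have := cM g h; rewrite !first_orderE dual_mxM => /dual_mx_inj[_ e].
  have := congr1 (mulmx^~ (rho (g * h)^-1%g)) e.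
  rewrite -mulmxA rV mulmx1 => ->; rewrite invMg rM mulmxDl !mulmxA addrC; congr (_ + _).
    by rewrite -(mulmxA _ (rho h)) rV mulmx1 -(mulmxA _ (rho g)) rV mulmx1.
  by rewrite /ad_action -(mulmxA _ (rho h)) rV mulmx1.
have [r rP] := cC g 2; exists r => h gh i j.
suff -> : c h = c g by rewrite subrr; have [] := ideal_pow_ideal [set (0 : k)]%classic n.
have I2 (x : dual_number k) : ideal_pow (@cnl_max _ _ _ (dual_cnl red)) 2 x -> x = 0.
  case=> s hs ->; rewrite big_seq big1 // => t /hs[u [us uI ->]].
  case: u us uI => [|y [|z [|]]] //= _ uI; rewrite big_cons big_seq1.
  have y0 : dual_res y = 0 := uI y (mem_head _ _).
  have z0 : dual_res z = 0 by apply: uI; rewrite !inE eqxx orbT.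
  suff -> : y * z = 0 by rewrite mulr0.
  by case: y z {uI} y0 z0 => [a b] [a' b']; rewrite /dual_res /= => -> ->; congr pair => /=; ring.
have : first_order rho c h = first_order rho c g.
  by apply/matrixP => x y; apply/eqP; rewrite -subr_eq0; apply/eqP/I2/rP.
rewrite !first_orderE => /dual_mx_inj[e1 e2].
have := congr1 (mulmx^~ (rho g^-1%g)) e2.
by rewrite e1 -!mulmxA rV !mulmx1.
Qed.

End DualMatrices.

(** Raise h to a power l^a with a large and l^a congruent to 1 modulo an exponent m, prime to l, of
    its image: the class in [gT] is unchanged, while eps, b and kap become trivial to level N. *)
Lemma deep_representative (F E : fieldType) (iota : F -> E) l (l_pr : prime l) (sigma : abs_gal iota)
    (inert : abs_gal iota -> Prop) (T : tame_parameters l_pr sigma inert)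
    (k : finFieldType) (chl : l \in [pchar k]) (gT : finGroupType) (q : abs_gal iota -> gT) N0 :
  (forall g h, q (g * h)%g = (q g * q h)%g) -> (0 < N0)%N ->
  (forall N g, (N0 <= N)%N -> in_GP T N g -> exists m, ~~ (l %| m)%N /\ q (g ^+ m)%g = 1%g) ->
  forall h N, in_GN T N0 h -> exists h', [/\ in_GN T N h', tp_kap T h' N = 0%N & q h' = q h].
Proof.
move=> qM N00 tors h N hN; have [m [lm qm]] := tors N0 h (leqnn _) (GN_GP hN).
have m0 : (0 < m)%N by case: m lm {qm} => //; rewrite dvdn0.
pose a := (totient m * (N + N + N))%N.
have aN : (N + N <= a)%N by rewrite /a; have := totient_gt0 m; rewrite m0; move: (totient m) => [|t] //; rewrite mulSn; lia.
have am : (l ^ a = 1 %[mod m])%N.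
  rewrite /a expnM -modnXm Euler_exp_totient ?modnXm ?exp1n //.
  by rewrite prime_coprime.
have [c cE] : exists c, (l ^ a = c * m + 1)%N.
  exists ((l ^ a - 1) %/ m)%N; rewrite divnK ?subnK ?expn_gt0 ?prime_gt0 //.
  by rewrite -eqn_mod_dvd ?expn_gt0 ?prime_gt0 //; apply/eqP.
have qX g i : q (g ^+ i)%g = (q g ^+ i)%g.
  have q1 : q 1%g = 1%g by apply: (mulgI (q 1%g)); rewrite -qM !mulg1.
  by elim: i => [|i IH]; rewrite ?expg0 // !expgS qM IH.
have GNX g i : in_GN T N g -> in_GN T N (g ^+ i)%g.
  have [g1 gM _] := GN_subgroup T N.
  by move=> gN; elim: i => [|i IH]; rewrite ?expg0 // expgS; apply: gM.
exists (h ^+ (l ^ a))%g; split.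
- rewrite -(subnKC aN) expnD expgnA; apply/GNX/GN_pow/(chi_eq1 chl)/(GN_chi chl N00 hN).
- rewrite kapX; have -> : (l ^ a)%:R * tp_kap T h = (l ^ N)%:R * ((l ^ (a - N))%:R * tp_kap T h).
    by rewrite mulrA -natrM -expnD subnKC //; lia.
  by apply/padic_dvdP; eexists.
by rewrite cE expgnDr expg1 qM mulnC expgnA qX qm expg1n mul1g.
Qed.

Lemma conj_transfer (R : pzRingType) (p1 q1 p2 q2 r1 r2 : R) : q1 * p1 = 1 -> q2 * p2 = 1 ->
  p1 * r1 * q1 = p2 * r2 * q2 -> q2 * p1 * r1 = r2 * (q2 * p1).
Proof.
move=> h1 h2 e; have e1 : p1 * r1 = p2 * r2 * q2 * p1 by rewrite -e -mulrA h1 mulr1.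
by rewrite -mulrA e1 !mulrA h2 mul1r.
Qed.

Lemma conj_insert (R : pzRingType) (p q o ov r r' : R) : o * ov = 1 -> o * r' = r * o ->
  p * o * r' * (ov * q) = p * r * q.
Proof. by move=> h e; rewrite -(mulrA p) e !mulrA -(mulrA _ o ov) h mulr1. Qed.

Lemma unblkB (R : comNzRingType) m n (A B : 'M['M[R]_n]_m) i j :
  unblk A i j - unblk B i j = unblk (A - B) i j.
Proof. by case: (mxtens_indexP i) => i1 i2; case: (mxtens_indexP j) => j1 j2; rewrite !unblkE !mxE. Qed.

(** * The representations R_y over CNL algebras and the deformation condition *)

Section Model.
Variables (F E : fieldType) (iota : F -> E) (l : nat) (l_pr : prime l) (l_gt2 : (2 < l)%N).
Variables (sigma : abs_gal iota) (inert : abs_gal iota -> Prop).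
Variable T : tame_parameters l_pr sigma inert.
Local Notation G := (abs_gal iota).
Local Notation eps := (tp_eps T).
Local Notation b := (tp_b T).
Local Notation kap := (tp_kap T).
Variables (k : finFieldType) (chl : l \in [pchar k]) (m' n' : nat).
Local Notation m := m'.+1.
Local Notation n := n'.+1.
Local Notation chi := (chi T k).
Local Notation om := (chi sigma).
Variables (W : comNzRingType) (red : {rmorphism W -> k}) (witt_W : is_witt_ring l red).
Hypothesis l_ndvd_n : ~~ (l %| n)%N.
Hypothesis m_le : (m <= l)%N.
Variables (tW : G -> 'M[W]_n).
Hypothesis tW1 : tW 1%g = 1.
Hypothesis tWM : forall g h, tW (g * h)%g = tW g * tW h.
Variables (gT : finGroupType) (q : G -> gT) (N0 : nat).
Hypothesis qM : forall g h, q (g * h)%g = (q g * q h)%g.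
Hypothesis tW_q : forall g h, q g = q h -> tW g = tW h.
Hypothesis deep : forall h N, in_GN T N0 h -> exists h', [/\ in_GN T N h', kap h' N = 0%N & q h' = q h].
Variables (eN : seq G) (eNP : averaging q l (in_GN T N0) eN).
Variables (s s' f : nat) (s'_prim : s'.-primitive_root om) (f_prim : f.-primitive_root (om ^+ s)) (s_dvd : (s %| s')%N).
Variables (Xw : 'M[W]_n) (chiW : G -> W).
Hypothesis chiW_red : forall g, red (chiW g) = chi g.
Hypothesis Xw_int : forall g, tW g * Xw = chiW g ^+ s *: (Xw * tW g).
Hypothesis cent_W : forall Z : 'M[W]_n, (forall h, in_GN T N0 h -> tW h * Z = Z * tW h) ->
  exists P, Z = horner_mx Xw P.
Hypothesis tr_XW : forall i, ~~ (f %| i)%N -> \tr (Xw ^+ i) = 0.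
Variables (mu : W) (mu0 : red mu != 0) (XWf : Xw ^+ f = mu%:M).
Variables (w : 'I_m -> nat) (d : 'I_m -> bool) (y0 : 'M[k]_m) (M : nat).
Hypothesis w_window : forall i j, (w i + 2 <= w j + s)%N.
Hypothesis d_graded : forall i j : 'I_m, d i -> j = i.+1 :> nat -> w i = (w j + 1)%N.
Hypothesis d_bt : b (tp_t T) = 1 \/ (forall i j : 'I_m, d i -> j = i.+1 :> nat -> False) /\ forall g, b g = 0.
Hypothesis y0M : y0 ^+ (l ^ M) = 1.

Let f_gt0 : (0 < f)%N. Proof. exact: prim_order_gt0 f_prim. Qed.

Section OverA.
Variable A : cnl red.
Local Notation alg := (cnl_alg A).
Local Notation MA := 'M[A]_m.
Local Notation BM := 'M['M[A]_n]_m.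
Local Notation mxI := (mxI (@cnl_max _ _ _ A)).
Local Notation Pi := (shift_mx A d).
Local Notation pw := (pw M).

Definition epsA g : A := alg (zl W (eps g)).
Definition bA g : A := alg (zl W (b g)).
Definition tA g : 'M[A]_n := map_mx alg (tW g).
Definition wt g : MA := diag_mx (\row_i epsA g ^+ w i).
                                                                                    
(** The left Kronecker factor of R_y(g); its residue is that of [structure_k] ([Rp_residue]). *)
Definition Vg (y : MA) g : MA := pw y (kap g) * expm (bA g) Pi * wt g.
Definition Rp y g : BM := outer n' (Vg y g) * inner m' (tA g).
(** The parameter y is the only part of R_y that varies: these conditions are linear, apart from the
    prescribed residue. *)
Definition good (y : MA) := [/\ hgraded w w 0 y, y * Pi = Pi * y & map_mx (cnl_res A) y = y0].

Lemma good_unipotent y : good y -> unipotent_mod l M y.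
Proof.
by move=> [_ _ yr]; apply/mxI1E; rewrite map_mxB map_mxX_ring yr y0M map_mx1 subrr.
Qed.

Lemma nat_unitA a : ~~ (l %| a)%N -> (a%:R : A) \is a GRing.unit.
Proof. by move=> la; rewrite cnl_local rmorph_nat -(dvdn_pcharf chl). Qed.

Lemma fact_unitA j : (j < m)%N -> (j`!%:R : A) \is a GRing.unit.
Proof. by move=> jm; rewrite cnl_local rmorph_nat (fact_neq0 chl) //; apply: leq_trans jm m_le. Qed.

Lemma Pi_graded : hgraded w w 1 Pi.
Proof.
move=> i j; rewrite mxE; case: (boolP (d i && _)) => [/andP[di /eqP ji] _|_]; last by rewrite eqxx.
exact: d_graded.
Qed.

Lemma Pi_nilp : Pi ^+ m = 0.
Proof.
apply: strict_upper_nilpotent => i j ji; rewrite mxE.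
by case: eqP => [e|]; [rewrite e ltnn in ji | rewrite andbF].
Qed.

Lemma wt_comm (B : MA) g : hgraded w w 0 B -> wt g * B = B * wt g.
Proof.
move=> Bg; rewrite -!mulmxE mul_mx_diag mul_diag_mx; apply/matrixP => i j; rewrite !mxE mulrC.
by have [->|/Bg ->] := eqVneq (B i j) 0; rewrite ?mulr0 ?mul0r // addn0.
Qed.

Lemma wt_Pi g : wt g * Pi = epsA g *: (Pi * wt g).
Proof.
rewrite -!mulmxE mul_mx_diag mul_diag_mx; apply/matrixP => i j; rewrite !mxE.
case: (boolP (d i && _)) => [/andP[di /eqP ji]|_]; last by rewrite mulr0 mul0r mulr0.
by rewrite (d_graded di ji) addn1 exprS mulr1 mul1r.
Qed.

Lemma epsAM g h : epsA (g * h)%g = epsA g * epsA h.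
Proof. by rewrite /epsA tp_epsM (zlM witt_W) rmorphM. Qed.

Lemma epsA_eq1 g : eps g = 1 -> epsA g = 1.
Proof. by rewrite /epsA => ->; rewrite (zl1 l_pr witt_W) rmorph1. Qed.

Lemma epsA_res g : cnl_res A (epsA g) = chi g.
Proof. by rewrite cnl_algE (zl_red witt_W). Qed.

Lemma wtM g h : wt (g * h)%g = wt g * wt h.
Proof.
by rewrite /wt -mulmxE mulmx_diag; congr diag_mx; apply/rowP => i; rewrite !mxE epsAM exprMn.
Qed.

Lemma wt1 g : epsA g = 1 -> wt g = 1.
Proof. by move=> e; apply/matrixP => i j; rewrite !mxE e expr1n. Qed.

Lemma wt_unit g : wt g * wt g^-1%g = 1.
Proof. by rewrite -wtM mulgV wt1 // epsA_eq1 // eps1. Qed.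

Lemma expm_unit c : expm c Pi * expm (- c) Pi = 1.
Proof. by rewrite -expmD ?subrr ?expm_c0 //; [exact: fact_unitA | exact: Pi_nilp]. Qed.

Lemma Vg1 y : good y -> Vg y 1%g = 1.
Proof.
move=> gy; rewrite /Vg kap1 (pw0 l_pr chl (good_unipotent gy)) /bA b1 (zl0 l_pr witt_W) rmorph0 expm_c0.
by rewrite wt1 ?mulr1 // epsA_eq1 // eps1.
Qed.

Lemma VgM y g h : good y -> Vg y (g * h)%g = Vg y g * Vg y h.
Proof.
move=> gy; have yM := good_unipotent gy; have [y1 y2 _] := gy.
have pE (z : padic_int l_pr) c : expm c Pi * pw y z = pw y z * expm c Pi.
  exact: (pw_intertwine chl z yM yM (esym (expm_comm c y2))).
have pD (z : padic_int l_pr) x : wt x * pw y z = pw y z * wt x.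
  exact: (pw_intertwine chl z yM yM (wt_comm x y1)).
have DE x c : wt x * expm c Pi = expm (c * epsA x) Pi * wt x.
  by apply: expm_twist; apply: wt_Pi.
rewrite /Vg tp_kapM (pwD chl) // {1}/bA tp_bM (zlD witt_W) (zlM witt_W) rmorphD rmorphM /= -/(bA g) -/(epsA g) -/(bA h).
rewrite (expmD fact_unitA _ _ Pi_nilp) wtM (mulrC (epsA g)) -!mulrA; congr (_ * _).
by rewrite (mulrA (wt g)) pD -!mulrA (mulrA _ (pw y _)) pE -!mulrA; congr (_ * (_ * _)); rewrite !mulrA DE.
Qed.

Lemma tA1 : tA 1%g = 1. Proof. by rewrite /tA tW1 map_mx1. Qed.
Lemma tAM g h : tA (g * h)%g = tA g * tA h. Proof. by rewrite /tA tWM -mulmxE map_mxM. Qed.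
Lemma tAV g : tA g * tA g^-1%g = 1. Proof. by rewrite -tAM mulgV tA1. Qed.
Lemma tAVl g : tA g^-1%g * tA g = 1. Proof. by rewrite -tAM mulVg tA1. Qed.

Lemma Rp1 y : good y -> Rp y 1%g = 1.
Proof. by move=> gy; rewrite /Rp Vg1 // outer1 tA1 mul1r. Qed.

Lemma RpM y g h : good y -> Rp y (g * h)%g = Rp y g * Rp y h.
Proof.
move=> gy; rewrite /Rp VgM // tAM outerM innerM -!mulrA; congr (_ * _).
by rewrite !mulrA outer_inner.
Qed.

Lemma Rp_conj y y' B g : good y -> good y' -> hgraded w w 0 B -> B * Pi = Pi * B -> B * y = y' * B ->
  outer n' B * Rp y g = Rp y' g * outer n' B.
Proof.
move=> gy gy' Bg BP By; rewrite /Rp mulrA -outerM -(mulrA (outer _ (Vg y' g))) -outer_inner mulrA -outerM.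
congr (outer _ _ * _); rewrite /Vg !mulrA (pw_intertwine chl (kap g) (good_unipotent gy) (good_unipotent gy') By).
by rewrite -!mulrA (mulrA B) (expm_comm _ BP) -mulrA wt_comm.
Qed.

Let XA : 'M[A]_n := map_mx alg Xw.
Let muA : A := alg mu.

Lemma muA_unit : muA \is a GRing.unit. Proof. by rewrite cnl_local cnl_algE. Qed.

Lemma XAf : XA ^+ f = muA%:M.
Proof. by rewrite -map_mxX_ring XWf map_scalar_mx. Qed.

Lemma tr_XA i : ~~ (f %| i)%N -> \tr (XA ^+ i) = 0.
Proof.
move=> fi; rewrite -map_mxX_ring /mxtrace (eq_bigr (fun j => alg ((Xw ^+ i) j j))) => [|j _]; last by rewrite mxE.
by rewrite -rmorph_sum -/(mxtrace _) tr_XW // rmorph0.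
Qed.

Lemma map_horner P : map_mx alg (horner_mx Xw P) = horner_mx XA (map_poly alg P).
Proof.
elim/poly_ind: P => [|P c IH]; first by rewrite !rmorph0.
rewrite !rmorphD !rmorphM /= !horner_mx_X !horner_mx_C map_polyC map_polyX horner_mx_X horner_mx_C.
by rewrite IH map_scalar_mx.
Qed.

Lemma horner_span P : exists c : 'I_f -> A, horner_mx XA P = \sum_i c i *: XA ^+ i.
Proof.
have := XAf; case: (f) f_gt0 => // f' _ Xf.
elim/poly_ind: P => [|P c0 [c cE]].
  by exists (fun=> 0); rewrite rmorph0 big1 // => i _; rewrite scale0r.
exists (fun i => if unlift ord0 i is Some j then c (widen_ord (leqnSn f') j) else c0 + c ord_max * muA).
rewrite rmorphD rmorphM /= horner_mx_X horner_mx_C cE mulr_suml big_ord_recr [RHS]big_ord_recl /= unlift_none.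
rewrite -addrA addrC; congr (_ + _); last by apply: eq_bigr => i _; rewrite liftK -scalerAl -exprSr.
by rewrite -scalerAl -exprSr Xf scale_scalar_mx expr0 addrC -raddfD /= scalemx1.
Qed.

Lemma XA_free (c : 'I_f -> A) : \sum_i c i *: XA ^+ i = 0 -> forall i, c i = 0.
Proof.
move=> e i; have := congr1 (fun Z => \tr (Z * XA ^+ (f - i))) e; rewrite mul0r mxtrace0 mulr_suml raddf_sum /=.
rewrite (bigD1 i) //= big1 => [|x xi].
  rewrite addr0 -scalerAl -exprD subnKC 1?ltnW // XAf mxtraceZ mxtrace_scalar -mulr_natr mulrA => h.
  apply: (mulIr (nat_unitA l_ndvd_n)); apply: (mulIr muA_unit); rewrite !mul0r -[RHS]h; ring.
rewrite -scalerAl -exprD mxtraceZ tr_XA ?mulr0 //; apply: contra xi => /dvdnP[a aE].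
rewrite -val_eqE /=; apply/eqP; move: (ltn_ord x) (ltn_ord i) aE.
move: (nat_of_ord x) (nat_of_ord i) => x1 i1; clear; case: a => [|[|a]]; rewrite ?mulSn ?mul0n; lia.
Qed.

(** Averaging the elementary matrices over the deep subgroup already over W expresses Z as an
    A-combination of matrices with entries from W that centralize, and each of those is a polynomial
    in Xw. *)
Lemma cent_A Z : (forall h, in_GN T N0 h -> tA h * Z = Z * tA h) ->
  exists c : 'I_f -> A, Z = \sum_i c i *: XA ^+ i.
Proof.
move=> cZ; have [eS el eF] := eNP.
have [u uE] : exists u : W, u * (size eN)%:R = 1.
  by apply: (witt_unit witt_W); rewrite rmorph_nat -(dvdn_pcharf chl).
pose av (Y : 'M[W]_n) := u *: \sum_(x <- eN) tW x * Y * tW x^-1%g.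
have q1 : q 1%g = 1%g by apply: (mulgI (q 1%g)); rewrite -qM !mulg1.
have qV x y : q x = q y -> q x^-1%g = q y^-1%g.
  by move=> xy; apply: (mulgI (q x)); rewrite -qM mulgV xy -qM mulgV.
have av_cent Y : exists P, av Y = horner_mx Xw P.
  apply: cent_W => h hN; rewrite /av -scalerAr -scalerAl; congr (_ *: _).
  pose Fx x := tW x * Y * tW x^-1%g.
  have [e1 _] := eF _ Fx (fun x y xy => congr2 (fun a c => a * Y * c) (tW_q xy) (tW_q (qV _ _ xy))) h hN.
  rewrite -/(Fx _) mulr_sumr -[\sum_(x <- eN) tW x * _ * _]e1 mulr_suml; apply: eq_bigr => x _.
  by rewrite /Fx invMg !tWM -!mulrA -tWM mulVg tW1 mulr1.
have /choice[P PE] : forall ab : 'I_n * 'I_n, exists P, av (delta_mx ab.1 ab.2) = horner_mx Xw P by move=> ab; apply: av_cent.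
have ZE : Z = \sum_a \sum_c Z a c *: map_mx alg (av (delta_mx a c)).
  pose avA (Y : 'M[A]_n) := alg u *: \sum_(x <- eN) tA x * Y * tA x^-1%g.
  have avAZ : Z = avA Z.
    rewrite /avA big_seq (eq_bigr (fun=> Z)) => [|x /eS xN]; last by rewrite cZ // -mulrA tAV mulr1.
    rewrite -big_seq big_const_seq count_predT iter_addr_0 -scaler_nat scalerA -(rmorph_nat alg) -rmorphM uE.
    by rewrite rmorph1 scale1r.
  rewrite [LHS]avAZ {1}[Z]matrix_sum_delta.
  transitivity (\sum_a \sum_c Z a c *: avA (delta_mx a c)).
    have avD Y Y' : avA (Y + Y') = avA Y + avA Y'.
      rewrite /avA -scalerDr -big_split; congr (_ *: _); apply: eq_bigr => x _ /=.
      by rewrite mulrDr mulrDl.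
    have av0 : avA 0 = 0 by rewrite /avA big1 ?scaler0 // => x _; rewrite mulr0 mul0r.
    have avZ c Y : avA (c *: Y) = c *: avA Y.
      rewrite /avA !scaler_sumr; apply: eq_bigr => x _.
      by rewrite -scalerAr -scalerAl !scalerA mulrC.
    rewrite (big_morph avA avD av0); apply: eq_bigr => a _.
    by rewrite (big_morph avA avD av0); apply: eq_bigr => c _; rewrite avZ.
  apply: eq_bigr => a _; apply: eq_bigr => c _; congr (_ *: _); rewrite /avA /av map_mxZ [X in _ = _ *: X]raddf_sum /=.
  by congr (_ *: _); apply: eq_bigr => x _; rewrite -!mulmxE !map_mxM map_delta_mx.
have [] := horner_span (\sum_a \sum_c Z a c *: map_poly alg (P (a, c))) => c cE.
exists c; rewrite -cE rmorph_sum {1}ZE; apply: eq_bigr => a _; rewrite rmorph_sum; apply: eq_bigr => c' _.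
transitivity (horner_mx XA ((Z a c')%:P * map_poly alg (P (a, c')))); last by rewrite mul_polyC.
by rewrite (PE (a, c')) map_horner rmorphM /= horner_mx_C -mulmxE mul_scalar_mx.
Qed.

(** The analogue of [weight_scalar] over A: each coefficient of Z is killed by a difference of
    powers of lifts of chi(sigma), a unit whenever its residue is nonzero. *)
Lemma weight_A Z g (e : A) (x y : nat) : (forall h, in_GN T N0 h -> tA h * Z = Z * tA h) ->
  chi g = om -> cnl_res A e = om -> (x < y + s)%N -> (y < x + s)%N ->
  e ^+ x *: (tA g * Z) = e ^+ y *: (Z * tA g) -> exists c, Z = c%:M /\ (x != y -> c = 0).
Proof.
move=> /cent_A[c ->] go eo xy yx.
pose r := alg (chiW g); have ro : cnl_res A r = om by rewrite cnl_algE chiW_red.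
have tX i : tA g * XA ^+ i = r ^+ (s * i) *: (XA ^+ i * tA g).
  have X1 : tA g * XA = r ^+ s *: (XA * tA g).
    by rewrite -!mulmxE -!map_mxM !mulmxE Xw_int map_mxZ rmorphXn.
  elim: i => [|i IH]; first by rewrite muln0 !expr0 mulr1 mul1r scale1r.
  by rewrite exprS mulrA X1 -scalerAl -(mulrA XA (tA g)) IH -scalerAr scalerA -exprD mulnS mulrA.
move=> rel; have {}rel : \sum_i (c i * (e ^+ x * r ^+ (s * i) - e ^+ y)) *: XA ^+ i = 0.
  have tu : tA g \is a GRing.unit by apply/unitrP; exists (tA g^-1%g); rewrite tAV tAVl.
  apply: (mulIr tu); rewrite mul0r mulr_suml; set lhs := LHS.
  have -> : lhs = e ^+ x *: (tA g * (\sum_i c i *: XA ^+ i)) - e ^+ y *: ((\sum_i c i *: XA ^+ i) * tA g).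
    rewrite /lhs mulr_sumr mulr_suml !scaler_sumr -sumrB; apply: eq_bigr => i _.
    rewrite -scalerAr tX -!scalerAl !scalerA -scalerBl; congr (_ *: _); ring.
  by rewrite rel subrr.
have c0 (i : 'I_f) : (x != y) || (i != 0 :> nat) -> c i = 0.
  move=> h; have := XA_free rel i; set v := _ - _ => cv.
  suff vu : v \is a GRing.unit by apply: (mulIr vu); rewrite mul0r.
  rewrite cnl_local /v rmorphB rmorphM !rmorphXn /= eo ro -exprD subr_eq0.
  rewrite (eq_prim_root_expr s'_prim); apply: contraL h => h; rewrite negb_or !negbK.
  have xs : x = y.
    have : (x + s * i == y %[mod s])%N by rewrite -(modn_dvdm (x + _) s_dvd) (eqP h) modn_dvdm.
    rewrite mulnC addnC modnMDl; have [xy'|xy'] := leqP x y.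
      by rewrite eq_sym eqn_mod_dvd // => /dvdnP[[|a]]; rewrite ?mulSn; lia.
    by rewrite eqn_mod_dvd 1?ltnW // => /dvdnP[[|a]]; rewrite ?mulSn; lia.
  rewrite xs eqxx /=; move: h; rewrite xs -[X in _ == X %[mod _]]addn0 eqn_modDl.
  rewrite -(eq_prim_root_expr s'_prim) expr0 exprM -(prim_order_dvd f_prim) => /dvdnP[[|a] ia]; first by rewrite ia.
  by have := ltn_ord i; rewrite ia mulSn; move: (a * f)%N; lia.
exists (c (Ordinal f_gt0)); split.
  rewrite (bigD1 (Ordinal f_gt0)) //= expr0 scalemx1 big1 ?addr0 // => i i0.
  by rewrite c0 ?scale0r //; apply/orP; right; move: i0; rewrite -val_eqE.
by move=> ne; apply: c0; rewrite ne.
Qed.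

Lemma alg_small N (x z : padic_int l_pr) i : (forall a, ideal_pow (@cnl_max _ _ _ A) N a -> a = 0) ->
  (N <= i)%N -> x i = z i -> alg (zl W x) = alg (zl W z).
Proof.
move=> AN Ni /(zl_congr witt_W)[u uE]; apply/eqP; rewrite -subr_eq0 -rmorphB uE; apply/eqP/AN.
rewrite rmorphMn /= -mulr_natl natrX; apply/ipowMr/(ipow_le Ni); elim: i {uE Ni} => [|i IH].
  by have := mxI_all (@cnl_max _ _ _ A) (const_mx 1 : 'M_1) 0 0; rewrite mxE.
by rewrite exprS; apply: (@ipowM _ _ 1 i) => //; exact/ipow1/(cnl_max_l chl).
Qed.

Lemma Pi_exp_graded r : hgraded w w r (Pi ^+ r).
Proof.
elim: r => [|r IH]; last by rewrite exprSr -mulmxE => i j /(hgradedM IH Pi_graded); rewrite addn1.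
by move=> i j; rewrite expr0 mxE; have [-> _|_] := eqVneq i j; rewrite ?addn0 ?eqxx.
Qed.

Lemma expm1_degree1 i j : w i = (w j + 1)%N -> expm 1 Pi i j = Pi i j.
Proof.
move=> wij; have m1 : (1 < m)%N.
  have := ltn_ord i; have := ltn_ord j; have : i != j :> nat by apply/eqP => /val_inj ij; move: wij; rewrite ij; lia.
  lia.
rewrite /expm summxE (bigD1 (Ordinal m1)) //= big1 => [|r r1]; first by rewrite mxE !expr1 factS fact0 muln1 divr1 mul1r addr0.
rewrite mxE; have [->|/Pi_exp_graded wr] := eqVneq ((Pi ^+ r) i j) 0; first by rewrite mulr0.
by case/eqP: r1; apply: val_inj => /=; lia.
Qed.

Lemma mul_outer_diag (U : BM) r i j : (U * outer n' (diag_mx r)) i j = r 0 j *: U i j.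
Proof.
rewrite -mulmxE mxE (bigD1 j) //= big1 => [|x xj]; last by rewrite !mxE (negPf xj) mulr0n raddf0 mulr0.
by rewrite addr0 !mxE eqxx mulr1n -mulmxE mul_mx_scalar.
Qed.

Lemma outer_diag_mul (U : BM) r i j : (outer n' (diag_mx r) * U) i j = r 0 i *: U i j.
Proof.
rewrite -mulmxE mxE (bigD1 i) //= big1 => [|x xj]; last by rewrite !mxE eq_sym (negPf xj) mulr0n raddf0 mul0r.
by rewrite addr0 !mxE eqxx mulr1n -mulmxE mul_scalar_mx.
Qed.

                                                                                     
                                                                                        
                                        
(** Over an Artinian ring a congruence modulo a high power of l is an equality, so deep elements act
    through tW alone and a deep power of sigma through its weights and tW. The first fact puts the
    blocks of U in the centralizer, the second makes them scalars of degree 0; then t gives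
    commutation with Pi, and phi the relation with y. *)
Lemma intertwiner (U : BM) y y' : artinian A -> good y -> good y' ->
  (forall g, U * Rp y g = Rp y' g * U) ->
  exists X, [/\ U = outer n' X, hgraded w w 0 X, X * Pi = Pi * X & X * y = y' * X].
Proof.
move=> art gy gy' rel; have [N AN] := artinian_nilpotent art.
have yM := good_unipotent gy; have yM' := good_unipotent gy'.
have pw_one (z : MA) g : unipotent_mod l M z -> kap g (N + M)%N = 0%N -> pw z (kap g) = 1.
  by move=> zM k0; apply/eqP; rewrite -subr_eq0; apply/eqP/matrixP => i j; have := pw_small chl zM k0; move/(_ i j); rewrite !mxE => /AN.
have small (x z : padic_int l_pr) : x (N + M)%N = z (N + M)%N -> alg (zl W x) = alg (zl W z).
  by apply: alg_small AN _; apply: leq_addr.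
(* h is replaced by a deeper representative with the same tW(h), at which the factors y^kap, exp(b
   Pi) and eps^w are all 1. *)
have cU h : in_GN T N0 h -> forall i j, tA h * U i j = U i j * tA h.
  move=> hN i j; have [h' [[e1 e2] e3 e4]] := deep (N + M)%N hN.
  have V1 (z : MA) : unipotent_mod l M z -> Vg z h' = 1.
    move=> zM; rewrite /Vg pw_one // wt1; last by rewrite /epsA (small _ 1 e1) (zl1 l_pr witt_W) rmorph1.
    by rewrite /bA (small _ 0) ?padic_zeroE // (zl0 l_pr witt_W) rmorph0 expm_c0 !mulr1.
  have /matrixP/(_ i j) := rel h'; rewrite /Rp !V1 // outer1 !mul1r mulr_inner inner_mulr.
  by rewrite /tA (tW_q e4) => ->.
pose g := (sigma ^+ (l ^ (N + M)))%g.
have Vw (z : MA) : unipotent_mod l M z -> Vg z g = wt g.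
  move=> zM; rewrite /Vg pw_one //; last by rewrite kapX; apply/padic_dvdP; eexists.
  by rewrite /bA b_sigmaX (zl0 l_pr witt_W) rmorph0 expm_c0 !mul1r.
have go : chi g = om.
  exact: (proj2 (sigma_pow_GP T chl _)).
have /choice[X XE] : forall ij : 'I_m * 'I_m, exists c, U ij.1 ij.2 = c%:M /\ (w ij.1 != w ij.2 -> c = 0).
  move=> [i j] /=; apply: (@weight_A _ g (epsA g)); rewrite ?epsA_res //.
  - by move=> h /cU.
  - by have := w_window i j; lia.
  - by have := w_window j i; lia.
  have /matrixP/(_ i j) := rel g; rewrite /Rp !Vw // /wt => /esym.
  by rewrite outer_inner -(mulrA (inner _ _)) inner_mulr outer_diag_mul -outer_inner mulrA mulr_inner mul_outer_diag !mxE -scalerAl -scalerAr.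
have UE : U = outer n' (\matrix_(i, j) X (i, j)).
  by apply/matrixP => i j; rewrite !mxE; have [] := XE (i, j).
set X' := \matrix_(i, j) _ in UE; have Xg : hgraded w w 0 X'.
  by move=> i j; rewrite mxE addn0; apply: contraNeq => /(proj2 (XE (i, j))) ->.
have relV h : X' * Vg y h = Vg y' h * X'.
  apply: (@outer_inj _ _ n'); rewrite (outerM n' X') (outerM n' _ X') -UE.
  apply: (@can_inj _ _ (fun Z => Z * inner m' (tA h)) (fun Z => Z * inner m' (tA h^-1%g))) => [Z|].
    by rewrite -mulrA -innerM tAV inner1 mulr1.
  have := rel h; rewrite /Rp mulrA => ->; rewrite -(mulrA (outer _ _) (inner _ _) U) -(mulrA (outer _ _) U); congr (_ * _).
  by rewrite UE outer_inner.
(* At t the relation says that X' commutes with exp(Pi). Since X' has degree 0, comparing the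
   entries of degree 1 leaves Pi itself. *)
have XP : X' * Pi = Pi * X'.
  case: d_bt => [bt|[d0 _]]; last first.
    suff -> : Pi = 0 by rewrite mulr0 mul0r.
    apply/matrixP => i j; rewrite !mxE; case: (boolP (d i && _)) => // /andP[di /eqP ji].
    by case: (d0 _ _ di ji).
  have := relV (tp_t T); rewrite /Vg tp_eps1_kap ?tp_eps_t // !(pw0 l_pr chl) // !mul1r wt1 ?epsA_eq1 ?tp_eps_t // !mulr1.
  rewrite /bA bt (zl1 l_pr witt_W) rmorph1 => /matrixP e; apply/matrixP => i j; rewrite !mxE.
  have [wij|wij] := eqVneq (w i) (w j + 1)%N.
    have := e i j; rewrite !mxE => e'; etransitivity; last first.
      etransitivity; first exact: e'.
      apply: eq_bigr => x _; have [->|/Xg xj] := eqVneq (X' x j) 0; first by rewrite !mulr0.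
      by rewrite expm1_degree1 // wij; lia.
    symmetry; apply: eq_bigr => x _; have [->|/Xg xj] := eqVneq (X' i x) 0; first by rewrite !mul0r.
    by rewrite expm1_degree1 //; lia.
  rewrite !big1 // => x _.
    have [->|/Xg xj] := eqVneq (X' x j) 0; first by rewrite mulr0.
    have [->|/Pi_graded] := eqVneq (Pi i x) 0; first by rewrite mul0r.
    by move=> ix; case/eqP: wij; lia.
  have [->|/Xg xj] := eqVneq (X' i x) 0; first by rewrite mul0r.
  have [->|/Pi_graded ix] := eqVneq (Pi x j) 0; first by rewrite mulr0.
  by case/eqP: wij; lia.
exists X'; split=> //.
(* At phi the power y^kap is y; the exponential and the weights commute with X' and cancel. *)
have := relV (tp_phi T); rewrite /Vg tp_kap_phi !(pw1 l_pr chl) // -!mulrA (wt_comm _ Xg) (mulrA (expm _ _)) -(expm_comm _ XP) !mulrA.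
move=> /(congr1 (fun Z => Z * wt (tp_phi T)^-1%g * expm (- bA (tp_phi T)) Pi)).
by rewrite -!(mulrA _ (wt _) (wt _)) wt_unit !mulr1 -!(mulrA _ (expm _ _) (expm _ _)) expm_unit !mulr1.
Qed.

End OverA.
Definition bmap (A B : cnl red) (f : {rmorphism A -> B}) (Z : 'M['M[A]_n]_m) : 'M['M[B]_n]_m := map_mx (map_mx f) Z.

Definition Tg (A : cnl red) g : 'M['M[A]_n]_m :=
  outer n' (expm (bA A g) (shift_mx A d) * wt A g) * inner m' (tA A g).

Lemma RpE (A : cnl red) (y : 'M[A]_m) g : Rp y g = outer n' (pw M y (kap g)) * Tg A g.
Proof. by rewrite /Rp /Tg mulrA -outerM /Vg mulrA. Qed.

Section Functoriality.
Variables (A B : cnl red) (phi : {rmorphism A -> B}).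

Lemma bmapM Y Z : bmap phi (Y * Z) = bmap phi Y * bmap phi Z.
Proof.
apply/matrixP => i j; rewrite -!mulmxE !mxE raddf_sum /=; apply: eq_bigr => x _.
by rewrite !mxE -!mulmxE map_mxM.
Qed.

Lemma bmap1 : bmap phi 1 = 1.
Proof.
apply/matrixP => i j; rewrite !mxE; case: (i == j); rewrite ?mulr1n ?mulr0n ?raddf0 //.
by rewrite map_mx1.
Qed.

Lemma bmap_outer y : bmap phi (outer n' y) = outer n' (map_mx phi y).
Proof. by apply/matrixP => i j; rewrite !mxE map_scalar_mx. Qed.

Lemma bmap_inner z : bmap phi (inner m' z) = inner m' (map_mx phi z).
Proof. by apply/matrixP => i j; rewrite !mxE; case: (i == j); rewrite ?mulr1n ?mulr0n ?raddf0. Qed.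

Lemma blk_map (Z : 'M[A]_(m * n)) : blk (map_mx phi Z) = bmap phi (blk Z).
Proof. by apply/matrixP => i j; apply/matrixP => a c; rewrite !mxE. Qed.

(** Multiplying by Pi only moves entries or replaces them by 0, so it commutes with any map
    preserving 0, additive or not. It is applied to set-theoretic sections of surjections. *)
Lemma map_mx_mul_shift (h : A -> B) (X : 'M[A]_m) : h 0 = 0 ->
  map_mx h (X * shift_mx A d) = map_mx h X * shift_mx B d /\
  map_mx h (shift_mx A d * X) = shift_mx B d * map_mx h X.
Proof.
move=> h0.
have one (R : nmodType) (Fn : 'I_m -> R) x : (forall y, y != x -> Fn y = 0) -> \sum_y Fn y = Fn x.
  by move=> z; rewrite (bigD1 x) //= big1 ?addr0.
have ne (x y : 'I_m) : y != x -> (y == x :> nat) = false by move=> /negPf; rewrite -val_eqE.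
split; apply/matrixP => i j; rewrite -!mulmxE !mxE.
  have [x /andP[dx xj]|no] := pickP (fun x : 'I_m => d x && (j == x.+1 :> nat)); last first.
    by rewrite !big1 // => x _; rewrite !mxE no mulr0.
  have z y : y != x -> d y && (j == y.+1 :> nat) = false.
    by move=> yx; rewrite (eqP xj) eqSS eq_sym ne // andbF.
  rewrite !(one _ _ x) => [|y yx|y yx]; first by rewrite !mxE dx xj !mulr1.
    by rewrite !mxE (z y yx) mulr0.
  by rewrite !mxE (z y yx) mulr0.
have [x /andP[dx xj]|no] := pickP (fun x : 'I_m => d i && (x == i.+1 :> nat)); last first.
  by rewrite !big1 // => x _; rewrite !mxE no mul0r.
have z (y : 'I_m) : y != x -> d i && (y == i.+1 :> nat) = false.
  by move=> yx; rewrite -(eqP xj) ne // andbF.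
rewrite !(one _ _ x) => [|y yx|y yx]; first by rewrite !mxE dx xj !mul1r.
  by rewrite !mxE (z y yx) mul0r.
by rewrite !mxE (z y yx) mul0r.
Qed.

Lemma map_shift : map_mx phi (shift_mx A d) = shift_mx B d.
Proof. by apply/matrixP => i j; rewrite !mxE rmorph_nat. Qed.

Hypothesis fm : cnl_morphism phi.

Lemma map_tA g : map_mx phi (tA A g) = tA B g.
Proof. by have [f1 _] := fm; apply/matrixP => i j; rewrite !mxE f1. Qed.

Lemma good_map y : good y -> good (map_mx phi y).
Proof.
move=> [y1 y2 y3]; split.
- by move=> i j; rewrite mxE => h; apply: y1; apply: contraNneq h => ->; rewrite rmorph0.
- by rewrite -map_shift -!mulmxE -!map_mxM !mulmxE y2.
by rewrite -y3; apply/matrixP => i j; rewrite !mxE (cnl_res_morphism (red_surj witt_W) fm).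
Qed.

Lemma map_Tg g : bmap phi (Tg A g) = Tg B g.
Proof.
rewrite /Tg bmapM bmap_outer bmap_inner map_tA; congr (outer _ _ * _).
have [f1 _] := fm; rewrite -!mulmxE !map_mxM !mulmxE; congr (_ * _).
  rewrite /expm raddf_sum; apply: eq_bigr => j _ /=; rewrite map_mxZ map_mxX_ring map_shift; congr (_ *: _).
  by rewrite rmorphM rmorphV ?fact_unitA // rmorphXn rmorph_nat /bA f1.
by apply/matrixP => i j; rewrite !mxE rmorphMn rmorphXn /epsA f1.
Qed.

Lemma map_Rp y g : good y -> bmap phi (Rp y g) = Rp (map_mx phi y) g.
Proof. by move=> gy; rewrite !RpE bmapM bmap_outer map_Tg (pw_map chl _ fm (good_unipotent gy)). Qed.

End Functoriality.

Lemma Rp_residue g : good (y0 : 'M[residue_cnl red]_m) ->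
  Rp (y0 : 'M[residue_cnl red]_m) g =
  outer n' (expm (b g 1%N)%:R (shift_mx k d) * y0 ^+ (kap g M) * weight_mx T k w g) * inner m' (map_mx red (tW g)).
Proof.
move=> gy; rewrite /Rp; congr (outer _ _ * inner _ _); rewrite /Vg; congr (_ * _).
  have [_ yP _] := gy; have <- : bA (residue_cnl red) g = (b g 1%N)%:R by apply: (zl_red witt_W).
  have -> : pw M (y0 : 'M[residue_cnl red]_m) (kap g) = y0 ^+ kap g M.
    have h := pwP chl (kap g) 1 (good_unipotent gy).
    have e : kap g (1 + M)%N = kap g M %[mod l ^ M] by apply: padic_coh.
    have X (i : nat) : y0 ^+ i = y0 ^+ (i %% l ^ M).
      by rewrite {1}(divn_eq i (l ^ M)) exprD mulnC exprM y0M expr1n mul1r.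
    rewrite (X (kap g M)) -e -X; apply/eqP; rewrite -subr_eq0; apply/eqP/matrixP => i j.
    have := ipow1E (cnl_max_ideal (residue_cnl red)) (h i j).
    by rewrite /cnl_max /= => ->; rewrite mxE.
  rewrite -expm_comm //; elim: (kap g M) => [|i IH]; first by rewrite expr0 mulr1 mul1r.
  by rewrite exprS -mulrA IH !mulrA; congr (_ * _); exact: yP.
apply/matrixP => i j; rewrite !mxE; congr (_ ^+ _ *+ _); exact: (zl_red witt_W).
Qed.

Variable rhobar : G -> 'M[k]_(m * n).
Hypothesis rhobar_rep : is_rep rhobar.
Local Notation K := (residue_cnl red).
Variables (P0 Q0 : 'M['M[K]_n]_m).
Hypothesis PQ0 : P0 * Q0 = 1.
Hypothesis QP0 : Q0 * P0 = 1.
Hypothesis y0_good : good (y0 : 'M[K]_m).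
Hypothesis rhobarE : forall g, blk (rhobar g : 'M[K]_(m * n)) = P0 * Rp (y0 : 'M[K]_m) g * Q0.
Hypothesis q_open : exists r : seq E, forall g : G, {in r, forall x, g x = x} -> q g = 1%g.

Definition model_of (A : cnl red) (rho : G -> 'M[A]_(m * n)) P Q y :=
  [/\ P * Q = 1, Q * P = 1, good y & forall g, blk (rho g) = P * Rp y g * Q].

(** The deformation condition: continuous representations conjugate over A to some R_y. The
    conjugating matrices are not asked to reduce to [P0] and [Q0]. *)
Definition defo : rep_class iota red (m * n) := fun A rho =>
  cnl_rep rho /\ exists P Q y, model_of rho P Q y.

Lemma alg_congr (A : cnl red) N (x z : padic_int l_pr) : x N = z N ->
  ideal_pow (@cnl_max _ _ _ A) N (cnl_alg A (zl W x) - cnl_alg A (zl W z)).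
Proof.
move=> /(zl_congr witt_W)[u uE]; rewrite -rmorphB uE rmorphMn /= -mulr_natl natrX; apply/ipowMr.
elim: N {uE u} => [|i IH].
  by have := mxI_all (@cnl_max _ _ _ A) (const_mx 1 : 'M_1) 0 0; rewrite mxE.
by rewrite exprS; apply: (@ipowM _ _ 1 i) => //; exact/ipow1/(cnl_max_l chl).
Qed.

Lemma Rp_continuous (A : cnl red) (y : 'M[A]_m) N : good y -> exists r : seq E,
  forall g h : G, {in r, g =1 h} -> mxI (@cnl_max _ _ _ A) N (Vg y g - Vg y h) /\ tA A g = tA A h.
Proof.
move=> gy; have yM := good_unipotent gy.
have [r1 e1] := tp_eps_cont T N; have [r2 e2] := tp_b_cont T N; have [r3 e3] := tp_kap_cont T (N + M)%N.
have [r4 e4] := q_open; exists (r1 ++ r2 ++ r3 ++ r4) => g h gh.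
have {}e1 : eps g N = eps h N by apply: e1 => x xr; apply: gh; rewrite !mem_cat xr.
have {}e2 : b g N = b h N by apply: e2 => x xr; apply: gh; rewrite !mem_cat xr ?orbT.
have {}e3 : kap g (N + M)%N = kap h (N + M)%N by apply: e3 => x xr; apply: gh; rewrite !mem_cat xr ?orbT.
split; last first.
  rewrite /tA; congr (map_mx _ _); apply: tW_q; apply: (mulgI (q h^-1%g)); rewrite -!qM mulVg.
  rewrite !e4 // => x xr /=.
  by rewrite gh ?abs_gal_funK // !mem_cat xr !orbT.
have powB (a c : A) j : ideal_pow (@cnl_max _ _ _ A) N (a - c) -> ideal_pow (@cnl_max _ _ _ A) N (a ^+ j - c ^+ j).
  by move=> ac; rewrite subrXX; apply: ipowMr.
have prod (X Y X' Y' : 'M[A]_m) : mxI (@cnl_max _ _ _ A) N (X - X') -> mxI (@cnl_max _ _ _ A) N (Y - Y') ->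
    mxI (@cnl_max _ _ _ A) N (X * Y - X' * Y').
  move=> hX hY; have -> : X * Y - X' * Y' = (X - X') * Y + X' * (Y - Y').
    by rewrite mulrBl mulrBr addrA subrK.
  by apply: mxID; [apply: mxIMr | apply: mxIMl].
rewrite /Vg; apply: (prod); first apply: (prod).
- by apply: (mxI_trans (pwP chl (kap g) N yM)); rewrite e3; apply/mxIC/(pwP chl).
- rewrite /expm -sumrB => i j; rewrite summxE; apply: ipow_sum => x _.
  by rewrite -scalerBl mxE -mulrBl; apply/ipowMr/ipowMr/powB/alg_congr.
move=> i j; rewrite !mxE; case: (i == j); rewrite ?mulr1n ?mulr0n ?subrr; last exact: ipow0.
exact/powB/alg_congr.
Qed.

Lemma model_cnl_rep (A : cnl red) (rho : G -> 'M[A]_(m * n)) P Q y : model_of rho P Q y -> cnl_rep rho.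
Proof.
move=> [PQ QP gy rhoE]; split.
  split=> [|g h]; apply: (can_inj (@blkK _ _ _)).
    by rewrite rhoE Rp1 // mulr1 PQ blk1.
  by rewrite blkM !rhoE RpM // -!mulrA (mulrA Q) QP mul1r.
move=> g N; have [r rP] := Rp_continuous N gy; exists r => h gh i j.
have [hV ht] := rP g h gh.
have dist (X X' Z : 'M['M[A]_n]_m) : P * ((X - X') * Z) * Q = P * (X * Z) * Q - P * (X' * Z) * Q.
  by rewrite mulrBl mulrBr mulrBl.
have -> : rho h i j - rho g i j = unblk (P * (outer n' (Vg y h - Vg y g) * inner m' (tA A g)) * Q) i j.
  rewrite -[rho h]blkK -[rho g]blkK !rhoE /Rp -ht.
  have -> : outer n' (Vg y h - Vg y g) = outer n' (Vg y h) - outer n' (Vg y g).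
    by apply/matrixP => a c; rewrite !mxE raddfB.
  by rewrite dist; exact: unblkB.
rewrite !unblkM; suff : mxI (@cnl_max _ _ _ A) N (unblk P *m (unblk (outer n' (Vg y h - Vg y g)) *m unblk (inner m' (tA A g))) *m unblk Q) by apply.
apply/mxIMr/mxIMl/mxIMr => a c.
case: (mxtens_indexP a) => a1 a2; case: (mxtens_indexP c) => c1 c2; rewrite unblkE mxE mxE.
case: (a2 == c2); rewrite ?mulr1n ?mulr0n; last exact: ipow0.
exact: (mxIC hV).
Qed.

Lemma defo_unblk (A : cnl red) (P Q : 'M['M[A]_n]_m) (y : 'M[A]_m) : P * Q = 1 -> Q * P = 1 -> good y ->
  defo (fun g => unblk (P * Rp y g * Q)).
Proof.
move=> PQ QP gy; have h : model_of (fun g => unblk (P * Rp y g * Q)) P Q y.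
  by split=> // g; rewrite unblkK.
by split; [apply: model_cnl_rep h | exists P, Q, y].
Qed.

Lemma model_map (A B : cnl red) (phi : {rmorphism A -> B}) (rho : G -> 'M[A]_(m * n)) P Q y : cnl_morphism phi ->
  model_of rho P Q y -> model_of (fun g => map_mx phi (rho g)) (bmap phi P) (bmap phi Q) (map_mx phi y).
Proof.
move=> fm [PQ QP gy rhoE]; split; rewrite -?bmapM ?PQ ?QP ?bmap1 //; first exact: good_map.
by move=> g; rewrite blk_map rhoE (bmapM _ (P * _)) (bmapM _ P) (map_Rp fm).
Qed.

Lemma defo_map (A B : cnl red) (phi : {rmorphism A -> B}) (rho : G -> 'M[A]_(m * n)) : cnl_morphism phi ->
  defo rho -> defo (fun g => map_mx phi (rho g)).
Proof.
move=> fm [_ [P [Q [y /(model_map fm) h]]]]; split; first exact: model_cnl_rep h.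
by exists (bmap phi P), (bmap phi Q), (map_mx phi y).
Qed.

Lemma res_cnl_morphism (A : cnl red) : @cnl_morphism _ _ _ A K (cnl_res A).
Proof. by split=> // x; apply: cnl_algE. Qed.

Lemma defo_conj (A : cnl red) (rho rho' : G -> 'M[A]_(m * n)) (N : 'M[A]_(m * n)) : N \in unitmx ->
  (forall g, rho g = N *m rho' g *m invmx N) -> defo rho -> defo rho'.
Proof.
move=> Nu e [_ [P [Q [y [PQ QP gy rhoE]]]]].
have e1 : blk (invmx N) * blk N = 1 by rewrite -blkM mulVmx // blk1.
have e2 : blk N * blk (invmx N) = 1 by rewrite -blkM mulmxV // blk1.
have h : model_of rho' (blk (invmx N) * P) (Q * blk N) y.
  split=> // [||g]; first by rewrite -mulrA (mulrA P) PQ mul1r.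
    by rewrite -mulrA (mulrA (blk N)) e2 mul1r.
  have -> : rho' g = invmx N *m rho g *m N by rewrite e -mulmxA mulmxKV // mulKmx.
  by rewrite !blkM rhoE !mulrA.
split; first exact: model_cnl_rep h.
by do 3 eexists; apply: h.
Qed.

Lemma defo_reduction (A : cnl red) (rho : G -> 'M[A]_(m * n)) : defo rho ->
  rep_equiv (fun g => map_mx (cnl_res A) (rho g)) rhobar.
Proof.
move=> [_ [P [Q [y h]]]]; have [_ _ [_ _ yr] _] := h.
have [PQ QP _ rhoE] := model_map (@res_cnl_morphism A) h.
move: (bmap _ P) (bmap _ Q) PQ QP rhoE => P1 Q1 PQ QP rhoE.
exists (unblk (P1 * Q0)), (unblk (P0 * Q1)); split; rewrite -?unblkM.
- by rewrite -mulrA (mulrA Q0) QP0 mul1r PQ unblk1.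
- by rewrite -mulrA (mulrA Q1) QP mul1r PQ0 unblk1.
move=> g; apply: (can_inj (@blkK _ _ _)); rewrite rhoE !blkM !unblkK rhobarE yr.
move: (Rp _ g) => R.
by rewrite !mulrA -(mulrA P1 Q0 P0) QP0 mulr1 -(mulrA _ Q0 P0) QP0 mulr1.
Qed.

Lemma surjective_section (A B : cnl red) (phi : {rmorphism A -> B}) : surjective_map phi ->
  exists2 h : B -> A, forall x, phi (h x) = x & h 0 = 0.
Proof.
move=> /choice[h hE]; exists (fun x => h x - h 0); last by rewrite subrr.
by move=> x; rewrite rmorphB !hE subr0.
Qed.

Lemma det_unit (A B : cnl red) (phi : {rmorphism A -> B}) r (X : 'M[A]_r) : cnl_morphism phi ->
  map_mx phi X \in unitmx -> X \in unitmx.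
Proof. by move=> fm; rewrite !unitmxE !cnl_local det_map_mx (cnl_res_morphism (red_surj witt_W) fm). Qed.

(** Lifting entrywise by a section that fixes 0 preserves both the grading and the commutation with
    Pi. *)
Lemma lift_commuting (A B : cnl red) (phi : {rmorphism A -> B}) (X : 'M[B]_m) :
  surjective_map phi -> hgraded w w 0 X -> X * shift_mx B d = shift_mx B d * X ->
  exists Y, [/\ map_mx phi Y = X, hgraded w w 0 Y & Y * shift_mx A d = shift_mx A d * Y].
Proof.
move=> /surjective_section[h hK h0] Xg XP; exists (map_mx h X); split.
- by apply/matrixP => i j; rewrite !mxE hK.
- by move=> i j; rewrite mxE => nz; apply: Xg; apply: contraNneq nz => ->; rewrite h0.
by have [<- _] := map_mx_mul_shift X h0; rewrite XP; have [_ ->] := map_mx_mul_shift X h0.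
Qed.

Lemma lift_invertible (A B : cnl red) (phi : {rmorphism A -> B}) (P Q : 'M['M[B]_n]_m) :
  cnl_morphism phi -> surjective_map phi -> P * Q = 1 ->
  exists P' Q', [/\ P' * Q' = 1, Q' * P' = 1, bmap phi P' = P & bmap phi Q' = Q].
Proof.
move=> fm /surjective_section[h hK _] PQ; pose X := map_mx h (unblk P).
have XE : map_mx phi X = unblk P by apply/matrixP => i j; rewrite !mxE hK.
have QP : unblk Q *m unblk P = 1%:M by apply: mulmx1C; rewrite -unblkM PQ unblk1.
have Xu : X \in unitmx by apply: (det_unit fm); rewrite XE; case: (mulmx1_unit QP).
have PE : bmap phi (blk X) = P by rewrite -blk_map XE unblkK.
have XV : blk X * blk (invmx X) = 1 by rewrite -blkM mulmxV // blk1.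
exists (blk X), (blk (invmx X)); split=> //; first by rewrite -blkM mulVmx // blk1.
have {}QP : Q * P = 1 by rewrite -[Q]unblkK -[P]unblkK -blkM QP blk1.
by rewrite -[LHS]mul1r -QP -{1}PE -mulrA -bmapM XV bmap1 mulr1.
Qed.

Lemma model_conj (A : cnl red) (rho : G -> 'M[A]_(m * n)) P Q y X : model_of rho P Q y ->
  X \is a GRing.unit -> hgraded w w 0 X -> X * shift_mx A d = shift_mx A d * X ->
  map_mx (cnl_res A) X * y0 = y0 * map_mx (cnl_res A) X ->
  model_of rho (P * outer n' X) (outer n' X^-1 * Q) (X^-1 * y * X).
Proof.
move=> [PQ QP gy rhoE] Xu Xg XP Xy; have XVg : hgraded w w 0 X^-1 := hgraded_inv Xu Xg.
have oX : outer n' X * outer n' X^-1 = 1 by rewrite -outerM mulrV // outer1.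
have oV : outer n' X^-1 * outer n' X = 1 by rewrite -outerM mulVr // outer1.
have gy' : good (X^-1 * y * X).
  have [y1 y2 y3] := gy; split.
  - by rewrite -!mulmxE; apply: (hgradedM (hgradedM XVg y1) Xg).
  - have XVP : X^-1 * shift_mx A d = shift_mx A d * X^-1.
      by symmetry; apply: commrV; symmetry.
    by rewrite -(mulrA _ X) XP mulrA -(mulrA X^-1 y) y2 (mulrA X^-1) XVP -!mulrA.
  have XXb : map_mx (cnl_res A) X^-1 * map_mx (cnl_res A) X = 1.
    by rewrite -mulmxE -map_mxM mulmxE mulVr // map_mx1.
  by rewrite -!mulmxE !map_mxM !mulmxE y3 -mulrA -Xy mulrA XXb mul1r.
split; [by rewrite -mulrA (mulrA (outer n' X)) oX mul1r | | exact: gy' | move=> g].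
  by rewrite -mulrA (mulrA Q) QP mul1r.
have e : outer n' X * Rp (X^-1 * y * X) g = Rp y g * outer n' X.
  by apply: (Rp_conj _ gy' gy Xg XP); rewrite mulrA mulrA mulrV // mul1r.
etransitivity; first exact: rhoE.
by symmetry; apply: conj_insert oX e.
Qed.

(** The two models become isomorphic over C. By [intertwiner] the isomorphism is a graded matrix X
    commuting with Pi; lifted to B, it changes the second model so that P, Q and y agree over C and
    can be glued entrywise. *)
Lemma defo_glue (A B C R : cnl red) (alpha : {rmorphism A -> C}) (beta : {rmorphism B -> C})
    (p1 : {rmorphism R -> A}) (p2 : {rmorphism R -> B}) (rho : G -> 'M[R]_(m * n)) :
  artinian C -> cnl_morphism alpha -> cnl_morphism beta -> surjective_map beta ->
  cnl_morphism p1 -> cnl_morphism p2 -> fiber_product alpha beta p1 p2 -> cnl_rep rho ->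
  defo (fun g => map_mx p1 (rho g)) -> defo (fun g => map_mx p2 (rho g)) -> defo rho.
Proof.
move=> artC am bm bs m1 m2 [comp fib] rhoR [_ [P1 [Q1 [y1 M1]]]] [_ [P2 [Q2 [y2 M2]]]].
have resE := cnl_res_morphism (red_surj witt_W).
have inj (x y : R) : p1 x = p1 y -> p2 x = p2 y -> x = y.
  by move=> e1 e2; have [z [_ u]] := fib _ _ (comp x); rewrite -(u x) // -(u y).
have injm r t (X Y : 'M[R]_(r, t)) : map_mx p1 X = map_mx p1 Y -> map_mx p2 X = map_mx p2 Y -> X = Y.
  move=> /matrixP e1 /matrixP e2; apply/matrixP => i j.
  by have := e1 i j; have := e2 i j; rewrite !mxE => e e'; apply: inj.
have injb (X Y : 'M['M[R]_n]_m) : bmap p1 X = bmap p1 Y -> bmap p2 X = bmap p2 Y -> X = Y.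
  move=> /matrixP e1 /matrixP e2; apply/matrixP => i j.
  by have := e1 i j; have := e2 i j; rewrite !mxE => e e'; apply: injm.
have gluem r t (X : 'M[A]_(r, t)) (Y : 'M[B]_(r, t)) : map_mx alpha X = map_mx beta Y ->
    exists Z, map_mx p1 Z = X /\ map_mx p2 Z = Y.
  move=> /matrixP e; have /choice[Z ZE] : forall ij : 'I_r * 'I_t, exists x, p1 x = X ij.1 ij.2 /\ p2 x = Y ij.1 ij.2.
    move=> [i j]; have [z [zE _]] := fib (X i j) (Y i j) ltac:(by have := e i j; rewrite !mxE).
    by exists z.
  by exists (\matrix_(i, j) Z (i, j)); split; apply/matrixP => i j; rewrite !mxE; have [] := ZE (i, j).
have glueb (X : 'M['M[A]_n]_m) (Y : 'M['M[B]_n]_m) : bmap alpha X = bmap beta Y -> exists Z, bmap p1 Z = X /\ bmap p2 Z = Y.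
  move=> e; have [|Z [Z1 Z2]] := gluem _ _ (unblk X) (unblk Y).
    by apply: (can_inj (@blkK _ _ _)); rewrite !blk_map !unblkK.
  by exists (blk Z); rewrite -!blk_map Z1 Z2 !unblkK.
have [PQ1 QP1 gy1 E1] := model_map am M1; have [PQ2 QP2 gy2 E2] := model_map bm M2.
have EE g : bmap alpha P1 * Rp (map_mx alpha y1) g * bmap alpha Q1 = bmap beta P2 * Rp (map_mx beta y2) g * bmap beta Q2.
  etransitivity; first by symmetry; apply: E1.
  etransitivity; last exact: E2.
  by congr blk; apply/matrixP => i j; rewrite !mxE comp.
have [X [UX Xg XP Xy]] : exists X, [/\ bmap beta Q2 * bmap alpha P1 = outer n' X, hgraded w w 0 X,
    X * shift_mx C d = shift_mx C d * X & X * map_mx alpha y1 = map_mx beta y2 * X].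
  by apply: intertwiner => // g; apply: conj_transfer QP1 QP2 (EE g).
(* The opposite comparison of the two models provides the inverse. *)
have Xu : X \is a GRing.unit.
  have [V [VX _ _ _]] : exists V, [/\ bmap alpha Q1 * bmap beta P2 = outer n' V, hgraded w w 0 V,
      V * shift_mx C d = shift_mx C d * V & V * map_mx beta y2 = map_mx alpha y1 * V].
    by apply: intertwiner => // g; apply: conj_transfer QP2 QP1 (esym (EE g)).
  apply/unitrP; exists V; split; apply: (@outer_inj _ _ n'); rewrite outerM outer1 -UX -VX.
    by rewrite mulrA -(mulrA _ _ (bmap beta Q2)) PQ2 mulr1 QP1.
  by rewrite mulrA -(mulrA _ _ (bmap alpha Q1)) PQ1 mulr1 QP2.
have [Y [YX Yg YP]] := lift_commuting bs Xg XP.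
have Yu : Y \is a GRing.unit by apply: (det_unit bm); rewrite YX.
have yrA := let: And4 _ _ gy _ := M1 in let: And3 _ _ r := gy in r.
have yrB := let: And4 _ _ gy _ := M2 in let: And3 _ _ r := gy in r.
(* Both parameters reduce to y0, so the residue of X commutes with y0, as [model_conj] requires. *)
have Yr : map_mx (cnl_res B) Y * y0 = y0 * map_mx (cnl_res B) Y.
  have bE : map_mx (cnl_res B) Y = map_mx (cnl_res C) X.
    by rewrite -YX; apply/matrixP => i j; rewrite !mxE resE.
  have aE : map_mx (cnl_res C) (map_mx alpha y1) = y0 by rewrite -yrA; apply/matrixP => i j; rewrite !mxE resE.
  have cE : map_mx (cnl_res C) (map_mx beta y2) = y0 by rewrite -yrB; apply/matrixP => i j; rewrite !mxE resE.
  by rewrite bE -{1}aE -cE -!mulmxE -!map_mxM !mulmxE Xy.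
have M2' := model_conj M2 Yu Yg YP Yr; have [PQ2' QP2' gy2' E2'] := M2'; have [PQ1' QP1' gy1' E1'] := M1.
have YVX : map_mx beta Y^-1 = X^-1 
  by apply: (mulIr Xu); rewrite mulVr // -{1}YX -!mulmxE -map_mxM mulmxE mulVr // map_mx1.
have yE : map_mx alpha y1 = map_mx beta (Y^-1 * y2 * Y).
  by rewrite -!mulmxE !map_mxM !mulmxE YVX YX -mulrA -Xy mulKr.
have PE : bmap alpha P1 = bmap beta (P2 * outer n' Y).
  by rewrite bmapM bmap_outer YX -UX mulrA PQ2 mul1r.
have QE : bmap alpha Q1 = bmap beta (outer n' Y^-1 * Q2).
  rewrite -[LHS]mulr1 -[1 in LHS](bmap1 beta) -PQ2' bmapM -PE mulrA QP1 mul1r; done.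
have [P [pP1 pP2]] := glueb _ _ PE; have [Q [pQ1 pQ2]] := glueb _ _ QE; have [y [py1 py2]] := gluem _ _ _ _ yE.
have gy : good y.
  have [a1 a2 a3] := gy1'; have [c1 c2 _] := gy2'; split.
  - move=> i j nz; have [e1|] := eqVneq (y1 i j) 0; last exact: a1.
    apply: c1; apply: contraNneq nz => e2; apply/eqP/inj; rewrite rmorph0.
      by rewrite -e1 -py1 mxE.
    by rewrite -e2 -py2 mxE.
  - by apply: injm; rewrite -!mulmxE !map_mxM !map_shift // ?py1 ?py2 !mulmxE.
  by rewrite -a3 -py1; apply/matrixP => i j; rewrite !mxE resE.
split; first exact: rhoR.
exists P, Q, y; split; [| | exact: gy | move=> g].
- by apply: injb; rewrite bmapM bmap1 ?pP1 ?pQ1 ?pP2 ?pQ2.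
- by apply: injb; rewrite bmapM bmap1 ?pP1 ?pQ1 ?pP2 ?pQ2.
apply: injb; rewrite -blk_map ?E1' ?E2' (bmapM _ (P * _)) (bmapM _ P) map_Rp //.
  by rewrite pP1 pQ1 py1.
by rewrite pP2 pQ2 py2.
Qed.

(** The conjugating matrix lifts because invertibility is read on residues, and y lifts by
    [lift_commuting]. *)
Lemma defo_smooth : smooth defo.
Proof.
move=> A B phi rhoB fm ps [_ [P [Q [y [PQ QP [y1 y2 y3] E1]]]]].
have [P' [Q' [PQ' QP' PE QE]]] := lift_invertible fm ps PQ.
have [Y [YE Yg YP]] := lift_commuting ps y1 y2.
have gY : good Y.
  split=> //; rewrite -y3 -YE; apply/matrixP => i j; rewrite !mxE.
  by rewrite (cnl_res_morphism (red_surj witt_W) fm).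
exists (fun g => unblk (P' * Rp Y g * Q')); first exact: defo_unblk.
move=> g; apply: (can_inj (@blkK _ _ _)); rewrite E1 blk_map unblkK.
by rewrite (bmapM _ (P' * _)) (bmapM _ P') map_Rp // PE QE YE.
Qed.

Lemma det_unipotent_outer (A : cnl red) c : \det (unblk (outer n' (expm c (shift_mx A d)))) = 1.
Proof.
pose N := shift_mx A d; have sh1 : hgraded (fun i : 'I_m => (m - i)%N) (fun i => (m - i)%N) 1 N.
  move=> x y; rewrite mxE; case: andP => [[_ /eqP ->] _|_]; last by rewrite eqxx.
  by have := ltn_ord y; have := ltn_ord x; lia.
have shg r : hgraded (fun i : 'I_m => (m - i)%N) (fun i => (m - i)%N) r (N ^+ r).
  elim: r => [|r IH].
    by move=> i j; rewrite expr0 mxE; have [-> _|_] := eqVneq i j; rewrite ?addn0 ?eqxx.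
  by rewrite exprSr -mulmxE => i j /(hgradedM IH sh1) ->; rewrite addn1.
have E0 (i j : 'I_m) : (j < i)%N -> expm c N i j = 0.
  move=> ji; rewrite /expm summxE big1 // => r _; rewrite mxE.
  have [->|/shg h] := eqVneq ((N ^+ r) i j) 0; first by rewrite mulr0.
  by have := ltn_ord i; move: h ji; move: (nat_of_ord r); lia.
have E1 i : expm c N i i = 1.
  rewrite /expm summxE (bigD1 ord0) //= big1 => [|r r0]; first by rewrite !expr0 !mxE eqxx fact0 divr1 mulr1 addr0.
  rewrite mxE; have [->|/shg h] := eqVneq ((N ^+ r) i i) 0; first by rewrite mulr0.
  by case/eqP: r0; apply: val_inj => /=; lia.
rewrite -det_tr det_trig.
  rewrite big1 // => x _; rewrite mxE; case: (mxtens_indexP x) => i a.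
  by rewrite unblkE !mxE E1 eqxx.
apply/is_trig_mxP => x y; rewrite mxE; case: (mxtens_indexP x) => i a; case: (mxtens_indexP y) => j e.
rewrite unblkE !mxE /= => lt; have [ea|] := eqVneq e a; last by rewrite mulr0n.
suff /E0 -> : (i < j)%N by rewrite mul0rn.
by rewrite ltnNge; apply/negP => ji; move: lt; rewrite ea ltn_add2r ltnNge leq_mul2r ji orbT.
Qed.

(** On inertia eps = 1, hence kap = 0 and the weights are trivial; there remains a unitriangular
    matrix tensored with tW. *)
Lemma det_inertia (A : cnl red) (rho : G -> 'M[A]_(m * n)) : defo rho ->
  forall g, inert g -> \det (rho g) = cnl_alg A (\det (unblk (inner m' (tW g)))).
Proof.
move=> [_ [P [Q [y [PQ QP gy rhoE]]]]] g /(tp_inertia T) eg.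
have kg := tp_eps1_kap eg.
rewrite -[rho g]blkK rhoE unblkM unblkM !det_mulmx mulrAC -det_mulmx -unblkM PQ unblk1 det1 mul1r.
rewrite /Rp /Vg kg (pw0 l_pr chl (good_unipotent gy)) mul1r wt1 ?epsA_eq1 // mulr1 unblkM det_mulmx det_unipotent_outer mul1r.
rewrite -det_map_mx; congr (\det _); apply/matrixP => i j; rewrite !mxE.
by case: eqP; rewrite ?mulr1n ?mulr0n !mxE ?rmorph0.
Qed.

Lemma defo_residual : @defo K rhobar.
Proof.
have h : @model_of K rhobar P0 Q0 y0 by split.
by split; [apply: model_cnl_rep h | exists P0, Q0, y0].
Qed.

Lemma defo_det (A : cnl red) (rho : G -> 'M[A]_(m * n)) : defo rho ->
  forall g, inert g -> \det (rho g) = cnl_alg A (teichmuller red (\det (rhobar g))).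
Proof.
move=> dA g ig; rewrite (det_inertia dA ig); congr (cnl_alg A _).
have dK := defo_residual.
set t := \det _; have tr : \det (rhobar g) = red t by rewrite -[red t](det_inertia dK ig).
have r0 : red t != 0.
  rewrite -tr; have [r1 rM] := rhobar_rep; have : rhobar g *m rhobar g^-1%g = 1%:M by rewrite -rM mulgV r1.
  by move/(congr1 determinant); rewrite det_mulmx det1; apply: contra_eq_neq => ->; rewrite mul0r eq_sym oner_eq0.
rewrite tr; apply: (teichmullerE l_pr chl witt_W).
have k1 := finNzRing_gt1 k.
have red1 : red t ^+ #|k|.-1 = 1.
  by apply: (mulfI r0); rewrite -exprS prednK ?(ltnW k1) // expf_card mulr1.
suff c1 : t ^+ #|k|.-1 = 1 by rewrite -(prednK (ltnW k1)) exprS c1 mulr1.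
have [u uE] : divl l 1 (t ^+ #|k|.-1 - 1).
  by apply/(red_eq0 witt_W); rewrite rmorphB rmorphXn red1 rmorph1 subrr.
(* t has finite order because tW factors through [gT]. So t^(q-1), with q the cardinal of [k], is
   torsion and congruent to 1 modulo l; [torsion_free] for matrices of size 1 makes it equal to
   1. *)
have q1 : q 1%g = 1%g by apply: (mulgI (q 1%g)); rewrite -qM !mulg1.
have qX i : q (g ^+ i)%g = (q g ^+ i)%g.
  by elim: i => [|i IH]; rewrite ?expg0 // !expgS qM IH.
have tX i : t ^+ i = \det (unblk (inner m' (tW (g ^+ i)%g))).
  elim: i => [|i IH]; first by rewrite expg0 tW1 inner1 unblk1 det1.
  by rewrite exprS IH /t expgS tWM innerM unblkM det_mulmx.
have t1 : t ^+ #[q g]%g = 1.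
  rewrite tX -[RHS](det1 W (m * n)) -unblk1 -inner1 -tW1; congr (\det (unblk (inner m' _))).
  by apply: tW_q; rewrite qX expg_order q1.
have sX i (x : W) : (x ^+ i)%:M = x%:M ^+ i :> 'M[W]_1 by rewrite rmorphXn.
have := torsion_free l_pr chl witt_W l_gt2 (c := (t ^+ #|k|.-1)%:M : 'M_1) (i := #[q g]%g) (order_gt0 _).
have <- : 1%:M = 1 :> 'M[W]_1 by [].
rewrite -raddfB /= uE -sX -exprM mulnC exprM t1 expr1n => /(_ _ erefl) h.
have /matrixP/(_ 0 0) : (t ^+ #|k|.-1)%:M = 1%:M :> 'M[W]_1.
  by apply: h; exists u%:M; rewrite raddfMn.
by rewrite !mxE.
Qed.

Lemma defo_condition : deformation_condition rhobar defo.
Proof.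
split.
- by move=> A rho [].
- exact: defo_residual.
- exact: defo_reduction.
- move=> A B phi N rhoA rhoB fm Nu dA rB e; apply: (defo_conj Nu e); exact: defo_map.
move=> A B C R alpha beta p1 p2 rho _ _ artC am bm [bs _] m1 m2 fib rhoR; split.
  by move=> dR; split; apply: defo_map.
by move=> [dA dB]; apply: (defo_glue artC am bm bs m1 m2 fib).
Qed.

(** * The tangent space and the invariants of the adjoint representation *)

Local Notation D := (dual_cnl red).
Local Notation Dc := (@dual_const k).

Fact const_morphism : @cnl_morphism _ _ _ K D Dc.
Proof. by split=> // x; rewrite /cnl_max /= => ->. Qed.

Definition off_degree (X : 'M[k]_m) : 'M[k]_m := \matrix_(i, j) (if w i == w j then 0 else X i j).

Fact off_degree_linear : linear off_degree.
Proof. by move=> a u v; apply/matrixP => i j; rewrite !mxE; case: eqP; rewrite ?mulr0 ?addr0. Qed.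
HB.instance Definition _ := GRing.isLinear.Build k 'M[k]_m 'M[k]_m _ off_degree off_degree_linear.

Local Notation Pk := (shift_mx k d).
(** The degree-0 commutant of Pi over [k], which is the space of first-order variations of the
    parameter y ([good_dual], [good_dual_inv]). *)
Definition Zsp : {vspace 'M[k]_m} := (lker (linfun (mulmxr Pk \- mulmx Pk)) :&: lker (linfun off_degree))%VS.

Lemma ZspP (X : 'M[k]_m) : X \in Zsp <-> hgraded w w 0 X /\ X * Pk = Pk * X.
Proof.
rewrite memv_cap !memv_ker !lfunE /= subr_eq0; split=> [/andP[/eqP XP /eqP /matrixP X0]|[Xg XP]].
  by split=> // i j; have := X0 i j; rewrite !mxE addn0; case: eqP => // _ ->; rewrite eqxx.
rewrite -!mulmxE in XP; rewrite XP eqxx; apply/eqP/matrixP => i j; rewrite !mxE.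
by have [//|wij] := eqVneq (w i) (w j); apply/eqP; apply: contraNT wij => /Xg ->; rewrite addn0.
Qed.

Definition Adk : 'End('M[k]_m) := linfun (mulmxr y0 \- mulmx y0).

Lemma AdkE X : Adk X = X * y0 - y0 * X. Proof. by rewrite lfunE. Qed.

Lemma Adk_Z : (Adk @: Zsp <= Zsp)%VS.
Proof.
apply/subvP => _ /memv_imgP[X /ZspP[Xg XP] ->]; rewrite AdkE; have [y1 y2 _] := y0_good.
have gM (A B : 'M[k]_m) : hgraded w w 0 A -> hgraded w w 0 B -> hgraded w w 0 (A * B) by apply: hgradedM.
have gB (A B : 'M[k]_m) : hgraded w w 0 A -> hgraded w w 0 B -> hgraded w w 0 (A - B).
  move=> hA hB i j; rewrite !mxE => h; have [e|/hA//] := eqVneq (A i j) 0.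
  by apply: hB; apply: contraNneq h => ->; rewrite e subr0.
apply/ZspP; split; first by apply: gB; [exact: gM Xg y1 | exact: gM y1 Xg].
have {}y2 : y0 * Pk = Pk * y0 := y2.
by rewrite mulrBl mulrBr -!mulrA XP y2 !mulrA XP y2.
Qed.

(** The infinitesimal part of (y0 + eps X)^N over the dual numbers; it is linear in X. *)
Fixpoint pow_eps N (X : 'M[k]_m) : 'M[k]_m := if N is N'.+1 then y0 * pow_eps N' X + X * y0 ^+ N' else 0.

Lemma pow_epsP N a u v : pow_eps N (a *: u + v) = a *: pow_eps N u + pow_eps N v.
Proof.
elim: N => [|N IH] /=; first by rewrite scaler0 addr0.
by rewrite IH mulrDr mulrDl -scalerAr -scalerAl scalerDr addrACA.
Qed.

Lemma dual_pow X N : (dual_mx y0 X : 'M[D]_m) ^+ N = dual_mx (y0 ^+ N) (pow_eps N X).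
Proof.
elim: N => [|N IH]; first by rewrite !expr0 -[1]/1%:M dual_mx1.
transitivity (dual_mx y0 X *m dual_mx (y0 ^+ N) (pow_eps N X)); first by rewrite exprS IH.
by rewrite dual_mxM exprS.
Qed.

Lemma good_dual X : X \in Zsp -> good (dual_mx y0 X : 'M[D]_m).
Proof.
move=> /ZspP[Xg XP]; have [y1 y2 _] := y0_good; split.
- move=> i j; rewrite mxE => h; have [e|] := eqVneq (y0 i j) 0; last exact: y1.
  by apply: Xg; apply: contraNneq h => ->; rewrite e.
- rewrite -(map_shift (Dc : {rmorphism K -> D})) dual_mx_const -!mulmxE !dual_mxM !mulmx0 !mul0mx !addr0 !add0r.
  by congr dual_mx; [exact: y2 | exact: XP].
exact: dual_mx_res.
Qed.

Lemma good_dual_inv (y : 'M[D]_m) : good y -> exists2 X, X \in Zsp & y = dual_mx y0 X.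
Proof.
move=> [y1 y2 y3]; exists (map_mx snd y); last by rewrite -y3 -dual_mx_eta.
apply/ZspP; split.
  by move=> i j; rewrite mxE => h; apply: y1; apply: contraNneq h => ->.
move: y2; rewrite -(map_shift (Dc : {rmorphism K -> D})) dual_mx_const {1 2}(dual_mx_eta y) -!mulmxE !dual_mxM.
by rewrite !mulmx0 !mul0mx !addr0 !add0r => /dual_mx_inj[].
Qed.

Definition rhoY (X : 'M[k]_m) g : 'M[D]_(m * n) :=
  unblk ((bmap (Dc : {rmorphism K -> D}) P0) * Rp (dual_mx y0 X : 'M[D]_m) g * (bmap (Dc : {rmorphism K -> D}) Q0)).

Local Notation Pd := (bmap (Dc : {rmorphism K -> D}) P0).
Local Notation Qd := (bmap (Dc : {rmorphism K -> D}) Q0).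

Lemma PQd : Pd * Qd = 1 /\ Qd * Pd = 1.
Proof. by rewrite -!bmapM PQ0 QP0 bmap1. Qed.

Lemma rhoY_defo X : X \in Zsp -> @defo D (rhoY X).
Proof. by move=> XZ; have [h1 h2] := PQd; exact: defo_unblk h1 h2 (good_dual XZ). Qed.

Lemma unblk_bmap_const (Z : 'M['M[K]_n]_m) : unblk (bmap (Dc : {rmorphism K -> D}) Z) = dual_mx (unblk Z) 0.
Proof. by rewrite -dual_mx_const; apply: (can_inj (@blkK _ _ _)); rewrite unblkK (@blk_map K D) unblkK. Qed.

Lemma unblk_outer_dual (A B : 'M[k]_m) :
  unblk (outer n' (dual_mx A B)) = dual_mx (unblk (outer n' A)) (unblk (outer n' B)).
Proof.
apply/matrixP => x y; case: (mxtens_indexP x) => i a; case: (mxtens_indexP y) => j c.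
by rewrite [RHS]mxE !unblkE !mxE; case: (a == c); rewrite ?mulr1n ?mulr0n.
Qed.

(** The cocycle through which [rhoY X] is a first-order deformation of rhobar ([rhoY_first]). *)
Definition cfun X : G -> 'M[k]_(m * n) := fun g => map_mx snd (rhoY X g) *m rhobar g^-1%g.

Lemma rhobarV g : rhobar g *m rhobar g^-1%g = 1%:M /\ rhobar g^-1%g *m rhobar g = 1%:M.
Proof. by have [r1 rM] := rhobar_rep; rewrite -!rM mulgV mulVg r1. Qed.

Lemma rhoY_first X : X \in Zsp -> rhoY X = first_order rhobar (cfun X).
Proof.
move=> XZ; apply/funext => g; rewrite first_orderE [LHS]dual_mx_eta /cfun -mulmxA; have [_ ->] := rhobarV g.
rewrite mulmx1; congr dual_mx; apply: (can_inj (@blkK _ _ _)).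
have rc (Z : 'M['M[K]_n]_m) : @bmap D K (cnl_res D) (bmap (Dc : {rmorphism K -> D}) Z) = Z.
  by apply/matrixP => i j; apply/matrixP => a c; rewrite !mxE.
have dr : map_mx (cnl_res D) (dual_mx y0 X : 'M[D]_m) = y0 := dual_mx_res y0 X.
have h : model_of (rhoY X) Pd Qd (dual_mx y0 X : 'M[D]_m).
  have [h1 h2] := PQd; split; [exact: h1 | exact: h2 | exact: good_dual | move=> x; exact: unblkK].
have [_ _ _ /(_ g)] := model_map (@res_cnl_morphism D) h; rewrite !rc dr rhobarE; exact.
Qed.

(** Over the dual numbers the Z_l-power is an ordinary power whose exponent is independent of X, so
    the infinitesimal part of rhoY depends on X only through [pow_eps]. *)
Lemma rhoY_snd g : exists N (S : 'M['M[K]_n]_m), forall X, X \in Zsp ->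
  map_mx snd (rhoY X g) = unblk (P0 * (outer n' (pow_eps N X) * S) * Q0).
Proof.
have [Nn NP] := artinian_nilpotent (artinian_finite (mem_enum {: dual_number k}) : artinian D).
exists (kap g (Nn + M)%N), (Tg K g) => X XZ; have gX := good_dual XZ.
have pE : pw M (dual_mx y0 X : 'M[D]_m) (kap g) = dual_mx y0 X ^+ kap g (Nn + M)%N.
  apply/eqP; rewrite -subr_eq0; apply/eqP/matrixP => i j; rewrite [RHS]mxE; apply: NP.
  exact: (pwP chl (kap g) Nn (good_unipotent gX)).
rewrite /rhoY RpE pE dual_pow -(map_Tg const_morphism); move: (Tg K g) => S.
rewrite !unblkM !unblk_bmap_const unblk_outer_dual !dual_mxM dual_mx_snd.
by rewrite !mulmx0 !mul0mx !addr0 !add0r !mulmxA.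
Qed.

Lemma cfunP a X Y : X \in Zsp -> Y \in Zsp -> cfun (a *: X + Y) = a *: cfun X + cfun Y.
Proof.
move=> XZ YZ; apply/funext => g; rewrite /cfun; have [N [S h]] := rhoY_snd g.
have XYZ : a *: X + Y \in Zsp by apply: rpredD => //; apply: rpredZ.
have -> : (a *: cfun X + cfun Y) g = a *: cfun X g + cfun Y g by [].
have cE Z : Z \in Zsp -> cfun Z g = unblk (P0 * (outer n' (pow_eps N Z) * S) * Q0) *m rhobar g^-1%g.
  by move=> ZZ; exact: (congr1 (mulmx^~ _) (h _ ZZ)).
etransitivity; first exact: cE XYZ.
etransitivity; last exact: (congr2 (fun u v => a *: u + v) (esym (cE _ XZ)) (esym (cE _ YZ))).
rewrite pow_epsP scalemxAl -mulmxDl; congr (mulmx _ _).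
rewrite !unblkM; have -> (u v : 'M[k]_m) : unblk (outer n' (a *: u + v)) = a *: unblk (outer n' u) + unblk (outer n' v).
  apply/matrixP => x y; case: (mxtens_indexP x) => i b1; case: (mxtens_indexP y) => j b2.
  by rewrite [RHS]mxE [X in _ = X + _]mxE !unblkE !mxE mulrnDl mulrnAr.
by rewrite mulmxDl mulmxDr mulmxDl -!scalemxAl -scalemxAr -scalemxAl.
Qed.

Lemma cfun_cocycle X : X \in Zsp -> cfun X \in cocycle_pred rhobar.
Proof.
move=> XZ; apply/asboolP; apply: (first_order_cocycle (red := red)) => //; rewrite -rhoY_first //.
by have [] := rhoY_defo XZ.
Qed.

Definition cclass X : H1_ad rhobar := (\pi_(H1_ad rhobar) (insubd (0 : cocycle rhobar) (cfun X)))%qT.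

Lemma pi_eq0 (c : cocycle rhobar) : (\pi_(H1_ad rhobar) c)%qT = 0 <-> exists N, forall g, c g = ad_action rhobar g N - N.
Proof.
have h0 := lquot_pi_eq0 (@coboundary_pred _ _ _ _ _ rhobar) c.
by split=> [/h0/asboolP|h] //; apply/h0/asboolP.
Qed.

Lemma val_cfun X : X \in Zsp -> val (insubd (0 : cocycle rhobar) (cfun X)) = cfun X.
Proof. by move=> XZ; exact: (insubdK _ (cfun_cocycle XZ)). Qed.

Lemma cclassP a X Y : X \in Zsp -> Y \in Zsp -> cclass (a *: X + Y) = a *: cclass X + cclass Y.
Proof.
move=> XZ YZ; have XYZ : a *: X + Y \in Zsp by apply: rpredD => //; apply: rpredZ.
etransitivity; last exact: lquot_piP.
rewrite /cclass; congr (\pi_(_) _)%qT; apply: val_inj.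
etransitivity; first exact: val_cfun XYZ.
etransitivity; first exact: cfunP.
exact: (congr2 (fun u v => a *: u + v) (esym (val_cfun XZ)) (esym (val_cfun YZ))).
Qed.

Lemma cclass_eq0 X : X \in Zsp -> cclass X = 0 <-> exists N, forall g, cfun X g = ad_action rhobar g N - N.
Proof.
move=> XZ; have e := val_cfun XZ; rewrite /cclass pi_eq0; split=> -[N NE]; exists N => g.
  exact: (etrans (esym (congr1 (@^~ g) e)) (NE g)).
exact: (etrans (congr1 (@^~ g) e) (NE g)).
Qed.

Lemma rhoYE X g : X \in Zsp -> rhoY X g = dual_mx (rhobar g) (cfun X g *m rhobar g).
Proof. by move=> XZ; exact: (etrans (congr1 (@^~ g) (rhoY_first XZ)) (first_orderE _ _ _)). Qed.

Lemma bmap_res_const (Z : 'M['M[K]_n]_m) : @bmap D K (cnl_res D) (bmap (Dc : {rmorphism K -> D}) Z) = Z.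
Proof. by apply/matrixP => i j; apply/matrixP => a c; rewrite !mxE. Qed.

Lemma constE g : blk (map_mx Dc (rhobar g) : 'M[D]_(m * n)) = Pd * Rp (map_mx Dc y0 : 'M[D]_m) g * Qd.
Proof.
etransitivity; first exact: (@blk_map K D Dc (rhobar g)).
apply: (etrans (congr1 (@bmap K D Dc) (rhobarE g))).
apply: (etrans (@bmapM K D Dc (P0 * Rp (y0 : 'M[K]_m) g) Q0)); congr (_ * _).
apply: (etrans (@bmapM K D Dc P0 (Rp (y0 : 'M[K]_m) g))); congr (_ * _).
exact: (map_Rp const_morphism _ y0_good).
Qed.

Lemma coboundary_of N c : (forall g, N *m rhobar g = rhobar g *m N + c g *m rhobar g) ->
  forall g, c g = ad_action rhobar g (- N) - (- N).
Proof.
move=> h g; have [e _] := rhobarV g; have := congr1 (mulmx^~ (rhobar g^-1%g)) (h g).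
rewrite mulmxDl -!mulmxA e !mulmx1 mulmxA => e2.
have -> : c g = N - rhobar g *m N *m rhobar g^-1%g by apply/eqP; rewrite eq_sym subr_eq addrC -e2.
by rewrite /ad_action mulmxN mulNmx opprK addrC.
Qed.

Lemma conj_transfer' (R : pzRingType) (p q' r r' v : R) : q' * p = 1 ->
  p * r' * q' * v = v * (p * r * q') -> q' * v * p * r = r' * (q' * v * p).
Proof.
move=> qp e; have := congr1 (fun x => q' * x * p) e.
by rewrite !mulrA qp mul1r -(mulrA _ q' p) qp mulr1 => ->.
Qed.

Lemma conj_push (R : pzRingType) (p q' o r r' : R) : q' * p = 1 -> o * r = r' * o ->
  (p * o * q') * (p * r * q') = (p * r' * q') * (p * o * q').
Proof. by move=> qp e; rewrite -!mulrA !(mulrA q' p) qp !mul1r (mulrA o) e -mulrA. Qed.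

Lemma dual_Z (Y : 'M[D]_m) : hgraded w w 0 Y -> Y * shift_mx D d = shift_mx D d * Y -> map_mx snd Y \in Zsp.
Proof.
move=> y1; rewrite -(map_shift (Dc : {rmorphism K -> D})) dual_mx_const {1 2}(dual_mx_eta Y) -!mulmxE !dual_mxM.
rewrite !mulmx0 !mul0mx !addr0 !add0r => /dual_mx_inj[_ y2]; apply/ZspP; split=> //.
by move=> i j; rewrite mxE => h; apply: y1; apply: contraNneq h => ->.
Qed.

(** If the class is trivial, a matrix congruent to 1 intertwines the constant deformation with
    [rhoY X]. By [intertwiner] it comes from some 1 + eps Y with Y in Z, and comparing the
    parameters gives X = [Y, y0]. *)
Lemma kernel_of_cclass X : X \in Zsp -> cclass X = 0 -> X \in (Adk @: Zsp)%VS.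
Proof.
move=> XZ /(cclass_eq0 XZ)[N cN].
have artD : artinian D := artinian_finite (mem_enum {: dual_number k}).
have [PQ QP] := PQd; have gX := good_dual XZ; have g0 := good_map const_morphism y0_good.
pose V : 'M[D]_(m * n) := dual_mx 1%:M (- N).
have rel g : rhoY X g *m V = V *m map_mx Dc (rhobar g).
  rewrite rhoYE // dual_mx_const /V !dual_mxM cN /ad_action mulmxBl -!mulmxA.
  have [_ ->] := rhobarV g; rewrite !mulmx1 !mulmx0 !mul1mx add0r; congr dual_mx.
  by rewrite mulmxN addrA addNr add0r mulNmx.
have [Y [YU Yg YP Yy]] : exists Y, [/\ Qd * blk V * Pd = outer n' Y, hgraded w w 0 Y,
    Y * shift_mx D d = shift_mx D d * Y & Y * map_mx Dc y0 = dual_mx y0 X * Y].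
  apply: (intertwiner artD g0 gX) => g; apply: (conj_transfer' QP).
  transitivity (blk (rhoY X g) * blk V); first by congr (_ * _); symmetry; exact: unblkK.
  by rewrite -blkM rel blkM; congr (_ * _); exact: constE.
have Y0 : map_mx (@dual_res k) Y = 1.
  apply: (@outer_inj k m' n'); rewrite outer1.
  have <- : @bmap D K (cnl_res D) (outer n' Y) = outer n' (map_mx (@dual_res k) Y) by apply: (@bmap_outer D K).
  have bV : @bmap D K (cnl_res D) (blk V) = 1.
    by rewrite -blk_map -blk1; congr blk; exact: dual_mx_res.
  by rewrite -YU !bmapM !bmap_res_const bV mulr1 QP0.
have YZ := dual_Z Yg YP.
have -> : X = Adk (map_mx snd Y).
  have := Yy; rewrite dual_mx_const {1 2}(dual_mx_eta Y) Y0 -!mulmxE !dual_mxM => /dual_mx_inj[_].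
  have m1 : X *m (1 : 'M_m) = X := mulmx1 X.
  by rewrite mulmx0 add0r m1 AdkE -!mulmxE => ->; rewrite addrAC subrr add0r.
exact: memv_img.
Qed.

(** Conversely, for X = [Y, y0], conjugation by 1 + eps Y carries the constant deformation to
    [rhoY X]. *)
Lemma cclass_kernel X : X \in (Adk @: Zsp)%VS -> cclass X = 0.
Proof.
move=> XA; have XZ : X \in Zsp := subvP Adk_Z _ XA.
have /memv_imgP[Y YZ XE] := XA; have [Yg YP] := iffLR (ZspP Y) YZ.
have [PQ QP] := PQd; have gX := good_dual XZ; have g0 := good_map const_morphism y0_good.
pose B : 'M[D]_m := dual_mx 1%:M Y.
have Bg : hgraded w w 0 B.
  move=> i j; rewrite !mxE => h; have [->|ij] := eqVneq i j; first by rewrite addn0.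
  by apply: Yg; apply: contraNneq h => ->; rewrite (negPf ij).
have BP : B * shift_mx D d = shift_mx D d * B.
  rewrite -(map_shift (Dc : {rmorphism K -> D})) dual_mx_const -!mulmxE !dual_mxM !mulmx0 !mul0mx !addr0 !add0r mulmx1 mul1mx.
  by congr dual_mx; exact: YP.
have By : B * map_mx Dc y0 = dual_mx y0 X * B.
  rewrite dual_mx_const -!mulmxE !dual_mxM !mulmx0 mul1mx !mulmx1 add0r XE AdkE; congr dual_mx.
  by rewrite addrC subrK.
pose N := unblk P0 *m unblk (outer n' Y) *m unblk Q0.
have VE : unblk (Pd * outer n' B * Qd) = dual_mx 1%:M N.
  rewrite !unblkM !unblk_bmap_const unblk_outer_dual !dual_mxM; congr dual_mx.
    by rewrite -[1%:M]/1 outer1 unblk1 mulmx1 -unblkM PQ0 unblk1.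
  by rewrite !mulmx0 !mul0mx !addr0 add0r.
apply/(cclass_eq0 XZ); exists (- N); apply: coboundary_of => g.
have := Rp_conj g g0 gX Bg BP By => e.
have : unblk (Pd * outer n' B * Qd) *m map_mx Dc (rhobar g) = rhoY X g *m unblk (Pd * outer n' B * Qd).
  have e1 := unblkK (Pd * outer n' B * Qd); have e2 := constE g.
  have e3 : blk (rhoY X g) = Pd * Rp (dual_mx y0 X : 'M[D]_m) g * Qd := unblkK _.
  apply: (can_inj (@blkK _ _ _)); apply: (etrans (blkM _ _)); apply: etrans (esym (blkM _ _)).
  exact: (etrans (congr2 *%R e1 e2) (etrans (conj_push QP e) (esym (congr2 *%R e3 e1)))).
rewrite VE rhoYE // dual_mx_const !dual_mxM => /dual_mx_inj[_].
by rewrite mulmx0 add0r mulmx1.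
Qed.

Lemma conj_cancel (R : pzRingType) (p q' p0 q0 r : R) : q' * p = 1 -> q0 * p0 = 1 ->
  p * r * q' * (p * q0) = p * q0 * (p0 * r * q0).
Proof. by move=> h h0; rewrite -!mulrA (mulrA q') h mul1r (mulrA q0 p0) h0 mul1r. Qed.

                                                                            
(** The residue of an arbitrary model differs from (P0, Q0, y0) by an automorphism, whose constant
    lift corrects the model so that P reduces to P0. The remaining discrepancy is congruent to 1 and
    changes the cocycle by a coboundary. *)
Lemma tangent_class (c : cocycle rhobar) : @defo D (first_order rhobar c) ->
  exists2 X, X \in Zsp & (\pi_(H1_ad rhobar) c)%qT = cclass X.
Proof.
move=> [_ [P [Q [y h]]]]; have [_ _ [_ _ yr] _] := h.
have artK : artinian K := artinian_finite (mem_enum k).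
have [PQr QPr _ Er] := model_map (@res_cnl_morphism D) h; rewrite yr in Er.
set rP := bmap _ P in PQr QPr Er; set rQ := bmap _ Q in PQr QPr Er.
have EE g : P0 * Rp (y0 : 'M[K]_m) g * Q0 = rP * Rp (y0 : 'M[K]_m) g * rQ.
  rewrite -rhobarE; apply: etrans (Er g); congr blk; symmetry.
  by rewrite first_orderE; exact: dual_mx_res.
have [X [UX Xg XP Xy]] := intertwiner artK y0_good y0_good (fun g => conj_transfer QPr QP0 (esym (EE g))).
have [X' [UX' Xg' XP' Xy']] := intertwiner artK y0_good y0_good (fun g => conj_transfer QP0 QPr (EE g)).
have XX' : X * X' = 1.
  by apply: (@outer_inj _ _ n'); rewrite outerM outer1 -UX -UX' mulrA -(mulrA Q0) PQr mulr1 QP0.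
have X'X : X' * X = 1.
  by apply: (@outer_inj _ _ n'); rewrite outerM outer1 -UX -UX' mulrA -(mulrA rQ) PQ0 mulr1 QPr.
pose Xc : 'M[D]_m := map_mx Dc X'.
have Xcu : Xc \is a GRing.unit.
  apply/unitrP; exists (map_mx Dc X); rewrite /Xc -!mulmxE -!map_mxM !mulmxE XX' X'X; split; exact: map_mx1.
have Xcg : hgraded w w 0 Xc by move=> i j; rewrite mxE => nz; apply: Xg'; apply: contraNneq nz => ->.
have XcP : Xc * shift_mx D d = shift_mx D d * Xc.
  rewrite -(map_shift (Dc : {rmorphism K -> D})) -!mulmxE -!map_mxM; congr map_mx; exact: XP'.
have Xcr : map_mx (cnl_res D) Xc = X' by apply/matrixP => i j; rewrite !mxE.
have Xcy : map_mx (cnl_res D) Xc * y0 = y0 * map_mx (cnl_res D) Xc by rewrite Xcr; exact: Xy'.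
have [PQ' QP' gy' E'] := model_conj h Xcu Xcg XcP Xcy.
have Pr : @bmap D K (cnl_res D) (P * outer n' Xc) = P0.
  apply: (etrans (@bmapM D K (cnl_res D) P _)); rewrite (@bmap_outer D K (cnl_res D) Xc) Xcr -UX' mulrA.
  by rewrite -/rP PQr mul1r.
move: (P * outer n' Xc) (outer n' Xc^-1 * Q) (Xc^-1 * y * Xc) PQ' QP' gy' E' Pr => P' Q' y' PQ' QP' gy' E' Pr.
have [X1 X1Z yE] := good_dual_inv gy'; rewrite {}yE in E'; exists X1 => //.
have [PQ QP] := PQd.
have [N VE] : exists N, unblk (P' * Qd) = dual_mx 1%:M N.
  exists (map_mx snd (unblk (P' * Qd))); rewrite {1}[unblk _]dual_mx_eta; congr dual_mx.
  apply: (can_inj (@blkK _ _ _)); rewrite blk1; apply: (etrans (@blk_map D K (cnl_res D) _)).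
  by rewrite unblkK bmapM Pr bmap_res_const PQ0.
have rel g : first_order rhobar c g *m unblk (P' * Qd) = unblk (P' * Qd) *m rhoY X1 g.
  have e1 := unblkK (P' * Qd); have e2 := E' g.
  have e3 : blk (rhoY X1 g) = Pd * Rp (dual_mx y0 X1 : 'M[D]_m) g * Qd := unblkK _.
  apply: (can_inj (@blkK _ _ _)); apply: (etrans (blkM _ _)); apply: etrans (esym (blkM _ _)).
  apply: (etrans (congr2 *%R e2 e1)); apply: etrans (esym (congr2 *%R e1 e3)).
  exact: conj_cancel QP' QP.
have cN g : N *m rhobar g = rhobar g *m N + (c g - cfun X1 g) *m rhobar g.
  have := rel g; rewrite VE rhoYE // first_orderE !dual_mxM => /dual_mx_inj[_].
  by rewrite mulmx1 mul1mx mulmxBl addrA => ->; rewrite addrAC subrr add0r.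
have z : (\pi_(H1_ad rhobar) (- 1 *: insubd (0 : cocycle rhobar) (cfun X1) + c))%qT = 0.
  apply/pi_eq0; exists (- N) => g; rewrite -(coboundary_of (c := fun g => c g - cfun X1 g) cN).
  have e : (- 1 *: insubd (0 : cocycle rhobar) (cfun X1) + c) g = - 1 *: val (insubd (0 : cocycle rhobar) (cfun X1)) g + c g by [].
  by rewrite e val_cfun // scaleN1r addrC.
have := lquot_piP (@coboundary_pred _ _ _ _ _ rhobar) (- 1) (insubd (0 : cocycle rhobar) (cfun X1)) c.
by rewrite [LHS]z scaleN1r addrC => /esym/eqP; rewrite subr_eq0 => /eqP.
Qed.

(** The tangent space is Z modulo [Z, y0], represented by a complement; by rank and nullity on Z its
    dimension is that of the kernel of ad(y0). *)
Lemma tangent_dim : has_dim (tangent_space rhobar defo) (\dim (Zsp :&: lker Adk)%VS).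
Proof.
have -> : \dim (Zsp :&: lker Adk)%VS = \dim (Zsp :\: (Adk @: Zsp))%VS.
  have h1 := limg_ker_dim Adk Zsp; have h2 := dimv_cap_compl Zsp (Adk @: Zsp)%VS.
  have /capv_idPr h3 := Adk_Z; rewrite h3 addnC in h2.
  by apply: (@addIn (\dim (Adk @: Zsp)%VS)); rewrite h1 h2.
have sub : (Zsp :\: (Adk @: Zsp) <= Zsp)%VS := diffvSl _ _.
apply: (has_dim_image (L := cclass)) => [a u v uU vU|u uU u0|xi].
- by apply: cclassP; apply: (subvP sub).
- have uZ := subvP sub _ uU; have := kernel_of_cclass uZ u0 => uA.
  have : u \in ((Zsp :\: (Adk @: Zsp)) :&: (Adk @: Zsp))%VS by rewrite memv_cap uU uA.
  by rewrite capv_diff memv0 => /eqP.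
split=> [[c [-> /tangent_class[X XZ ->]]]|[X XU ->]].
  have := addv_diff Zsp (Adk @: Zsp)%VS; have /addv_idPl -> := Adk_Z => e.
  have : X \in (Zsp :\: (Adk @: Zsp) + (Adk @: Zsp))%VS by rewrite e.
  move=> /memv_addP[u uU [v vA XE]]; exists u; first exact: uU.
  have uZ := subvP sub _ uU; have vZ := subvP Adk_Z _ vA.
  have e1 : cclass (u + v) = cclass u + cclass v.
    by have := cclassP 1 uZ vZ; rewrite !scale1r => h; exact: h.
  exact: (etrans (congr1 cclass XE) (etrans e1 (etrans (congr1 (+%R (cclass u)) (cclass_kernel vA)) (addr0 _)))).
have XZ := subvP sub _ XU; exists (insubd (0 : cocycle rhobar) (cfun X)); split; first by [].
have e : first_order rhobar (insubd (0 : cocycle rhobar) (cfun X)) = rhoY X.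
  exact: (etrans (congr1 (first_order rhobar) (val_cfun XZ)) (esym (rhoY_first XZ))).
exact: (eq_ind_r (fun r => @defo D r) (rhoY_defo XZ) e).
Qed.

(** An invariant of the adjoint action is a self-intertwiner of R_y0 over [k], so [intertwiner]
    identifies it with an element of Z commuting with y0. *)
Lemma H0_dim : has_dim (H0_ad rhobar) (\dim (Zsp :&: lker Adk)%VS).
Proof.
pose L (X : 'M[k]_m) : 'M[k]_(m * n) := unblk P0 *m unblk (outer n' X) *m unblk Q0.
have artK : artinian K := artinian_finite (mem_enum k).
have kerP X : X \in (Zsp :&: lker Adk)%VS <-> X \in Zsp /\ X * y0 = y0 * X.
  rewrite memv_cap memv_ker AdkE subr_eq0; split=> [/andP[-> /eqP]|[-> ->]] //; by rewrite eqxx.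
apply: (has_dim_image (L := L)) => [a u v _ _|u _|B].
- rewrite /L; have -> : unblk (outer n' (a *: u + v)) = a *: unblk (outer n' u) + unblk (outer n' v).
    apply/matrixP => x y; case: (mxtens_indexP x) => i b1; case: (mxtens_indexP y) => j b2.
    by rewrite [RHS]mxE [X in _ = X + _]mxE !unblkE !mxE mulrnDl mulrnAr.
  by rewrite mulmxDr mulmxDl -scalemxAr -scalemxAl.
- rewrite /L -!unblkM => u0; apply: (@outer_inj k m' n').
  have : Q0 * blk (unblk (P0 * outer n' u * Q0)) * P0 = 0.
    rewrite u0; have -> : blk (0 : 'M[k]_(m * n)) = 0 by apply/matrixP => i j; apply/matrixP => x y; rewrite !mxE.
    by rewrite mulr0 mul0r.
  rewrite unblkK !mulrA QP0 mul1r -mulrA QP0 mulr1 => ->.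
  by apply/matrixP => i j; rewrite !mxE raddf0.
split=> [BH|[X /kerP[XZ Xy] ->] g].
  have rel g : (Q0 * blk B * P0) * Rp (y0 : 'M[K]_m) g = Rp (y0 : 'M[K]_m) g * (Q0 * blk B * P0).
    apply: (conj_transfer' QP0); rewrite -rhobarE -!blkM; congr blk.
    have [_ e] := rhobarV g; have := BH g; rewrite /ad_action => eB.
    by rewrite -[in RHS]eB -!mulmxA e mulmx1.
  have [X [UX Xg XP Xy]] := intertwiner artK y0_good y0_good rel.
  exists X; first by apply/kerP; split=> //; apply/ZspP.
  apply: (can_inj (@blkK _ _ _)); rewrite /L -!unblkM unblkK -UX !mulrA PQ0 mul1r -mulrA PQ0 mulr1.
  done.
have [Xg XP] := iffLR (ZspP X) XZ.
have e := Rp_conj g y0_good y0_good Xg XP Xy.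
rewrite /ad_action; have [r1 _] := rhobarV g.
suff -> : rhobar g *m L X = L X *m rhobar g by rewrite -mulmxA r1 mulmx1.
apply: (can_inj (@blkK _ _ _)); rewrite /L -!unblkM.
have e1 := unblkK (P0 * outer n' X * Q0); have e2 := rhobarE g.
apply: (etrans (blkM _ _)); apply: etrans (esym (blkM _ _)).
exact: (etrans (congr2 *%R e2 e1) (etrans (esym (conj_push QP0 e)) (esym (congr2 *%R e1 e2)))).
Qed.

Lemma defo_conclusion : [/\ deformation_condition rhobar defo,
    forall (A : cnl red) (rho : G -> 'M[A]_(m * n)), defo rho -> forall g, inert g ->
      \det (rho g) = cnl_alg A (teichmuller red (\det (rhobar g))),
    smooth defo
  & exists h, has_dim (tangent_space rhobar defo) h /\ has_dim (H0_ad rhobar) h].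
Proof.
split; [exact: defo_condition | by move=> A rho; apply: defo_det | exact: defo_smooth |].
by exists (\dim (Zsp :&: lker Adk)%VS); split; [exact: tangent_dim | exact: H0_dim].
Qed.

End Model.

(** * Assembly: choice of sigma, of the levels and of the finite quotient *)

Lemma character_generator (G : groupType) (k : finFieldType) (chi : G -> k) :
  (forall g h, chi (g * h)%g = chi g * chi h) -> chi 1%g = 1 ->
  exists sigma, forall g, exists i, chi g = chi sigma ^+ i.
Proof.
move=> chiM chi1.
have chiV g : chi g \is a GRing.unit.
  by apply/unitrP; exists (chi g^-1%g); rewrite -!chiM mulgV mulVg chi1.
pose u g : {unit k} := FinRing.unit k (chiV g).
pose H := [set x : {unit k} | `[< exists g, u g = x >]]%SET.
have inH x : (x \in H) = `[< exists g, u g = x >] by rewrite inE.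
have gH : group_set H.
  apply/group_setP; split; first by rewrite inH; apply/asboolP; exists 1%g; apply: val_inj.
  move=> x y xH yH; rewrite inH; apply/asboolP; move: xH yH; rewrite !inH => /asboolP xg /asboolP yh.
  by case: xg => g <-; case: yh => h <-; exists (g * h)%g; apply: val_inj; rewrite /= chiM.
have /cyclicP[x xE] := field_unit_group_cyclic (Group gH).
have : x \in H by rewrite -[H]/(gval (Group gH)) xE cycle_id.
rewrite inH => /asboolP[sigma sE]; exists sigma => g.
have : u g \in <[x]>%g by rewrite -xE inH; apply/asboolP; exists g.
by move=> /cycleP[i e]; exists i; have := congr1 val e; rewrite -sE FinRing.val_unitX.
Qed.

                                                                                              
(** chi(h) = 1 gives eps(h)^(l^N) = 1 modulo l^N; together with eps(h)^(l-1) = 1, and since l^N is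
    congruent to 1 modulo l - 1, this gives eps(h) = 1 at that level. *)
Lemma GP_GN (F E : fieldType) (iota : F -> E) l (l_pr : prime l) sigma inert
    (T : @tame_parameters F E iota l l_pr sigma inert) (k : finFieldType) (chl : l \in [pchar k]) N h :
  in_GP T N h -> chi T k h = 1 -> in_GN T N h.
Proof.
move=> [h1 h2] /(chi_eq1 chl) e1; split=> //; rewrite /in_GE.
have l1 : (0 < l.-1)%N by have := prime_gt1 l_pr; case: (l) => [|[]].
have : (l ^ N = 1 %[mod l.-1])%N.
  rewrite -{1}(prednK (prime_gt0 l_pr)) -addn1 -modnXm -modnDml modnn add0n modnXm exp1n //.
move/eqP; rewrite eqn_mod_dvd ?expn_gt0 ?prime_gt0 // => /dvdnP[c cE].
have {}cE : (l ^ N = l.-1 * c + 1)%N.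
  by rewrite mulnC -cE subnK // expn_gt0 prime_gt0.
have e2 : (tp_eps T h ^+ (l ^ N)) N = (1 : padic_int l_pr) N.
  apply: (@padic_congr_le _ _ _ _ _ N.+1) => //; rewrite -[tp_eps T h]expr1; apply: eps_pow_l.
  by rewrite expr1.
rewrite -e2 cE exprD expr1 exprM (padic_congrM (padic_congrX c h1) (erefl _)).
by rewrite expr1n mul1r.
Qed.

Lemma model_exists (F E : fieldType) (iota : F -> E) l (l_pr : prime l) (l_gt2 : (2 < l)%N)
    sigma inert (T : @tame_parameters F E iota l l_pr sigma inert)
    (k : finFieldType) (chl : l \in [pchar k]) m' n' (W : comNzRingType) (red : {rmorphism W -> k})
    (witt_W : is_witt_ring l red) (theta : abs_gal iota -> 'M[k]_n'.+1) (theta_rep : is_rep theta)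
    (theta_cont : discrete_continuous theta) (theta_irr : absolutely_irreducible theta)
    (l_ndvd_n : ~~ (l %| n'.+1)%N)
    (chi_gen : forall g, exists i, chi T k g = chi T k sigma ^+ i)
    s (s_gt0 : (0 < s)%N) (X : 'M[k]_n'.+1) (X_unit : X \is a GRing.unit)
    (X_int : intertwines theta (chi T k) s X)
    (s_min : forall a z, (0 < a)%N -> z \is a GRing.unit -> intertwines theta (chi T k) a z -> (s <= a)%N)
    (m_s : (m'.+1 + 2 <= s)%N) (rhobar : abs_gal iota -> 'M[k]_(m'.+1 * n'.+1))
    (rhobar_rep : is_rep rhobar) (rhobar_cont : discrete_continuous rhobar) (a : 'I_m'.+1 -> int)
    (rhobar_ss : is_semisimplification rhobar
       (rep_sum (fun (i : 'I_m'.+1) g => chi T k g ^ (a i) *: theta g))) :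
  exists D : rep_class iota red (m'.+1 * n'.+1),
    [/\ deformation_condition rhobar D,
        forall (A : cnl red) (rho : abs_gal iota -> 'M[A]_(m'.+1 * n'.+1)), D A rho ->
          forall g, inert g -> \det (rho g) = cnl_alg A (teichmuller red (\det (rhobar g))),
        smooth D
      & exists h : nat, has_dim (tangent_space rhobar D) h /\ has_dim (H0_ad rhobar) h].
Proof.
have chiM := chiM' T chl.
have l1_gt0 : (0 < l.-1)%N by have := prime_gt1 l_pr; case: (l) => [|[]].
have [s' s'_prim s'_dvd] := prim_order_exists l1_gt0 (chi_l1 T chl sigma).
have [f f_prim f_dvd] : {f | f.-primitive_root (chi T k sigma ^+ s) & (f %| l.-1)%N}.
  by apply: prim_order_exists => //; rewrite exprAC chi_l1 ?expr1n.
have l_ndvd j : (j %| l.-1)%N -> ~~ (l %| j)%N.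
  move=> jd; have := dvdn_leq l1_gt0 jd; have [j0|j0] := posnP j; last first.
    by move=> jl; rewrite gtnNdvd //; move: jl l1_gt0; clear; lia.
  by move: jd l1_gt0; rewrite j0 dvd0n; clear; lia.
have l_ndvd_s' := l_ndvd _ s'_dvd; have l_ndvd_f := l_ndvd _ f_dvd.
have s_dvd := s_dvd_s' chi_gen s_gt0 X_unit X_int s_min f_prim s'_prim.
have m_le : (m'.+1 <= l)%N.
  have h1 := dvdn_leq (prim_order_gt0 s'_prim) s_dvd; have h2 := dvdn_leq l1_gt0 s'_dvd.
  by move: h1 h2 m_s; clear; lia.
have [gT [q [N1 [qM qE [r0 qc] tors]]]] := joint_quotient T chl theta_rep theta_cont rhobar_rep rhobar_cont.
pose N0 := maxn N1 1; have N00 : (0 < N0)%N by rewrite /N0 leq_max orbT.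
have torsP N g : (N0 <= N)%N -> in_GP T N g -> exists j, ~~ (l %| j)%N /\ q (g ^+ j)%g = 1%g.
  by move=> hN; apply: tors; apply: leq_trans hN; exact: leq_maxl.
have torsN g : in_GN T N0 g -> exists j, ~~ (l %| j)%N /\ q (g ^+ j)%g = 1%g.
  by move=> /GN_GP; apply: torsP.
have [e eP] := averaging_seq l_pr qM (GP_subgroup T N0) (torsP N0 ^~ (leqnn N0)).
have [eN eNP] := averaging_seq l_pr qM (GN_subgroup T N0) torsN.
have theta_q g h : q g = q h -> theta g = theta h by case/qE.
have chi_q g h : q g = q h -> chi T k g = chi T k h by case/qE.
have [GP1 GPM GPV] := GP_subgroup T N0.
have eP' := eP; have [eS el eF] := eP'.
have witt_U : @is_witt_ring l k (unitized W) red := witt_W.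
have [phi [phi_red phi_q phiM]] := lift_l'group l_pr chl witt_U qM theta_rep theta_q (GP_subgroup T N0) eS el eF.
have GNn := @GN_normal _ _ _ _ _ _ _ T N0.
have GNc : forall h, in_GN T N0 h -> chi T k h = 1 by move=> h; apply: GN_chi.
have [Xw [Xw_red Xw_int]] := X_lift l_pr chl witt_U qM theta_rep chiM chi_q (GP_subgroup T N0)
  (GN_subgroup T N0) GNc eP X_int phi_red phi_q phiM.
have [sgS sg_chi] := sigma_pow_GP T chl N0; set sg := (sigma ^+ _)%g in sgS sg_chi.
have sg_gen g : exists i, chi T k g = chi T k sg ^+ i by rewrite sg_chi; apply: chi_gen.
have f_prim' : f.-primitive_root (chi T k sg ^+ s) by rewrite sg_chi.
have [la la0 Xf] := Xf_scalar theta_irr chi_gen X_unit X_int f_prim.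
have trXk := trX theta_rep X_int f_prim.
have cX z : (forall h, in_GN T N0 h -> theta h * z = z * theta h) -> exists c : 'I_f -> k, z = \sum_i c i *: X ^+ i.
  move=> zc; apply: (centralizer_span l_pr chl theta_rep theta_irr l_ndvd_n chiM chi_gen s_gt0 X_unit X_int s_min
    f_prim (GN := in_GN T N0) GNn (GN_l T chl N0) s'_prim l_ndvd_s') => //.
have [mu mu_unit Xwf_mu] := Xwf l_pr chl witt_U theta_rep l_ndvd_n (GP_subgroup T N0) (@GN_GP _ _ _ _ _ _ _ T N0) GNc sgS
  f_prim' trXk la0 Xf cX phi_red phiM Xw_red Xw_int.
have f_dvd_k : (f %| #|k|.-1)%N.
  have k1 := finNzRing_gt1 k; rewrite (prim_order_dvd f_prim).
  have om0 : chi T k sigma ^+ s != 0.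
    apply: contraTneq (oner_neq0 k) => e0; rewrite -(prim_expr_order f_prim) e0 expr0n.
    by rewrite gtn_eqF ?eqxx // (prim_order_gt0 f_prim).
  by apply/eqP; apply: (mulfI om0); rewrite -exprS prednK ?(ltnW k1) // expf_card mulr1.
have [tW [tW1 tWM tW_red tW_q tW_int]] := thetaW_exists l_pr l_gt2 chl witt_U qM theta_rep l_ndvd_n theta_q chiM chi_q
  (GP_subgroup T N0) (GN_subgroup T N0) GNn (@GN_GP _ _ _ _ _ _ _ T N0) GNc (@GP_GN _ _ _ _ _ _ _ T k chl N0) eNP sgS sg_gen
  X_unit X_int f_prim' trXk la0 Xf cX l_ndvd_f phi_red phi_q phiM Xw_red Xw_int mu_unit Xwf_mu f_dvd_k.
(* [cent_horner] is used a second time, with the homomorphism tW in the role of phi. *)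
have cW (Z : 'M[unitized W]_n'.+1) : (forall h, in_GN T N0 h -> tW h * Z = Z * tW h) -> exists P, Z = horner_mx Xw P.
  apply: (cent_horner l_pr l_gt2 chl witt_U theta_rep l_ndvd_n (GP_subgroup T N0) (@GN_GP _ _ _ _ _ _ _ T N0) GNc sgS X_unit
    f_prim' trXk la0 Xf cX l_ndvd_f tW_red _ Xw_red) => g *; [exact: tWM | exact: tW_int].
have trW := tr_Xw l_pr chl witt_U theta_rep (GP_subgroup T N0) sgS f_prim' phi_red phiM Xw_int.
have [w [d [P [Q [y0 [M [[PQ QP] w_window [Pi_graded d_b] [y1 y2 y0M] rhoE]]]]]]] :=
  structure_k chl theta_rep theta_cont theta_irr l_ndvd_n chi_gen s_gt0 X_unit X_int s_min f_prim s'_prim l_ndvd_s' m_le m_s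
    rhobar_rep rhobar_cont rhobar_ss.
have Pi1 (i j : 'I_m'.+1) : d i -> j = i.+1 :> nat -> shift_mx k d i j = 1 by move=> di ji; rewrite mxE di ji eqxx.
have d_graded (i j : 'I_m'.+1) : d i -> j = i.+1 :> nat -> w i = (w j + 1)%N.
  by move=> di ji; apply: Pi_graded; rewrite Pi1 // oner_eq0.
have d_bt : tp_b T (tp_t T) = 1 \/ (forall i j : 'I_m'.+1, d i -> j = i.+1 :> nat -> False) /\ forall g, tp_b T g = 0.
  case: d_b => [|[Pi0 b0]]; [by left | right; split=> // i j di ji].
  by have := Pi1 i j di ji; rewrite Pi0 mxE => /eqP; rewrite eq_sym oner_eq0.
have mu0 : red mu != 0 by move: mu_unit; rewrite (witt_unitE witt_U).
have y0_good : good (red := red) w d y0 (A := residue_cnl red) y0.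
  by split; [exact: y1 | exact: y2 | apply/matrixP => i j; rewrite mxE].
have chiW_red g : red (teichmuller red (chi T k g)) = chi T k g by have [] := teichmullerP l_pr chl witt_W (chi T k g).
have rhobarE g : blk (rhobar g : 'M[residue_cnl red]_(m'.+1 * n'.+1)) =
    P * Rp T (red := red) (tW : _ -> 'M[W]_n'.+1) w d M (A := residue_cnl red) y0 g * Q.
  have e1 := Rp_residue T chl witt_W (tW : abs_gal iota -> 'M[W]_n'.+1) y0M g y0_good.
  rewrite e1 (tW_red g : map_mx red _ = _); exact: rhoE.
have q_open : exists r : seq E, forall g : abs_gal iota, {in r, forall x, g x = x} -> q g = 1%g by exists r0.
exists (defo T (red := red) (tW : _ -> 'M[W]_n'.+1) w d y0 M).
apply: (defo_conclusion l_gt2 chl witt_W l_ndvd_n m_le tW1 tWM qM tW_q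
  (deep_representative chl qM N00 torsP) eNP s'_prim f_prim s_dvd chiW_red tW_int cW trW mu0 Xwf_mu
  w_window d_graded d_bt y0M rhobar_rep PQ QP y0_good rhobarE q_open).
Qed.

Theorem theorem4p12
    (p : nat) (p_pr : prime p) (F : fieldExtType (padic_num p_pr))
                                   
    (Fbar : closedFieldType) (iota : {rmorphism F -> Fbar})
    (alg_Fbar : forall x : Fbar, algebraicOver iota x)
    (l : nat) (k : finFieldType) (char_k : l \in [pchar k]) (l_neq_p : l <> p)
    (W : comNzRingType) (red : {rmorphism W -> k}) (witt_W : is_witt_ring l red)
    (n : nat) (theta : abs_gal iota -> 'M[k]_n)
    (theta_rep : is_rep theta) (theta_cont : discrete_continuous theta)
    (theta_irr : absolutely_irreducible theta)
    (l_ndvd_n : ~~ (l %| n)%N)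
    (theta_twist1 : ~ rep_equiv theta (twist l theta 1))
    (s : nat) (s_gt0 : (0 < s)%N)
    (theta_twists : rep_equiv (twist l theta s%:Z) theta)
    (s_min : forall r : nat, (0 < r)%N -> rep_equiv (twist l theta r%:Z) theta ->
       (s <= r)%N)
    (m : nat) (m_ge1 : (1 <= m)%N) (m_le : (m + 2 <= s)%N)
    (rhobar : abs_gal iota -> 'M[k]_(m * n))
    (rhobar_rep : is_rep rhobar) (rhobar_cont : discrete_continuous rhobar)
    (a : 'I_m -> int)
    (rhobar_ss : is_semisimplification rhobar
       (rep_sum (fun i : 'I_m => twist l theta (a i)))) :
  exists D : rep_class iota red (m * n),
    [/\ deformation_condition rhobar D,
        forall (A : cnl red) (rho : abs_gal iota -> 'M[A]_(m * n)), D A rho ->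
          forall g, inertia g ->
            \det (rho g) = cnl_alg A (teichmuller red (\det (rhobar g))),
        smooth D
      & exists h : nat,
          has_dim (tangent_space rhobar D) h /\ has_dim (H0_ad rhobar) h].
Proof.
have l_pr := pcharf_prime char_k.
pose c0 g : k := (cyclo l_pr (iota := iota) g 1%N)%:R.
have c0E g : mod_cyclotomic l k g = c0 g := mod_cyclotomicE l_pr k g.
have c0M g h : c0 (g * h)%g = c0 g * c0 h by rewrite /c0 cycloM level1_natr.
have c01 : c0 1%g = 1. by rewrite /c0 cyclo1; exact: level1_1.
(* A trivial cyclotomic character would make theta(1) equal to theta and s equal to 1, while s >= m
   + 2. *)
have ntriv : ~ forall g, c0 g = 1.
  move=> triv; suff : (s <= 1)%N by move: m_ge1 m_le; clear; lia.
  apply: s_min => //.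
  exists 1%:M, 1%:M; split; rewrite ?mulmx1 // => g.
  by rewrite mulmx1 mul1mx /twist c0E triv scale1r.
have [sigma sg] := character_generator c0M c01.
have sigma1 : c0 sigma <> 1 by move=> e; apply: ntriv => g; have [i ->] := sg g; rewrite e expr1n.
(* The values of the character are nonzero residues modulo l; for l = 2 they would all be 1. *)
have l_gt2 : (2 < l)%N.
  rewrite ltn_neqAle prime_gt1 // andbT; apply/eqP => l2; apply: sigma1.
  have c0V : c0 sigma != 0.
    by apply: contraTneq (oner_neq0 k) => e; rewrite -c01 -(mulgV sigma) c0M e mul0r eqxx.
  move: c0V; rewrite /c0; have := padic_lt (cyclo l_pr (iota := iota) sigma) 1; rewrite expn1.
  by move: (cyclo _ _ _) => [|[|i]]; rewrite ?eqxx //; lia.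
have [T] : inhabited (tame_parameters l_pr sigma (@inertia _ p_pr F Fbar iota)).
  apply: tame_parameters_exist => // e; apply: sigma1; rewrite /c0 e; exact: level1_1.
have chiE g : chi T k g = mod_cyclotomic l k g by rewrite (tp_mod T).
have tw : twist l theta = fun r g => chi T k g ^ r *: theta g.
  by apply/funext => r; apply/funext => g; rewrite /twist chiE.
rewrite {}tw in theta_twists s_min rhobar_ss theta_twist1.
have [n_gt0 _] := theta_irr k idfun.
case: n n_gt0 theta theta_rep theta_cont theta_irr l_ndvd_n theta_twist1 theta_twists s_min rhobar rhobar_rep rhobar_cont rhobar_ss
  => [//|n'] _ theta theta_rep theta_cont theta_irr l_ndvd_n _ theta_twists s_min rhobar rhobar_rep rhobar_cont rhobar_ss.
case: m m_ge1 m_le a rhobar rhobar_rep rhobar_cont rhobar_ss => [//|m'] _ m_le a rhobar rhobar_rep rhobar_cont rhobar_ss.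
have [M [N [MN NM twE]]] := theta_twists.
(* N carries theta(s) to theta, so it serves as the invertible intertwiner X of weight s. *)
have N_unit : (N : 'M_n'.+1) \is a GRing.unit by apply/unitrP; exists M.
have N_int : intertwines theta (chi T k) s N.
  move=> g; have := twE g; rewrite -exprnP => e.
  transitivity (N *m (chi T k g ^+ s *: theta g)); last by rewrite -scalemxAr.
  by rewrite e !mulmxA NM mul1mx.
have chi_gen g : exists i, chi T k g = chi T k sigma ^+ i.
  by have [i e] := sg g; exists i; rewrite !chiE !c0E.
have s_minN r (z : 'M_n'.+1) : (0 < r)%N -> z \is a GRing.unit -> intertwines theta (chi T k) r z -> (s <= r)%N.
  move=> r0 zu zint; apply: s_min => //; exists (invmx z), z; split; [exact: mulVmx | exact: mulmxV | move=> g].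
  rewrite -exprnP; have e : theta g *m z = chi T k g ^+ r *: (z *m theta g) := zint g.
  by rewrite -mulmxA e -scalemxAr mulmxA mulVmx // mul1mx.
have := model_exists l_gt2 (T := T) char_k witt_W theta_rep theta_cont theta_irr l_ndvd_n chi_gen s_gt0
  N_unit N_int s_minN m_le rhobar_rep rhobar_cont rhobar_ss.
exact.
Qed.
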